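(* Let $V\subset\mathbb{P}^N(\mathbb{C})$ be a smooth complex projective variety of dimension $n\ge 1$, and let $f:\mathbb{C}^p\to V$ be an algebraically nondegenerate meromorphic mapping with reduced representation $\tilde f=(f_0,\ldots,f_N)$. Let $Q_1,\ldots,Q_q$ be arbitrary hypersurfaces in $\mathbb{P}^N(\mathbb{C})$, all of the same degree $\Delta$ (identified with their defining homogeneous polynomials), and let $m\ge n$ be an integer. Let $\mathcal{K}$ denote the set of all subsets $K\subset\{1,\ldots,q\}$ such that $\dim\big(V\cap\bigcap_{j\in K}Q_j\big)\le m-\#K$ (with the convention $\dim\emptyset=-1$). Then for every $\epsilon>0$, $$\int_{S(r)}\max_{K\in\mathcal{K}}\log\prod_{j\in K}\frac{\|\tilde f(z)\|^{\Delta}\,\|Q_j\|}{|Q_j(\tilde f(z))|}\,\sigma_p\le\big(\Delta(m-n+1)(n+1)+\epsilon\big)\,T_f(r)$$ for all $r\in[0,+\infty)$ outside a Borel set of finite measure.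
   Context: A reduced representation of a meromorphic map $f:\mathbb{C}^p\to\mathbb{P}^N(\mathbb{C})$ is $\tilde f=(f_0,\ldots,f_N)$ with $f_i$ holomorphic on $\mathbb{C}^p$ and common zero set of codimension at least two; $\|\tilde f\|=(|f_0|^2+\cdots+|f_N|^2)^{1/2}$. $f$ is algebraically nondegenerate (into $V$) if its image is not contained in any proper algebraic subvariety of $V$. For a hypersurface $Q(\omega)=\sum_{I}a_I\omega^I$, $\|Q\|$ denotes the maximum of the moduli $|a_I|$ of its coefficients. $S(r)=\{z\in\mathbb{C}^p:\|z\|=r\}$, $\sigma_p=d^c\log\|z\|^2\wedge(dd^c\log\|z\|^2)^{p-1}$, and the characteristic function is $T_f(r)=\int_{S(r)}\log\|\tilde f\|\sigma_p-\int_{S(1)}\log\|\tilde f\|\sigma_p$.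
   Formalization: It is assumed in addition that no Q_j vanishes identically on f, i.e. V is contained in no Q_j; otherwise the left side is +∞ when m>n (take K={j}), while for m=n such Q_j lie in no K of the family and can be dropped. *)

(* Defs.v *)
From HB Require Import structures.
From mathcomp Require Import all_boot all_order all_algebra.
From mathcomp Require Import all_classical all_reals all_analysis.
From mathcomp Require Import complex.
From mathcomp Require mpoly.

Unset Printing Implicit Defensive.

Import Order.TTheory GRing.Theory Num.Theory.
Local Open Scope classical_set_scope.
Local Open Scope ring_scope.

Definition cabs {R : realType} (z : R[i]) : R :=
  Num.sqrt (complex.Re z ^+ 2 + complex.Im z ^+ 2).

Definition cvnorm {R : realType} {k : nat} (v : 'I_k -> R[i]) : R :=
  Num.sqrt (\sum_(i < k) (complex.Re (v i) ^+ 2 + complex.Im (v i) ^+ 2)).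

Definition elog {R : realType} (x : R) : \bar R :=
  if x == 0 then -oo%E else (ln x)%:E.

Definition holomorphic {R : realType} {p : nat}
  (g : ('I_p -> R[i]) -> R[i]) : Prop :=
  forall a : 'I_p -> R[i], exists c : 'I_p -> R[i],
    forall eps : R, 0 < eps -> exists delta : R, 0 < delta /\
      forall z : 'I_p -> R[i], cvnorm (fun k => z k - a k) < delta ->
        cabs (g z - g a - \sum_(k < p) c k * (z k - a k))
          <= eps * cvnorm (fun k => z k - a k).

Definition common_zero {R : realType} {p N : nat}
  (F : 'I_N.+1 -> ('I_p -> R[i]) -> R[i]) (z : 'I_p -> R[i]) : Prop :=
  forall i, F i z = 0.

(* The (analytic) common zero set of F has codimension >= 2, i.e. local
   dimension <= p-2 at each of its points: each point a of the zero set is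
   an isolated point of its intersection with some complex 2-plane through a. *)
Definition codim_ge2_zeros {R : realType} {p N : nat}
  (F : 'I_N.+1 -> ('I_p -> R[i]) -> R[i]) : Prop :=
  forall a, common_zero F a ->
    exists v1 v2 : 'I_p -> R[i],
      (forall s t : R[i], (forall k, s * v1 k + t * v2 k = 0) -> s = 0 /\ t = 0) /\
      exists delta : R, 0 < delta /\
        forall s t : R[i], 0 < cabs s + cabs t < delta ->
          ~ common_zero F (fun k => a k + s * v1 k + t * v2 k).

Definition reduced_rep {R : realType} {p N : nat}
  (F : 'I_N.+1 -> ('I_p -> R[i]) -> R[i]) : Prop :=
  (forall i, holomorphic (F i)) /\ codim_ge2_zeros F.

(* Projective geometry in P^N(C): points are nonzero vectors of C^{N+1}, *)
(* algebraic sets are cones cut out by homogeneous polynomials.          *)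

Notation cpoly R N := (mpoly.mpoly N.+1 R[i]).

Definition homog {R : realType} {N : nat} (d : nat) (P : cpoly R N) : Prop :=
  all [pred mm | mpoly.mdeg mm == d] (mpoly.msupp P).

Definition peval {R : realType} {N : nat} (x : 'I_N.+1 -> R[i]) (P : cpoly R N)
  : R[i] := mpoly.meval x P.

Definition nonzero_pt {R : realType} {N : nat} (x : 'I_N.+1 -> R[i]) : Prop :=
  exists i, x i != 0.

Definition zero_locus {R : realType} {N : nat} (S : set (cpoly R N))
  : set ('I_N.+1 -> R[i]) :=
  [set x | nonzero_pt x /\ forall P, S P -> peval x P = 0].

Definition algebraic {R : realType} {N : nat} (X : set ('I_N.+1 -> R[i])) : Prop :=
  exists S : set (cpoly R N), (forall P, S P -> exists d, homog d P) /\
    X = zero_locus S.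

Definition irreducible_alg {R : realType} {N : nat} (X : set ('I_N.+1 -> R[i]))
  : Prop :=
  [/\ algebraic X, X !=set0 &
    forall A B : set ('I_N.+1 -> R[i]), algebraic A -> algebraic B ->
      X `<=` A `|` B -> X `<=` A \/ X `<=` B].

Definition chain_in {R : realType} {N : nat} (X : set ('I_N.+1 -> R[i]))
  (d : nat) (Z : nat -> set ('I_N.+1 -> R[i])) : Prop :=
  [/\ forall i, (i <= d)%N -> irreducible_alg (Z i),
      forall i, (i < d)%N -> Z i `<` Z i.+1 & Z d `<=` X].

Definition dim_le {R : realType} {N : nat} (X : set ('I_N.+1 -> R[i])) (k : int)
  : Prop :=
  (X = set0 -> -1 <= k) /\
  forall (d : nat) (Z : nat -> set ('I_N.+1 -> R[i])), chain_in X d Z -> (d%:Z <= k).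

Definition dim_eq {R : realType} {N : nat} (X : set ('I_N.+1 -> R[i])) (n : nat)
  : Prop :=
  dim_le X n%:Z /\ exists Z, chain_in X n Z.

Definition ideal_of {R : realType} {N : nat} (X : set ('I_N.+1 -> R[i]))
  : set (cpoly R N) :=
  [set P | (exists d, homog d P) /\ forall x, X x -> peval x P = 0].

Definition grad {R : realType} {N : nat} (P : cpoly R N) (x : 'I_N.+1 -> R[i])
  : 'I_N.+1 -> R[i] :=
  fun i => peval x (mpoly.mderiv i P).

Definition lin_indep {R : realType} {k m : nat} (w : 'I_k -> 'I_m -> R[i]) : Prop :=
  forall c : 'I_k -> R[i], (forall i, \sum_(j < k) c j * w j i = 0) ->
    forall j, c j = 0.

(* Jacobian criterion: V of dimension n is smooth iff at every point the
   gradients of the (homogeneous) ideal of V span a space of dimension N - n *)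
Definition smooth_of_dim {R : realType} {N : nat} (V : set ('I_N.+1 -> R[i]))
  (n : nat) : Prop :=
  forall x, V x ->
    (exists G : 'I_(N - n) -> cpoly R N,
        (forall j, ideal_of V (G j)) /\ lin_indep (fun j => grad (G j) x)) /\
    (forall G : 'I_(N - n).+1 -> cpoly R N,
        (forall j, ideal_of V (G j)) -> ~ lin_indep (fun j => grad (G j) x)).

Definition smooth_proj_variety {R : realType} {N : nat}
  (V : set ('I_N.+1 -> R[i])) (n : nat) : Prop :=
  [/\ irreducible_alg V, dim_eq V n & smooth_of_dim V n].

Definition fval {R : realType} {p N : nat}
  (F : 'I_N.+1 -> ('I_p -> R[i]) -> R[i]) (z : 'I_p -> R[i]) : 'I_N.+1 -> R[i] :=
  fun i => F i z.

Definition meromorphic_into {R : realType} {p N : nat}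
  (V : set ('I_N.+1 -> R[i])) (F : 'I_N.+1 -> ('I_p -> R[i]) -> R[i]) : Prop :=
  reduced_rep F /\ forall z, ~ common_zero F z -> V (fval F z).

(* f algebraically nondegenerate into V: f(C^p) lies in no proper algebraic
   subset of V, i.e. no homogeneous polynomial outside I(V) vanishes on f *)
Definition alg_nondegenerate {R : realType} {p N : nat}
  (V : set ('I_N.+1 -> R[i])) (F : 'I_N.+1 -> ('I_p -> R[i]) -> R[i]) : Prop :=
  forall (d : nat) (P : cpoly R N), homog d P -> ~ ideal_of V P ->
    exists z, peval (fval F z) P != 0.

Definition polynorm {R : realType} {N : nat} (Q : cpoly R N) : R :=
  \big[Num.max/0]_(mm <- mpoly.msupp Q) cabs (mpoly.mcoeff mm Q).

Definition hypersurface {R : realType} {N : nat} (Q : cpoly R N)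
  : set ('I_N.+1 -> R[i]) :=
  zero_locus [set Q].

Fixpoint iint {R : realType} (k : nat) (g : seq R -> \bar R) : \bar R :=
  match k with
  | 0 => g [::]
  | k'.+1 => (\int[@lebesgue_measure R]_x iint k' (fun s => g (x :: s)))%E
  end.

Definition pt_of_seq {R : realType} (p : nat) (s : seq R) : 'I_p -> R[i] :=
  fun k => Complex (nth 0 s (2 * k)) (nth 0 s (2 * k).+1).

(* int_{S(r)} g sigma_p, realized as the average of g(r z/|z|) over the
   unit ball of C^p (the radial projection of the normalized volume of the
   ball is the normalized rotation invariant measure of the sphere) *)
Definition sphere_int {R : realType} (p : nat) (r : R)
  (g : ('I_p -> R[i]) -> \bar R) : \bar R :=
  let ball_vol : \bar R := iint (2 * p)
      (fun s : seq R => if (cvnorm (@pt_of_seq R p s) < 1)%R then 1%E else 0%E) in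
  let avg : \bar R := iint (2 * p) (fun s : seq R =>
     let z := @pt_of_seq R p s in
     if ((cvnorm z < 1) && (0 < cvnorm z))%R
     then g (fun k => Complex (r / cvnorm z) 0 * z k)
     else 0%E) in
  (avg * ((fine ball_vol)^-1)%:E)%E.

Definition log_norm_f {R : realType} {p N : nat}
  (F : 'I_N.+1 -> ('I_p -> R[i]) -> R[i]) (z : 'I_p -> R[i]) : \bar R :=
  elog (cvnorm (fval F z)).

Definition char_fun {R : realType} {p N : nat}
  (F : 'I_N.+1 -> ('I_p -> R[i]) -> R[i]) (r : R) : \bar R :=
  (sphere_int p r (log_norm_f F) - sphere_int p 1 (log_norm_f F))%E.

(* log ( ||f~(z)||^Delta ||Q|| / |Q(f~(z))| ), +oo where Q(f~(z)) = 0;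
   set to 0 on the (null) indeterminacy set f~(z) = 0 *)
Definition log_ratio {R : realType} {p N : nat}
  (F : 'I_N.+1 -> ('I_p -> R[i]) -> R[i]) (Delta : nat) (Q : cpoly R N)
  (z : 'I_p -> R[i]) : \bar R :=
  let w := fval F z in
  if cvnorm w == 0 then 0%E
  else if peval w Q == 0 then +oo%E
  else (Delta%:R * ln (cvnorm w) + ln (polynorm Q) - ln (cabs (peval w Q)))%:E.

Definition admissible {R : realType} {N q : nat}
  (V : set ('I_N.+1 -> R[i])) (Q : 'I_q -> cpoly R N) (m : nat)
  (K : {set 'I_q}) : Prop :=
  dim_le (V `&` \bigcap_(j in [set j | j \in K]) hypersurface (Q j))
         (m%:Z - #|K|%:Z).

Definition max_log_prod {R : realType} {p N q : nat}
  (V : set ('I_N.+1 -> R[i])) (F : 'I_N.+1 -> ('I_p -> R[i]) -> R[i])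
  (Delta : nat) (Q : 'I_q -> cpoly R N) (m : nat) (z : 'I_p -> R[i]) : \bar R :=
  ereal_sup [set (\sum_(j in K) log_ratio F Delta (Q j) z)%E
            | K in [set K : {set 'I_q} | admissible V Q m K]].

Definition poly_nonzero {R : realType} {N : nat} (P : cpoly R N) : Prop :=
  exists mm, mpoly.mcoeff mm P != 0.

(* Main.v *)
(* Order the Q_j at a point of C^p by the size of Q_j(f).  A set K of the family meets V in
   codimension at least #K - (m - n), so generic linear combinations P_0, ..., P_n of its initial
   segments have no common zero on V, and the product over K is bounded by the (m - n + 1)-st
   power of the product of the |f|^Delta / |P_i(f)|.  The coordinate ring of V is finite over
   C[P_0, ..., P_n], so a basis of its graded pieces may be chosen among the monomials P^a e, and
   Cartan's method applies to the map given by that basis.  In place of a Wronskian and the lemma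
   on the logarithmic derivative we use a determinant of torus translates: for a difference
   u F - v of plurisubharmonic functions, the mean oscillation over a small translation is
   controlled by the growth of the means between two radii, and Borel's growth lemma makes the
   shift cost O(log T).  The functions log |F| are regularized as log (|F|^2 + d^2)^(1/2), and d
   tends to 0. *)

Require Import Defs.
From HB Require Import structures.
From mathcomp Require Import all_boot all_order all_algebra fingroup perm.
From mathcomp Require Import all_classical all_reals all_analysis.
From mathcomp Require Import measurable_realfun complex.
From mathcomp Require mpoly.
From mathcomp Require Import ring lra zify.

Import Order.TTheory GRing.Theory Num.Theory.
Local Open Scope classical_set_scope.
Local Open Scope ring_scope.
Set Implicit Arguments. Unset Strict Implicit.

Local Notation "x %:C" := (real_complex _ x) : ring_scope.
Local Notation mfun f := (measurable_fun setT f).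
Local Notation Cn R p := ('I_p -> R[i]).
Local Notation Re := (@complex.Re _).
Local Notation Im := (@complex.Im _).
Local Notation uf g := (fun _ : unit => g).
Local Notation mcst := measurable_cst.

(** The constant is a count. Over all monomials of degree b each P_i has average exponent b/(n + 1),
    while the basis has degree u = Delta (b + b1); as b grows, the weight of one P_i divided by u
    times the number of basis elements tends to 1/(Delta (n + 1)), and the power m - n + 1 supplies
    the other factor. All orderings share one basis Phi of the graded piece of degree u, so their
    adapted bases are constant invertible combinations of Phi, and a single determinant D(z) =
    det(Phi_i(lambda_k z)) serves them all. The lambda_k multiply the coordinates by numbers of
    modulus 1 with angles c theta_k, and so preserve spherical means. The shift c has two opposite
    roles: it must be of order 1/T^2, up to the gap between the radii, for the logarithms of the
    basis to move little in mean; and log |D| is bounded below by a multiple of log c, because D at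
    (1, ..., 1) extends to a nonzero entire function of c. The integrals in the statement are
    iterated integrals of functions with infinite values. They are transferred to a probability
    space on which Tonelli applies to nonnegative functions. *)

Ltac complex_ring := by apply/eqP; rewrite eq_complex /=; apply/andP; split; apply/eqP; ring.

Module Algebra.
Import -(notations) mpoly.

(** * Linear algebra modulo a subspace *)

Section LinearAlgebra.
Variables (K : fieldType) (E : lmodType K).
Implicit Types (c : nat -> K) (s t : seq E) (J U : E -> Prop).

Definition lin c s := \sum_(i < size s) c i *: s`_i.

Lemma lin_nil c : lin c [::] = 0. Proof. exact: big_ord0. Qed.

Lemma lin_cons c x s : lin c (x :: s) = c 0%N *: x + lin (fun i => c i.+1) s.
Proof. by rewrite /lin big_ord_recl. Qed.

Lemma lin_cat c s t : lin c (s ++ t) = lin c s + lin (fun i => c (size s + i)%N) t.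
Proof.
elim: s c => [|x s IH] c /=; first by rewrite lin_nil add0r.
by rewrite !lin_cons IH addrA.
Qed.

Lemma lin_ext c d s : (forall i, (i < size s)%N -> c i = d i) -> lin c s = lin d s.
Proof. by move=> h; apply: eq_bigr => i _; rewrite h. Qed.

Lemma linZ a c s : lin (fun i => a * c i) s = a *: lin c s.
Proof. by rewrite /lin scaler_sumr; apply: eq_bigr => i _; rewrite scalerA. Qed.

Lemma lin0 s : lin (fun=> 0) s = 0.
Proof. by rewrite /lin big1 // => i _; rewrite scale0r. Qed.

(** Subspaces are predicates, and independence and spanning are taken modulo a subspace [J]; graded
    pieces of coordinate rings are then handled without forming quotients. *)
Definition subsp J := [/\ J 0, (forall x y, J x -> J y -> J (x + y)) & forall a x, J x -> J (a *: x)].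
Definition inside U s := forall i, (i < size s)%N -> U s`_i.
Definition indep J s := forall c, J (lin c s) -> forall i, (i < size s)%N -> c i = 0.
Definition spans J U s := forall x, U x -> exists c, J (x - lin c s).

Lemma subspB J x y : subsp J -> J x -> J y -> J (x - y).
Proof. by move=> [_ jD jZ] jx jy; rewrite -scaleN1r; apply: jD => //; exact: jZ. Qed.

Lemma subsp_sum J I (r : seq I) (P : pred I) (F : I -> E) : subsp J -> (forall i, P i -> J (F i)) -> J (\sum_(i <- r | P i) F i).
Proof. by move=> [j0 jD _] h; apply: big_ind. Qed.

Lemma subsp_lin J c s : subsp J -> inside J s -> J (lin c s).
Proof. by move=> sj h; apply: subsp_sum => // i _; case: (sj) => _ _; apply; exact: h. Qed.

Lemma inside_cat U s t : inside U s -> inside U t -> inside U (s ++ t).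
Proof.
move=> us ut i; rewrite size_cat nth_cat; case: (ltnP i (size s)) => [h _|h h2]; first exact: us.
by apply: ut; rewrite ltn_subLR.
Qed.

Lemma inside_mem U s : (forall x, x \in s -> U x) -> inside U s.
Proof. by move=> h i hi; apply: h; exact: mem_nth. Qed.

(** Steinitz exchange: with more rows than columns, the matrix of coefficients of [s] in terms of
    [t] has a nonzero left kernel vector, which would be a relation of [s] modulo [J]. *)
Lemma indep_le_spans J U s t : subsp J -> inside U s -> indep J s -> spans J U t -> (size s <= size t)%N.
Proof.
move=> sJ us js ts; rewrite leqNgt; apply/negP => lt.
have ex (i : 'I_(size s)) : exists c, J (s`_i - lin c t) by apply: ts; exact: us.
have [c hc] := choice ex.
pose M : 'M[K]_(size s, size t) := \matrix_(i, j) c i j.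
have : kermx M != 0.
 by rewrite kermx_eq0 -row_leq_rank -ltnNge (leq_ltn_trans (rank_leq_col _)).
case/rowV0Pn => v /sub_kermxP vM; apply/negP; rewrite negbK; apply/eqP/rowP => i; rewrite mxE.
pose w k := if insub k is Some j then v 0 j else 0.
have wE (j : 'I_(size s)) : w j = v 0 j by rewrite /w valK.
rewrite -wE; apply: js => //.
have -> : lin w s = \sum_(i < size s) v 0 i *: (s`_i - lin (c i) t).
 rewrite /lin; under [RHS]eq_bigr do rewrite scalerBr; rewrite sumrB.
 have -> : \sum_(i < size s) v 0 i *: lin (c i) t = 0.
  under eq_bigr => j _ do rewrite /lin scaler_sumr; rewrite exchange_big big1 //= => k _.
  under eq_bigr => j _ do rewrite scalerA; rewrite -scaler_suml.
  have /(congr1 (fun A : 'rV_(size t) => A 0 k)) := vM.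
  by rewrite !mxE; under eq_bigr do rewrite mxE; move=> ->; rewrite scale0r.
 by rewrite subr0; apply: eq_bigr => j _; rewrite wE.
by apply: subsp_sum => // j _; case: (sJ) => _ _; apply; exact: hc.
Qed.

Lemma indep_rcons J s x : subsp J -> indep J s -> ~ (exists c, J (x - lin c s)) -> indep J (s ++ [:: x]).
Proof.
move=> sJ js nx c; rewrite lin_cat lin_cons lin_nil addr0 addn0 => hc.
have cx : c (size s) = 0.
 apply/eqP/negPn/negP => c0; apply: nx; exists (fun i => - ((c (size s))^-1 * c i)).
 have -> : x - lin (fun i => - ((c (size s))^-1 * c i)) s = (c (size s))^-1 *: (lin c s + c (size s) *: x).
  rewrite scalerDr scalerA mulVf // scale1r -linZ addrC; congr (_ + _).
  by rewrite /lin -sumrN; apply: eq_bigr => i _; rewrite scaleNr opprK.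
 by case: (sJ) => _ _; apply.
move: hc; rewrite cx scale0r addr0 => /js hc i; rewrite size_cat addn1 ltnS leq_eqVlt => /predU1P[->//|]; exact: hc.
Qed.

Lemma extend_basis J U s t : subsp J -> inside U s -> indep J s -> spans J U t ->
 exists r, [/\ inside U r, indep J (s ++ r) & spans J U (s ++ r)].
Proof.
move=> sJ; have [k] := ubnP (size t - size s)%N; elim: k s => // k IH s en us js ts.
have [ss|/existsNP[x /not_implyP[Ux nx]]] := pselect (spans J U s); first by exists [::]; rewrite cats0.
have usx : inside U (s ++ [:: x]) by apply: inside_cat => // -[].
have jsx := indep_rcons sJ js nx.
have := indep_le_spans sJ usx jsx ts; rewrite size_cat /= => le.
have [|r [ur jr sr]] := IH (s ++ [:: x]) _ usx jsx ts; first by rewrite size_cat /=; lia.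
by exists (x :: r); rewrite -cat1s catA; split => //; apply: inside_cat => // -[].
Qed.

Lemma basis_exists J U t : subsp J -> spans J U t ->
 exists s, [/\ inside U s, indep J s & spans J U s].
Proof.
move=> sJ ts; have [//|//|r [? ? ?]] := @extend_basis J U [::] t sJ _ _ ts.
by exists r.
Qed.

(** Completing [s] to a basis modulo [J] gives [r]; modulo the larger [J'] the vectors of [s]
    vanish, so [r] alone spans. This bounds the dimension of a quotient from above. *)
Lemma spans_quotient J U J' s t : subsp J -> subsp J' -> (forall x, J x -> J' x) -> inside U s -> inside J' s -> indep J s -> spans J U t ->
 exists r, spans J' U r /\ (size s + size r <= size t)%N.
Proof.
move=> sJ sJ' JJ' us js' js ts; have [r [ur jr sr]] := extend_basis sJ us js ts; exists r; split; last first.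
 by rewrite -size_cat; apply: indep_le_spans jr ts => //; exact: inside_cat.
move=> x /sr[c]; rewrite lin_cat opprD addrA => hc; exists (fun i => c (size s + i)%N).
have -> : x - lin (fun i => c (size s + i)%N) r = x - lin c s - lin (fun i => c (size s + i)%N) r + lin c s by rewrite addrAC subrK.
by case: (sJ') => _ jD _; apply: jD; [exact: JJ'|exact: subsp_lin].
Qed.

Lemma spans_weak J J' U s : (forall x, J x -> J' x) -> spans J U s -> spans J' U s.
Proof. by move=> h hs x /hs[c /h hc]; exists c. Qed.

End LinearAlgebra.

(** * Dependent choice and Dickson's lemma *)

Lemma dependent_choice (T : Type) (Rel : T -> T -> Prop) (x0 : T) : (forall x, exists y, Rel x y) ->
 exists f : nat -> T, f 0%N = x0 /\ forall n, Rel (f n) (f n.+1).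
Proof. by move=> /choice[g hg]; exists (fun n => iter n g x0); split => // n; exact: hg. Qed.

Section Dickson.

Definition increasing (g : nat -> nat) := forall i j, (i < j)%N -> (g i < g j)%N.

(** The next index minimizes [f] on the remaining tail, so later values cannot be smaller. *)
Lemma monotone_subsequence (f : nat -> nat) : exists2 g, increasing g & forall i j, (i <= j)%N -> (f (g i) <= f (g j))%N.
Proof.
have min N : exists k, (N <= k)%N /\ forall j, (N <= j)%N -> (f k <= f j)%N.
 have ex : exists v, `[< exists k, (N <= k)%N /\ f k = v >] by exists (f N); apply/asboolP; exists N.
 have [v /asboolP[k [Nk fk]] hv] := find_ex_minn ex.
 by exists k; split => // j Nj; rewrite fk; apply: hv; apply/asboolP; exists j.
have [k hk] := choice min; pose g := fix g i := if i is i'.+1 then k (g i').+1 else k 0%N.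
have gS i : (g i < g i.+1)%N by exact: (hk _).1.
have ginc : increasing g.
 by move=> i; elim=> // j IH; rewrite ltnS leq_eqVlt => /predU1P[-> //|/IH h]; exact: ltn_trans (gS j).
exists g => // i j; rewrite leq_eqVlt => /predU1P[-> //|/ginc h].
case: i h => [|i] h; first exact: (hk 0%N).2.
apply: (hk _).2; apply: leq_trans (ltnW h); exact: (hk _).1.
Qed.

Lemma monotone_subsequences (f : nat -> nat -> nat) k :
 exists2 g, increasing g & forall l i j, (l < k)%N -> (i <= j)%N -> (f l (g i) <= f l (g j))%N.
Proof.
elim: k => [|k [g gi gm]]; first by exists id.
have [h hi hm] := monotone_subsequence (f k \o g).
exists (g \o h) => [i j /hi|l i j]; first exact: gi.
rewrite ltnS leq_eqVlt => /predU1P[->|lk ij]; first exact: hm.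
apply: gm => //; move: ij; rewrite leq_eqVlt => /predU1P[-> //|/hi]; exact: ltnW.
Qed.

Lemma dickson n (m : nat -> multinom n) : exists i j, (i < j)%N /\ lem (m i) (m j).
Proof.
have [g gi gm] := monotone_subsequences (fun l i => if insub l is Some o then m i o else 0%N) n.
exists (g 0%N), (g 1%N); split; first exact: gi.
by apply/mnm_lepP => o; have := gm o 0%N 1%N (ltn_ord o) isT; rewrite valK.
Qed.

End Dickson.

(** * Graded ideals and the ascending chain condition *)

Section GradedIdeals.
Variables (K : fieldType) (n : nat).
Notation poly := (mpoly n K).
Implicit Types (f g h : poly) (J : nat -> poly -> Prop).

Definition hg d f : Prop := f \is @ishomog1 n K d mdeg.

Lemma hgP d f : hg d f <-> forall m, m \in msupp f -> mdeg m = d.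
Proof. by split => [/dhomogP h m /h|h]; last exact/dhomogP. Qed.

Lemma hg0 d : hg d 0. Proof. exact: dhomog0. Qed.
Lemma hgD d f g : hg d f -> hg d g -> hg d (f + g). Proof. exact: dhomogD. Qed.
Lemma hgZ d a f : hg d f -> hg d (a *: f). Proof. exact: dhomogZ. Qed.
Lemma hgM d e f g : hg d f -> hg e g -> hg (d + e) (f * g). Proof. exact: dhomogM. Qed.
Lemma hgX m : hg (mdeg m) (mpolyX K m). Proof. by rewrite /hg dhomogX. Qed.

(** An ideal is the family of its homogeneous pieces [J u]; inhomogeneous elements never occur. *)
Definition graded_ideal J := [/\ forall u f, J u f -> hg u f, forall u, subsp (J u)
 & forall u e f h, J u f -> hg e h -> J (e + u)%N (h * f)].

Lemma mon_min (P : multinom n -> Prop) m0 : P m0 -> exists m, P m /\ forall m', (m' < m)%O -> ~ P m'.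
Proof.
move: m0; apply: (well_founded_ind (@ltom_wf n)) => m0 IH Pm.
have [[m' [lt Pm']]|h] := pselect (exists m', (m' < m0)%O /\ P m'); first exact: IH lt Pm'.
by exists m0; split => // m' lt Pm'; apply: h; exists m'.
Qed.

(** For each strict step take the least leading monomial of an element of the step. By Dickson, one
    of them divides a later one; subtracting the corresponding multiple of the earlier polynomial
    cancels the leading term of the later one without leaving the step, against minimality. *)
Lemma ascending_chain (J : nat -> nat -> poly -> Prop) : (forall k, graded_ideal (J k)) ->
 (forall k u f, J k u f -> J k.+1 u f) -> exists k, forall u f, J k.+1 u f -> J k u f.
Proof.
move=> gJ asc; apply: contrapT => /forallNP nst.
have mono k l u f : (k <= l)%N -> J k u f -> J l u f.
 by move=> /subnK <-; elim: (l - k)%N => // i IH /IH; exact: asc.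
pose Q k m := exists u f, [/\ J k.+1 u f, ~ J k u f & mlead f = m].
have exQ k : exists m, Q k m.
 by have /existsNP[u /existsNP[f /not_implyP[h1 h2]]] := nst k; exists (mlead f), u, f.
have exm k : exists m, Q k m /\ forall m', (m' < m)%O -> ~ Q k m' by have [m0 /mon_min] := exQ k.
have [m hm] := choice exm; have [i [j [ij le]]] := dickson m.
have [[u [f [fi nfi fm]]] _] := hm i; have [[v [g [gj ngj gm]]] minj] := hm j.
have [hJ sJ mJ] := gJ j.
have g0 : g != 0 by apply: contra_notN ngj => /eqP ->; case: (sJ v).
have f0 : f != 0 by apply: contra_notN nfi => /eqP ->; case: (gJ i) => _ si _; case: (si u).
have df : mdeg (m i) = u by have [hi _ _] := gJ i.+1; have /hgP -> := hi _ _ fi => //; rewrite -fm mlead_supp.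
have dg : mdeg (m j) = v by have [hi _ _] := gJ j.+1; have /hgP -> := hi _ _ gj => //; rewrite -gm mlead_supp.
have lf : mcoeff (mlead f) f != 0 by rewrite mleadc_eq0.
pose a := mcoeff (mlead g) g / mcoeff (mlead f) f.
have a0 : a != 0 by rewrite mulf_neq0 ?invr_eq0 ?mleadc_eq0.
pose x : poly := a *: mpolyX K (mnm_sub (m j) (m i)).
have mE : mnm_add (mnm_sub (m j) (m i)) (m i) = m j by rewrite submK.
have hx : hg (v - u) x.
 apply: hgZ; rewrite /hg dhomogX; apply/eqP; rewrite -dg -df -[in RHS]mE mdegD addnK //.
have uv : (v - u + u)%N = v by rewrite subnK // -dg -df -mE mdegD leq_addl.
have xf : J j v (x * f).
 by rewrite -uv; apply: mJ => //; apply: (mono i.+1).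
have lx : mlead x = mnm_sub (m j) (m i) by rewrite mleadZ_proper mleadXm // mcoeffX eqxx mulr1.
have cx : mcoeff (mlead x) x = a by rewrite lx mcoeffZ mcoeffX eqxx mulr1.
have c0 : mcoeff (mlead x) x * mcoeff (mlead f) f != 0 by rewrite cx mulf_neq0.
have xl : mlead (x * f) = m j by rewrite mleadM_proper // lx fm mE.
have xc : mcoeff (m j) (x * f) = mcoeff (mlead g) g by rewrite -xl mleadcM_proper // cx /a mulfVK.
pose d := g - x * f.
have dJ : J j.+1 v d by have [_ s1 _] := gJ j.+1; apply: subspB => //; exact: asc.
have ndJ : ~ J j v d.
 by move=> h; apply: ngj; rewrite -(subrK (x * f) g); case: (sJ v) => _ jD _; exact: jD.
apply: (minj (mlead d)); last by exists v, d.
have d0 : d != 0 by apply: contra_notN ndJ => /eqP ->; case: (sJ v).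
rewrite lt_neqAle; apply/andP; split.
 by apply: contraNneq d0 => e; rewrite -mleadc_eq0 e mcoeffB xc -gm subrr.
by apply: le_trans (mleadB_le _ _) _; rewrite xl gm leUx lexx.
Qed.

(** The chain condition takes the place of Zorn's lemma: without a maximal element, dependent choice
    would build a strictly ascending sequence. *)
Lemma maximal_ideal (Phi : (nat -> poly -> Prop) -> Prop) J0 : graded_ideal J0 -> Phi J0 ->
 exists J, [/\ graded_ideal J, Phi J, (forall u f, J0 u f -> J u f) &
  forall J', graded_ideal J' -> Phi J' -> (forall u f, J u f -> J' u f) -> forall u f, J' u f -> J u f].
Proof.
move=> g0 p0; apply: contrapT => nex.
pose T := {J | [/\ graded_ideal J, Phi J & forall u f, J0 u f -> J u f]}.
pose Rel (J J' : T) := (forall u f, sval J u f -> sval J' u f) /\ ~ (forall u f, sval J' u f -> sval J u f).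
have hR (J : T) : exists J' : T, Rel J J'.
 case: J => J hJ; apply: contrapT => /forallNP h; apply: nex; exists J; case: (hJ) => gJ pJ J0J; split => //.
 move=> J' gJ' pJ' JJ'; have hJ' : [/\ graded_ideal J', Phi J' & forall u f, J0 u f -> J' u f].
  by split => // u f /J0J; exact: JJ'.
 by have /not_andP[|/contrapT] := h (exist _ J' hJ' : T).
have [s [_ hs]] := dependent_choice (exist _ J0 (And3 g0 p0 (fun _ _ => id)) : T) hR.
have [|k hk] := @ascending_chain (fun k => sval (s k)) _ (fun k => (hs k).1).
 by move=> k; case: (svalP (s k)).
exact: (hs k).2.
Qed.

(** The piece of degree [u] of J + (g). Below degree [e] the multiplier is forced to be 0, since
    truncated subtraction would otherwise admit constants. *)
Definition adjoin J e g u f := exists j h, [/\ J u j, (if (e <= u)%N then hg (u - e) h else h = 0) & f = j + h * g].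

Lemma adjoin_ideal J e g : graded_ideal J -> hg e g -> graded_ideal (adjoin J e g).
Proof.
move=> [hJ sJ mJ] hgg; split.
- move=> u f [j [h [ju hh ->]]]; apply: hgD; first exact: hJ.
 by case: leqP hh => [eu hh|_ ->]; [rewrite -(subnK eu); exact: hgM|rewrite mul0r; exact: hg0].
- move=> u; have [j0 jD jZ] := sJ u; split.
 + by exists 0, 0; rewrite mul0r addr0; split => //; case: ifP => // _; exact: hg0.
 + move=> _ _ [j [h [ju hh ->]]] [j' [h' [ju' hh' ->]]]; exists (j + j'), (h + h'); split.
  * exact: jD.
  * by case: leqP hh hh' => [_ hh hh'|_ -> ->]; [exact: hgD|rewrite addr0].
  * by rewrite mulrDl addrACA.
 + move=> a _ [j [h [ju hh ->]]]; exists (a *: j), (a *: h); split; first exact: jZ.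
   by case: leqP hh => [_ hh|_ ->]; [exact: hgZ|rewrite scaler0].
  by rewrite scalerDr scalerAl.
- move=> u e' _ k [j [h [ju hh ->]]] hk; exists (k * j), (k * h); split; first exact: mJ.
  case: leqP hh => [eu hh|_ ->]; last by rewrite mulr0; case: ifP => // _; exact: hg0.
  by rewrite (leq_trans eu) ?leq_addl // -addnBA //; exact: hgM.
 by rewrite mulrDr mulrA.
Qed.

Lemma adjoin_sub J e g u f : J u f -> adjoin J e g u f.
Proof. by move=> jf; exists f, 0; rewrite mul0r addr0; split => //; case: ifP => // _; exact: hg0. Qed.

Lemma adjoin_self J e g : graded_ideal J -> hg e g -> adjoin J e g e g.
Proof.
move=> [_ sJ _] _; exists 0, 1; rewrite leqnn subnn mul1r add0r; split => //; first by case: (sJ e).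
exact: dhomog1.
Qed.

Definition prime_ideal J := forall d e f g, hg d f -> hg e g -> J (d + e)%N (f * g) -> J d f \/ J e g.

End GradedIdeals.

Lemma homogeneous_basis (K : fieldType) n u : exists s : seq (mpoly n.+1 K),
 [/\ inside (hg u) s, indep (fun f => f = 0) s, spans (fun f => f = 0) (hg u) s & size s = 'C(u + n, u)].
Proof.
pose V := dhomog n.+1 K u; pose b := vbasis (fullv : {vspace V}).
pose s := [seq mpoly_of_dhomog v | v <- b].
have linE c : lin c s = mpoly_of_dhomog (\sum_(i < \dim (fullv : {vspace V})) c i *: b`_i).
 rewrite raddf_sum /lin size_map size_tuple; apply: eq_bigr => i _.
 by rewrite (nth_map 0) // size_tuple.
exists s; split.
- by apply: inside_mem => _ /mapP[v _ ->]; exact: dhomog_is_dhomog.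
- move=> c; rewrite linE => h i; rewrite size_map size_tuple => ib.
 have h0 : \sum_(i < \dim (fullv : {vspace V})) c i *: b`_i = 0 by apply: val_inj; exact: h.
 have /freeP fb := basis_free (vbasisP (fullv : {vspace V})).
 exact: (fb (fun i => c i) h0 (Ordinal ib)).
- move=> f hf; pose v : V := DHomog hf.
 have vE := coord_vbasis (memvf v).
 exists (fun i => if insub i is Some j then coord b j v else 0).
 rewrite linE -[f]/(mpoly_of_dhomog v) {1}vE; apply/eqP; rewrite subr_eq0; apply/eqP; congr mpoly_of_dhomog.
 by apply: eq_bigr => i _; rewrite valK.
- by rewrite size_map size_tuple dimvf.
Qed.

Lemma lin_mul (K : fieldType) n (c : nat -> K) (g : mpoly n K) s : lin c [seq g * x | x <- s] = g * lin c s.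
Proof. by rewrite /lin size_map mulr_sumr; apply: eq_bigr => i _; rewrite (nth_map 0) // scalerAr. Qed.

(** * The projective Nullstellensatz *)

Section HomogeneousInduction.
Variables (K : fieldType) (n : nat).
Notation poly := (mpoly n K).
Notation X i := (mpolyX K (mnm1 i) : mpoly n K).

Lemma hg_var i : hg 1 (X i). Proof. by rewrite /hg dhomogX /= mdeg1. Qed.

Lemma hgS_ind d (T : poly -> Prop) : subsp T -> (forall i f, hg d f -> T (X i * f)) -> forall h, hg d.+1 h -> T h.
Proof.
move=> sT hT h /hgP hh; rewrite [h]mpolyE big_seq; apply: subsp_sum => // m /hh dm.
case: (sT) => _ _; apply.
have [i mi] : exists i, m i != 0%N.
 by apply: contrapT => /forallNP h0; move: dm; rewrite mdegE big1 // => i _; apply/eqP/negPn/negP; exact: h0.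
have mE : mnm_add (mnm1 i) (mnm_sub m (mnm1 i)) = m by rewrite addmC submK // lep1mP.
rewrite -mE mpolyXD; apply: hT; rewrite /hg dhomogX /=; apply/eqP.
by have := congr1 mdeg mE; rewrite mdegD mdeg1 dm => -[].
Qed.

Lemma hg0E (f : poly) : hg 0 f -> exists c, f = c *: 1.
Proof.
move=> /hgP h; exists (mcoeff mnm0 f); rewrite [LHS]mpolyE -mpolyX0.
case: (eqVneq f 0) => [->|f0]; first by rewrite msupp0 big_nil mcoeff0 scale0r.
rewrite -mpolyE; apply/mpolyP => m; rewrite mcoeffZ mcoeffX.
case: eqP => [<-|/eqP m0]; first by rewrite mulr1.
rewrite mulr0; apply/eqP; rewrite mcoeff_eq0; apply: contra m0 => /h/eqP; rewrite mdeg_eq0 => /eqP ->; exact: eqxx.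
Qed.

Lemma hg_prod (T : poly -> Prop) a b : subsp T -> (forall f g, hg a f -> hg b g -> T (f * g)) ->
 forall h, hg (a + b) h -> T h.
Proof.
elim: a T => [|a IH] T sT hT h hh; first by rewrite -[h]mul1r; apply: hT => //; exact: dhomog1.
apply: (hgS_ind sT) hh => i f hf; apply: (IH (fun f => T (X i * f))) hf => [|f1 g h1 hg1].
 case: sT => t0 tD tZ; split; first by rewrite mulr0.
  by move=> x y; rewrite mulrDr; exact: tD.
 by move=> c x; rewrite -scalerAr; exact: tZ.
by rewrite mulrA; apply: hT => //; exact: (hgM (hg_var i)).
Qed.

(** The algebraic form of having no projective zero: the ideal contains a power of the irrelevant
    ideal. *)
Definition eventually_all (J : nat -> poly -> Prop) := exists M, forall u f, (M <= u)%N -> hg u f -> J u f.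

Lemma eventually_all_from J M : graded_ideal J -> (forall f, hg M f -> J M f) -> eventually_all J.
Proof.
move=> [_ sJ mJ] h; exists M => u f Mu hf; rewrite -(subnK Mu) in hf *.
by apply: (hg_prod (sJ _)) hf => f1 g h1 /h gM; exact: mJ.
Qed.

(** If [f] and [g] both lay outside [J], then J + (f) and J + (g) would contain all forms of large
    degree. Products of such forms fill the sum of the two degrees, and each product lies in [J]
    because f g does. *)
Lemma maximal_prime J : graded_ideal J -> ~ eventually_all J ->
 (forall J', graded_ideal J' -> ~ eventually_all J' -> (forall u f, J u f -> J' u f) -> forall u f, J' u f -> J u f) ->
 prime_ideal J.
Proof.
move=> gJ nJ max d e f g hf hgg fg; apply: contrapT => /not_orP[nf ng].
have ev d' f' : hg d' f' -> ~ J d' f' -> eventually_all (adjoin J d' f').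
 move=> hf' nf'; apply: contrapT => h; apply: nf'.
 by apply: (max _ (adjoin_ideal gJ hf') h (@adjoin_sub _ _ J d' f')); exact: adjoin_self.
have [a ha] := ev d f hf nf; have [b hb] := ev e g hgg ng.
case: (gJ) => hJ sJ mJ; apply: nJ; pose a' := maxn a d; pose b' := maxn b e.
apply: (@eventually_all_from _ (a' + b')) => // h; apply: (hg_prod (sJ _)) => p q hp hq.
have [j [k [jj + pE]]] := ha a' p (leq_maxl _ _) hp; rewrite leq_maxr => hk.
have [j' [k' [jj' + qE]]] := hb b' q (leq_maxl _ _) hq; rewrite leq_maxr => hk'.
have -> : p * q = q * j + p * j' - j * j' + k * k' * (f * g) by rewrite pE qE; ring.
have [_ jD _] := sJ (a' + b')%N; apply: (jD).
 apply: subspB => //; last by apply: mJ => //; exact: hJ.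
 by apply: (jD); [rewrite addnC; exact: mJ|exact: mJ].
have -> : (a' + b' = (a' - d + (b' - e)) + (d + e))%N.
 by have := leq_maxr a d; have := leq_maxr b e; rewrite -/a' -/b'; lia.
by apply: mJ => //; exact: hgM.
Qed.

End HomogeneousInduction.

Section Nullstellensatz.
Variables (K : closedFieldType) (N : nat).
Notation poly := (mpoly N.+1 K).
Notation X i := (mpolyX K (mnm1 i) : mpoly N.+1 K).
Variable (p : nat -> poly -> Prop).
Hypotheses (gp : graded_ideal p) (pp : prime_ideal p) (np : ~ eventually_all p).
Variable i : 'I_N.+1.
Hypothesis ni : ~ p 1 (X i).

Lemma hg_pow j k : hg k (X j ^+ k).
Proof. by have := dhomogMn k (hg_var K j); rewrite mul1n. Qed.

Lemma pow_notin k : ~ p k (X i ^+ k).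
Proof.
elim: k => [|k IH].
 move=> h; apply: np; apply: (@eventually_all_from _ _ p 0) => // f /hg0E[c ->].
 by case: gp => _ /(_ 0%N)[_ _ pZ] _; exact: pZ.
by rewrite exprS => /(pp (d := 1) (hg_var K i) (hg_pow i k))[].
Qed.

Definition homogenize j u (g : {poly K}) : poly := \sum_(a < u.+1) g`_a *: (X j ^+ a * X i ^+ (u - a)).

Lemma homogenize_factor j u (q : {poly K}) r : (size q <= u.+1)%N ->
 homogenize j u.+1 (('X - r%:P) * q) = (X j - r *: X i) * homogenize j u q.
Proof.
move=> sq; rewrite /homogenize [('X - _) * q]mulrBl [RHS]mulrBl.
have -> : \sum_(a < u.+2) ('X * q - r%:P * q)`_a *: (X j ^+ a * X i ^+ (u.+1 - a)) =
  \sum_(a < u.+2) ('X * q)`_a *: (X j ^+ a * X i ^+ (u.+1 - a)) - \sum_(a < u.+2) (r * q`_a) *: (X j ^+ a * X i ^+ (u.+1 - a)).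
 by rewrite -sumrB; apply: eq_bigr => a _; rewrite coefB coefCM scalerBl.
congr (_ - _).
 rewrite big_ord_recl coefXM eqxx scale0r add0r mulr_sumr; apply: eq_bigr => a _.
 by rewrite coefXM /= -scalerAr mulrA -exprS subSS.
rewrite big_ord_recr /= nth_default // mulr0 scale0r addr0 mulr_sumr; apply: eq_bigr => a _.
rewrite -scalerAr -scalerAl scalerA mulrC; congr (_ *: _).
by rewrite mulrCA -exprS subSn // -ltnS.
Qed.

(** Over a closed field [g] splits, its homogenization is a product of linear forms X_j - r X_i and
    a power of X_i, and the prime must contain one of the former because no power of X_i lies in
    it. *)
Lemma linear_factor j u (g : {poly K}) : g != 0 -> (size g <= u.+1)%N -> p u (homogenize j u g) ->
 exists r, p 1 (X j - r *: X i).
Proof.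
elim: u g => [|u IH] g g0 sg pg.
 have sg1 : size g = 1%N by apply/eqP; rewrite eqn_leq sg lt0n size_poly_eq0.
 case: (@pow_notin 0); move: pg; rewrite /homogenize big_ord1 !expr0 mulr1 => pg.
 have g00 : g`_0 != 0 by have : lead_coef g != 0 by [rewrite lead_coef_eq0]; rewrite /lead_coef sg1.
 by case: gp => _ /(_ 0%N)[_ _ pZ] _; have := pZ (g`_0)^-1 _ pg; rewrite scalerA mulVf // scale1r.
have [sg1|] := eqVneq (size g) 1%N.
 case: (@pow_notin u.+1); have [c c0 gE] := size_poly1P _ (introT eqP sg1); move: pg.
 rewrite /homogenize big_ord_recl /= big1 => [|a _]; last by rewrite gE coefC /= scale0r.
 rewrite addr0 gE coefC /= mul1r subn0 => pg.
 by case: gp => _ /(_ u.+1)[_ _ pZ] _; have := pZ c^-1 _ pg; rewrite scalerA mulVf // scale1r.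
move=> /closed_rootP[r /factor_theorem[q gE]]; rewrite mulrC in gE.
have q0 : q != 0 by apply: contraNneq g0 => q0; rewrite gE q0 mulr0.
have sq : (size q <= u.+1)%N by move: sg; rewrite gE size_monicM ?monicXsubC // size_XsubC.
move: pg; rewrite gE homogenize_factor // => pg.
have h1 : hg 1 (X j - r *: X i) by rewrite -scaleN1r scalerA; apply: hgD; [|apply: hgZ]; exact: hg_var.
have hq : hg u (homogenize j u q).
 rewrite /homogenize /hg; apply: rpred_sum => a _; apply: hgZ.
 by have := hgM (hg_pow j a) (hg_pow i (u - a)); rewrite subnKC // -ltnS.
have [|] := pp h1 hq pg; first by exists r.
by move/IH; apply.
Qed.

(** Once p + (X_i) is everything, a form of degree k + M is congruent modulo [p] to X_i^k times a
    form of degree M. *)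
Lemma bounded_dimension : eventually_all (adjoin p 1 (X i)) ->
 exists M h, forall k, exists2 t : seq poly, size t = h & spans (p (k + M)%N) (hg (k + M)%N) t.
Proof.
case: (gp) => hp sp mp [M hM]; have [s [us _ ss _]] := homogeneous_basis K N M.
exists M, (size s) => k; exists [seq X i ^+ k * f | f <- s]; first by rewrite size_map.
have linX c : lin c [seq X i ^+ k * f | f <- s] = X i ^+ k * lin c s.
 rewrite /lin size_map mulr_sumr; apply: eq_bigr => l _; by rewrite (nth_map 0) // scalerAr.
suff H : forall f, hg (k + M)%N f -> exists2 g, hg M g & p (k + M)%N (f - X i ^+ k * g).
 move=> f /H[g /ss[c gE] hf]; exists c; rewrite linX.
 by move/eqP: gE; rewrite subr_eq0 => /eqP <-.
elim: {linX} k => [|k IH] f hf; first by exists f => //; rewrite mul1r subrr; case: (sp (0 + M)%N).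
have [j [h [jp + fE]]] := hM (k.+1 + M)%N f (leq_addl _ _) hf.
rewrite addSn subSS subn0 => /IH[g hgg hh]; exists g => //.
have -> : f - X i ^+ k.+1 * g = j + X i * (h - X i ^+ k * g) by rewrite fE exprS; ring.
by case: (sp (k.+1 + M)%N) => _ pD _; apply: pD => //; apply: (mp _ 1%N) => //; exact: hg_var.
Qed.

(** Among the h + 1 monomials X_j^a X_i^(h + M - a) there is a relation modulo [p], because the
    quotient has dimension at most [h]; it is the homogenization of a nonzero polynomial in one
    variable. *)
Lemma coordinates : eventually_all (adjoin p 1 (X i)) -> forall j, exists r, p 1 (X j - r *: X i).
Proof.
move=> /bounded_dimension[M [h hb]] j; have [t st ts] := hb h.
pose s := [seq X j ^+ a * X i ^+ (h + M - a) | a <- iota 0 h.+1].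
have us : inside (hg (h + M)%N) s.
 apply: inside_mem => _ /mapP[a + ->]; rewrite mem_iota ltnS => /andP[_ ah].
 by have := hgM (hg_pow j a) (hg_pow i (h + M - a)); rewrite subnKC // (leq_trans ah) // leq_addr.
have [c [pc [a ah ca]]] : exists c, p (h + M)%N (lin c s) /\ exists2 a, (a < h.+1)%N & c a != 0.
 apply: contrapT => nex; have js : indep (p (h + M)%N) s.
  move=> c pc a; rewrite size_map size_iota => ah; apply/eqP/negPn/negP => ca; apply: nex; exists c; split => //.
  by exists a.
 by have := indep_le_spans (let: And3 _ sp _ := gp in sp _) us js ts; rewrite size_map size_iota st ltnn.
pose g := \poly_(a < h.+1) c a.
apply: (@linear_factor j (h + M) g).
- by apply: contraNneq ca => g0; have := coef_poly h.+1 c a; rewrite -/g g0 coef0 ah => ->.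
- by apply: leq_trans (size_poly _ _) _; rewrite ltnS leq_addr.
have -> // : homogenize j (h + M) g = lin c s.
rewrite /homogenize /lin size_map size_iota.
rewrite (big_ord_widen_cond (h + M).+1 xpredT (fun a => c a *: s`_a)) ?ltnS ?leq_addr // [RHS]big_mkcond /=.
apply: eq_bigr => b _; rewrite coef_poly; case: ifP => bh; last by rewrite scale0r.
by rewrite (nth_map 0%N) ?size_iota // nth_iota.
Qed.

(** The values r found for each j are the coordinates of the point. By induction on the degree, f is
    congruent to f(x) X_i^u modulo [p]; as X_i^u is not in [p], the elements of [p] vanish at x. *)
Lemma point_of_prime : eventually_all (adjoin p 1 (X i)) -> exists2 x : 'I_N.+1 -> K, x i = 1 &
 forall u f, p u f -> meval x f = 0.
Proof.
move=> /coordinates /choice[x hx]; case: (gp) => hp sp mp.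
have pZ u a f : p u f -> p u (a *: f) by case: (sp u) => _ _; apply.
have xi : x i = 1.
 apply/eqP/negPn/negP => x1; apply: ni; rewrite -[X i]scale1r -(@mulVf _ (1 - x i)) ?subr_eq0 1?eq_sym //.
 by rewrite -scalerA; apply: pZ; rewrite scalerBl scale1r.
have ev u : forall f, hg u f -> p u (f - meval x f *: X i ^+ u).
 elim: u => [|u IH] f.
  move=> /hg0E[c ->]; rewrite mevalZ meval1 mulr1 subrr; by case: (sp 0%N).
 apply: (hgS_ind (T := fun f => p u.+1 (f - meval x f *: X i ^+ u.+1))) => [|j g hgg].
  split; first by rewrite meval0 scale0r subr0; case: (sp u.+1).
   by move=> f1 f2 h1 h2; rewrite mevalD scalerDl opprD addrACA; case: (sp u.+1) => _ pD _; exact: pD.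
  by move=> c f1 h1; rewrite mevalZ -scalerA -scalerBr; exact: pZ.
 rewrite mevalM mevalXU.
 have -> : X j * g - (x j * meval x g) *: X i ^+ u.+1 =
   g * (X j - x j *: X i) + (x j *: X i) * (g - meval x g *: X i ^+ u).
  rewrite exprS -scalerA -!mul_mpolyC; ring.
 case: (sp u.+1) => _ pD _; apply: pD; first by rewrite -addn1; exact: mp.
 by apply: (mp _ 1%N); [exact: IH|apply: hgZ; exact: hg_var].
exists x => // u f pf; have := ev u f (hp u f pf) => h.
apply/eqP/negPn/negP => fx; apply: (@pow_notin u).
have h2 : p u (meval x f *: X i ^+ u).
 by rewrite -[_ *: _](subKr f); exact: subspB.
by have := pZ u (meval x f)^-1 _ h2; rewrite scalerA mulVf // scale1r.
Qed.

End Nullstellensatz.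

(** An ideal maximal among those that contain [J] and miss forms of arbitrarily large degree is
    prime, and has a point. *)
Theorem projective_nullstellensatz (K : closedFieldType) N (J : nat -> mpoly N.+1 K -> Prop) : graded_ideal J ->
 (forall x : 'I_N.+1 -> K, (exists i, x i != 0) -> exists u f, J u f /\ meval x f != 0) -> eventually_all J.
Proof.
move=> gJ noz; apply: contrapT => nJ.
have [p [gp np Jp max]] := maximal_ideal (Phi := fun J => ~ eventually_all J) gJ nJ; have pp := maximal_prime gp np max.
have [i ni] : exists i, ~ p 1%N (mpolyX K (mnm1 i)).
 apply: contrapT => /forallNP h; apply: np; apply: (@eventually_all_from _ _ p 1) => // f.
 case: (gp) => _ sp mp; apply: (hgS_ind (sp 1%N)) => i g hgg; rewrite mulrC; apply: (mp _ 0%N) => //; exact: contrapT (h i).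
have [|x xi hx] := point_of_prime gp pp np ni.
 apply: contrapT => h; apply: ni; apply: (max _ (adjoin_ideal gp (hg_var K i)) h (@adjoin_sub _ _ p 1 _)).
 exact/adjoin_self/hg_var.
have [|u [f [Jf]]] := noz x; first by exists i; rewrite xi oner_neq0.
by rewrite (hx u f) ?eqxx //; exact: Jp.
Qed.

(** * Algebraic sets, decomposition, and growth of Hilbert functions *)

Section AlgebraicSets.
Context {R : realType} {N : nat}.
Local Notation K := (R[i]).
Local Notation pt := ('I_N.+1 -> R[i]).
Local Notation poly := (mpoly N.+1 R[i]).
Local Notation X i := (mpolyX R[i] (mnm1 i) : poly).
Implicit Types (A B Y : set pt).

Lemma homog_hg d (f : poly) : homog d f <-> hg d f.
Proof. by rewrite /hg dhomogE. Qed.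

Definition van A u (f : poly) := hg u f /\ forall x, A x -> peval x f = 0.

Lemma van_ideal A : graded_ideal (van A).
Proof.
split.
- by move=> u f [].
- move=> u; split.
 + by split; [exact: hg0|move=> x _; exact: meval0].
 + by move=> f g [hf f0] [hh g0]; split; [exact: hgD|move=> x ax; rewrite /peval mevalD -!/(peval _ _) f0 // g0 // addr0].
 + by move=> a f [hf f0]; split; [exact: hgZ|move=> x ax; rewrite /peval mevalZ -/(peval _ _) f0 // mulr0].
- move=> u e f h [hf f0] hh; split; first exact: hgM.
 by move=> x ax; rewrite /peval mevalM -!/(peval _ _) f0 // mulr0.
Qed.

Lemma algebraicP A : algebraic A -> (forall x, A x -> nonzero_pt x) /\
 forall x, nonzero_pt x -> (forall u f, van A u f -> peval x f = 0) -> A x.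
Proof.
move=> [S [hS ->]]; split; first by move=> x [].
move=> x nx h; split => // f Sf; have [d /homog_hg hf] := hS f Sf.
by apply: (h d); split => // y [_]; exact.
Qed.

Lemma algebraic_zero (S : set poly) : (forall f, S f -> exists d, hg d f) -> algebraic (zero_locus S).
Proof. by move=> hS; exists S; split => // f /hS[d /homog_hg]; exists d. Qed.

Lemma algebraicI A B : algebraic A -> algebraic B -> algebraic (A `&` B).
Proof.
move=> [S [hS ->]] [T [hT ->]]; exists (S `|` T); split; first by move=> f [/hS|/hT].
apply/seteqP; split=> [x [[nx hx] [_ hy]]|x [nx h]]; first by split => // f [/hx|/hy].
by split; split => // f Sf; apply: h; [left|right].
Qed.

Lemma van_strict A B : algebraic A -> algebraic B -> A `<=` B -> ~ (B `<=` A) -> exists u f, van A u f /\ ~ van B u f.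
Proof.
move=> /algebraicP[nA hA] /algebraicP[nB _] AB /existsNP[x /not_implyP[Bx nAx]].
apply: contrapT => h; apply: nAx; apply: hA => [|u f vf]; first exact: nB.
have [|] := pselect (van B u f); first by move=> [_]; exact.
by move=> nvB; case: h; exists u, f.
Qed.

(** A strictly descending sequence of algebraic sets would give a strictly ascending one of
    vanishing ideals. *)
Lemma algebraic_min (Phi : set pt -> Prop) A : (forall B, Phi B -> algebraic B) -> Phi A ->
 exists B, Phi B /\ forall Y, Phi Y -> Y `<=` B -> B `<=` Y.
Proof.
move=> alg pA; apply: contrapT => nex.
pose T := {B | Phi B}; pose Rel (B Y : T) := sval Y `<=` sval B /\ ~ (sval B `<=` sval Y).
have hR (B : T) : exists Y : T, Rel B Y.
 case: B => B pB; apply: contrapT => /forallNP h; apply: nex; exists B; split => // Y pY YB.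
 by have /not_andP[|/contrapT] := h (exist _ Y pY : T).
have [s [_ hs]] := dependent_choice (exist _ A pA : T) hR.
have [|k u f|k hk] := @ascending_chain _ _ (fun k => van (sval (s k))).
- by move=> k; exact: van_ideal.
- by move=> [hf f0]; split => // x /(hs k).1; exact: f0.
have [h1 h2] := hs k; have [u [f [v1 v2]]] := van_strict (alg _ (svalP (s k.+1))) (alg _ (svalP (s k))) h1 h2.
exact: v2 (hk _ _ v1).
Qed.

Definition decomposable A := exists s : seq (set pt), (forall Y, List.In Y s -> irreducible_alg Y /\ Y `<=` A) /\
 forall x, A x -> exists Y, List.In Y s /\ Y x.

(** Noetherian induction: a minimal set without decomposition would be reducible, and its two
    smaller parts decompose. *)
Lemma decomposition A : algebraic A -> decomposable A.
Proof.
move=> aA; apply: contrapT => nA.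
have [B [[aB nB] minB]] := @algebraic_min (fun B => algebraic B /\ ~ decomposable B) A (fun _ h => h.1) (conj aA nA).
apply: nB; have [[x0 Bx]|B0] := pselect (B !=set0); last first.
 by exists [::]; split => // x Bx; case: B0; exists x.
have [iB|niB] := pselect (irreducible_alg B).
 by exists [:: B]; split => [Y [<-|//]|x Bx']; [split|exists B; split => //; left].
have [A1 [A2 [a1 a2 BA n1 n2]]] : exists A1 A2, [/\ algebraic A1, algebraic A2, B `<=` A1 `|` A2, ~ B `<=` A1 & ~ B `<=` A2].
 apply: contrapT => h; apply: niB; split => //; first by exists x0.
 move=> A1 A2 a1 a2 BA; apply: contrapT => /not_orP[n1 n2]; apply: h; by exists A1, A2.
have dec A' : algebraic A' -> ~ (B `<=` A') -> decomposable (B `&` A').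
 move=> aA' nB; apply: contrapT => nd; apply: nB => x Bx'.
 by have [] := minB (B `&` A') (conj (algebraicI aB aA') nd) (@subIsetl _ _ _) x Bx'.
have [s1 [h1 c1]] := dec A1 a1 n1; have [s2 [h2 c2]] := dec A2 a2 n2.
exists (s1 ++ s2); split.
 by move=> Y /List.in_app_iff[/h1[iY YB]|/h2[iY YB]]; split => // x /YB[].
move=> x Bx'; case: (BA x Bx') => Ax.
 by have [Y [Ys Yx]] := c1 x (conj Bx' Ax); exists Y; split => //; apply/List.in_app_iff; left.
by have [Y [Ys Yx]] := c2 x (conj Bx' Ax); exists Y; split => //; apply/List.in_app_iff; right.
Qed.

Lemma algebraicU A B : algebraic A -> algebraic B -> algebraic (A `|` B).
Proof.
move=> [S [hS ->]] [T [hT ->]].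
exists [set h | exists f g, [/\ S f, T g & h = f * g]]; split.
 move=> _ [f [g [/hS[d /homog_hg hf] /hT[e /homog_hg hh] ->]]]; exists (d + e)%N; apply/homog_hg; exact: hgM.
apply/seteqP; split=> [x [[nx hx]|[nx hx]]|x [nx h]].
- by split => // _ [f [g [Sf _ ->]]]; rewrite /peval mevalM -!/(peval _ _) hx // mul0r.
- by split => // _ [f [g [_ /hx gx ->]]]; rewrite /peval mevalM [meval x g]gx mulr0.
have [hx|/existsNP[f /not_implyP[Sf /eqP fx]]] := pselect (forall f, S f -> peval x f = 0); first by left.
right; split => // g Tg; have /eqP := h (f * g) (ex_intro _ f (ex_intro _ g (And3 Sf Tg erefl))).
by rewrite /peval mevalM mulf_eq0 (negbTE fx) => /eqP.
Qed.

Lemma algebraic_union (s : seq (set pt)) : (forall A, List.In A s -> algebraic A) ->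
 algebraic [set x | exists A, List.In A s /\ A x].
Proof.
elim: s => [|A s IH] als.
 exists [set 1]; split; first by move=> _ ->; exists 0%N; apply/homog_hg; exact: dhomog1.
 apply/seteqP; split=> [x [A [[]]]|x [_ /(_ 1 erefl)/eqP]].
 by rewrite /peval meval1 oner_eq0.
have -> : [set x | exists B, List.In B (A :: s) /\ B x] = A `|` [set x | exists A, List.In A s /\ A x].
 apply/seteqP; split=> [x [B [[<-|Bs] Bx]]|x [Ax|[B [Bs Bx]]]]; [by left|by right; exists B| |].
  by exists A; split => //; left.
 by exists B; split => //; right.
apply: algebraicU; first by apply: als; left.
by apply: IH => B Bs; apply: als; right.
Qed.

Lemma irreducible_in_union Y (s : seq (set pt)) : irreducible_alg Y -> (forall A, List.In A s -> algebraic A) ->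
 (forall x, Y x -> exists A, List.In A s /\ A x) -> exists A, List.In A s /\ Y `<=` A.
Proof.
move=> [aY [y0 Yy] iY]; elim: s => [|A s IH] als cov; first by have [A []] := cov y0 Yy.
have aU := algebraic_union (fun B Bs => als B (or_intror Bs)).
have YU : Y `<=` A `|` [set x | exists A, List.In A s /\ A x].
 by move=> x /cov[B [[<-|Bs] Bx]]; [left|right; exists B].
have [YA|YU'] := iY _ _ (als A (or_introl erefl)) aU YU; first by exists A; split => //; left.
have [|B [Bs YB]] := IH _ YU'; first by move=> B Bs; apply: als; right.
by exists B; split => //; right.
Qed.

Lemma van_prime Y : irreducible_alg Y -> prime_ideal (van Y).
Proof.
move=> [aY _ iY] d e f g hf hh [_ fg].
pose Z h := zero_locus [set h : poly].
have [nY _] := algebraicP aY.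
have aZ d' h : hg d' h -> algebraic (Z h) by move=> hh'; apply: algebraic_zero => _ ->; exists d'.
have [|Yf|Yg] := iY _ _ (aZ d f hf) (aZ e g hh).
- move=> x Yx; have /eqP := fg x Yx; rewrite /peval mevalM mulf_eq0 => /orP[/eqP h|/eqP h].
  by left; split; [exact: nY|move=> _ ->].
 by right; split; [exact: nY|move=> _ ->].
- by left; split => // x /Yf[_]; apply.
- by right; split => // x /Yg[_]; apply.
Qed.

(* [k] is one more than the dimension. *)
Definition growth k (J : nat -> poly -> Prop) :=
 if k is k'.+1 then exists C, forall u, exists2 s, (size s <= C * u.+1 ^ k')%N & spans (J u) (hg u) s
 else eventually_all J.

Lemma expn_mono a b k : (a <= b)%N -> (a ^ k <= b ^ k)%N.
Proof. by case: k => // k ab; rewrite leq_exp2r. Qed.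

Lemma growth_bound k J : graded_ideal J -> growth k J -> exists h : nat -> nat, (forall u, exists2 s, (size s <= h u)%N & spans (J u) (hg u) s) /\
 exists C, forall u, (\sum_(v < u.+1) h v <= C * u.+1 ^ k)%N.
Proof.
move=> [_ sJ _]; case: k => [[M hM]|k [C hC]]; last first.
 exists (fun u => (C * u.+1 ^ k)%N); split => //; exists C => u.
 apply: (@leq_trans (\sum_(v < u.+1) C * u.+1 ^ k)); last by rewrite sum_nat_const card_ord expnS; nia.
 by apply: leq_sum => v _; rewrite leq_mul2l expn_mono ?ltn_ord ?orbT.
have [b hb] := choice (fun u => @homogeneous_basis K N u).
exists (fun u => if (u < M)%N then size (b u) else 0%N); split.
 move=> u; case: ltnP => [_|Mu]; last first.
  by exists [::] => // f hf; exists (fun=> 0); rewrite lin_nil subr0; exact: hM.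
 exists (b u) => //; have [_ _ sb _] := hb u; apply: spans_weak sb => _ ->; by case: (sJ u).
exists (\sum_(v < M) size (b v))%N => u; rewrite expn0 muln1.
rewrite (big_ord_widen (u.+1 + M) (fun v => size (b v))) ?leq_addl //.
rewrite (big_ord_widen (u.+1 + M) (fun v => if (v < M)%N then size (b v) else 0%N)) ?leq_addr //.
by rewrite big_mkcond [leqRHS]big_mkcond; apply: leq_sum => v _; case: ifP.
Qed.

Lemma pevalX (x : pt) (f : poly) k : peval x (f ^+ k) = peval x f ^+ k.
Proof. by elim: k => [|k IH]; rewrite /peval ?expr0 ?meval1 // !exprS mevalM -IH. Qed.

(** In degree u, generators modulo J + (g) together with g times generators of degree u - e span
    modulo [J]. Summing over the degrees raises the exponent of growth by one. *)
Lemma growth_adjoin k J e g : graded_ideal J -> hg e g -> (0 < e)%N -> growth k (adjoin J e g) -> growth k.+1 J.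
Proof.
move=> gJ hgg e0 gr; have [h [hs [C hC]]] := growth_bound (adjoin_ideal gJ hgg) gr.
case: (gJ) => hJ sJ mJ; exists C => u.
suff [t st tt] : exists2 t, (size t <= \sum_(v < u.+1) h v)%N & spans (J u) (hg u) t.
 by exists t => //; exact: leq_trans st (hC u).
have [m] := ubnP u; elim: m u => // m IH u; rewrite ltnS => um.
have [s ss us] := hs u; have [eu|ue] := leqP e u; last first.
 exists s; first by rewrite big_ord_recr /= (leq_trans ss) // leq_addl.
 by move=> f /us[c [j [k' [jj + fE]]]]; rewrite leqNgt ue /= => k0; exists c; rewrite fE k0 mul0r addr0.
have [|t st ut] := IH (u - e)%N; first by lia.
exists (s ++ [seq g * x | x <- t]).
 rewrite size_cat size_map big_ord_recr /= addnC leq_add // (leq_trans st) //.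
 have -> : (u - e).+1 = (u - e.-1)%N by lia.
 by rewrite (big_ord_widen u) ?leq_subr // big_mkcond; apply: leq_sum => v _; case: ifP.
move=> f /us[c [j [k' [jj + fE]]]]; rewrite eu => /ut[d hd].
exists (fun i => if (i < size s)%N then c i else d (i - size s)%N); rewrite lin_cat.
rewrite (lin_ext (d := c)) => [|i ->] //.
rewrite (_ : lin _ [seq g * x | x <- t] = lin d [seq g * x | x <- t]); last first.
 by apply: lin_ext => i _; rewrite ltnNge leq_addr /= addKn.
rewrite lin_mul.
have -> : f - (lin c s + g * lin d t) = j + g * (k' - lin d t) by rewrite opprD addrA fE; ring.
by case: (sJ u) => _ jD _; apply: jD => //; rewrite -(subnKC eu); exact: mJ.
Qed.

(** Lower bound for the Hilbert function along a chain. A form g vanishes on Z_e but not on Z_(e+1);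
    a family independent on Z_e, joined to a power of g times the family already built on Z_(e+1),
    is independent on Z_(e+1): restriction to Z_e kills the second part, and primality removes the
    factor. The sizes add up by Pascal's rule. *)
Lemma chain_lower (e : nat) (Z : nat -> set pt) : (forall i, (i <= e)%N -> irreducible_alg (Z i)) ->
 (forall i, (i < e)%N -> Z i `<` Z i.+1) -> exists2 D, (0 < D)%N & forall b, exists s,
 [/\ inside (hg (D * b)) s, indep (van (Z e) (D * b)) s & ('C(b + e, e) <= size s)%N].
Proof.
elim: e => [|e IH] iZ cZ.
 have [aZ [x Zx] _] := iZ 0%N isT; have [nZ _] := algebraicP aZ; have [i xi] := nZ x Zx.
 exists 1%N => // b; rewrite mul1n; exists [:: X i ^+ b]; split; last by rewrite bin0.
  by move=> [|//] _; exact: hg_pow.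
 move=> c; rewrite lin_cons lin_nil addr0 => -[_ /(_ x Zx)]; rewrite /peval mevalZ [meval x _]pevalX /peval mevalXU => /eqP.
 by rewrite mulf_eq0 expf_eq0 (negbTE xi) andbF orbF => /eqP c0 [].
have [|i ie|D D0 hD] := IH; first by move=> i ie; apply: iZ; exact: leqW.
 by apply: cZ; exact: leqW.
have [aZ [x0 Zx0] _] := iZ e (leqnSn e); have [aZ' _ _] := iZ e.+1 (leqnn _).
have [ZZ nZZ] := cZ e (leqnn _).
have [d [g [[hg' g0] ng]]] := van_strict aZ aZ' ZZ nZZ.
have pr := van_prime (iZ e.+1 (leqnn _)); have gv := van_ideal (Z e.+1).
have d0 : (0 < d)%N.
 rewrite lt0n; apply: contra_notN ng => /eqP d0; rewrite d0 in hg' *.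
 have [c gE] := hg0E hg'; move: (g0 x0 Zx0); rewrite gE /peval mevalZ meval1 mulr1 => ->.
 by rewrite scale0r; case: gv => _ /(_ 0%N)[].
(* With exponent [D] the degree of [G] is a multiple of [D], so the family on Z_e exists in every
   degree d D b. *)
pose G := g ^+ D.
have hG : hg (d * D) G by exact: dhomogMn.
have G0 x : Z e x -> peval x G = 0 by move=> /g0 gx; rewrite pevalX gx expr0n gtn_eqF.
have nG : ~ van (Z e.+1) (d * D) G.
 rewrite /G; elim: (D) => [|k IHk]; last first.
  by rewrite exprS mulnS => /(pr _ _ _ _ hg' (dhomogMn k hg'))[].
 by rewrite expr0 => -[_ /(_ x0 (ZZ _ Zx0))/eqP]; rewrite /peval meval1 oner_eq0.
exists (d * D)%N; first by rewrite muln_gt0 d0.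
elim=> [|b [F [uF jF sF]]].
 have [x1 Zx1] : Z e.+1 !=set0 by exists x0; exact: ZZ.
 exists [:: 1]; rewrite muln0 binn; split => //; first by move=> [|//] _; exact: dhomog1.
 move=> c; rewrite lin_cons lin_nil addr0 => -[_ /(_ x1 Zx1)]; rewrite /peval mevalZ meval1 mulr1 => c0.
 by case.
have [s [us js ss]] := hD (d * b.+1)%N.
have De : (D * (d * b.+1) = d * D * b.+1)%N by lia.
rewrite De in us js.
exists (s ++ [seq G * x | x <- F]); split.
- apply: inside_cat => // i; rewrite size_map => iF; rewrite (nth_map 0) // mulnS; exact: hgM (uF i iF).
- move=> c; rewrite lin_cat lin_mul => hc.
 have /js c0 : van (Z e) (d * D * b.+1) (lin c s).
  case: hc => h1 h2; split; first by rewrite /lin /hg; apply: rpred_sum => j _; apply: hgZ; exact: us.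
  move=> x Zx; have := h2 x (ZZ _ Zx); rewrite /peval mevalD mevalM [meval x G]G0 // mul0r addr0 //.
 move: hc; rewrite (lin_ext (d := fun=> 0)) // lin0 add0r mulnS => hc i.
 rewrite size_cat size_map => ilt; case: (ltnP i (size s)) => [|si]; first exact: c0.
 have hl : hg (d * D * b) (lin (fun i => c (size s + i)%N) F).
  by rewrite /lin /hg; apply: rpred_sum => j _; apply: hgZ; exact: uF.
 have [//|/jF h] := pr _ _ _ _ hG hl hc.
 by have := h (i - size s)%N; rewrite subnKC //; apply; rewrite ltn_subLR.
- rewrite size_cat size_map addSn binS addnC leq_add //.
  by rewrite addnS -addSn; apply: leq_trans ss; rewrite leq_bin2l // leq_add2r; nia.
Qed.

(** The lower bound is a polynomial of degree [e] in b and the upper one of degree [k]. They are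
    compared along the common multiples of [D] and [D']. *)
Lemma chain_growth D' b1 C k J e Z : (0 < D')%N ->
 (forall b, (b1 <= b)%N -> exists2 s, (size s <= C * b.+1 ^ k)%N & spans (J (D' * b)%N) (hg (D' * b)) s) ->
 (forall i, (i <= e)%N -> irreducible_alg (Z i)) ->
 (forall i, (i < e)%N -> Z i `<` Z i.+1) -> (forall u f, J u f -> van (Z e) u f) -> (e <= k)%N.
Proof.
move=> D'0 gr iZ cZ JZ; rewrite leqNgt; apply/negP => ke.
have [D D0 hD] := chain_lower iZ cZ.
have bnd b : (b1 <= b)%N -> (b.+1 <= e`! * C * D ^ k)%N.
 move=> bb; have [s [us js ss]] := hD (D' * b)%N; have [|t st ts] := gr (D * b)%N.
  by apply: leq_trans bb _; rewrite leq_pmull.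
 have E : (D * (D' * b) = D' * (D * b))%N by rewrite mulnCA.
 rewrite E in us js; have sv : subsp (van (Z e) (D' * (D * b))) by case: (van_ideal (Z e)).
 have h1 := leq_trans ss (leq_trans (indep_le_spans sv us js (spans_weak (JZ _) ts)) st).
 have h2 : (b.+1 ^ e <= e`! * 'C(D' * b + e, e))%N.
  apply: (@leq_trans (e`! * 'C(b + e, e))); last by rewrite leq_mul2l leq_bin2l ?orbT // leq_add2r leq_pmull.
  by rewrite mulnC bin_ffact; elim: (e) => // j IHj; rewrite addnS ffactSS expnS leq_mul // ltnS leq_addr.
 have h3 : (b.+1 ^ e <= e`! * (C * (D * b).+1 ^ k))%N by apply: leq_trans h2 _; rewrite leq_mul2l h1 orbT.
 have h4 : (e`! * (C * (D * b).+1 ^ k) <= e`! * C * D ^ k * b.+1 ^ k)%N.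
  by rewrite -!mulnA -expnMn !leq_mul2l expn_mono ?orbT //; nia.
 have := leq_trans h3 h4; rewrite -{1}(subnK ke) expnD expnS => h5.
 have : (b.+1 * b.+1 ^ k <= e`! * C * D ^ k * b.+1 ^ k)%N.
  by apply: leq_trans h5; rewrite leq_pmull // expn_gt0.
 by rewrite leq_pmul2r ?expn_gt0.
by have := bnd (b1 + e`! * C * D ^ k)%N (leq_addr _ _); rewrite ltnNge leq_addl.
Qed.

Lemma growth_chain k J e Z : growth k J -> (forall i, (i <= e)%N -> irreducible_alg (Z i)) ->
 (forall i, (i < e)%N -> Z i `<` Z i.+1) -> (forall u f, J u f -> van (Z e) u f) -> (e < k)%N.
Proof.
move=> gr iZ cZ JZ; case: k gr => [[M hM]|k [C hC]]; last first.
 rewrite ltnS; apply: (@chain_growth 1 0 C k J e Z isT _ iZ cZ JZ) => b _; rewrite mul1n; exact: hC.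
have [aZ [x Zx] _] := iZ e (leqnn _); have [nZ _] := algebraicP aZ; have [i xi] := nZ x Zx.
have [_ /(_ x Zx)/eqP] := JZ _ _ (hM M (X i ^+ M) (leqnn _) (hg_pow _ i M)).
by rewrite pevalX /peval mevalXU expf_eq0 (negbTE xi) andbF.
Qed.

End AlgebraicSets.

(** * Dimension by chains and generic hypersurface sections *)

Section ChainDimension.
Context {R : realType} {N : nat}.
Local Notation K := (R[i]).
Local Notation pt := ('I_N.+1 -> R[i]).
Local Notation poly := (mpoly N.+1 R[i]).
Local Notation X i := (mpolyX R[i] (mnm1 i) : poly).
Implicit Types (A B Y V : set pt) (s W : seq poly).

(** Dimension less than [k]; the shift by one lets k = 0 stand for the empty set and keeps the
    arithmetic in the natural numbers. *)
Definition cdim A k := forall e Z, chain_in A e Z -> (e < k)%N.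

Lemma cdimS A B k l : A `<=` B -> (k <= l)%N -> cdim B k -> cdim A l.
Proof. by move=> AB kl h e Z [i c ZA]; apply: leq_trans kl; apply: (h _ Z); split => // x /ZA/AB. Qed.

Lemma cdim0 A : algebraic A -> cdim A 0 -> A = set0.
Proof.
move=> /decomposition[s [hs cs]] h; apply/seteqP; split => // x /cs[Y [/hs[iY YA] _]].
by have := h 0%N (fun=> Y) (And3 (fun _ _ => iY) (fun i (l : (i < 0)%N) => False_ind _ (notF l)) YA).
Qed.

Definition zeros s := zero_locus [set` s].

Lemma zeros_algebraic d s : (forall f, f \in s -> hg d f) -> algebraic (zeros s).
Proof. by move=> h; apply: algebraic_zero => f /h; exists d. Qed.

Lemma poly_nonroot (g : {poly K}) : g != 0 -> exists t, g.[t] != 0.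
Proof.
move=> g0; apply: contrapT => /forallNP h.
have := @max_poly_roots _ g [seq i%:R | i <- iota 0 (size g)] g0; rewrite size_map size_iota ltnn.
move=> /(_ _ _)/notF; apply.
 by apply/allP => _ /mapP[i _ ->]; apply/rootP/eqP/negPn/negP; exact: h.
by rewrite map_inj_uniq ?iota_uniq // => i j /eqP; rewrite eqr_nat => /eqP.
Qed.

(* Evaluated at a point where [W] does not vanish identically, the combination with coefficients
  [1, t, t ^ 2, ...] is a nonzero polynomial in [t]. *)
Lemma generic_combination W (s : seq (set pt)) : exists c, forall Y, List.In Y s ->
 (forall x, Y x -> forall f, f \in W -> peval x f = 0) \/ exists2 x, Y x & peval x (lin c W) != 0.
Proof.
suff [g g0 hg] : exists2 g : {poly K}, g != 0 & forall t, g.[t] != 0 -> forall Y, List.In Y s ->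
  (forall x, Y x -> forall f, f \in W -> peval x f = 0) \/ exists2 x, Y x & peval x (lin (fun i => t ^+ i) W) != 0.
 by have [t /hg] := poly_nonroot g0; exists (fun i => t ^+ i).
elim: s => [|Y s [g g0 IH]]; first by exists 1; rewrite ?oner_neq0.
have [YW|] := pselect (forall x, Y x -> forall f, f \in W -> peval x f = 0).
 by exists g => // t gt Y' [<-|]; [left|exact: IH].
move=> /existsNP[x /not_implyP[Yx /existsNP[f /not_implyP[fW /eqP fx]]]].
pose h := \poly_(i < size W) peval x W`_i.
have h0 : h != 0.
 apply: contra fx => /eqP/polyP/(_ (index f W)); rewrite coef_poly index_mem fW coef0 nth_index // => ->; exact: eqxx.
exists (g * h); first by rewrite mulf_neq0.
move=> t; rewrite hornerM mulf_eq0 negb_or => /andP[gt ht] Y' [<-|]; last exact: IH.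
right; exists x => //; rewrite /peval /lin raddf_sum /=; apply: contra ht => /eqP e0; apply/eqP.
by rewrite horner_poly -[RHS]e0; apply: eq_bigr => i _; rewrite mevalZ mulrC.
Qed.

Lemma chain_extend A Y e (Z : nat -> set pt) : chain_in A e Z -> irreducible_alg Y -> Z e `<` Y -> Y `<=` A ->
 chain_in A e.+1 (fun i => if (i <= e)%N then Z i else Y).
Proof.
move=> [iZ cZ ZA] iY ZY YA; split; last by rewrite ltnn.
- by move=> i ie; case: ifP => // /iZ.
- move=> i; rewrite ltnS => ie; rewrite ie; case: (ltnP i e) => ie'; first exact: cZ.
 by have -> : i = e by apply/eqP; rewrite eqn_leq ie.
Qed.

(** One generic combination cuts as well as all of [W]. On a component of [A] where [W] vanishes
    identically nothing is to be done; on any other the combination is nonzero somewhere, so a chain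
    in its zeros is extended by the component. *)
Lemma cut W A d k : algebraic A -> (forall f, f \in W -> hg d f) -> cdim (A `&` zeros W) k -> cdim A k.+1 ->
 exists c, cdim (A `&` zeros [:: lin c W]) k.
Proof.
move=> aA hW dW dA; have [s [hs cs]] := decomposition aA; have [c hc] := generic_combination W s.
exists c => e Z [iZ cZ ZA].
have [|x Zx|Y [Ys ZY]] := irreducible_in_union (iZ e (leqnn _)) (s := s).
- by move=> Y /hs[[]].
- by apply: cs; exact: (ZA x Zx).1.
have [iY YA] := hs Y Ys; have [nA _] := algebraicP aA.
case: (hc Y Ys) => [YW|[x Yx Px]].
 apply: (dW e Z); split => // x Zx; split; first exact: (ZA x Zx).1.
 by split; [exact: nA (ZA x Zx).1|exact: YW (ZY x Zx)].
rewrite -ltnS; apply: (dA _ (fun i => if (i <= e)%N then Z i else Y)).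
apply: chain_extend => //; first by split => // y /ZA[].
split => // YZ; have [_ [_ h]] := ZA x (YZ x Yx).
by move: Px; rewrite h ?eqxx //= mem_seq1.
Qed.

Lemma hg_lin d c s : (forall f, f \in s -> hg d f) -> hg d (lin c s).
Proof. by move=> h; apply: subsp_sum => [|i _]; [split; [exact: hg0|exact: hgD|exact: hgZ]|apply: hgZ; apply: h; exact: mem_nth]. Qed.

Definition cuts_out (J : nat -> poly -> Prop) A := forall x, nonzero_pt x -> (forall u f, J u f -> peval x f = 0) -> A x.

Lemma adjoin_cuts J A d g : graded_ideal J -> hg d g -> cuts_out J A -> cuts_out (adjoin J d g) (A `&` zeros [:: g]).
Proof.
move=> gJ hgg hJ x nx h; split; first by apply: hJ => // u f /(adjoin_sub d g); exact: h.
by split => // f; rewrite /= mem_seq1 => /eqP ->; apply: (h d); exact: adjoin_self.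
Qed.

(** The powers of the coordinates have no common zero: in every positive degree they are a stock of
    forms with which a generic cut lowers the dimension. *)
Lemma power_zeros d x : (0 < d)%N -> ~ zeros [seq X i ^+ d | i <- enum 'I_N.+1] x.
Proof.
move=> d0 [[i xi] h]; move: xi; apply/negP/negPn.
have : peval x (X i ^+ d) == 0 by apply/eqP/h; rewrite /=; apply: map_f; rewrite mem_enum.
by rewrite pevalX /peval mevalXU expf_eq0 d0.
Qed.

Lemma power_hg d : forall f, f \in [seq X i ^+ d | i <- enum 'I_N.+1] -> hg d f.
Proof. by move=> _ /mapP[i _ ->]; exact: hg_pow. Qed.

Lemma power_cdim d A k : (0 < d)%N -> cdim (A `&` zeros [seq X i ^+ d | i <- enum 'I_N.+1]) k.
Proof.
by move=> d0 e Z [iZ _ ZA]; have [_ [x /ZA[_ /(power_zeros d0)]]] := iZ e (leqnn _).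
Qed.

(** Cutting with generic linear forms lowers the dimension until the set is empty, where the
    Nullstellensatz starts the induction on growth. *)
Lemma cdim_growth k A J : algebraic A -> graded_ideal J -> cuts_out J A -> cdim A k -> growth k J.
Proof.
elim: k A J => [|k IH] A J aA gJ hJ dA.
 apply: projective_nullstellensatz => // x nx; apply: contrapT => h.
 have : A x.
  by apply: hJ => // u f Jf; apply: contrapT => /eqP fx; apply: h; exists u, f.
 by rewrite (cdim0 aA dA).
have [c hc] := cut aA (@power_hg 1) (@power_cdim 1 A k isT) dA.
have hl := hg_lin c (@power_hg 1).
apply: (growth_adjoin gJ hl) => //; apply: (IH _ _ _ (adjoin_ideal gJ hl) (adjoin_cuts gJ hl hJ)) => //.
by apply: algebraicI => //; apply: (@zeros_algebraic 1) => f; rewrite mem_seq1 => /eqP ->.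
Qed.

Lemma van_cuts A : algebraic A -> cuts_out (van A) A.
Proof. by move=> /algebraicP[_ h] x nx hx; exact: h. Qed.

(** A hypersurface section lowers the dimension by at most one. The upper bound for the Hilbert
    function passes from the section to [A], and chains in [A] bound it from below. *)
Lemma cdim_drop A d g k : algebraic A -> (0 < d)%N -> hg d g -> cdim (A `&` zeros [:: g]) k -> cdim A k.+1.
Proof.
move=> aA d0 hgg dg e Z [iZ cZ ZA].
have gr : growth k.+1 (van A).
 apply: (growth_adjoin (van_ideal A) hgg d0); apply: (cdim_growth _ (adjoin_ideal (van_ideal A) hgg) (adjoin_cuts (van_ideal A) hgg (van_cuts aA)) dg).
 by apply: algebraicI => //; apply: (@zeros_algebraic d) => f; rewrite mem_seq1 => /eqP ->.
by apply: (growth_chain gr iZ cZ) => u f [hf f0]; split => // x /ZA/f0.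
Qed.

Lemma cdim_prefix A d s k : algebraic A -> (0 < d)%N -> (forall f, f \in s -> hg d f) ->
 cdim (A `&` zeros s) k -> forall t, (t <= size s)%N -> cdim (A `&` zeros (take t s)) (k + (size s - t)).
Proof.
move=> aA d0 hs ds t ts; rewrite -{1}(subKn ts); elim: (size s - t)%N (leq_subr t (size s)) => [|j IH] js.
 by rewrite subn0 take_size addn0.
have ht : (size s - j.+1 < size s)%N by rewrite ltn_subrL (leq_ltn_trans _ js).
have := IH (ltnW js); have -> : (size s - j = (size s - j.+1).+1)%N by rewrite subnSK.
rewrite (take_nth 0 ht) addnS => h; apply: (cdim_drop (g := s`_(size s - j.+1)) (d := d)) => //.
- by apply: algebraicI => //; apply: (@zeros_algebraic d) => f /mem_take; exact: hs.
- by apply: hs; exact: mem_nth.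
apply: cdimS h => // x [[Ax [nx h1]] [_ h2]]; split => //; split => // f.
by rewrite /= mem_rcons inE => /predU1P[->|]; [apply: h2; rewrite /= mem_seq1|exact: h1].
Qed.

Lemma cdim_hypersurface V g k : irreducible_alg V -> (exists2 x, V x & peval x g != 0) -> cdim V k.+1 ->
 cdim (V `&` zeros [:: g]) k.
Proof.
move=> iV [x Vx gx] dV e Z [iZ cZ ZA]; rewrite -ltnS; apply: (dV _ (fun i => if (i <= e)%N then Z i else V)).
apply: chain_extend => //; first by split => // y /ZA[].
split => [y /ZA[] //|VZ]; have [_ [_ h]] := ZA x (VZ x Vx).
by move: gx; rewrite h ?eqxx //= mem_seq1.
Qed.

(* Nochka-free replacement: hypersurfaces in subgeneral position are replaced by generic
  combinations of their initial segments. *)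
Definition prefix_length l i := if i is i'.+1 then (i + l)%N else 1%N.

(** For i > 0, removing equations from the end of [s] one at a time shows that the first i + (m - n
    + 1) of them cut [V] in dimension less than n - i, exactly what P_i needs. For i = 0 the first
    equation suffices, as it does not vanish identically on [V]; keeping P_0 to one equation makes
    it comparable with all of the first m - n + 1. *)
Lemma replacement V n m d (s : seq poly) : irreducible_alg V -> cdim V n.+1 -> (n <= m)%N -> (0 < d)%N ->
 (size s <= m.+1)%N -> (forall f, f \in s -> hg d f) -> (forall f, f \in s -> exists2 x, V x & peval x f != 0) ->
 cdim (V `&` zeros s) (m.+1 - size s) ->
 forall j, (j <= n.+1)%N -> exists P : seq poly, [/\ size P = j, forall f, f \in P -> hg d f,
  forall i, (i < j)%N -> (prefix_length (m - n).+1 i <= size s)%N -> exists c, P`_i = lin c (take (prefix_length (m - n).+1 i) s)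
  & cdim (V `&` zeros P) (n.+1 - j)].
Proof.
move=> iV dV nm d0 sm hs ns ds; have aV : algebraic V by case: iV.
elim=> [_|j IH jn].
 by exists [::]; split => //; apply: cdimS dV; [exact: subIsetl|rewrite subn0].
have [P [sP hP cP dP]] := IH (ltnW jn).
have aP : algebraic (V `&` zeros P) by apply: algebraicI => //; apply: zeros_algebraic hP.
suff [f [hf cf df]] : exists f, [/\ hg d f, (prefix_length (m - n).+1 j <= size s)%N -> exists c, f = lin c (take (prefix_length (m - n).+1 j) s)
  & cdim (V `&` zeros P `&` zeros [:: f]) (n - j)].
 exists (rcons P f); split.
 - by rewrite size_rcons sP.
 - by move=> g; rewrite mem_rcons inE => /predU1P[->|/hP].
 - move=> i; rewrite ltnS leq_eqVlt => /predU1P[->|ij]; first by rewrite nth_rcons sP ltnn eqxx.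
  by rewrite nth_rcons sP ij; exact: cP.
 - apply: cdimS df => [x [Vx [nx h]]|]; last by rewrite subSS.
  split; first by split => //; split => // g gP; apply: h; rewrite /= mem_rcons inE gP orbT.
  by split => // g; rewrite /= mem_seq1 => /eqP ->; apply: h; rewrite /= mem_rcons mem_head.
have dP' : cdim (V `&` zeros P) (n - j).+1 by rewrite -subSn.
(* When [s] is too short for this prefix, a generic combination of powers of the coordinates
   completes the system; no bound in terms of [s] is then claimed. *)
have [js|js] := leqP (prefix_length (m - n).+1 j) (size s); last first.
 have [c hc] := cut aP (@power_hg d) (@power_cdim d _ _ d0) dP'.
 by exists (lin c [seq X i ^+ d | i <- enum 'I_N.+1]); split => //; exact: hg_lin (@power_hg d).
set W := take _ s; have hW f : f \in W -> hg d f by move=> /mem_take; exact: hs.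
suff dW : cdim (V `&` zeros P `&` zeros W) (n - j).
 by have [c hc] := cut aP hW dW dP'; exists (lin c W); split => [|_|//]; [exact: hg_lin|exists c].
rewrite /W; case: (j) js jn => [|j'] js jn.
 have := cdim_hypersurface iV (ns _ (mem_nth 0 js)) dV; apply: cdimS; last by rewrite subn0.
 move=> x [[Vx _] [nx h]]; split => //; split => // f; rewrite /= mem_seq1 => /eqP ->; apply: h.
 by rewrite (take_nth 0 js) take0 /= mem_head.
have := cdim_prefix aV d0 hs ds js; apply: cdimS; first by move=> x [[Vx _] h].
move: js sm nm jn; move: (size s) => ss; rewrite /prefix_length; lia.
Qed.

End ChainDimension.

(** * Counting monomials and binomial asymptotics *)

Section Monomials.
Variable n : nat.

Definition mons b : seq (multinom n.+1) := [seq bmnm m | m <- enum {: bmultinom n.+1 b.+1} & mdeg (bmnm m) == b].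

Lemma mem_mons b m : (m \in mons b) = (mdeg m == b).
Proof.
apply/mapP/idP => [[x + ->]|mb]; first by rewrite mem_filter => /andP[].
have lt : (mdeg m < b.+1)%N by rewrite (eqP mb).
by exists (BMultinom lt) => //; rewrite mem_filter /= mb mem_enum.
Qed.

Lemma mons_uniq b : uniq (mons b).
Proof. by rewrite map_inj_uniq; [rewrite filter_uniq ?enum_uniq|exact: val_inj]. Qed.

Variable K : fieldType.
Local Notation xmon m := (mpolyX K (m : multinom n.+1)).

Definition xmons b := [seq xmon m | m <- mons b].

Lemma xmons_inside b : inside (hg b) (xmons b).
Proof. by apply: inside_mem => _ /mapP[m + ->]; rewrite mem_mons => /eqP <-; exact: hgX. Qed.

Lemma xmons_indep b : indep (fun f => f = 0) (xmons b).
Proof.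
move=> c h i; rewrite size_map => ib.
have := congr1 (mcoeff (nth mnm0 (mons b) i)) h; rewrite /lin size_map raddf_sum /= mcoeff0.
rewrite (bigD1 (Ordinal ib)) //= big1 => [|j ji].
 by rewrite addr0 mcoeffZ (nth_map mnm0) // mcoeffX eqxx mulr1.
by rewrite mcoeffZ (nth_map mnm0) // mcoeffX nth_uniq ?mons_uniq // (negbTE (ji : j != i :> nat)) mulr0.
Qed.

Lemma xmons_spans b : spans (fun f => f = 0) (hg b) (xmons b).
Proof.
move=> f /hgP hf; exists (fun i => mcoeff (nth mnm0 (mons b) i) f); apply/eqP; rewrite subr_eq0; apply/eqP.
apply/mpolyP => m; rewrite /lin size_map raddf_sum /=.
have E i (ib : (i < size (mons b))%N) : mcoeff m (mcoeff (nth mnm0 (mons b) i) f *: (xmons b)`_i) = if (nth mnm0 (mons b) i) == m then mcoeff m f else 0.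
 by rewrite mcoeffZ (nth_map mnm0) // mcoeffX; case: eqP => [->|]; rewrite ?mulr1 ?mulr0.
case: (boolP (m \in mons b)) => mb; last first.
 rewrite big1 => [|i _]; first by apply: memN_msupp_eq0; apply: contra mb => /hf mf; rewrite mem_mons mf.
 by rewrite E //; case: eqP => // mE; move: mb; rewrite -mE mem_nth.
have ib : (index m (mons b) < size (mons b))%N by rewrite index_mem.
rewrite (bigD1 (Ordinal ib)) //= E // nth_index // eqxx big1 ?addr0 // => j ji; rewrite E //; case: eqP => // jm.
by case/eqP: ji; apply: val_inj; rewrite /= -jm index_uniq ?mons_uniq.
Qed.

Lemma size_mons b : size (mons b) = 'C(b + n, n).
Proof.
have [s [us js ss sE]] := homogeneous_basis K n b; have s0 : subsp (fun f : mpoly n.+1 K => f = 0).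
 by split => // [x y -> ->|a x ->]; rewrite ?addr0 ?scaler0.
rewrite -(size_map (fun m => xmon m)) -bin_sub ?leq_addl // addnK -sE; apply/eqP; rewrite eqn_leq.
rewrite (indep_le_spans s0 (@xmons_inside b) (@xmons_indep b) ss).
by rewrite (indep_le_spans s0 us js (@xmons_spans b)).
Qed.

Lemma size_xmons b : size (xmons b) = 'C(b + n, n).
Proof. by rewrite size_map size_mons. Qed.

End Monomials.

(** Transpositions of the variables permute the monomials of degree [b], so all variables have the
    same total exponent, the (n + 1)-st part of [b] times the number of monomials. The factor n + 1
    of the theorem originates here. *)
Lemma sum_mons n b (i : 'I_n.+1) : (n.+1 * \sum_(m <- mons n b) m i = b * 'C(b + n, n))%N.
Proof.
pose pm_ (s : {perm 'I_n.+1}) (m : multinom n.+1) := Multinom [tuple m (s k) | k < n.+1].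
have sw j : (\sum_(m <- mons n b) m j = \sum_(m <- mons n b) m i)%N.
 pose pm := pm_ (tperm i j).
 have p : perm_eq (mons n b) [seq pm m | m <- mons n b].
  have inj : injective pm := @mperm_inj n.+1 (tperm i j).
  apply: uniq_perm; rewrite ?(map_inj_uniq inj) ?mons_uniq //.
  move=> m; rewrite mem_mons; apply/idP/mapP => [mb|[m' + ->]]; last by rewrite mem_mons mdeg_mperm.
  exists (pm m); first by rewrite mem_mons mdeg_mperm.
  by apply/mnmP => k; rewrite /pm /pm_ !mnmE tpermK.
 by rewrite (perm_big _ p) big_map; apply: eq_bigr => m _; rewrite /pm /pm_ mnmE tpermR.
transitivity (\sum_(j < n.+1) \sum_(m <- mons n b) m j)%N.
 transitivity (\sum_(j < n.+1) \sum_(m <- mons n b) m i)%N; first by rewrite sum_nat_const card_ord.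
 by apply: eq_bigr => j _; rewrite sw.
rewrite exchange_big /= big_seq (eq_bigr (fun=> b)) => [|m]; last by rewrite mem_mons mdegE => /eqP.
by rewrite -big_seq big_const_seq count_predT iter_addn_0 (size_mons n rat).
Qed.

Lemma bin_step n b : (b.+1 * 'C(b.+1 + n, n) = (b.+1 + n) * 'C(b + n, n))%N.
Proof. by have := mul_bin_down (b + n).+1 n; rewrite subSn ?leq_addl // addnK -addSn => ->. Qed.

Lemma bin_polynomial b k : ('C(b + k, k) <= b.+1 ^ k)%N.
Proof.
elim: k => [|k IH]; first by rewrite bin0.
have E := mul_bin_diag (b + k.+1) k; rewrite -(@leq_pmul2l k.+1) // -E addnS /= expnS.
apply: leq_trans (leq_mul (leqnn _) IH) _; rewrite mulnA leq_mul2r; apply/orP; right; nia.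
Qed.

(** Pascal's rule applied [r] times: modulo a fixed form of degree [r], the forms in k + 2 variables
    grow only like the k-th power of the degree. *)
Lemma bin_increment b k r : ('C(b + r + k.+1, k.+1) <= 'C(b + k.+1, k.+1) + r * (b + r).+1 ^ k)%N.
Proof.
elim: r => [|r IH]; first by rewrite addn0 leq_addr.
have h := bin_polynomial (b + r.+1) k; have -> : (b + r.+1 + k.+1 = (b + r + k.+1).+1)%N by lia.
rewrite binS.
have m : ((b + r).+1 ^ k <= (b + r.+1).+1 ^ k)%N by apply: expn_mono; lia.
have -> : 'C(b + r + k.+1, k) = 'C(b + r.+1 + k, k) by congr ('C(_, _)); lia.
by apply: leq_trans (leq_add IH h) _; rewrite -addnA leq_add2l mulSn addnC leq_add2l leq_mul2l m orbT.
Qed.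

(** The ratio tends to 1, and is approached one shift at a time: two factors 1 + 1/(3(q + 1))
    multiply to at most 1 + 1/q. *)
Lemma bin_ratio n c q : exists B, forall b, (B <= b)%N -> (q * 'C(b + c + n, n) <= q.+1 * 'C(b + n, n))%N.
Proof.
elim: c q => [|c IH] q; first by exists 0%N => b _; rewrite addn0 leq_mul2r leqnSn orbT.
have [B hB] := IH (3 * q.+1)%N; exists (B + 3 * q.+1 * n)%N => b bB.
have h1 := hB b (leq_trans (leq_addr _ _) bB).
have h2 := bin_step n (b + c); rewrite addnS -addSn.
move: h1 h2; set x := 'C(_, _); set y := 'C(b + n, n); set w := 'C(_, _) => h1 h2.
have h3 : (3 * q.+1 * w <= (3 * q.+1).+1 * x)%N.
 rewrite -(@leq_pmul2l (b + c).+1) //.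
 apply: (@leq_trans (3 * q.+1 * (((b + c).+1 + n) * x))); first by rewrite -h2; nia.
 by have : (3 * q.+1 * n <= b)%N; [lia|nia].
have h4 : ((3 * q.+1) * (3 * q.+1) * w <= (3 * q.+1).+1 * (3 * q.+1).+1 * y)%N.
 rewrite -mulnA; apply: leq_trans (leq_mul (leqnn _) h3) _; rewrite mulnCA -[leqRHS]mulnA leq_mul2l; exact/orP/or_intror.
rewrite -(@leq_pmul2l (3 * q.+1 * (3 * q.+1))) //; nia.
Qed.

Lemma hg_subsp (K : fieldType) n d : subsp (fun f : mpoly n K => hg d f).
Proof. by split; [exact: hg0|exact: hgD|exact: hgZ]. Qed.

(** * The coordinate ring as a finite module over C[P_0, ..., P_n] *)

Section FiniteModule.
Context {K : fieldType} {N n : nat}.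
Local Notation poly := (mpoly N.+1 K).
Local Notation ring := (mpoly n.+1 K).
Variables (J : nat -> poly -> Prop) (d : nat) (P : n.+1.-tuple poly).
Hypothesis gJ : graded_ideal J.
Hypothesis pJ : prime_ideal J.
Hypothesis d0 : (0 < d)%N.
Hypothesis hP : forall i, hg d (tnth P i).
Hypothesis evP : eventually_all (foldr (fun g I => adjoin I d g) J P).
Implicit Types (rho sigma : nat -> ring) (s es : seq poly).

Local Notation sub rho := (comp_mpoly P rho : poly).

Let sJ u : subsp (J u). Proof. by case: gJ. Qed.
Let mJ u e f h : J u f -> hg e h -> J (e + u)%N (h * f). Proof. by case: gJ => _ _; apply. Qed.

Lemma hg_prodX (T : finType) (F : T -> poly) (a : T -> nat) : (forall i, hg d (F i)) -> hg (d * \sum_i a i) (\prod_i F i ^+ a i).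
Proof.
move=> hF; rewrite big_distrr /=; apply: (big_ind2 (fun u (f : poly) => hg u f)).
- exact: dhomog1.
- by move=> u f v g; exact: hgM.
- by move=> i _; apply: dhomogMn; exact: hF.
Qed.

Lemma hg_sub b (rho : ring) : hg b rho -> hg (d * b) (sub rho).
Proof.
move=> /hgP h; rewrite comp_mpolyEX big_seq; apply: subsp_sum => [|m /h mb]; first exact: hg_subsp.
by apply: hgZ; rewrite comp_mpolyX -mb mdegE; exact: hg_prodX.
Qed.

Lemma subM (a b : ring) : sub (a * b) = sub a * sub b.
Proof. exact: (comp_mpoly_is_multiplicative P).1. Qed.

Local Opaque comp_mpoly.

Definition comb (rho : nat -> ring) es := \sum_(i < size es) sub (rho i) * es`_i.
Definition coeffs b (rho : nat -> ring) := forall i, hg b (rho i).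

Lemma comb_cons rho (f : poly) es : comb rho (f :: es) = sub (rho 0%N) * f + comb (fun i => rho i.+1) es.
Proof. by rewrite /comb big_ord_recl. Qed.

Lemma comb_ext rho rho' es : (forall i, (i < size es)%N -> rho i = rho' i) -> comb rho es = comb rho' es.
Proof. by move=> h; apply: eq_bigr => i _; rewrite h. Qed.

Lemma comb0 es : comb (fun=> 0) es = 0.
Proof. by rewrite /comb big1 // => i _; rewrite raddf0 mul0r. Qed.

Lemma combB rho rho' es : comb (fun i => rho i - rho' i) es = comb rho es - comb rho' es.
Proof. by rewrite /comb -sumrB; apply: eq_bigr => i _; rewrite raddfB mulrBl. Qed.

Lemma combM (a : ring) rho es : comb (fun i => a * rho i) es = sub a * comb rho es.
Proof. by rewrite /comb [RHS]mulr_sumr; apply: eq_bigr => i _; rewrite subM mulrA. Qed.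

Lemma comb_sum (T : finType) (a : T -> ring) (rho : T -> nat -> ring) es :
 comb (fun i => \sum_k a k * rho k i) es = \sum_k sub (a k) * comb (rho k) es.
Proof.
rewrite /comb; under [RHS]eq_bigr do rewrite mulr_sumr.
rewrite exchange_big /=; apply: eq_bigr => i _; rewrite raddf_sum /= mulr_suml; apply: eq_bigr => k _.
by rewrite subM mulrA.
Qed.

Lemma adjoin_list s u f : foldr (fun g I => adjoin I d g) J s u f -> (d <= u)%N ->
 exists j (h : nat -> poly), [/\ J u j, forall k, hg (u - d) (h k) & f = j + \sum_(k < size s) h k * s`_k].
Proof.
move=> + du; elim: s f => [|g s IH] f /=.
 by move=> jf; exists f, (fun=> 0); rewrite big_ord0 addr0; split => // _; exact: hg0.
move=> [f' [h' [/IH[j [h [jj hh ->]]]]]]; rewrite du => hh' ->.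
exists j, (fun k => if k is k'.+1 then h k' else h'); split => //; first by case.
by rewrite big_ord_recl /= addrA addrAC -addrA.
Qed.

(** Graded Nakayama argument: in large degree every form is, modulo [J], a combination of P_0, ...,
    P_n whose coefficients have degree lower by [d]; these are reduced by induction down to the base
    degree d b2. *)
Lemma generators : exists b1, forall b2, (b1 <= b2)%N -> exists gens, inside (hg (d * b2)) gens /\
 forall b f, hg (d * (b + b2)) f -> exists2 rho, coeffs b rho & J (d * (b + b2))%N (f - comb rho gens).
Proof.
have [M hM] := evP; exists M => b2 Mb.
have [gens [ug _ sg _]] := homogeneous_basis K N (d * b2); exists gens; split => //.
elim=> [|b IH] f hf.
 have [c /eqP] := sg f hf; rewrite subr_eq0 => /eqP fE; exists (fun i => c i *: 1) => [i|]; first by apply: hgZ; exact: dhomog1.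
 suff -> : f - comb (fun i => c i *: 1) gens = 0 by case: (sJ (d * (0 + b2))).
 apply/eqP; rewrite subr_eq0 {1}fE; apply/eqP/eq_bigr => i _.
 by rewrite comp_mpolyZ comp_mpoly1 -scalerAl mul1r.
have Mu : (M <= d * (b.+1 + b2))%N by nia.
have du : (d <= d * (b.+1 + b2))%N by nia.
have [j [h [jj hh ->]]] := adjoin_list (hM _ _ Mu hf) du.
have E : (d * (b.+1 + b2) - d = d * (b + b2))%N by rewrite addSn mulnS addKn.
have /choice[rho hr] : forall k, exists rho : nat -> ring, coeffs b rho /\ J (d * (b + b2))%N (h k - comb rho gens).
 by move=> k; have [|rho h1 h2] := IH (h k); [rewrite -E|exists rho].
exists (fun i => \sum_(k < n.+1) mpolyX K (mnm1 k) * rho k i).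
 move=> i; apply: subsp_sum => [|k _]; first exact: hg_subsp.
 by rewrite -[b.+1]add1n; apply: hgM; [exact: hg_var|exact: (hr k).1].
rewrite (comb_sum (fun k : 'I_n.+1 => mpolyX K (mnm1 k)) (fun k => rho k)) size_tuple.
rewrite -addrA -sumrB; case: (sJ (d * (b.+1 + b2))) => _ jD _; apply: jD => //.
apply: subsp_sum => [|k _]; first exact: sJ.
rewrite comp_mpolyXU mulrC -mulrBr -(tnth_nth 0).
by rewrite addSn mulnS; apply: mJ; [exact: (hr k).2|exact: hP].
Qed.

Definition fam (t : seq ring) es := flatten [seq [seq sub x * g | x <- t] | g <- es].

Lemma size_fam t es : size (fam t es) = (size es * size t)%N.
Proof. by elim: es => //= g l IH; rewrite /fam /= size_cat size_map -/(fam t l) IH. Qed.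

Lemma lin_fam c t es : lin c (fam t es) = comb (fun i => lin (fun k => c (i * size t + k)%N) t) es.
Proof.
elim: es c => [|g l IH] c; first by rewrite /fam lin_nil /comb big_ord0.
rewrite comb_cons /fam /= -/(fam t l) lin_cat size_map IH; congr (_ + _).
 rewrite /lin size_map raddf_sum /= mulr_suml; apply: eq_bigr => i _.
 by rewrite (nth_map 0) // comp_mpolyZ scalerAl.
by apply: comb_ext => i _; apply: lin_ext => k _; rewrite mulSn addnA.
Qed.

Lemma comb_fam (gam : nat -> nat -> K) t es :
 lin (fun l => gam (l %/ size t)%N (l %% size t)%N) (fam t es) = comb (fun i => lin (gam i) t) es.
Proof.
rewrite lin_fam; apply: comb_ext => i _; apply: lin_ext => k kt.
by rewrite divnMDl ?(leq_ltn_trans _ kt) // divn_small // addn0 modnMDl modn_small.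
Qed.

Hypothesis lower : forall D b1 C k, (0 < D)%N ->
 (forall b, (b1 <= b)%N -> exists2 s, (size s <= C * b.+1 ^ k)%N & spans (J (D * b)%N) (hg (D * b)) s) -> (n <= k)%N.
Hypothesis n0 : (0 < n)%N.

Lemma zero_subsp u : subsp (fun f : mpoly u K => f = 0).
Proof. by split => // [x y -> ->|a x ->]; rewrite ?addr0 ?scaler0. Qed.

(* A relation would bound the growth of the coordinate ring by that of a hypersurface in n + 1
  variables. *)
Lemma algebraic_independence r (rho : ring) : hg r rho -> J (d * r)%N (sub rho) -> rho = 0.
Proof.
move=> hr jr; apply: contrapT => r0.
have [b1 /(_ b1 (leqnn _))[gens [ug sg]]] := generators.
have [k nk] : exists k, n = k.+1 by case: (n) n0 => // k; exists k.
suff : (n <= k)%N by rewrite nk ltnn.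
apply: (@lower d (b1 + r) (size gens * r) k d0) => b' bb.
pose b := (b' - b1)%N; have bE : b' = (b + b1)%N by rewrite subnK //; lia.
have rb : (r <= b)%N by lia.
pose I f := exists2 h, hg (b - r) h & f = rho * h.
have sI : subsp I.
 split; first by exists 0; rewrite ?mulr0 //; exact: hg0.
  by move=> _ _ [h hh ->] [h' hh' ->]; exists (h + h'); rewrite ?mulrDr //; exact: hgD.
 by move=> a _ [h hh ->]; exists (a *: h); rewrite ?scalerAr //; exact: hgZ.
pose s := [seq rho * x | x <- xmons n K (b - r)%N]; have xin := @xmons_inside n K.
have us : inside (hg b) s.
 by apply: inside_mem => _ /mapP[x /(nthP 0)[i ib <-] ->]; have := hgM hr (xin _ _ ib); rewrite subnKC.
have us' : inside I s.
 by apply: inside_mem => _ /mapP[x /(nthP 0)[i ib <-] ->]; exists (xmons n K (b - r)%N)`_i => //; exact: (xin _ _ ib).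
have js : indep (fun f => f = 0) s.
 move=> c /eqP; rewrite lin_mul mulf_eq0 => /orP[/eqP //|/eqP h] i; rewrite size_map => ib; exact: xmons_indep h i ib.
have [|t [ts st]] := spans_quotient (@zero_subsp n.+1) sI _ us us' js (@xmons_spans n K b).
 by move=> _ ->; case: sI.
(* Modulo [rho] the forms of degree b are spanned by the list [t], of size at most C(b + n, n) - C(b
   - r + n, n), which is of order b^(n - 1). *)
exists (fam t gens).
 rewrite size_fam -mulnA leq_mul2l; apply/orP; right.
 move: st; rewrite size_map !size_xmons; move: (size t) => st0; rewrite nk => st.
 have := bin_increment (b - r) k r; rewrite subnK // => h.
 apply: (@leq_trans (r * b.+1 ^ k)); first by lia.
 by rewrite leq_mul2l expn_mono ?orbT //; lia.
move=> f; rewrite bE => /sg[sigma hs jf].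
have /choice[gam hgam] := fun i => ts _ (hs i).
exists (fun l => gam (l %/ size t)%N (l %% size t)%N); rewrite comb_fam.
have -> : f - comb (fun i => lin (gam i) t) gens = f - comb sigma gens + comb (fun i => sigma i - lin (gam i) t) gens.
 by rewrite combB addrA subrK.
case: (sJ (d * (b + b1))) => _ jD _; apply: jD => //; apply: subsp_sum => // i _.
have [h hh ->] := hgam i.
have -> : sub (rho * h) * gens`_i = sub h * gens`_i * sub rho by rewrite subM -mulrA mulrC.
have -> : (d * (b + b1) = (d * (b - r) + d * b1) + d * r)%N by rewrite -{1}(subnKC rb); lia.
by apply: mJ => //; apply: hgM; [exact: hg_sub|exact: ug].
Qed.

Definition module_indep b1 es := forall b rho, coeffs b rho -> J (d * (b + b1))%N (comb rho es) ->
 forall i, (i < size es)%N -> rho i = 0.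

Lemma fam_indep b1 es b : module_indep b1 es -> indep (J (d * (b + b1))%N) (fam (xmons n K b) es).
Proof.
move=> ie c; rewrite lin_fam; set M := size _ => jc i; rewrite size_fam -/M => iM.
have M0 : (0 < M)%N by case: (M) iM => //; rewrite muln0.
have hi : (i %/ M < size es)%N by rewrite ltn_divLR.
have := @xmons_indep n K b (fun k => c (i %/ M * M + k)%N) (ie b _ _ jc _ hi) (i %% M)%N; rewrite -divn_eq; apply; last by rewrite ltn_pmod.
move=> j; apply: subsp_lin; [exact: hg_subsp|exact: xmons_inside].
Qed.

Lemma module_relation b1 es f : module_indep b1 es -> ~ module_indep b1 (f :: es) ->
 exists c (r : ring) beta, [/\ r != 0, hg c r, coeffs c beta & J (d * (c + b1))%N (sub r * f - comb beta es)].
Proof.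
move=> ie /existsNP[c /existsNP[rho /not_implyP[hr /not_implyP[jr /existsNP[i /not_implyP[ii /eqP ri]]]]]].
exists c, (rho 0%N), (fun i => 0 - rho i.+1); split.
- apply: contraNneq ri => r0; case: i ii => [|i] ii; first by rewrite r0.
 apply/eqP; apply: (ie c (fun i => rho i.+1)) => //.
 by move: jr; rewrite comb_cons r0 raddf0 mul0r add0r.
- exact: hr.
- by move=> j; rewrite sub0r -scaleN1r; apply: hgZ; exact: hr.
- by rewrite combB comb0 sub0r opprK -comb_cons.
Qed.

(** By maximality of [es] each generator satisfies a relation with nonzero leading coefficient; the
    product of these coefficients clears all denominators at once. *)
Lemma common_denominator b1 es (gs : seq poly) : module_indep b1 es -> inside (hg (d * b1)) gs ->
 (forall f, hg (d * b1) f -> ~ module_indep b1 (f :: es)) ->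
 exists c (r : ring), [/\ r != 0, hg c r & forall i, (i < size gs)%N -> exists beta, coeffs c beta /\
  J (d * (c + b1))%N (sub r * gs`_i - comb beta es)].
Proof.
move=> ie + mx; elim: gs => [|g gs IH] ug.
 by exists 0%N, 1; split => //; [exact: oner_neq0|exact: dhomog1].
have [c1 [r1 [beta [n1 h1 hb j1]]]] := module_relation ie (mx g (ug 0%N isT)).
have [|c2 [r2 [n2 h2 hgs]]] := IH; first by move=> i il; exact: (ug i.+1).
exists (c1 + c2)%N, (r1 * r2); split; [by rewrite mulf_neq0|exact: hgM|].
have mul c c' r r' f (be : nat -> ring) : hg c' r' -> coeffs c be -> J (d * (c + b1))%N (sub r * f - comb be es) ->
  coeffs (c' + c) (fun i => r' * be i) /\ J (d * (c' + c + b1))%N (sub (r' * r) * f - comb (fun i => r' * be i) es).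
 move=> hr' hbe jr; split; first by move=> j; exact: hgM.
 rewrite combM subM -mulrA -mulrBr; have -> : (d * (c' + c + b1) = d * c' + d * (c + b1))%N by lia.
 by apply: mJ => //; exact: hg_sub.
case=> [_|i il].
 by exists (fun i => r2 * beta i); rewrite (addnC c1) (mulrC r1); exact: mul.
have [be [hbe jb]] := hgs i il.
by exists (fun i => r1 * be i); exact: mul.
Qed.

Lemma indep_module_size b1 gens es : inside (hg (d * b1)) es ->
 (forall b f, hg (d * (b + b1)) f -> exists2 rho, coeffs b rho & J (d * (b + b1))%N (f - comb rho gens)) ->
 module_indep b1 es -> (size es <= size gens)%N.
Proof.
move=> ue sg ie.
have : (size (fam (xmons n K 0) es) <= size (fam (xmons n K 0) gens))%N.
 apply: (@indep_le_spans _ _ (J (d * (0 + b1))%N) (hg (d * (0 + b1)))) => //; last 2 first.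
 - exact: fam_indep.
 - move=> f /sg[rho hr jr]; have /choice[gam hgam] := fun i => xmons_spans (hr i).
  exists (fun l => gam (l %/ size (xmons n K 0))%N (l %% size (xmons n K 0))%N); rewrite comb_fam.
  by rewrite (comb_ext (rho' := rho)) // => i _; apply/eqP; rewrite eq_sym -subr_eq0; apply/eqP.
 apply: inside_mem => _ /flattenP[_ /mapP[e /(nthP 0)[i ib <-] ->] /mapP[x /(nthP 0)[j jb <-] ->]].
 by rewrite mulnDr; apply: hgM; [apply: hg_sub; exact: xmons_inside|exact: ue].
by rewrite !size_fam size_xmons binn !muln1.
Qed.

(** [es] is a maximal family of degree d b1 independent over the polynomial ring, so its size is the
    rank of the module. The products with monomials bound the Hilbert function from below.
    Multiplication by a common denominator of degree c is injective modulo the prime [J] and lands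
    in their span in degree b + c, which bounds it from above. *)
Theorem finite_module : exists b1 c es, [/\ inside (hg (d * b1)) es,
 forall b, indep (J (d * (b + b1))%N) (fam (xmons n K b) es) &
 forall b s, inside (hg (d * (b + b1))) s -> indep (J (d * (b + b1))%N) s -> (size s <= size es * 'C(b + c + n, n))%N].
Proof.
have [b1 /(_ b1 (leqnn _))[gens [ug sg]]] := generators.
have [es [ue ie mx]] : exists es, [/\ inside (hg (d * b1)) es, module_indep b1 es &
  forall f, hg (d * b1) f -> ~ module_indep b1 (f :: es)].
 apply: contrapT => nex.
 have [es [ue ie se]] : exists es, [/\ inside (hg (d * b1)) es, module_indep b1 es & size es = (size gens).+1].
  elim: (size gens).+1 => [|k [es [ue ie <-]]]; first by exists [::].
  apply: contrapT => h; apply: nex; exists es; split => // f hf ife; apply: h; exists (f :: es); split => //.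
  by case=> // i; exact: ue.
 by have := indep_module_size ue sg ie; rewrite se ltnn.
have [c [rho [r0 hr hc]]] := common_denominator ie ug mx.
exists b1, c, es; split => // [b|b s us js]; first exact: fam_indep.
have := @indep_le_spans _ _ (J (d * (b + c + b1))%N) (fun f => exists2 x, hg (d * (b + b1)) x & f = sub rho * x)
 [seq sub rho * x | x <- s] (fam (xmons n K (b + c)) es) (sJ _); rewrite size_map size_fam size_xmons; apply.
- by apply: inside_mem => _ /mapP[x /(nthP 0)[i ib <-] ->]; exists s`_i => //; exact: us.
- move=> ga; rewrite lin_mul => jl i; rewrite size_map => ib.
 have E : (d * (b + c + b1) = d * c + d * (b + b1))%N by lia.
 rewrite E in jl.
 have [j|j] := pJ (hg_sub hr) (subsp_lin ga (hg_subsp K N.+1 _) us) jl; last exact: js.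
 by move: r0; rewrite (algebraic_independence hr j) eqxx.
move=> _ [x hx ->]; have [al ha ja] := sg _ _ hx.
have /choice[be hbe] : forall i : 'I_(size gens), exists beta, coeffs c beta /\ J (d * (c + b1))%N (sub rho * gens`_i - comb beta es).
 by move=> i; exact: hc.
pose sig k := \sum_(i < size gens) al i * be i k.
have hsig k : hg (b + c) (sig k).
 apply: subsp_sum => [|i _]; first exact: hg_subsp.
 by apply: hgM; [exact: ha|exact: (hbe i).1].
have /choice[gam hgam] := fun i => xmons_spans (hsig i).
exists (fun l => gam (l %/ size (xmons n K (b + c)))%N (l %% size (xmons n K (b + c)))%N); rewrite comb_fam.
rewrite (comb_ext (rho' := sig)) => [|i _]; last by apply/eqP; rewrite eq_sym -subr_eq0; apply/eqP.
have -> : sub rho * x - comb sig es = sub rho * (x - comb al gens) + (sub rho * comb al gens - comb sig es).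
 by rewrite mulrBr addrA subrK.
case: (sJ (d * (b + c + b1))) => _ jD _; apply: jD.
 have -> : (d * (b + c + b1) = d * c + d * (b + b1))%N by lia.
 by apply: mJ => //; exact: hg_sub.
rewrite (comb_sum (fun i : 'I_(size gens) => al i) be) /comb mulr_sumr -sumrB; apply: subsp_sum => // i _.
rewrite mulrCA -mulrBr; have -> : (d * (b + c + b1) = d * b + d * (c + b1))%N by lia.
by apply: mJ; [exact: (hbe i).2|exact: hg_sub].
Qed.

End FiniteModule.

(** * Bases adapted to an ordered family of hypersurfaces *)

Section AdaptedFamilies.
Context {R : realType} {N : nat}.
Local Notation K := (R[i]).
Local Notation pt := ('I_N.+1 -> R[i]).
Local Notation poly := (mpoly N.+1 R[i]).
Implicit Types (V : set pt) (s es : seq poly).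

(** As a dimension is at least -1, an admissible set has at most m + 1 elements, and the truncated
    subtraction in the conclusion loses nothing. *)
Lemma admissible_cdim q V (Q : 'I_q -> poly) m d (s : seq 'I_q) : algebraic V ->
 (forall j, hg d (Q j)) -> uniq s -> admissible V Q m [set j in s]%SET ->
 (size s <= m.+1)%N /\ cdim (V `&` zeros [seq Q j | j <- s]) (m.+1 - size s).
Proof.
move=> aV hQ us; rewrite /admissible cardsE (card_uniqP us).
have -> : V `&` \bigcap_(j in [set j | j \in [set j in s]%SET]) hypersurface (Q j) = V `&` zeros [seq Q j | j <- s].
 have [nV _] := algebraicP aV; apply/seteqP; split=> x [Vx h]; split => //.
  split => [|f /= /mapP[j js ->]]; first exact: nV.
  by have [|_] := h j; [rewrite /= inE|apply].
 move=> j /=; rewrite inE => js; split; first exact: nV.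
 by move=> f ->; apply: h.2; apply: map_f.
set X := V `&` _; move=> [h0 h1].
have ar (e k : nat) : (e%:Z <= m%:Z - k%:Z) -> (k + e <= m)%N by lia.
have ar1 (k : nat) : (-1 <= m%:Z - k%:Z) -> (k <= m.+1)%N by lia.
have sm : (size s <= m.+1)%N.
 have [X0|/eqP/set0P[x Xx]] := pselect (X = set0); first exact/ar1/h0.
 have aX : algebraic X by apply: algebraicI => //; apply: (@zeros_algebraic _ _ d) => f /mapP[j _ ->].
 have [c [hc cc]] := decomposition aX; have [Y [/hc[iY YX] _]] := cc x Xx.
 have := h1 0%N (fun=> Y) (And3 (fun _ _ => iY) (fun i (l : (i < 0)%N) => False_ind _ (notF l)) YX) => /ar; rewrite addn0; exact: leqW.
by split => // e Z /h1/ar h; rewrite ltn_subRL ltnS.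
Qed.

Lemma cdim_dim_le V n : dim_le V n%:Z -> cdim V n.+1.
Proof. by move=> [_ h] e Z /h; rewrite ltnS lez_nat. Qed.

Lemma adjoin_list_ideal J d (P : seq poly) : graded_ideal J -> (forall f, f \in P -> hg d f) ->
 graded_ideal (foldr (fun g I => adjoin I d g) J P).
Proof.
move=> gJ; elim: P => //= g P IH hP; apply: adjoin_ideal; last by apply: hP; rewrite mem_head.
by apply: IH => f fP; apply: hP; rewrite in_cons fP orbT.
Qed.

Lemma adjoin_list_cuts J d (P : seq poly) V : graded_ideal J -> (forall f, f \in P -> hg d f) -> cuts_out J V ->
 cuts_out (foldr (fun g I => adjoin I d g) J P) (V `&` zeros P).
Proof.
move=> gJ hP cJ; elim: P hP => [|g P IH] hP x nx /= h; first by split; [exact: cJ|split].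
have hP' f : f \in P -> hg d f by move=> fP; apply: hP; rewrite in_cons fP orbT.
have hgg : hg d g by apply: hP; rewrite mem_head.
have [[Vx h1] [_ h2]] := adjoin_cuts (adjoin_list_ideal gJ hP') hgg (IH hP') nx h.
split => //; split => // f; rewrite /= in_cons => /predU1P[->|fP]; last exact: h1.2.
by apply: h2; rewrite /= mem_seq1.
Qed.

(** The last two clauses enclose the Hilbert function of [V] in degree d (b + b1) between [size es]
    times two binomials that differ by the fixed shift [c]. *)
Definition adapted V n l d s (P : n.+1.-tuple poly) b1 c es :=
 [/\ (forall i, hg d (tnth P i)),
   (forall i : 'I_n.+1, (prefix_length l i <= size s)%N -> exists c, tnth P i = lin c (take (prefix_length l i) s)),
   inside (hg (d * b1)) es /\ (0 < size es)%N,
   forall b, indep (van V (d * (b + b1))%N) (fam P (xmons n K b) es) &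
   forall b t, inside (hg (d * (b + b1))) t -> indep (van V (d * (b + b1))%N) t -> (size t <= size es * 'C(b + c + n, n))%N].

Lemma adapted_exists V n m d s : irreducible_alg V -> dim_eq V n -> (0 < n)%N -> (n <= m)%N -> (0 < d)%N ->
 (size s <= m.+1)%N -> (forall f, f \in s -> hg d f) -> (forall f, f \in s -> exists2 x, V x & peval x f != 0) ->
 cdim (V `&` zeros s) (m.+1 - size s) ->
 exists (P : n.+1.-tuple poly) b1 c es, adapted V (m - n).+1 d s P b1 c es.
Proof.
move=> iV [dV [Z [iZ cZ ZV]]] n0 nm d0 sm hs ns ds.
have [P [sP hP cP]] := replacement iV (cdim_dim_le dV) nm d0 sm hs ns ds (leqnn n.+1).
rewrite subnn => dP; have aV : algebraic V by case: iV.
have sP' : size P == n.+1 by rewrite sP.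
have tE i : tnth (Tuple sP') i = P`_i by rewrite (tnth_nth 0).
have hT i : hg d (tnth (Tuple sP') i) by rewrite tE; apply: hP; rewrite mem_nth // sP.
have gV := van_ideal V.
have ev : eventually_all (foldr (fun g I => adjoin I d g) (van V) (Tuple sP')).
 apply: (@cdim_growth _ _ 0 _ _ _ (adjoin_list_ideal gV hP) (adjoin_list_cuts gV hP (van_cuts aV)) dP).
 by apply: algebraicI => //; apply: zeros_algebraic hP.
(* A chain of length [n] in [V] forces growth of order at least [n], which makes P_0, ..., P_n
   algebraically independent on [V]. *)
have low D b1 C k : (0 < D)%N -> (forall b, (b1 <= b)%N -> exists2 t, (size t <= C * b.+1 ^ k)%N & spans (van V (D * b)%N) (hg (D * b)) t) -> (n <= k)%N.
 move=> D0 h; apply: (@chain_growth R N D b1 C k (van V) n Z D0 h iZ cZ) => u f [hf f0].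
 by split => // x /ZV; exact: f0.
have [b1 [c [es [h1 h2 h3]]]] := finite_module gV (van_prime iV) d0 hT ev low n0.
exists (Tuple sP'), b1, c, es; split => //; first by move=> i; rewrite tE; exact: cP.
split => //; rewrite lt0n; apply/negP => /eqP e0.
have [_ [x Vx] _] := iV; have [nV _] := algebraicP aV; have [i xi] := nV x Vx.
have := h3 0%N [:: mpolyX K (mnm1 i) ^+ (d * (0 + b1))]; rewrite e0 mul0n => h; have : (1 <= 0)%N; last by []; apply: h.
 by case=> // _; exact: hg_pow.
move=> ga; rewrite lin_cons lin_nil addr0 => -[_ /(_ x Vx)/eqP].
by rewrite /peval mevalZ [meval x _]pevalX /peval mevalXU mulf_eq0 expf_eq0 (negbTE xi) andbF orbF => /eqP ? [].
Qed.

Lemma change_of_basis (J : poly -> Prop) U H (phi L : seq poly) : subsp J -> size phi = H -> size L = H ->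
 spans J U phi -> inside U L -> indep J L ->
 exists2 A : 'M[K]_H, A \in unitmx & forall i : 'I_H, J (L`_i - \sum_j A i j *: phi`_j).
Proof.
move=> sJ sp sL ps uL jL.
have /choice[c hc] : forall i : 'I_H, exists c, J (L`_i - lin c phi) by move=> i; apply/ps/uL; rewrite sL.
pose A := \matrix_(i < H, j < H) c i j.
have AJ (i : 'I_H) : J (L`_i - \sum_j A i j *: phi`_j).
 have := hc i; rewrite /lin sp; congr (J (_ - _)); apply: eq_bigr => j _; by rewrite mxE.
exists A => //; rewrite -row_free_unit -kermx_eq0; apply/eqP/row_matrixP => k; rewrite row0.
set v := row k _; have vA : v *m A = 0 by rewrite /v -row_mul mulmx_ker row0.
have : J (lin (fun i => if insub i is Some o then v 0 o else 0) L).
 have -> : lin (fun i => if insub i is Some o then v 0 o else 0) L = \sum_i v 0 i *: (L`_i - \sum_j A i j *: phi`_j).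
  rewrite (eq_bigr (fun i : 'I_H => v 0 i *: L`_i - \sum_j (v 0 i * A i j) *: phi`_j)); last first.
   by move=> i _; rewrite scalerBr scaler_sumr; congr (_ - _); apply: eq_bigr => j _; rewrite scalerA.
  rewrite sumrB exchange_big /= [X in _ - X]big1 => [|j _]; last first.
   by rewrite -scaler_suml; have /matrixP/(_ 0 j) := vA; rewrite !mxE => ->; rewrite scale0r.
  rewrite subr0 /lin sL; apply: eq_bigr => i _; by rewrite valK.
 by apply: subsp_sum => // i _; case: (sJ) => _ _; apply; exact: AJ.
move=> /jL h; apply/rowP => i; rewrite [RHS]mxE; have := h i; rewrite sL ltn_ord valK; exact.
Qed.

(** The fixed basis [phi] does not depend on the ordering; the adapted one is obtained from it by a
    constant invertible matrix, so their determinants differ by a constant factor. *)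
Lemma adapted_basis V n l d s (P : n.+1.-tuple poly) b1 c es b (phi : seq poly) : adapted V l d s P b1 c es ->
 inside (hg (d * (b + b1))) phi -> indep (van V (d * (b + b1))%N) phi -> spans (van V (d * (b + b1))%N) (hg (d * (b + b1))) phi ->
 exists (A : 'M[K]_(size phi)) r, [/\ A \in unitmx, inside (hg (d * (b + b1))) r, size (fam P (xmons n K b) es ++ r) = size phi &
  forall i : 'I_(size phi), van V (d * (b + b1))%N ((fam P (xmons n K b) es ++ r)`_i - \sum_j A i j *: phi`_j)].
Proof.
move=> [hP _ [ue _] ie _] up ip sp; have sJ : subsp (van V (d * (b + b1))%N) by case: (van_ideal V).
have uf : inside (hg (d * (b + b1))) (fam P (xmons n K b) es).
 apply: inside_mem => _ /flattenP[_ /mapP[e /(nthP 0)[i ib <-] ->] /mapP[x /(nthP 0)[j jb <-] ->]].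
 by rewrite mulnDr; apply: hgM; [apply: hg_sub => //; exact: xmons_inside|exact: ue].
have [r [ur ir sr]] := extend_basis sJ uf (ie b) sp; have ul := inside_cat uf ur.
have sz : size (fam P (xmons n K b) es ++ r) = size phi.
 by apply/eqP; rewrite eqn_leq (indep_le_spans sJ ul ir sp) (indep_le_spans sJ up ip sr).
have [A uA hA] := change_of_basis sJ (erefl _) sz sp ul ir.
by exists A, r.
Qed.

End AdaptedFamilies.

End Algebra.

Import numFieldNormedType.Exports.

Lemma eqW d (T : porderType d) (x y : T) : x = y -> (x <= y)%O.
Proof. by move=> ->. Qed.

Lemma big_closed (T V : Type) (idx : V) (op : V -> V -> V) (C : (T -> V) -> Prop) I (r : seq I) (P : pred I) F :
 C (fun=> idx) -> (forall f g, C f -> C g -> C (fun z => op (f z) (g z))) -> (forall i, C (F i)) ->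
 C (fun z => \big[op/idx]_(i <- r | P i) F i z).
Proof.
move=> C0 Cop CF; elim: r => [|i r IH]; first by under eq_fun do rewrite big_nil.
by under eq_fun do rewrite big_cons; case: (P i) => //; exact: Cop.
Qed.

(** * The modulus of a complex number *)

Section CabsTheory.
Context {R : realType}.
Implicit Types z w : R[i].
Lemma cabsE z : cabs z = Normc.normc z. Proof. by case: z. Qed.
Lemma cabsM z w : cabs (z * w) = cabs z * cabs w. Proof. by rewrite !cabsE Normc.normcM. Qed.
Lemma cabsD z w : cabs (z + w) <= cabs z + cabs w.
Proof. by have := ler_normD z w; rewrite !normc_def -rmorphD lecR. Qed.
Lemma cabsN z : cabs (- z) = cabs z. Proof. by case: z => a b; rewrite /cabs /= !sqrrN. Qed.
Lemma cabsBC z w : cabs (z - w) = cabs (w - z). Proof. by rewrite -cabsN opprB. Qed.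
Lemma cabsB z w : cabs (z - w) <= cabs z + cabs w. Proof. by rewrite -(cabsN w) cabsD. Qed.
Lemma cabs_dist z w : cabs z <= cabs w + cabs (z - w).
Proof. by rewrite addrC; apply: le_trans (cabsD _ _); rewrite subrK. Qed.
Lemma cabs_lip z w : `|cabs z - cabs w| <= cabs (z - w).
Proof. by rewrite ler_norml; have := cabs_dist z w; have := cabs_dist w z; rewrite (cabsBC w); lra. Qed.
Lemma cabs0 : cabs (0 : R[i]) = 0. Proof. by rewrite cabsE Normc.normc0. Qed.
Lemma cabs1 : cabs (1 : R[i]) = 1. Proof. by rewrite cabsE Normc.normc1. Qed.
Lemma cabs_ge0 z : 0 <= cabs z. Proof. exact: sqrtr_ge0. Qed.
Lemma cabs_eq0 z : (cabs z == 0) = (z == 0).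
Proof. by apply/eqP/eqP => [|->]; rewrite ?cabs0 // cabsE => /Normc.eq0_normc. Qed.
Lemma cabs_le0 z : cabs z <= 0 -> z = 0.
Proof. by move=> h; apply/eqP; rewrite -cabs_eq0 eq_le h cabs_ge0. Qed.
Lemma cabs_gt0 z : (0 < cabs z) = (z != 0).
Proof. by rewrite lt_def cabs_ge0 andbT cabs_eq0. Qed.
Lemma cabsV z : cabs z^-1 = (cabs z)^-1. Proof. by rewrite !cabsE Normc.normcV. Qed.
Lemma cabsX z n : cabs (z ^+ n) = cabs z ^+ n.
Proof. by elim: n => [|n IH]; rewrite ?expr0 ?cabs1 // !exprS cabsM IH. Qed.
Lemma cabs_sum I (r : seq I) (P : pred I) (F : I -> R[i]) :
 cabs (\sum_(i <- r | P i) F i) <= \sum_(i <- r | P i) cabs (F i).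
Proof.
elim/big_ind2 : _ => [|x a y b xa yb|//]; first by rewrite cabs0.
by rewrite (le_trans (cabsD _ _))// lerD.
Qed.
Lemma cabs_prod I (r : seq I) (P : pred I) (F : I -> R[i]) :
 cabs (\prod_(i <- r | P i) F i) = \prod_(i <- r | P i) cabs (F i).
Proof. by elim/big_ind2 : _ => [|x a y b <- <-|//]; rewrite ?cabs1 ?cabsM. Qed.
Lemma cabs_sqr z : cabs z ^+ 2 = Re z ^+ 2 + Im z ^+ 2.
Proof. by rewrite sqr_sqrtr // addr_ge0 // sqr_ge0. Qed.
Lemma cabs_Re z : `|Re z| <= cabs z.
Proof. by rewrite -sqrtr_sqr ler_wsqrtr // lerDl sqr_ge0. Qed.
Lemma cabs_Im z : `|Im z| <= cabs z.
Proof. by rewrite -sqrtr_sqr ler_wsqrtr // lerDr sqr_ge0. Qed.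
Lemma cabs_le_ReIm z : cabs z <= `|Re z| + `|Im z|.
Proof.
rewrite -[leRHS]ger0_norm ?addr_ge0// -sqrtr_sqr ler_wsqrtr //.
rewrite sqrrD !real_normK ?num_real// lerD2r lerDl.
by rewrite mulrn_wge0 // mulr_ge0.
Qed.
Lemma cabs_real (x : R) : cabs x%:C = `|x|.
Proof. by rewrite /cabs /= expr0n addr0 sqrtr_sqr. Qed.
Lemma cabs_conj z : cabs (conjc z) = cabs z.
Proof. by case: z => a b; rewrite /cabs /= sqrrN. Qed.
Lemma mul_conj z : z * (conjc z) = (cabs z ^+ 2)%:C.
Proof. rewrite cabs_sqr; case: z => a b; apply/eqP; rewrite eq_complex /=. by apply/andP; split; apply/eqP; ring. Qed.
End CabsTheory.

(** * Integrals of continuous functions over a segment *)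

Section ContinuousIntegral.
Context {R : realType}.
Notation mu := (@lebesgue_measure R).
Implicit Types f g : R -> R.

Definition itg f (a b : R) : R := (\int[mu]_(x in `[a, b]) f x)%R.

Lemma cont_integrable f a b : continuous f -> mu.-integrable `[a, b] (EFin \o f).
Proof.
move=> cf; apply: continuous_compact_integrable; first exact: segment_compact.
exact: continuous_subspaceT.
Qed.
Hint Resolve cont_integrable : core.

Lemma itgD f g a b : continuous f -> continuous g ->
 itg (fun x => f x + g x) a b = itg f a b + itg g a b.
Proof. by move=> cf cg; rewrite /itg RintegralD //; apply: cont_integrable. Qed.

Lemma itgZ f (k : R) a b : continuous f -> itg (fun x => k * f x) a b = k * itg f a b.
Proof. by move=> cf; rewrite /itg RintegralZl //; apply: cont_integrable. Qed.

Lemma itg_le f g a b : continuous f -> continuous g ->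
 (forall x, a <= x <= b -> f x <= g x) -> itg f a b <= itg g a b.
Proof.
move=> cf cg fg; apply: le_Rintegral => //; try exact: cont_integrable.
Qed.

Lemma itg_cst (k a b : R) : a <= b -> itg (fun=> k) a b = k * (b - a).
Proof.
move=> ab; rewrite /itg Rintegral_cst //= lebesgue_measure_itv /= lte_fin.
by move: ab; rewrite le_eqVlt => /predU1P[->|->] //=; rewrite ltxx subrr mulr0.
Qed.

Lemma itg_cat f a b c : continuous f -> a <= b -> b <= c ->
 itg f a c = itg f a b + itg f b c.
Proof.
move=> cf ab bc; apply/eqP; rewrite addrC -subr_eq; apply/eqP.
rewrite /itg Rintegral_itvB ?bnd_simp //; last exact: cont_integrable.
rewrite Rintegral_itv_obnd_cbnd //.
by apply: integrableS (cont_integrable _ _ cf) => //; apply: subset_itv_oc_cc.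
Qed.

Lemma itg_abs f a b M : continuous f -> a <= b ->
 (forall x, a <= x <= b -> `|f x| <= M) -> `|itg f a b| <= M * (b - a).
Proof.
move=> cf ab fM; rewrite ler_norml -mulNr -!itg_cst//.
apply/andP; split; apply: itg_le => //; try exact: cst_continuous.
- by move=> x /fM; rewrite ler_norml => /andP[].
- by move=> x /fM; rewrite ler_norml => /andP[].
Qed.

Lemma itg_deriv f (F : R -> R) (a b : R) : a <= b -> continuous f ->
 (forall x, is_derive (x : R) 1 F (f x)) -> itg f a b = F b - F a.
Proof.
rewrite le_eqVlt => /predU1P[-> _ _|ab cf dF].
 by rewrite /itg set_itv1 Rintegral_set1 subrr.
have cF : continuous F.
 move=> x; apply: differentiable_continuous; apply/derivable1_diffP.
 exact: (@ex_derive _ _ _ _ _ _ _ (dF x)).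
rewrite /itg /Rintegral (@continuous_FTC2 _ f F) //.
- exact: continuous_subspaceT.
- split => [x _||].
 + exact: (@ex_derive _ _ _ _ _ _ _ (dF x)).
 + by apply/cvg_at_right_filter/cF.
 + by apply/cvg_at_left_filter/cF.
- by move=> x _; rewrite derive1E; apply: (@derive_val _ _ _ _ _ _ _ (dF x)).
Qed.

Lemma itg_id a b : a <= b -> itg id a b = (b ^+ 2 - a ^+ 2) / 2.
Proof.
move=> ab; have d x : is_derive (x : R) 1 (fun x => x ^+ 2 / 2) (id x).
 by apply: is_derive_eq; rewrite /GRing.scale /=; field.
rewrite (itg_deriv ab _ d) /=; last by move=> x; apply: cvg_id.
by field.
Qed.
End ContinuousIntegral.

(** * Complex differentiability *)

Section ComplexCalculus.
Context {R : realType}.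
Implicit Types (f g h : R[i] -> R[i]) (a c z : R[i]).

Definition cnear a (P : R[i] -> Prop) :=
 exists2 d : R, 0 < d & forall z, cabs (z - a) < d -> P z.

Lemma cnear_imp a (P Q : R[i] -> Prop) :
 cnear a P -> (forall z, P z -> Q z) -> cnear a Q.
Proof. by move=> [d d0 dP] PQ; exists d => // z /dP/PQ. Qed.

Lemma cnearI a (P Q : R[i] -> Prop) :
 cnear a P -> cnear a Q -> cnear a (fun z => P z /\ Q z).
Proof.
move=> [d d0 dP] [e e0 eQ]; exists (Num.min d e); first by rewrite lt_min d0.
by move=> z; rewrite lt_min => /andP[/dP ? /eQ].
Qed.

Lemma cnear_at a (P : R[i] -> Prop) : cnear a P -> P a.
Proof. by move=> [d d0]; apply; rewrite subrr cabs0. Qed.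

Definition cca f a := forall e : R, 0 < e -> cnear a (fun z => cabs (f z - f a) < e).

Lemma cca_cst c a : cca (fun=> c) a.
Proof. by move=> e e0; exists 1 => // z _; rewrite subrr cabs0. Qed.

Lemma cca_id a : cca id a.
Proof. by move=> e e0; exists e. Qed.

Lemma ccaD f g a : cca f a -> cca g a -> cca (fun z => f z + g z) a.
Proof.
move=> fa ga e e0; have e2 : 0 < e / 2 by rewrite divr_gt0.
apply: cnear_imp (cnearI (fa _ e2) (ga _ e2)) _ => z [h1 h2].
by rewrite opprD addrACA (le_lt_trans (cabsD _ _))// [e]splitr ltrD.
Qed.

Lemma ccaM f g a : cca f a -> cca g a -> cca (fun z => f z * g z) a.
Proof.
move=> fa ga e e0.
have f0 := cabs_ge0 (f a); have g0 := cabs_ge0 (g a).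
have e1 : 0 < e / 2 / (cabs (g a) + 1) by rewrite !divr_gt0 // ltr_wpDl.
have e2 : 0 < e / 2 / (cabs (f a) + 1) by rewrite !divr_gt0 // ltr_wpDl.
apply: cnear_imp (cnearI (fa _ e1) (cnearI (ga _ e2) (ga _ ltr01))) _ => z [h1 [h2 h3]].
have -> : f z * g z - f a * g a = (f z - f a) * g z + f a * (g z - g a) by ring.
rewrite (le_lt_trans (cabsD _ _))// !cabsM [ltRHS]splitr ltr_leD //.
- have hg : cabs (g z) < cabs (g a) + 1.
  by rewrite (le_lt_trans (cabs_dist _ (g a)))// ltrD2l.
 rewrite (@le_lt_trans _ _ (cabs (f z - f a) * (cabs (g a) + 1))) //.
  by rewrite ler_wpM2l ?cabs_ge0 // ltW.
 by rewrite -ltr_pdivlMr // ltr_wpDl.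
- have h : cabs (g z - g a) * (cabs (f a) + 1) < e / 2 by rewrite -ltr_pdivlMr // ltr_wpDl.
 by rewrite mulrC (le_trans _ (ltW h))// ler_wpM2l ?cabs_ge0 // lerDl ler01.
Qed.

Lemma cca_comp f g a : cca f a -> cca g (f a) -> cca (fun z => g (f z)) a.
Proof. by move=> fa ga e /ga[d d0 dP]; apply: cnear_imp (fa _ d0) _ => z /dP. Qed.

Lemma ccaV a : a != 0 -> cca GRing.inv a.
Proof.
move=> a0 e e0; have na : 0 < cabs a by rewrite cabs_gt0.
pose d := Num.min (cabs a / 2) (e * (cabs a) ^+ 2 / 2).
exists d; first by rewrite lt_min !divr_gt0 // mulr_gt0 // exprn_gt0.
move=> z; rewrite lt_min => /andP[h1 h2].
have hz : cabs a / 2 < cabs z.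
 have := cabs_dist a z; rewrite (cabsBC a z) => h.
 by move: h h1; lra.
have z0 : z != 0 by rewrite -cabs_gt0 (lt_trans _ hz)// divr_gt0.
have -> : z^-1 - a^-1 = - (z - a) / (z * a) by field; rewrite ?z0 ?a0.
rewrite cabsM cabsN cabsV cabsM ltr_pdivrMr ?mulr_gt0 ?cabs_gt0 //.
apply: (lt_le_trans h2); rewrite -mulrA ler_pM2l // expr2 mulrAC.
by rewrite ler_pM2r // ltW.
Qed.

Lemma cca_ext f g a : cnear a (fun z => f z = g z) -> cca f a -> cca g a.
Proof.
move=> h fa e e0; have ea := cnear_at h.
by apply: cnear_imp (cnearI (fa _ e0) h) _ => z [+ <-]; rewrite ea.
Qed.

(* Carathéodory's form of complex differentiability at [a]. *)
Definition cdf f a := exists2 phi, cca phi a &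
 cnear a (fun z => f z = f a + phi z * (z - a)).

Lemma cdfP f a c :
 (forall e : R, 0 < e -> cnear a (fun z =>
   cabs (f z - f a - c * (z - a)) <= e * cabs (z - a))) -> cdf f a.
Proof.
move=> h; exists (fun z => if z == a then c else (f z - f a) / (z - a)).
 move=> e e0; rewrite eqxx; have e2 : 0 < e / 2 by rewrite divr_gt0.
 apply: cnear_imp (h _ e2) _ => z hz; case: eqP => [_|/eqP za].
  by rewrite subrr cabs0.
 have za0 : z - a != 0 by rewrite subr_eq0.
 have -> : (f z - f a) / (z - a) - c = (f z - f a - c * (z - a)) / (z - a).
  by field.
 rewrite cabsM cabsV (@le_lt_trans _ _ (e / 2)) //; last by lra.
 by rewrite ler_pdivrMr // cabs_gt0.
exists 1 => // z _; case: eqP => [->|/eqP za]; first by rewrite subrr mulr0 addr0.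
by rewrite divfK ?subr_eq0 // addrC subrK.
Qed.

Lemma cdf_cca f a : cdf f a -> cca f a.
Proof.
move=> [phi cp h].
apply: (@cca_ext (fun z => f a + phi z * (z - a))).
 by apply: cnear_imp h _ => z ->.
apply: ccaD; first exact: cca_cst.
by apply: ccaM => //; apply: ccaD; [exact: cca_id|exact: cca_cst].
Qed.

Lemma cdf_cst c a : cdf (fun=> c) a.
Proof. by exists (fun=> 0); [exact: cca_cst|exists 1 => // z _; rewrite mul0r addr0]. Qed.

Lemma cdf_id a : cdf id a.
Proof. by exists (fun=> 1); [exact: cca_cst|exists 1 => // z _; rewrite mul1r addrC subrK]. Qed.

Lemma cdfD f g a : cdf f a -> cdf g a -> cdf (fun z => f z + g z) a.
Proof.
move=> [p cp hp] [q cq hq]; exists (fun z => p z + q z); first exact: ccaD.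
by apply: cnear_imp (cnearI hp hq) _ => z [-> ->]; ring.
Qed.

Lemma cdfM f g a : cdf f a -> cdf g a -> cdf (fun z => f z * g z) a.
Proof.
move=> df dg; have cg := cdf_cca dg; case: df dg => [p cp hp] [q cq hq].
exists (fun z => p z * g z + f a * q z).
 by apply: ccaD; apply: ccaM => //; exact: cca_cst.
by apply: cnear_imp (cnearI hp hq) _ => z [-> ->]; ring.
Qed.

Lemma cdf_comp f g a : cdf f a -> cdf g (f a) -> cdf (fun z => g (f z)) a.
Proof.
move=> df; have cf := cdf_cca df; case: df => [p cp hp] [q cq [d d0 hq]].
exists (fun z => q (f z) * p z); first by apply: ccaM => //; apply: cca_comp cf _.
apply: cnear_imp (cnearI hp (cf _ d0)) _ => z [h1 /hq ->].
by rewrite {2}h1; ring.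
Qed.

Lemma cdfV a : a != 0 -> cdf GRing.inv a.
Proof.
move=> a0; exists (fun z => - (z^-1 * a^-1)).
 apply: (@cca_ext (fun z => (- a^-1) * z^-1)).
  by exists 1 => // z _; ring.
 by apply: ccaM; [exact: cca_cst|exact: ccaV].
exists (cabs a); first by rewrite cabs_gt0.
move=> z hz; have z0 : z != 0.
 by apply: contraTneq hz => ->; rewrite sub0r cabsN ltxx.
by field; rewrite ?z0 ?a0.
Qed.

Lemma cdf_ext f g a : cnear a (fun z => f z = g z) -> cdf f a -> cdf g a.
Proof.
move=> h [p cp hp]; exists p => //.
by have ea := cnear_at h; apply: cnear_imp (cnearI hp h) _ => z [+ <-]; rewrite ea.
Qed.

Definition entire f := forall a, cdf f a.

Lemma entire_cst c : entire (fun=> c). Proof. by move=> a; apply: cdf_cst. Qed.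
Lemma entire_id : entire id. Proof. by move=> a; apply: cdf_id. Qed.
Lemma entireD f g : entire f -> entire g -> entire (fun z => f z + g z).
Proof. by move=> hf hg a; apply: cdfD. Qed.
Lemma entireM f g : entire f -> entire g -> entire (fun z => f z * g z).
Proof. by move=> hf hg a; apply: cdfM. Qed.
Lemma entire_comp f g : entire f -> entire g -> entire (fun z => g (f z)).
Proof. by move=> hf hg a; apply: cdf_comp. Qed.
Lemma entire_sum I (r : seq I) (P : pred I) (F : I -> R[i] -> R[i]) :
 (forall i, entire (F i)) -> entire (fun z => \sum_(i <- r | P i) F i z).
Proof. by move=> h; apply: (big_closed (C := entire)) => //; [exact: entire_cst|exact: entireD]. Qed.
Lemma entire_prod I (r : seq I) (P : pred I) (F : I -> R[i] -> R[i]) :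
 (forall i, entire (F i)) -> entire (fun z => \prod_(i <- r | P i) F i z).
Proof. by move=> h; apply: (big_closed (C := entire)) => //; [exact: entire_cst|exact: entireM]. Qed.
End ComplexCalculus.

(** * Goursat's theorem on rectangles *)

Section Goursat.
Context {R : realType}.
Implicit Types (f g h : R[i] -> R[i]) (a b c d x y : R).

Lemma contP (f : R -> R) : continuous f <-> (forall x e, 0 < e ->
 exists2 d : R, 0 < d & forall y, `|y - x| < d -> `|f y - f x| < e).
Proof.
split=> [cf x e e0|h x].
 have /cvgrPdist_lt/(_ _ e0)[d /= d0 hd] := cf x.
 by exists d => // y yx; rewrite distrC; apply: hd => /=; rewrite distrC.
apply/cvgrPdist_lt => e e0; have [d d0 hd] := h x e e0.
by exists d => //= y yx; rewrite distrC; apply: hd; rewrite distrC.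
Qed.

Definition rcont (f : R -> R[i]) :=
 continuous (fun x => Re (f x)) /\ continuous (fun x => Im (f x)).

Lemma rcontP (f : R -> R[i]) : rcont f <-> (forall x e, 0 < e ->
 exists2 d : R, 0 < d & forall y, `|y - x| < d -> cabs (f y - f x) < e).
Proof.
split=> [[/contP h1 /contP h2] x e e0|h].
 have e2 : 0 < e / 2 by rewrite divr_gt0.
 have [d1 d10 H1] := h1 x _ e2; have [d2 d20 H2] := h2 x _ e2.
 exists (Num.min d1 d2); first by rewrite lt_min d10.
 move=> y; rewrite lt_min => /andP[/H1 a1 /H2 a2].
 rewrite (le_lt_trans (cabs_le_ReIm _))// !raddfB /=.
 by rewrite [e]splitr ltrD.
by split; apply/contP => x e e0; have [d d0 H] := h x e e0; exists d => // y /H;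
 apply: le_lt_trans; rewrite -raddfB /= ?cabs_Re ?cabs_Im.
Qed.

Lemma rcont_comp f (p : R -> R[i]) :
 (forall z, cca f z) -> rcont p -> rcont (fun x => f (p x)).
Proof.
move=> cf /rcontP cp; apply/rcontP => x e e0.
have [d d0 hd] := cf (p x) e e0; have [d' d'0 hd'] := cp x d d0.
by exists d' => // y /hd'/hd.
Qed.

Lemma rcontD (p q : R -> R[i]) : rcont p -> rcont q -> rcont (fun x => p x + q x).
Proof.
move=> [p1 p2] [q1 q2]; split=> x.
 by under eq_fun do rewrite raddfD /=; apply: cvgD; [exact: p1|exact: q1].
by under eq_fun do rewrite raddfD /=; apply: cvgD; [exact: p2|exact: q2].
Qed.

Lemma rcontM (p q : R -> R[i]) : rcont p -> rcont q -> rcont (fun x => p x * q x).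
Proof.
have ReM (z w : R[i]) : Re (z * w) =
 Re z * Re w - Im z * Im w by case: z; case: w.
have ImM (z w : R[i]) : Im (z * w) =
 Re z * Im w + Im z * Re w by case: z; case: w.
move=> [p1 p2] [q1 q2]; split=> x.
 under eq_fun do rewrite ReM; apply: cvgB; apply: cvgM;
  by [exact: p1|exact: q1|exact: p2|exact: q2].
under eq_fun do rewrite ImM; apply: cvgD; apply: cvgM;
 by [exact: p1|exact: q1|exact: p2|exact: q2].
Qed.

Lemma rcont_cst (z : R[i]) : rcont (fun=> z).
Proof. by split; apply: cst_continuous. Qed.

Lemma rcont_real : rcont (fun x => x%:C).
Proof. by split => x /=; [apply: cvg_id|apply: cvg_cst]. Qed.

Lemma rcont_line (z w : R[i]) : rcont (fun x => z + w * x%:C).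
Proof. by apply: rcontD; [exact: rcont_cst|apply: rcontM; [exact: rcont_cst|exact: rcont_real]]. Qed.

Definition citg (f : R -> R[i]) a b : R[i] :=
 Complex (itg (fun x => Re (f x)) a b) (itg (fun x => Im (f x)) a b).

Lemma citg_ext (f g : R -> R[i]) a b : f =1 g -> citg f a b = citg g a b.
Proof. by move=> fg; congr citg; apply/funext. Qed.

Lemma citgD (f g : R -> R[i]) a b : rcont f -> rcont g ->
 citg (fun x => f x + g x) a b = citg f a b + citg g a b.
Proof.
move=> [f1 f2] [g1 g2]; rewrite /citg.
under [X in itg X]eq_fun do rewrite raddfD /=.
under [X in Complex _ (itg X _ _)]eq_fun do rewrite raddfD /=.
by rewrite !itgD.
Qed.

Lemma citgZ (f : R -> R[i]) (k : R[i]) a b : rcont f ->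
 citg (fun x => k * f x) a b = k * citg f a b.
Proof.
case: k => k1 k2 [f1 f2]; rewrite /citg.
have cZ (p : R -> R) (k : R) : continuous p -> continuous (fun x => k * p x).
 by move=> cp x; apply: cvgM; [apply: cvg_cst|exact: cp].
have -> : (fun x => Re ((k1 +i* k2)%C * f x)) =
 (fun x => k1 * Re (f x) + (- k2) * Im (f x)).
 by apply/funext => x; case: (f x) => u v /=; rewrite mulNr.
have -> : (fun x => Im ((k1 +i* k2)%C * f x)) =
 (fun x => k1 * Im (f x) + k2 * Re (f x)).
 by apply/funext => x; case: (f x) => u v /=.
rewrite !itgD ?itgZ //; try exact: cZ.
by congr Complex; rewrite ?mulNr.
Qed.

Lemma citg_cat (f : R -> R[i]) a b c : rcont f -> a <= b -> b <= c ->
 citg f a c = citg f a b + citg f b c.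
Proof. by move=> [f1 f2] ab bc; rewrite /citg (itg_cat f1 ab bc) (itg_cat f2 ab bc). Qed.

Lemma citg_abs (f : R -> R[i]) a b M : rcont f -> a <= b ->
 (forall x, a <= x <= b -> cabs (f x) <= M) -> cabs (citg f a b) <= 2 * M * (b - a).
Proof.
move=> [f1 f2] ab fM; rewrite (le_trans (cabs_le_ReIm _))//= -mulrA mulrDl mul1r.
by apply: lerD; apply: itg_abs => // x /fM; apply: le_trans; rewrite ?cabs_Re ?cabs_Im.
Qed.

Lemma citg_cst (k : R[i]) a b : a <= b -> citg (fun=> k) a b = k * (b - a)%:C.
Proof.
move=> ab; rewrite /citg !itg_cst //; case: k => k1 k2 /=.
by apply/eqP; rewrite eq_complex /= !mulr0 subr0 add0r !eqxx.
Qed.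

Lemma citg_real a b : a <= b ->
 citg (fun x => x%:C) a b = ((b ^+ 2 - a ^+ 2) / 2)%:C.
Proof. by move=> ab; rewrite /citg /= itg_id // itg_cst // mul0r. Qed.

Lemma citg_line (z w : R[i]) a b : a <= b -> citg (fun x => z + w * x%:C) a b =
 z * (b - a)%:C + w * ((b ^+ 2 - a ^+ 2) / 2)%:C.
Proof.
move=> ab; rewrite citgD ?citgZ ?citg_cst ?citg_real //.
- exact: rcont_real.
- exact: rcont_cst.
- by apply: rcontM; [exact: rcont_cst|exact: rcont_real].
Qed.

(** The integral of [f] over the positively oriented boundary of the rectangle. *)
Definition rint f a b c d : R[i] :=
 citg (fun x => f (Complex 0 c + 1 * x%:C)) a b
 - citg (fun x => f (Complex 0 d + 1 * x%:C)) a b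
 + 'i%C * (citg (fun y => f (b%:C + 'i%C * y%:C)) c d
     - citg (fun y => f (a%:C + 'i%C * y%:C)) c d).

Lemma rint_splitx f a m b c d : (forall z, cca f z) -> a <= m -> m <= b ->
 rint f a b c d = rint f a m c d + rint f m b c d.
Proof.
move=> cf am mb; rewrite /rint !(@citg_cat _ a m b) //;
 try (apply: rcont_comp => //; exact: rcont_line).
ring.
Qed.

Lemma rint_splity f a b c m d : (forall z, cca f z) -> c <= m -> m <= d ->
 rint f a b c d = rint f a b c m + rint f a b m d.
Proof.
move=> cf am mb; rewrite /rint !(@citg_cat _ c m d) //;
 try (apply: rcont_comp => //; exact: rcont_line).
ring.
Qed.

Lemma nested_interval (u v : nat -> R) :
 (forall n, u n <= u n.+1) -> (forall n, v n.+1 <= v n) -> (forall n, u n <= v n) ->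
 exists x, forall n, u n <= x <= v n.
Proof.
move=> hu hv uv.
have mu i j : (i <= j)%N -> u i <= u j.
 by move/subnK <-; elim: (j - i)%N => // k IH; rewrite addSn (le_trans IH).
have mv i j : (i <= j)%N -> v j <= v i.
 by move/subnK <-; elim: (j - i)%N => // k IH; rewrite addSn (le_trans _ IH).
have key i j : u i <= v j.
 by rewrite (le_trans (mu i (maxn i j) _)) ?leq_maxl // (le_trans (uv _)) // mv // leq_maxr.
have hs : has_sup (range u).
 by split; [exists (u 0%N); exists 0%N|exists (v 0%N) => _ [i _ <-]].
exists (sup (range u)) => n; apply/andP; split.
 by apply: ub_le_sup => //; exact: hs.2.
by apply: ge_sup; [exact: hs.1|move=> _ [i _ <-]].
Qed.

Section Bisection.
Variable Phi : R -> R -> R -> R -> R[i].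
Hypothesis Phix : forall a m b c d, a <= m -> m <= b ->
 Phi a b c d = Phi a m c d + Phi m b c d.
Hypothesis Phiy : forall a b c m d, c <= m -> m <= d ->
 Phi a b c d = Phi a b c m + Phi a b m d.
Variables a0 b0 c0 d0 : R.
Hypothesis Philoc : forall x y (e : R), a0 <= x <= b0 -> c0 <= y <= d0 -> 0 < e ->
 exists2 r : R, 0 < r & forall a b c d, a <= x <= b -> c <= y <= d -> (b - a) + (d - c) < r ->
 cabs (Phi a b c d) <= e * ((b - a) + (d - c)) ^+ 2.

Let rect := (R * R * R * R)%type.
Let ok (q : rect) := (q.1.1.1 <= q.1.1.2) && (q.1.2 <= q.2).
Let PhiR (q : rect) := cabs (Phi q.1.1.1 q.1.1.2 q.1.2 q.2).
Let sub (q q' : rect) := [/\ q.1.1.1 <= q'.1.1.1, q'.1.1.2 <= q.1.1.2,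
 q.1.2 <= q'.1.2 & q'.2 <= q.2].

Lemma quarter (q : rect) : ok q -> exists q', [/\ ok q', sub q q',
 q'.1.1.2 - q'.1.1.1 = (q.1.1.2 - q.1.1.1) / 2 /\ q'.2 - q'.1.2 = (q.2 - q.1.2) / 2 &
 PhiR q <= 4 * PhiR q'].
Proof.
case: q => [[[a b] c] d] /andP /= [ab cd].
pose m := (a + b) / 2; pose n := (c + d) / 2.
have am : a <= m by rewrite /m; lra.
have mb : m <= b by rewrite /m; lra.
have cn : c <= n by rewrite /n; lra.
have nd : n <= d by rewrite /n; lra.
have E : PhiR (a, b, c, d) <= PhiR (a, m, c, n) + PhiR (a, m, n, d)
  + (PhiR (m, b, c, n) + PhiR (m, b, n, d)).
 rewrite /PhiR /= (Phix _ _ am mb) (Phiy a m cn nd) (Phiy m b cn nd).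
 by rewrite (le_trans (cabsD _ _)) // lerD // cabsD.
have [h|h1] := leP (PhiR (a, b, c, d)) (4 * PhiR (a, m, c, n)).
 by exists (a, m, c, n); split => //=; rewrite ?/ok ?/sub /= ?am //; split; rewrite /m /n //; lra.
have [h|h2] := leP (PhiR (a, b, c, d)) (4 * PhiR (a, m, n, d)).
 by exists (a, m, n, d); split => //=; rewrite ?/ok ?/sub /= ?am //; split; rewrite /m /n //; lra.
have [h|h3] := leP (PhiR (a, b, c, d)) (4 * PhiR (m, b, c, n)).
 by exists (m, b, c, n); split => //=; rewrite ?/ok ?/sub /= ?mb //; split; rewrite /m /n //; lra.
have [h|h4] := leP (PhiR (a, b, c, d)) (4 * PhiR (m, b, n, d)).
 by exists (m, b, n, d); split => //=; rewrite ?/ok ?/sub /= ?mb //; split; rewrite /m /n //; lra.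
by exfalso; lra.
Qed.

(** An additive function of rectangles that is, near each point, of smaller order than the square of
    the size must vanish: one of the four quarters always carries at least a fourth of the modulus,
    and the nested rectangles shrink to a point. *)
Lemma bisection : a0 <= b0 -> c0 <= d0 -> Phi a0 b0 c0 d0 = 0.
Proof.
set a := a0; set b := b0; set c := c0; set d := d0.
move=> ab cd; apply/eqP; rewrite -cabs_eq0; apply/negP => /negP K0.
have K : 0 < cabs (Phi a b c d) by rewrite lt_def K0 cabs_ge0.
have /choice[nx hnx] : forall q : rect, exists q', ok q -> [/\ ok q', sub q q',
 q'.1.1.2 - q'.1.1.1 = (q.1.1.2 - q.1.1.1) / 2 /\ q'.2 - q'.1.2 = (q.2 - q.1.2) / 2 &
 PhiR q <= 4 * PhiR q'].
 move=> q; have [/quarter[q' h]|nq] := boolP (ok q); first by exists q'.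
 by exists q.
pose s n := iter n nx (a, b, c, d).
have oks n : ok (s n) by elim: n => [|n /hnx[]//]; rewrite /ok /= ab.
have hs n := hnx _ (oks n).
have [x hx] : exists x, forall n, (s n).1.1.1 <= x <= (s n).1.1.2.
 apply: nested_interval => n; by [have [_ []] := hs n|have /andP[] := oks n].
have [y hy] : exists y, forall n, (s n).1.2 <= y <= (s n).2.
 apply: nested_interval => n; by [have [_ []] := hs n|have /andP[] := oks n].
pose L n := ((s n).1.1.2 - (s n).1.1.1) + ((s n).2 - (s n).1.2).
have LE n : L n = L 0%N / 2 ^+ n.
 elim: n => [|n IH]; first by rewrite expr0 divr1.
 have [_ _ [e1 e2] _] := hs n; rewrite exprS invfM mulrCA -IH /L /= e1 e2; ring.
have PE n : PhiR (s 0%N) <= 4 ^+ n * PhiR (s n).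
 elim: n => [|n IH]; first by rewrite expr0 mul1r.
 have [_ _ _ e] := hs n; rewrite (le_trans IH) // exprSr -mulrA ler_wpM2l ?exprn_ge0 //.
have L0 : 0 <= L 0%N by rewrite /L /=; lra.
pose e := cabs (Phi a b c d) / (2 * (L 0%N) ^+ 2 + 1).
have e0 : 0 < e by rewrite divr_gt0 // ltr_wpDl // mulr_ge0 // sqr_ge0.
have [r r0 hr] := Philoc (hx 0%N) (hy 0%N) e0.
have [n hn] : exists n, L n < r.
 have hn := archi_boundP (divr_ge0 L0 (ltW r0)).
 exists (Num.bound (L 0%N / r)); rewrite LE ltr_pdivrMr ?exprn_gt0 // mulrC -ltr_pdivrMr //.
 rewrite (lt_le_trans hn) // -natrX ler_nat ltnW // ltn_expl //.
have := hr _ _ _ _ (hx n) (hy n) hn; rewrite -/(L n) LE => h.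
have : cabs (Phi a b c d) <= e * (L 0%N) ^+ 2.
 apply: le_trans (PE n) _; rewrite /PhiR.
 apply: le_trans (ler_wpM2l _ h) _; first by rewrite exprn_ge0.
 have -> : (4 : R) = 2 * 2 by ring.
 rewrite exprMn.
 apply: eqW; field.
 by rewrite expf_neq0.
rewrite /e mulrAC ler_pdivlMr; last by rewrite ltr_wpDl // mulr_ge0 // sqr_ge0.
by have := sqr_ge0 (L 0%N); nra.
Qed.
End Bisection.

Lemma goursat f a b c d : (forall z, cca f z) ->
 (forall x y, a <= x <= b -> c <= y <= d -> cdf f (Complex x y)) ->
 a <= b -> c <= d -> rint f a b c d = 0.
Proof.
move=> cf df ab cd; apply: (bisection _ _ _ ab cd) => [????? ? ?|????? ? ?|].
- exact: rint_splitx.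
- exact: rint_splity.
move=> x y e hx hy e0; have [phi cphi hphi] := df x y hx hy.
have e4 : 0 < e / 16 by rewrite divr_gt0.
have [r r0 hr] := cnearI hphi (cphi _ e4).
exists r => // a' b' c' d' /andP[ax xb] /andP[cy yd] hlt.
have ab' := le_trans ax xb; have cd' := le_trans cy yd.
pose w := Complex x y; pose k := phi w; pose L := (b' - a') + (d' - c').
(* [f] minus its first-order expansion at [w]; the affine part has boundary integral 0. *)
pose g z := f z - (f w - k * w) - k * z.
have cg z : cca g z.
 apply: ccaD; first by apply: ccaD; [exact: cf|exact: cca_cst].
 have -> : (fun z => - (k * z)) = (fun z => (- k) * z) by apply/funext => ?; rewrite mulNr.
 by apply: ccaM; [exact: cca_cst|exact: cca_id].
have -> : rint f a' b' c' d' = rint g a' b' c' d'.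
 have E u v p q : p <= q -> citg (fun x => g (u + v * x%:C)) p q =
   citg (fun x => f (u + v * x%:C)) p q -
    ((f w - k * w + k * u) * (q - p)%:C + (k * v) * ((q ^+ 2 - p ^+ 2) / 2)%:C).
  move=> pq; rewrite -citg_line // -mulN1r -citgZ; last exact: rcont_line.
  rewrite -citgD.
  - by apply: citg_ext => t; rewrite /g; ring.
  - by apply: rcont_comp => //; exact: rcont_line.
  - by apply: rcontM; [exact: rcont_cst|exact: rcont_line].
 rewrite /rint !E //.
 suff H : (f w - k * w + k * (0 +i* c')%C) * (b' - a')%:C
   - (f w - k * w + k * (0 +i* d')%C) * (b' - a')%:C
   + 'i%C * ((f w - k * w + k * b'%:C) * (d' - c')%:C
    - (f w - k * w + k * a'%:C) * (d' - c')%:C) = 0.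
  rewrite -[LHS]subr0 -[X in _ - X = _]H; ring.
 have -> : (0 +i* c')%C = 'i%C * c'%:C by complex_ring.
 have -> : (0 +i* d')%C = 'i%C * d'%:C by complex_ring.
 rewrite !rmorphB; ring.
have gb z : cabs (z - w) <= L -> cabs (g z) <= e / 16 * L.
 move=> hz; have [h1 h2] := hr z (le_lt_trans hz hlt).
 have -> : g z = (phi z - phi w) * (z - w) by rewrite /g h1 /k -/w; ring.
 by rewrite cabsM ler_pM ?cabs_ge0 // ltW.
have side u v p q : p <= q -> q - p <= L -> rcont (fun x => u + v * x%:C) ->
 (forall t, p <= t <= q -> cabs (u + v * t%:C - w) <= L) ->
 cabs (citg (fun t => g (u + v * t%:C)) p q) <= e / 8 * L ^+ 2.
 move=> pq qp ct ht; apply: le_trans (citg_abs _ pq (fun t tt => gb _ (ht t tt))) _.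
  by apply: rcont_comp.
 have L0 : 0 <= L by rewrite (le_trans _ qp) // subr_ge0.
 have -> : 2 * (e / 16 * L) * (q - p) = e / 8 * (L * (q - p)) by field.
 by rewrite ler_wpM2l ?divr_ge0 // ?(ltW e0) // expr2 ler_wpM2l.
have dist (u v : R) : a' <= u <= b' -> c' <= v <= d' -> cabs (Complex u v - w) <= L.
 move=> /andP[u1 u2] /andP[v1 v2]; rewrite (le_trans (cabs_le_ReIm _)) //= lerD //;
 by rewrite ler_norml; apply/andP; split; lra.
have cE (u v : R) : u%:C + 'i%C * v%:C = Complex u v.
 by complex_ring.
have cE' (u v : R) : (Complex 0 v) + 1 * u%:C = Complex u v.
 by complex_ring.
rewrite /rint (le_trans (cabsD _ _)) //.
have -> : e * L ^+ 2 = (e / 8 * L ^+ 2 + e / 8 * L ^+ 2) + (e / 8 * L ^+ 2 + e / 8 * L ^+ 2)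
  + e / 2 * L ^+ 2 by field.
rewrite -[leLHS]addr0; apply: lerD; last by rewrite mulr_ge0 ?sqr_ge0 // divr_ge0 // ltW.
have ci : cabs ('i%C : R[i]) = 1 by rewrite /cabs /= expr0n expr1n add0r sqrtr1.
rewrite cabsM ci mul1r; apply: lerD; apply: le_trans (cabsB _ _) _; apply: lerD;
 apply: side => //; try exact: rcont_line; rewrite /L; try lra.
all: move=> t tt; rewrite ?cE ?cE'; apply: dist => //; apply/andP; split; lra.
Qed.
End Goursat.

(** * The exponential, Cauchy's formula and Hadamard's three circles *)

Section ComplexExponential.
Context {R : realType}.
Implicit Types (r s t x y : R) (z w : R[i]).

Lemma derive_near (f : R -> R) x d : is_derive x 1 f d -> forall e : R, 0 < e ->
 exists2 r : R, 0 < r & forall h, `|h| < r -> `|f (x + h) - f x - d * h| <= e * `|h|.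
Proof.
move=> df e e0.
have dv : derivable f x 1 by exact: (@ex_derive _ _ _ _ _ _ _ df).
have ev : 'D_1 f x = d by exact: (@derive_val _ _ _ _ _ _ _ df).
have : (fun h : R => h^-1 *: ((f \o shift x) (h *: 1) - f x)) @ 0^' --> d.
 by rewrite -ev; exact: dv.
move=> /cvgrPdist_le/(_ _ e0)[r /= r0 hr]; exists r => // h hh.
have [->|h0] := eqVneq h 0; first by rewrite addr0 subrr sub0r mulr0 oppr0 !normr0 mulr0.
have := hr h; rewrite /= sub0r normrN => /(_ hh h0).
rewrite /shift /= /GRing.scale /= mulr1 [h + x]addrC distrC => H.
have -> : f (x + h) - f x - d * h = (h^-1 * (f (x + h) - f x) - d) * h by field.
by rewrite normrM ler_wpM2r.
Qed.

Definition cexp z : R[i] :=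
 Complex (expR (Re z) * cos (Im z)) (expR (Re z) * sin (Im z)).

Lemma cexpD z w : cexp (z + w) = cexp z * cexp w.
Proof.
case: z w => a b [c d]; rewrite /cexp /= expRD cosD sinD.
by complex_ring.
Qed.

Lemma cexp0 : cexp 0 = 1.
Proof. by rewrite /cexp /= expR0 cos0 sin0 mulr0 mulr1. Qed.

Lemma cabs_cexp z : cabs (cexp z) = expR (Re z).
Proof.
rewrite /cabs /= !exprMn -mulrDr cos2Dsin2 mulr1 sqrtr_sqr.
by rewrite ger0_norm // expR_ge0.
Qed.

Lemma cexp_neq0 z : cexp z != 0.
Proof. by rewrite -cabs_gt0 cabs_cexp expR_gt0. Qed.

Lemma cexp_near0 (e : R) : 0 < e -> cnear 0 (fun h => cabs (cexp h - 1 - h) <= e * cabs h).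
Proof.
move=> e0; have e4 : 0 < Num.min 1 (e / 8) by rewrite lt_min ltr01 divr_gt0.
have [r1 r10 h1] := derive_near (is_derive_expR (0 : R)) e4.
have [r2 r20 h2] := derive_near (is_derive_cos (0 : R)) e4.
have [r3 r30 h3] := derive_near (is_derive_sin (0 : R)) e4.
set k := Num.min 1 (e / 8) in e4 h1 h2 h3.
have [k1 ke] : k <= 1 /\ k <= e / 8 by split; rewrite ge_min lexx ?orbT.
exists (Num.min (Num.min r1 r2) (Num.min r3 k)); first by rewrite (lt_min 0) (lt_min 0 r1) (lt_min 0 r3) r10 r20 r30.
case=> x y; rewrite subr0 !lt_min => /andP[/andP[l1 l2] /andP[l3 l4]].
set n := cabs _ in l1 l2 l3 l4 *.
have hx : `|x| <= n by exact: (cabs_Re (Complex x y)).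
have hy : `|y| <= n by exact: (cabs_Im (Complex x y)).
have := h1 x (le_lt_trans hx l1); have := h2 y (le_lt_trans hy l2).
have := h3 y (le_lt_trans hy l3).
rewrite !add0r expR0 cos0 sin0 !mul1r subr0 oppr0 mul0r subr0 => H3 H2 H1.
apply: le_trans (cabs_le_ReIm _) _; rewrite /= oppr0 addr0.
have cy : `|cos y| <= 1 by rewrite ler_norml cos_geN1 cos_le1.
have sy : `|sin y| <= 2 * `|y|.
 have := ler_normD (sin y - y) y; rewrite subrK; have := normr_ge0 y; nra.
have ex : `|expR x - 1| <= 2 * `|x|.
 have := ler_normD (expR x - 1 - x) x; rewrite subrK; have := normr_ge0 x; nra.
have n0 : 0 <= n by exact: cabs_ge0.
have B1 : `|expR x * cos y - 1 - x| <= k * n + (1 + n) * (k * n).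
 have -> : expR x * cos y - 1 - x = (expR x - 1 - x) * cos y + (1 + x) * (cos y - 1) by ring.
 rewrite (le_trans (ler_normD _ _)) // !normrM lerD //.
  rewrite -[leRHS]mulr1 ler_pM // (le_trans H1) // ler_wpM2l // ltW //.
 rewrite ler_pM //; last by rewrite (le_trans H2) // ler_wpM2l // ltW.
 by rewrite (le_trans (ler_normD _ _)) // normr1 lerD2l.
have B2 : `|expR x * sin y - y| <= k * n + (2 * n) * (2 * n).
 have -> : expR x * sin y - y = (sin y - y) + (expR x - 1) * sin y by ring.
 rewrite (le_trans (ler_normD _ _)) // !normrM lerD //.
  by rewrite (le_trans H3) // ler_wpM2l // ltW.
 by rewrite ler_pM // ?(le_trans ex) ?(le_trans sy) // ler_wpM2l.
apply: le_trans (lerD B1 B2) _.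
have nk : n <= k by rewrite le_min; case/andP: l4 => /ltW -> /ltW ->.
have : n * n <= k * n by rewrite ler_wpM2r.
have : k * n <= e / 8 * n by rewrite ler_wpM2r.
have : n * (k * n) <= 1 * (k * n) by rewrite ler_wpM2r ?(le_trans nk) // mulr_ge0 // ltW.
nra.
Qed.

Lemma entire_cexp : entire cexp.
Proof.
move=> a; apply: (@cdfP _ _ _ (cexp a)) => e e0.
have ea : 0 < cabs (cexp a) by rewrite cabs_gt0 cexp_neq0.
have [d d0 hd] := cexp_near0 (divr_gt0 e0 ea).
exists d => // z hz; have := hd (z - a); rewrite subr0 => /(_ hz) H.
have -> : cexp z - cexp a - cexp a * (z - a) = cexp a * (cexp (z - a) - 1 - (z - a)).
 have -> : cexp z = cexp a * cexp (z - a) by rewrite -cexpD addrC subrK.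
 by ring.
by rewrite cabsM (le_trans (ler_wpM2l _ H)) ?cabs_ge0 // mulrA mulrCA divff ?mulr1 // gt_eqF.
Qed.

Definition circ r x : R[i] := Complex (r * cos x) (r * sin x).

Lemma circE r x : circ r x = r%:C * circ 1 x.
Proof. by complex_ring. Qed.

Lemma circM r s x y : circ r x * circ s y = circ (r * s) (x + y).
Proof.
apply/eqP; rewrite eq_complex /= cosD sinD.
by apply/andP; split; apply/eqP; ring.
Qed.

Lemma circ0 r : circ r 0 = r%:C.
Proof. by rewrite /circ cos0 sin0 mulr1 mulr0. Qed.

Lemma cabs_circ r x : cabs (circ r x) = `|r|.
Proof. by rewrite /cabs /= !exprMn -mulrDr cos2Dsin2 mulr1 sqrtr_sqr. Qed.

Lemma cexp_circ s x : cexp (Complex s x) = circ (expR s) x.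
Proof. by []. Qed.

Lemma circ_periodic r x : circ r (x + pi *+ 2) = circ r x.
Proof. by rewrite /circ sinD2pi cosD2pi. Qed.

Lemma circ_neq0 r x : r != 0 -> circ r x != 0.
Proof. by rewrite -!(cabs_gt0 (circ r x)) cabs_circ normr_gt0. Qed.

Lemma rcont_circ r : rcont (circ r).
Proof.
by split => x /=; apply: cvgM; (try exact: cvg_cst); [exact: continuous_cos|exact: continuous_sin].
Qed.

Lemma cexp_imag x : cexp ('i%C * x%:C) = circ 1 x.
Proof.
have -> : 'i%C * x%:C = Complex 0 x.
 by complex_ring.
by rewrite cexp_circ expR0.
Qed.

(* [2 pi] times the mean over the circle of radius [r]. *)
Definition cmean (f : R[i] -> R[i]) r := citg (fun x => f (circ r x)) (- pi) pi.

Lemma Npi_le_pi : - pi <= pi :> R. Proof. by have := @pi_ge0 R; lra. Qed.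

Lemma rcont_fcirc (f : R[i] -> R[i]) r : (forall z, cca f z) -> rcont (fun x => f (circ r x)).
Proof. by move=> cf; apply: rcont_comp => //; exact: rcont_circ. Qed.

Lemma cmean_abs (f : R[i] -> R[i]) r M : 0 <= r -> (forall z, cca f z) ->
 (forall z, cabs z = r -> cabs (f z) <= M) -> cabs (cmean f r) <= 4 * pi * M.
Proof.
move=> r0 cf hM; rewrite (_ : 4 * pi * M = 2 * M * (pi - (- pi))); last by ring.
apply: citg_abs; [exact: rcont_fcirc|exact: Npi_le_pi|].
by move=> x _; apply: hM; rewrite cabs_circ ger0_norm.
Qed.

(** Under the exponential the vertical sides of the rectangle become the two circles, while the
    integrals over the horizontal sides cancel by periodicity. *)
Lemma cmean_rint (f : R[i] -> R[i]) r s : 0 < r -> 0 < s ->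
 rint (fun w => f (cexp w)) (ln r) (ln s) (- pi) pi = 0 -> cmean f r = cmean f s.
Proof.
move=> r0 s0; rewrite /rint.
have E x y : (y*i + 1 * x%:C)%C = Complex x y :> R[i].
 by complex_ring.
have -> : citg (fun x => f (cexp ((- pi)*i + 1 * x%:C)%C)) (ln r) (ln s) =
     citg (fun x => f (cexp (pi*i + 1 * x%:C)%C)) (ln r) (ln s).
 apply: citg_ext => x; rewrite !E !cexp_circ -(circ_periodic _ (- pi)).
 by congr (f (circ _ _)); ring.
rewrite subrr add0r => /eqP; rewrite mulf_eq0 => /orP[|].
 by rewrite eq_complex /= oner_eq0 andbF.
rewrite subr_eq0 => /eqP H.
have E' t : 0 < t ->
 citg (fun y => f (cexp ((ln t)%:C + 'i * y%:C)%C)) (- pi) pi = cmean f t.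
 move=> t0; apply: citg_ext => x.
 have -> : ((ln t)%:C + 'i * x%:C)%C = Complex (ln t) x :> R[i] by complex_ring.
 by rewrite cexp_circ lnK.
by rewrite -(E' r r0) -(E' s s0); exact: esym H.
Qed.

(* Cauchy's theorem on annuli, in the logarithmic coordinate. *)
Lemma cmean_const (f : R[i] -> R[i]) r s : (forall z, z != 0 -> cdf f z) ->
 0 < r -> r <= s -> cmean f r = cmean f s.
Proof.
move=> df r0 rs; have s0 := lt_le_trans r0 rs.
apply: cmean_rint => //.
have dF w : cdf (fun w => f (cexp w)) w.
 by apply: (@cdf_comp _ cexp f); [exact: entire_cexp|apply: df; exact: cexp_neq0].
by apply: goursat; rewrite ?ler_ln ?Npi_le_pi // => *; exact: cdf_cca.
Qed.

(** At one interior point only continuity is known. Everything but a small square around it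
    contributes 0, and the integral over the square of half-side e is at most 16 K e. *)
Lemma goursat_sing (f : R[i] -> R[i]) (a b c d x0 y0 : R) : (forall z, cca f z) ->
 (forall x y, a <= x <= b -> c <= y <= d -> (x, y) != (x0, y0) -> cdf f (Complex x y)) ->
 a < x0 < b -> c < y0 < d -> rint f a b c d = 0.
Proof.
move=> cf df /andP[ax xb] /andP[cy yd].
have [r r0 hr] := cf (Complex x0 y0) 1 ltr01.
pose K := cabs (f (Complex x0 y0)) + 1.
have K0 : 0 < K by rewrite ltr_wpDl ?cabs_ge0.
apply: cabs_le0; apply/ler_addgt0Pr => k kp; rewrite add0r.
pose m := Num.min (Num.min (x0 - a) (b - x0)) (Num.min (y0 - c) (d - y0)).
pose e := Num.min (Num.min m (r / 4)) (k / (16 * K)).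
have e0 : 0 < e.
 rewrite (lt_min 0) (lt_min 0 m) !divr_gt0 ?mulr_gt0 // !andbT.
 by rewrite (lt_min 0) (lt_min 0 (x0 - a)) (lt_min 0 (y0 - c)) !subr_gt0 ax xb cy yd.
have em : e <= m by rewrite ge_min ge_min lexx.
have er : e <= r / 4 by rewrite ge_min (@ge_min _ _ _ m) lexx !orbT.
have eP : e * (16 * K) <= k by rewrite -ler_pdivlMr ?mulr_gt0 // ge_min lexx orbT.
move: em; rewrite /m !le_min => /andP[/andP[m1 m2] /andP[m3 m4]].
have z0 a' b' c' d' : a <= a' <= b' -> b' <= b -> c <= c' <= d' -> d' <= d ->
 (b' < x0) || (x0 < a') || (d' < y0) || (y0 < c') -> rint f a' b' c' d' = 0.
 move=> /andP[h1 h2] h3 /andP[h4 h5] h6 h7; apply: goursat => // x y /andP[k1 k2] /andP[k3 k4].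
 apply: df; [by apply/andP; split; lra|by apply/andP; split; lra|].
 by apply/eqP => -[ex ey]; move: h7; rewrite -ex -ey; lra.
have S : rint f a b c d = rint f (x0 - e) (x0 + e) (y0 - e) (y0 + e).
 rewrite (@rint_splitx _ f a (x0 - e) b) //; [|lra|lra].
 rewrite (z0 a (x0 - e)) ?add0r; [|lra|lra|lra|lra|lra].
 rewrite (@rint_splitx _ f (x0 - e) (x0 + e) b) //; [|lra|lra].
 rewrite (z0 (x0 + e) b) ?addr0; [|lra|lra|lra|lra|lra].
 rewrite (@rint_splity _ f _ _ c (y0 - e) d) //; [|lra|lra].
 rewrite (z0 _ _ c (y0 - e)) ?add0r; [|lra|lra|lra|lra|lra].
 rewrite (@rint_splity _ f _ _ (y0 - e) (y0 + e) d) //; [|lra|lra].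
 by rewrite (z0 _ _ (y0 + e) d) ?addr0; [|lra|lra|lra|lra|lra].
have fb x y : x0 - e <= x <= x0 + e -> y0 - e <= y <= y0 + e -> cabs (f (Complex x y)) <= K.
 move=> /andP[h1 h2] /andP[h3 h4]; apply: le_trans (cabs_dist _ (f (Complex x0 y0))) _.
 rewrite lerD2l; apply/ltW/hr; apply: le_lt_trans (cabs_le_ReIm _) _ => /=.
 have [] : `|x - x0| <= e /\ `|y - y0| <= e.
  by split; rewrite ler_norml; apply/andP; split; lra.
 lra.
have E1 (u v : R) : (u*i + 1 * v%:C)%C = Complex v u :> R[i].
 by complex_ring.
have E2 (u v : R) : (u%:C + 'i * v%:C)%C = Complex u v :> R[i].
 by complex_ring.
have side (u v : R[i]) p : (forall t, p - e <= t <= p + e -> cabs (f (u + v * t%:C)) <= K) ->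
  cabs (citg (fun t => f (u + v * t%:C)) (p - e) (p + e)) <= 4 * K * e.
 move=> h; have -> : 4 * K * e = 2 * K * ((p + e) - (p - e)) by ring.
 apply: citg_abs => //; last by lra.
 by apply: rcont_comp => //; exact: rcont_line.
rewrite S /rint (le_trans (cabsD _ _)) // cabsM.
have ci : cabs ('i%C : R[i]) = 1 by rewrite /cabs /= expr0n expr1n add0r sqrtr1.
apply: (@le_trans _ _ ((4 * K * e + 4 * K * e) + (4 * K * e + 4 * K * e))); last by move: eP; lra.
rewrite ci mul1r; apply: lerD; apply: le_trans (cabsB _ _) _; apply: lerD; apply: side => t tt;
 rewrite ?E1 ?E2; apply: fb => //; apply/andP; split; lra.
Qed.

Lemma quotient_at (f : R[i] -> R[i]) a : entire f -> exists q : R[i] -> R[i],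
 [/\ forall z, cca q z, forall z, z != a -> cdf q z & forall z, f z - f a = q z * (z - a)].
Proof.
move=> ef; have [phi cphi [d d0 hd]] := ef a.
pose q z := if z == a then phi a else (f z - f a) / (z - a).
have dq z : z != a -> cdf q z.
 move=> za; apply: (@cdf_ext _ (fun w => (f w - f a) * (w - a)^-1)).
  exists (cabs (z - a)); first by rewrite cabs_gt0 subr_eq0.
  move=> w hw; rewrite /q; case: eqP hw => // ->.
  by rewrite cabsBC ltxx.
 apply: cdfM; first by apply: cdfD; [exact: ef|exact: cdf_cst].
 apply: (@cdf_comp _ (fun w => w - a)); first by apply: cdfD; [exact: cdf_id|exact: cdf_cst].
 by apply: cdfV; rewrite subr_eq0.
exists q; split => // z; last first.
 rewrite /q; case: eqP => [->|/eqP za]; first by rewrite !subrr mulr0.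
 by rewrite divfK // subr_eq0.
have [->|za] := eqVneq z a; last by apply/cdf_cca/dq.
apply: (@cca_ext _ phi) => //; exists d => // w /hd hw.
rewrite /q; case: eqP => [->//|/eqP wa].
by rewrite hw addrAC subrr add0r mulfK // subr_eq0.
Qed.

(** In the logarithmic coordinate the exceptional point is ln a, inside the rectangle, so the means
    of q(z) z over a small circle and over that of radius r agree; the former tend to 0 with the
    radius. *)
Lemma cauchy_zero (f q : R[i] -> R[i]) (a r : R) : entire f -> 0 < a -> a < r ->
 (forall z, cca q z) -> (forall z, z != a%:C -> cdf q z) ->
 (forall z, f z - f a%:C = q z * (z - a%:C)) -> cmean (fun z => q z * z) r = 0.
Proof.
move=> ef a0 ar cq dq hq; pose G z := q z * z.
have r0 := lt_trans a0 ar.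
have cG z : cca G z by apply: ccaM => //; exact: cca_id.
apply: cabs_le0; apply/ler_addgt0Pr => e e0; rewrite add0r.
have [d d0 hd] := cq 0 _ ltr01.
pose K := cabs (q 0) + 1.
have K0 : 0 < K by rewrite ltr_wpDl ?cabs_ge0.
have p0 := @pi_gt0 R; have pK : 0 < 4 * pi * K by rewrite !mulr_gt0.
pose s := Num.min (Num.min (a / 2) (d / 2)) (e / (4 * pi * K)).
have s0 : 0 < s by rewrite (lt_min 0) (lt_min 0 (a / 2)) !divr_gt0.
have [sa sd] : s <= a / 2 /\ s <= d / 2 by split; rewrite ge_min ge_min lexx ?orbT.
have sP : s * (4 * pi * K) <= e by rewrite -ler_pdivlMr // ge_min lexx orbT.
have E : cmean G s = cmean G r.
 have sr : s < r by lra.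
 apply: cmean_rint => //; apply: (@goursat_sing _ _ _ _ _ (ln a) 0).
 - by move=> w; apply: (@cca_comp _ cexp G) => //; apply/cdf_cca/entire_cexp.
 - move=> x y _ /andP[y1 y2] xy; apply: (@cdf_comp _ cexp G); first exact: entire_cexp.
  apply: cdfM; last exact: cdf_id.
  apply: dq; apply: contra xy => /eqP; rewrite cexp_circ => h.
  have hx : expR x = a.
   have := congr1 cabs h; rewrite cabs_circ cabs_real !ger0_norm ?expR_ge0 //; exact: ltW.
  have xE : x = ln a by rewrite -hx expRK.
  move: h; rewrite hx => -[h1 _]; have h2 : cos y = 1.
   by apply: (mulfI (lt0r_neq0 a0)); rewrite h1 mulr1.
  have -> : y = 0; last by rewrite xE.
  have /cos_inj : cos `|y| = cos 0 by rewrite cos0 -h2; case: (ger0P y) => // _; rewrite cosN.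
  rewrite !in_itv /= !lexx pi_ge0 normr_ge0 ler_norml y1 y2 => /(_ isT isT)/eqP.
  by rewrite normr_eq0 => /eqP.
 - by rewrite !ltr_ln ?posrE //; apply/andP; split => //; lra.
 - by rewrite oppr_lt0 p0.
rewrite -E; apply: (@le_trans _ _ (4 * pi * (K * s))); last by move: sP; lra.
apply: cmean_abs => //; first exact: ltW.
move=> z zs; rewrite /G cabsM zs ler_wpM2r // ?(ltW s0) //.
apply: le_trans (cabs_dist _ (q 0)) _; rewrite lerD2l; apply/ltW/hd.
by rewrite subr0 zs; lra.
Qed.

(** This is 2 pi times the j-th Taylor coefficient, for every radius. *)
Definition coef (f : R[i] -> R[i]) (j : nat) (r : R) := cmean (fun z => f z * (z^-1) ^+ j) r.

Lemma cdf_expV (j : nat) z : z != 0 -> cdf (fun w : R[i] => (w^-1) ^+ j) z.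
Proof.
move=> z0; elim: j => [|j IH].
 by apply: cdf_ext (cdf_cst 1 z); exists 1 => // w _; rewrite expr0.
apply: cdf_ext (cdfM (cdfV z0) IH); exists 1 => // w _.
by rewrite exprS.
Qed.

Lemma coef_const (f : R[i] -> R[i]) j r s : entire f -> 0 < r -> 0 < s -> coef f j r = coef f j s.
Proof.
move=> ef; wlog rs : r s / r <= s => [h r0 s0|r0 _].
 by have [rs|/ltW sr] := leP r s; [exact: h|apply/esym/h].
apply: cmean_const => // z z0; apply: cdfM; [exact: ef|exact: cdf_expV].
Qed.

Lemma rcont_coef (f : R[i] -> R[i]) j r : entire f -> 0 < r ->
 rcont (fun x => f (circ r x) * (circ r x)^-1 ^+ j).
Proof.
move=> ef r0; apply/rcontP => x.
have c0 : circ r x != 0 by rewrite circ_neq0 // gt_eqF.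
have cG : cca (fun z : R[i] => f z * (z^-1) ^+ j) (circ r x).
 by apply/cdf_cca/cdfM; [exact: ef|exact: cdf_expV].
move=> e e0; have [d d0 hd] := cG _ e0.
have [d' d'0 hd'] := (rcontP _).1 (rcont_circ r) x d d0.
by exists d' => // y /hd'/hd.
Qed.

Lemma coef_bound (f : R[i] -> R[i]) j r M : entire f -> 0 < r ->
 (forall z, cabs z = r -> cabs (f z) <= M) -> cabs (coef f j r) <= 4 * pi * (M * r^-1 ^+ j).
Proof.
move=> ef r0 hM.
have -> : 4 * pi * (M * r^-1 ^+ j) = 2 * (M * r^-1 ^+ j) * (pi - - pi) by ring.
apply: citg_abs; [exact: rcont_coef|exact: Npi_le_pi|].
move=> x _; have hc : cabs (circ r x) = r by rewrite cabs_circ ger0_norm // ltW.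
rewrite cabsM cabsX cabsV hc ler_wpM2r ?hM //.
by rewrite exprn_ge0 // invr_ge0 ltW.
Qed.

Section Taylor.
Variables (a r : R).
Hypotheses (a0 : 0 < a) (ar : a < r).
Let r0 : 0 < r := lt_trans a0 ar.
(** [K] is the Cauchy kernel zeta/(zeta - a) on the circle of radius [r], and [T] the ratio a/zeta
    of its geometric expansion. Only positive real points [a] are treated; other points are reached
    by rotation. *)
Let K (x : R) : R[i] := (1 - a%:C * (circ r x)^-1)^-1.
Let T (x : R) : R[i] := a%:C * (circ r x)^-1.

Let cT x : cabs (T x) = a / r.
Proof. by rewrite cabsM cabsV cabs_circ cabs_real !ger0_norm // ltW. Qed.

Let T1 x : T x != 1.
Proof.
apply/eqP => h; have := cT x; rewrite h cabs1 => /esym/eqP.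
by rewrite lt_eqF // ltr_pdivrMr // mul1r.
Qed.

Let rT : rcont T.
Proof.
apply: rcontM; first exact: rcont_cst.
have := @rcont_coef (fun=> 1) 1 r (entire_cst 1) r0.
by under eq_fun do rewrite expr1 mul1r.
Qed.

Let rTX k : rcont (fun x => T x ^+ k).
Proof.
elim: k => [|k IH]; first by under eq_fun do rewrite expr0; exact: rcont_cst.
by under eq_fun do rewrite exprS; apply: rcontM.
Qed.

Let rK : rcont K.
Proof.
apply/rcontP => x e e0.
have h : 1 - T x != 0 by rewrite subr_eq0 eq_sym.
have [d d0 hd] := ccaV h e0.
have cN : rcont (fun x => 1 - T x).
 apply: rcontD; first exact: rcont_cst.
 have -> : (fun x => - T x) = (fun x => (-1) * T x) by apply/funext => y; rewrite mulN1r.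
 by apply: rcontM => //; exact: rcont_cst.
have [d' d'0 hd'] := (rcontP _).1 cN x d d0.
by exists d' => // y /hd'/hd.
Qed.

Let bK x : cabs (K x) <= r / (r - a).
Proof.
have ra : 0 < r - a by rewrite subr_gt0.
rewrite cabsV -[r / (r - a)]invrK lef_pV2 ?posrE ?invr_gt0 ?divr_gt0 ?invf_div //; last first.
 by rewrite cabs_gt0 subr_eq0 eq_sym T1.
rewrite mulrBl divff ?gt_eqF // -(cT x) lerBlDr addrC.
by rewrite -[leLHS]cabs1 cabs_dist.
Qed.

Let taylor_kernel f k : entire f ->
 citg (fun x => f (circ r x) * K x) (- pi) pi =
 \sum_(j < k) a%:C ^+ j * coef f j r
 + citg (fun x => f (circ r x) * (T x ^+ k * K x)) (- pi) pi.
Proof.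
move=> ef; have rf : rcont (fun x => f (circ r x)) by apply: rcont_fcirc => z; exact: cdf_cca.
elim: k => [|k IH].
 by rewrite big_ord0 add0r; apply: citg_ext => x; rewrite expr0 mul1r.
rewrite IH big_ord_recr /= -addrA; congr (_ + _).
rewrite /coef /cmean -citgZ; last exact: rcont_coef.
rewrite -citgD.
- apply: citg_ext => x; have hK : K x = 1 + T x * K x by rewrite /K -/(T x); field; rewrite subr_eq0 eq_sym.
 have -> : (circ r x)^-1 ^+ k = T x ^+ k / a%:C ^+ k.
  rewrite /T exprMn mulrC mulrA mulVf ?mul1r // expf_neq0 //.
  by rewrite -cabs_gt0 cabs_real normr_gt0 gt_eqF.
 rewrite {1}hK exprS; field.
 by rewrite expf_neq0 // -cabs_gt0 cabs_real normr_gt0 gt_eqF.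
- by apply: rcontM; [exact: rcont_cst|exact: rcont_coef].
- by apply: rcontM => //; apply: rcontM.
Qed.

Let rem_bound f k M : entire f -> (forall z, cabs z = r -> cabs (f z) <= M) ->
 cabs (citg (fun x => f (circ r x) * (T x ^+ k * K x)) (- pi) pi)
  <= 4 * pi * (M * ((a / r) ^+ k * (r / (r - a)))).
Proof.
move=> ef hM; rewrite [leRHS](_ : _ = 2 * (M * ((a / r) ^+ k * (r / (r - a)))) * (pi - - pi)); last by ring.
have rf : rcont (fun x => f (circ r x)) by apply: rcont_fcirc => z; exact: cdf_cca.
apply: citg_abs; [by apply: rcontM => //; apply: rcontM|exact: Npi_le_pi|].
move=> x _; rewrite !cabsM cabsX cT ler_pM ?mulr_ge0 ?exprn_ge0 ?cabs_ge0 ?divr_ge0 //.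
- exact: ltW.
- exact: ltW.
- by apply: hM; rewrite cabs_circ ger0_norm // ltW.
- by rewrite ler_wpM2l // exprn_ge0 // divr_ge0 // ltW.
Qed.

Lemma small_zero (x C q : R) : 0 <= q -> q < 1 -> (forall k, x <= C * q ^+ k) -> x <= 0.
Proof.
move=> q0 q1 h; rewrite leNgt; apply/negP => x0.
have C0 : 0 < C by have := h 0%N; rewrite expr0 mulr1; apply: lt_le_trans.
have [qE|qn0] := eqVneq q 0; first by have := h 1%N; rewrite qE expr1 mulr0; lra.
have qp : 0 < q by rewrite lt_def qn0.
have e0 : 0 < x / (2 * C) by rewrite divr_gt0 // mulr_gt0.
have q1' : `|q| < 1 by rewrite ger0_norm.
have /cvgrPdist_lt/(_ _ e0) [n _ hn] := cvg_expr q1'.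
have := hn n (leqnn n); rewrite /= sub0r normrN ger0_norm ?exprn_ge0 // => hq.
have := h n; rewrite leNgt => /negP; apply.
rewrite mulrC -ltr_pdivlMr // (lt_le_trans hq) //.
by rewrite invfM mulrA ler_wpM2r ?invr_ge0 ?(ltW C0) // ler_pdivrMr //; lra.
Qed.

Let coef1 j : coef (fun=> 1) j r = (2 * pi)%:C *+ (j == 0%N).
Proof.
case: j => [|j].
 rewrite /coef /cmean; under citg_ext do rewrite expr0 mul1r.
 by rewrite citg_cst ?Npi_le_pi // mul1r mulr1n; congr _%:C; ring.
apply: cabs_le0.
apply: (@small_zero _ (4 * pi * 1) 2^-1); [lra|lra|move=> k].
have s0 : 0 < (2 ^+ k : R) by rewrite exprn_gt0.
rewrite (coef_const _ (entire_cst 1) r0 s0).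
apply: (@le_trans _ _ (4 * pi * (1 * (2 ^+ k)^-1 ^+ j.+1))).
 by apply: coef_bound => // [|z _]; [exact: entire_cst|rewrite cabs1].
rewrite mul1r mulr1 ler_wpM2l ?mulr_ge0 ?pi_ge0 // !exprVn -exprM lef_pV2 ?posrE ?exprn_gt0 //.
by rewrite ler_eXn2l ?ltr1n // mulnS leq_addr.
Qed.

(** Splitting f(zeta) = f(a) + q(zeta)(zeta - a) gives Cauchy's formula, since q(zeta) zeta
    integrates to 0 and the kernel to 2 pi. Expanding the kernel to order [k] leaves a remainder of
    ratio a/r. *)
Lemma taylor f k M : entire f -> (forall z, cabs z = r -> cabs (f z) <= M) ->
 cabs ((2 * pi)%:C * f a%:C - \sum_(j < k) a%:C ^+ j * coef f j r)
  <= 4 * pi * (M * ((a / r) ^+ k * (r / (r - a)))).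
Proof.
move=> ef hM; have [q [cq dq hq]] := quotient_at a%:C ef.
have X1 : citg K (- pi) pi = (2 * pi)%:C.
 apply/eqP; rewrite -subr_eq0 -cabs_eq0 eq_le cabs_ge0 andbT.
 apply: (@small_zero _ (4 * pi * (r / (r - a))) (a / r)); rewrite ?divr_ge0 ?(ltW a0) ?(ltW r0) //.
  by rewrite ltr_pdivrMr // mul1r.
 move=> n; have := taylor_kernel n.+1 (entire_cst 1).
 under citg_ext do rewrite mul1r; move=> ->.
 rewrite big_ord_recl expr0 mul1r coef1 mulr1n.
 rewrite big1 => [|i _]; last by rewrite coef1 mulr0n mulr0.
 rewrite addr0 addrAC subrr add0r.
 apply: (@le_trans _ _ (4 * pi * (1 * ((a / r) ^+ n.+1 * (r / (r - a)))))).
  have h1 z : cabs z = r -> cabs (1 : R[i]) <= 1 by rewrite cabs1.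
  exact: (rem_bound n.+1 (entire_cst 1) h1).
 have ra : 0 <= r / (r - a) by rewrite divr_ge0 ?subr_ge0 // ltW.
 rewrite mul1r -[leRHS]mulrA ler_wpM2l ?mulr_ge0 ?pi_ge0 // mulrC ler_wpM2l // exprS.
 by rewrite ler_piMl ?exprn_ge0 ?divr_ge0 ?(ltW a0) ?(ltW r0) // ler_pdivrMr // mul1r ltW.
have Xf : citg (fun x => f (circ r x) * K x) (- pi) pi = (2 * pi)%:C * f a%:C.
 have := cauchy_zero ef a0 ar cq dq hq; rewrite /cmean => Z.
 have -> : citg (fun x => f (circ r x) * K x) (- pi) pi =
   citg (fun x => q (circ r x) * circ r x) (- pi) pi
   + f a%:C * citg K (- pi) pi.
  rewrite -citgZ // -citgD.
  + apply: citg_ext => x.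
   have c0 : circ r x != 0 by rewrite circ_neq0 // gt_eqF.
   have ca : circ r x - a%:C != 0.
    rewrite subr_eq0; apply/eqP => h; have := T1 x.
    by rewrite /T -h divff // eqxx.
   have -> : K x = circ r x / (circ r x - a%:C).
    by rewrite /K; field; rewrite c0 ca.
   have -> : q (circ r x) = (f (circ r x) - f a%:C) / (circ r x - a%:C).
    by rewrite hq mulfK.
   by field.
  + apply: rcontM; last exact: rcont_circ.
   by apply: rcont_comp => //; exact: rcont_circ.
  + by apply: rcontM => //; exact: rcont_cst.
 by rewrite Z add0r X1 mulrC.
rewrite -Xf (taylor_kernel k ef) addrC addKr.
exact: rem_bound.
Qed.
End Taylor.

Lemma polar z : exists2 x, - pi <= x <= pi & z = circ (cabs z) x.
Proof.
have [->|z0] := eqVneq z 0.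
 exists 0; first by rewrite oppr_le0 pi_ge0.
 by rewrite circ0 cabs0.
have n0 : 0 < cabs z by rewrite cabs_gt0.
pose c := Re z / cabs z.
have hc : -1 <= c <= 1.
 by rewrite -ler_norml normrM normfV (ger0_norm (ltW n0)) ler_pdivrMr // mul1r cabs_Re.
have cE : Re z = cabs z * c by rewrite /c mulrC divfK // gt_eqF.
have p0 := @pi_ge0 R.
have s2 : Im z ^+ 2 = (cabs z * sin (acos c)) ^+ 2.
 have := cabs_sqr z; rewrite exprMn sin2cos2 acosK ?in_itv // mulrBr mulr1 -exprMn -cE.
 by move=> ->; ring.
have [h|h] := eqVneq (Im z) (cabs z * sin (acos c)).
 exists (acos c); first by rewrite acos_lepi // (le_trans _ (acos_ge0 hc)) // oppr_le0.
 by apply/eqP; rewrite eq_complex /= acosK ?in_itv // -cE -h !eqxx.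
exists (- acos c); first by rewrite lerNr opprK acos_lepi //= (le_trans _ p0) // oppr_le0 acos_ge0.
apply/eqP; rewrite eq_complex /= cosN sinN acosK ?in_itv // -cE eqxx /=.
by move/eqP: s2; rewrite eqf_sqr (negbTE h) /= mulrN.
Qed.

Lemma entire_bounded (f : R[i] -> R[i]) r : entire f -> exists2 M : R, 0 < M & forall z, cabs z = r -> cabs (f z) <= M.
Proof.
move=> ef; have rf : rcont (fun x => f (circ r x)) by apply: rcont_fcirc => z; exact: cdf_cca.
have cf : continuous (fun x => cabs (f (circ r x))).
 apply/contP => x e e0; have [d d0 hd] := (rcontP _).1 rf x e e0.
 by exists d => // y /hd; apply: le_lt_trans; exact: cabs_lip.
have [c _ hc] := EVT_max (@Npi_le_pi) (continuous_subspaceT cf).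
exists (cabs (f (circ r c)) + 1); first by rewrite ltr_wpDl ?cabs_ge0.
move=> z zr; have [x hx ->] := polar z; rewrite zr.
by rewrite (le_trans (hc x _)) ?lerDl // in_itv.
Qed.

Lemma coef_zero f (a r : R) : entire f -> 0 < a -> a < r -> (forall k, coef f k r = 0) -> f a%:C = 0.
Proof.
move=> ef a0 ar h0; have r0 := lt_trans a0 ar; have [M _ hM] := entire_bounded r ef.
have : cabs ((2 * pi)%:C * f a%:C) <= 0.
 apply: (@small_zero _ (4 * pi * (M * (r / (r - a)))) (a / r)) => [||k].
 - by rewrite divr_ge0 // ltW.
 - by rewrite ltr_pdivrMr // mul1r.
 have := taylor a0 ar k ef hM; rewrite big1 ?subr0 => [h|i _]; last by rewrite h0 mulr0.
 by apply: le_trans h _; apply: eqW; ring.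
have tp : 0 < 2 * pi :> R by rewrite mulr_gt0 ?pi_gt0.
by rewrite cabsM cabs_real gtr0_norm // pmulr_rle0 // => /cabs_le0.
Qed.

(** The first nonvanishing Taylor coefficient dominates near 0; it exists because f(1) would
    otherwise be 0. *)
Lemma entire_pos_lower (f : R[i] -> R[i]) : entire f -> f 1 != 0 ->
 exists k (eta d : R), [/\ 0 < eta, 0 < d &
  forall c, 0 < c -> c < d -> eta * c ^+ k <= cabs (f c%:C)].
Proof.
move=> ef f1.
have [M M0 hM] := entire_bounded 2 ef.
have [k0 hk0] : exists k, coef f k 2 != 0.
 apply: contrapT => /forallNP h0; move/eqP: f1; apply.
 by apply: (@coef_zero f 1 2) => // [|k]; [rewrite ltr1n|apply/eqP/negPn/negP].
have [k hk hmin] : exists2 k, coef f k 2 != 0 & forall j, (j < k)%N -> coef f j 2 = 0.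
 have ex : exists k, (fun k => coef f k 2 != 0) k by exists k0.
 exists (ex_minn ex); first by case: ex_minnP.
 case: ex_minnP => n _ hn j jn; apply/eqP; apply: contraLR jn => /hn.
 by rewrite -leqNgt.
have p0 := @pi_gt0 R.
pose A := cabs (coef f k 2); have A0 : 0 < A by rewrite cabs_gt0.
pose D := 8 * pi * M; have D0 : 0 < D by rewrite !mulr_gt0.
pose e := Num.min 1 (A / (2 * D)).
have e0 : 0 < e by rewrite (lt_min 0) ltr01 divr_gt0 // mulr_gt0.
exists k, (A / (4 * pi)), e; split => //; first by rewrite divr_gt0 // mulr_gt0.
move=> c c0; rewrite lt_min => /andP[c1 cA].
have c2 : c < 2 by lra.
have := taylor c0 c2 k.+1 ef hM.
rewrite big_ord_recr /= big1 ?add0r => [h|i _]; last by rewrite hmin ?ltn_ord // mulr0.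
have h1 : 4 * pi * (M * ((c / 2) ^+ k.+1 * (2 / (2 - c)))) <= c ^+ k * (A / 2).
 have -> : 4 * pi * (M * ((c / 2) ^+ k.+1 * (2 / (2 - c)))) =
   c ^+ k * (4 * pi * M * c * ((2^-1) ^+ k * (1 / (2 - c)))).
  have -> : (c / 2) ^+ k.+1 = c * c ^+ k * (2^-1 ^+ k) / 2 by rewrite exprMn !exprS; ring.
  by move: (pi : R) (2^-1 ^+ k) (c ^+ k) => P Y X; field; lra.
 rewrite ler_wpM2l ?exprn_ge0 ?(ltW c0) //.
 apply: (@le_trans _ _ (4 * pi * M * c * 1)).
  rewrite ler_wpM2l ?mulr_ge0 ?(ltW p0) ?(ltW M0) ?(ltW c0) //.
  rewrite -[leRHS]mulr1 ler_pM ?exprn_ge0 ?divr_ge0 ?invr_ge0 //; try lra.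
   by rewrite exprn_ile1 //; lra.
  by rewrite ler_pdivrMr; lra.
 rewrite mulr1; have : c * (2 * D) <= A by rewrite -ler_pdivlMr ?mulr_gt0 // ltW.
 by rewrite /D; lra.
have h2 : cabs ((2 * pi)%:C * f c%:C) = 2 * pi * cabs (f c%:C).
 by rewrite cabsM cabs_real ger0_norm // mulr_ge0 // ltW.
have h3 : cabs (c%:C ^+ k * coef f k 2) = c ^+ k * A.
 by rewrite cabsM cabsX cabs_real ger0_norm // ltW.
have := cabs_dist (c%:C ^+ k * coef f k 2) ((2 * pi)%:C * f c%:C).
rewrite h2 h3 cabsBC => h4.
have h5 : c ^+ k * (A / 2) <= 2 * pi * cabs (f c%:C).
 have -> : c ^+ k * (A / 2) = c ^+ k * A - c ^+ k * (A / 2) by field.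
 by rewrite lerBlDr (le_trans h4) // lerD2l (le_trans h).
have -> : A / (4 * pi) * c ^+ k = c ^+ k * (A / 2) / (2 * pi).
 by move: (pi : R) p0 => P P0; field; rewrite gt_eqF.
by rewrite ler_pdivrMr ?mulr_gt0 // [leRHS]mulrC.
Qed.

(** The constant [C] is not sharp but does not depend on [f]. Coefficients of index below j are
    estimated on the circle of radius [r1] and the remainder on that of radius [r2], with j close to
    (B - A)/(ln r2 - ln r1). The constant disappears when the bound is applied to n-fold products
    and divided by n. *)
Lemma hadamard r1 a r2 : 0 < r1 -> r1 < a -> a < r2 -> exists2 C : R, 0 < C &
 forall (f : R[i] -> R[i]) (A B : R), entire f ->
  (forall z, cabs z = r1 -> cabs (f z) <= expR A) ->
  (forall z, cabs z = r2 -> cabs (f z) <= expR B) ->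
  cabs (f a%:C) <= C * expR (A + (ln a - ln r1) / (ln r2 - ln r1) * (B - A)).
Proof.
move=> r10 ra1 ar2; have a0 := lt_trans r10 ra1; have r20 := lt_trans a0 ar2.
pose x := a / r1; pose y := a / r2.
have x1 : 1 < x by rewrite /x ltr_pdivlMr // mul1r.
have x0 : 0 < x by exact: lt_trans ltr01 x1.
have y1 : y < 1 by rewrite /y ltr_pdivrMr // mul1r.
have y0 : 0 < y by rewrite divr_gt0.
pose lx := ln a - ln r1; pose ly := ln r2 - ln a.
have lx0 : 0 < lx by rewrite subr_gt0 ltr_ln.
have ly0 : 0 < ly by rewrite subr_gt0 ltr_ln.
have xE : x = expR lx by rewrite expRB !lnK.
have yE : y = expR (- ly) by rewrite opprB expRB !lnK.
exists (2 * x / (x - 1) + 2 / (1 - y)).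
 by move: (x) (y) x0 x1 y1 => X Y X0 X1 Y1; rewrite addr_gt0 ?divr_gt0 ?mulr_gt0 ?subr_gt0.
move=> f A B ef hA hB.
have p0 := @pi_gt0 R.
have key k : cabs (f a%:C) <= 2 * expR A * ((x ^+ k - 1) / (x - 1))
  + 2 * (expR B * y ^+ k) / (1 - y).
 have := taylor a0 ar2 k ef hB.
 set S := \sum_(j < k) _ => h.
 have hS : cabs S <= 2 * pi * (2 * expR A * ((x ^+ k - 1) / (x - 1))).
  apply: (@le_trans _ _ (\sum_(j < k) 2 * pi * (2 * expR A) * x ^+ j)).
   rewrite (le_trans (cabs_sum _ _ _)) // ler_sum // => j _.
   rewrite cabsM cabsX cabs_real (ger0_norm (ltW a0)) (coef_const j ef r20 r10).
   apply: le_trans (ler_wpM2l _ (coef_bound j ef r10 hA)) _; first by rewrite exprn_ge0 // ltW.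
   by rewrite /x exprMn; apply: eqW; ring.
  rewrite -mulr_sumr -[leRHS]mulrA -![in leRHS]mulrA -!mulrA.
  apply: eqW.
  have -> : \sum_(j < k) x ^+ j = (x ^+ k - 1) / (x - 1).
   by rewrite subrX1 mulrC mulKf // subr_eq0 gt_eqF.
  by ring.
 have h2 : cabs ((2 * pi)%:C * f a%:C) = 2 * pi * cabs (f a%:C).
  by rewrite cabsM cabs_real ger0_norm // mulr_ge0 // ltW.
 have := cabs_dist ((2 * pi)%:C * f a%:C) S; rewrite h2 => h3.
 have {}h3 := le_trans h3 (lerD hS h).
 rewrite -(ler_pM2l (mulr_gt0 (ltr0Sn R 1) p0)) (le_trans h3) //.
 rewrite [leRHS]mulrDr lerD2l; apply: eqW.
 have r2a : r2 - a != 0 by rewrite subr_eq0 gt_eqF.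
 have r2n : r2 != 0 by rewrite gt_eqF.
 have -> : 1 - y = (r2 - a) / r2 by rewrite /y; field.
 by rewrite -/y; move: (pi : R) (y ^+ k) (expR B) => P Y X; field; rewrite r2a r2n.
set E := expR _.
have xd : 0 < x - 1 by rewrite subr_gt0.
have yd : 0 < 1 - y by rewrite subr_gt0.
have xy0 : 0 < lx + ly by rewrite addr_gt0.
have EE : lx / (lx + ly) = (ln a - ln r1) / (ln r2 - ln r1) by rewrite /lx /ly; congr (_ / _); ring.
pose t := (B - A) / (lx + ly).
have tE : A + t * lx = A + (ln a - ln r1) / (ln r2 - ln r1) * (B - A).
 by rewrite -EE /t; ring.
have tE' : B - t * ly = A + (ln a - ln r1) / (ln r2 - ln r1) * (B - A).
 by rewrite -EE /t; field; rewrite gt_eqF.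
have E0 : 0 < E by exact: expR_gt0.
have [t0|t0] := leP t 0.
 apply: le_trans (key 0%N) _; rewrite expr0 subrr mul0r mulr0 add0r mulr1 [leRHS]mulrDl.
 apply: ler_wpDl; first by rewrite !mulr_ge0 ?invr_ge0 ?(ltW xd) ?(ltW E0) ?(ltW a0) ?(ltW r10).
 rewrite mulrAC ler_wpM2l ?divr_ge0 // ?(ltW yd) //.
 by rewrite /E -tE' ler_expR lerDl oppr_ge0 mulr_le0_ge0 // ltW.
pose j := (Num.truncn t).+1.
have /andP[tj jt] : (t <= j%:R <= t + 1).
 by rewrite ltW ?truncnS_gt //= /j -natr1 lerD2r truncn_le // ltW.
apply: le_trans (key j) _; rewrite [leRHS]mulrDl; apply: lerD.
 rewrite [leRHS](_ : _ = 2 * (x * E) / (x - 1)); last by ring.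
 rewrite -[leLHS]mulrA -[leRHS]mulrA ler_pM2l // [leLHS]mulrA ler_wpM2r ?invr_ge0 ?(ltW xd) //.
 apply: (@le_trans _ _ (expR A * x ^+ j)).
  by rewrite ler_wpM2l ?expR_ge0 // gerDl lerN10.
 rewrite /E -tE xE -expRM_natl -!expRD ler_expR.
 have : j%:R * lx <= (t + 1) * lx by rewrite ler_pM2r.
 by rewrite -mulr_natl; lra.
rewrite [leRHS](_ : _ = 2 * E / (1 - y)); last by ring.
rewrite ler_wpM2r ?invr_ge0 ?(ltW yd) // ler_pM2l //.
rewrite /E -tE' yE -expRM_natl -!expRD ler_expR.
have : t * ly <= j%:R * ly by rewrite ler_pM2r.
by rewrite -mulr_natl; lra.
Qed.
End ComplexExponential.

(** * Continuity with respect to a given distance function *)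

Section EpsilonContinuity.
Context {R : realType} {T : Type}.
Variable dist : T -> T -> R.
Implicit Types u v : T -> R.

Definition epsc u a := forall e : R, 0 < e -> exists2 d : R, 0 < d &
 forall z, dist z a < d -> `|u z - u a| < e.

Lemma epsc_comp (phi : R -> R) u a :
 epsc u a -> {for u a, continuous phi} -> epsc (fun z => phi (u z)) a.
Proof.
move=> cu /cvgrPdist_lt cphi e e0; have [d /= d0 hd] := cphi e e0.
have [d' d'0 hd'] := cu d d0; exists d' => // z /hd' hz.
by rewrite distrC; apply: hd => /=; rewrite distrC.
Qed.

Lemma epscD u v a : epsc u a -> epsc v a -> epsc (fun z => u z + v z) a.
Proof.
move=> cu cv e e0; have e2 : 0 < e / 2 by rewrite divr_gt0.
have [d d0 hd] := cu _ e2; have [d' d'0 hd'] := cv _ e2.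
exists (Num.min d d'); first by rewrite (lt_min 0) d0.
move=> z; rewrite lt_min => /andP[/hd h1 /hd' h2].
by rewrite opprD addrACA (le_lt_trans (ler_normD _ _)) // [e]splitr ltrD.
Qed.

Lemma epsc_sum (I : finType) (F : I -> T -> R) a : (forall i, epsc (F i) a) ->
 epsc (fun z => \sum_i F i z) a.
Proof.
move=> cF; elim: (index_enum I) => [|i l IH].
 by move=> e e0; exists 1 => // z _; rewrite !big_nil subrr normr0.
have H := epscD (cF i) IH; move=> e /H[d d0 hd]; exists d => // z /hd.
by rewrite !big_cons.
Qed.

Lemma epsc_nf (I : finType) (g : I -> T -> R[i]) a :
 (forall i, forall e : R, 0 < e -> exists2 d : R, 0 < d &
  forall z, dist z a < d -> cabs (g i z - g i a) < e) ->
 epsc (fun z => Num.sqrt (\sum_i cabs (g i z) ^+ 2)) a.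
Proof.
move=> cg; apply: (epsc_comp (phi := Num.sqrt)); last exact: sqrt_continuous.
apply: epsc_sum => i; apply: (epsc_comp (phi := fun x => x ^+ 2)); last first.
 by apply: cvgM; exact: cvg_id.
by move=> e /(cg i)[d d0 hd]; exists d => // z /hd; apply: le_lt_trans; exact: cabs_lip.
Qed.

End EpsilonContinuity.

(** * Circle means of the logarithm of a norm: convexity and monotonicity *)

Section LogMean.
Context {R : realType}.
Implicit Types (r s t x y : R) (z w : R[i]).

Lemma itg_shift (f : R -> R) (a b c : R) : a <= b -> continuous f ->
 itg (fun x => f (x + c)) a b = itg f (a + c) (b + c).
Proof.
move=> ab cf; rewrite /itg /Rintegral.
have D x : is_derive (x : R) 1 (fun x : R => x + c) 1.
 by apply: is_derive_eq; rewrite addr0.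
have dE : derive1 (fun x : R => x + c) = cst 1.
 by apply/funext => x; rewrite derive1E (@derive_val _ _ _ _ _ _ _ (D x)).
have cF : continuous (fun x : R => x + c).
 by move=> x; apply: cvgD; [exact: cvg_id|exact: cvg_cst].
rewrite (@integration_by_substitution_increasing _ (fun x => x + c) f a b ab).
- by rewrite dE; congr fine; apply: eq_integral => x _; rewrite /= mulr1.
- by move=> x y _ _ xy; rewrite ltrD2r.
- by rewrite dE => x _; exact: cvg_cst.
- by rewrite dE; apply: is_cvg_cst.
- by rewrite dE; apply: is_cvg_cst.
- split => [x _||]; first exact: (@ex_derive _ _ _ _ _ _ _ (D x)).
  by apply/cvg_at_right_filter/cF.
 by apply/cvg_at_left_filter/cF.
- exact: continuous_subspaceT.
Qed.

Lemma unif_cont (f : R -> R) (a b e : R) : continuous f -> 0 < e ->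
 exists2 d : R, 0 < d & forall x y, a <= x <= b -> `|y - x| < d -> `|f y - f x| < e.
Proof.
move=> /contP cf e0.
have := @segment_compact R a b; rewrite compact_near_coveringP.
move=> /(_ R (0 : R)^'+ (fun d x => forall y, `|y - x| < d -> `|f y - f x| < e) _)[].
 move=> x _; have [d d0 hd] := cf x (e / 2) (divr_gt0 e0 (ltr0Sn _ 1)).
 exists ([set y | `|x - y| < d / 2], [set t | 0 < t < d / 2]).
  split => /=.
   by apply/nbhs_ballP; exists (d / 2) => //=; rewrite divr_gt0.
  by near=> t; apply/andP; split; [near: t; exact: nbhs_right_gt|near: t; apply: nbhs_right_lt; rewrite divr_gt0].
 move=> [x' t] /= [h1 /andP[t0 h2]] y hy; rewrite distrC in h1.
 have := hd x'; have := hd y; have := ler_normD (y - x') (x' - x).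
 rewrite subrKA => h3 /(_ _)h4 /(_ _)h5.
 have {}h4 : `|f y - f x| < e / 2 by apply: h4; lra.
 have {}h5 : `|f x' - f x| < e / 2 by apply: h5; lra.
 have := ler_normB (f y - f x) (f x' - f x); rewrite opprB addrA subrK => h6; lra.
move=> d /= d0 hd; exists (d / 2); first by rewrite divr_gt0.
move=> x y xab; apply: (hd (d / 2)) => //=; last by rewrite divr_gt0.
by rewrite sub0r normrN ger0_norm ?divr_ge0 ?ltW //; lra.
Unshelve. all: by end_near.
Qed.

(** The threshold serves all starting angles [a] at once, by uniform continuity and periodicity.
    Uniformity is what allows the bounds on a whole circle that the three circles theorem asks
    for. *)
Lemma riemann_sum (U : R -> R) (e : R) : continuous U -> (forall x, U (x + pi *+ 2) = U x) ->
 0 < e -> exists n0 : nat, forall n a, (n0 < n)%N -> - pi <= a <= pi ->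
 `|(\sum_(k < n) U (a + k%:R * (2 * pi / n%:R))) * (2 * pi / n%:R) - itg U (- pi) pi| <= e.
Proof.
move=> cU pU e0; have p0 := @pi_gt0 R.
have e1 : 0 < e / (2 * pi) by rewrite divr_gt0 // mulr_gt0.
have [d d0 hd] := unif_cont (- pi) (4 * pi) cU e1.
have p2d : 0 <= 2 * pi / d by rewrite divr_ge0 ?mulr_ge0 ?ltW.
exists (Num.bound (2 * pi / d)) => n a hn /andP[a1 a2].
have n0 : 0 < n%:R :> R by rewrite ltr0n (leq_trans _ hn).
pose h : R := 2 * pi / n%:R; rewrite -/h.
have h0 : 0 < h by rewrite divr_gt0 // mulr_gt0.
have hlt : h < d.
 have := archi_boundP p2d; rewrite ltr_pdivrMr // => hb.
 by rewrite /h ltr_pdivrMr // (lt_le_trans hb) // mulrC ler_wpM2l ?(ltW d0) // ler_nat ltnW.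
have nh : n%:R * h = 2 * pi by rewrite /h mulrC divfK // gt_eqF.
have S k : itg U a (a + k%:R * h) = \sum_(j < k) itg U (a + j%:R * h) (a + j%:R * h + h).
 elim: k => [|k IH]; first by rewrite big_ord0 mul0r addr0 /itg set_itv1 Rintegral_set1.
 rewrite big_ord_recr /= -IH (@itg_cat _ _ _ (a + k%:R * h)) //.
 - by congr (_ + itg _ _ _); rewrite -natr1 mulrDl mul1r addrA.
 - by rewrite lerDl mulr_ge0 // ltW.
 - by rewrite lerD2l ler_pM2r // ler_nat.
have P : itg U (- pi) pi = itg U a (a + n%:R * h).
 rewrite nh (@itg_cat _ _ a pi) //; last by rewrite mulr_natl mulr2n; lra.
 rewrite (@itg_cat _ _ (- pi) a) // addrC; congr (_ + _).
 have := itg_shift (2 * pi) a1 cU; rewrite (_ : - pi + 2 * pi = pi) => [<-|]; last by ring.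
 by congr itg; apply/funext => x; rewrite -(pU x); congr U; rewrite mulr2n mulr_natl mulr2n.
rewrite P S mulr_suml -sumrB (le_trans (ler_norm_sum _ _ _)) //.
apply: (@le_trans _ _ (\sum_(j < n) (e / (2 * pi)) * h)).
 apply: ler_sum => j _.
 have ch : continuous (fun _ : R => U (a + j%:R * h)) by move=> x; exact: cvg_cst.
 have uh : a + j%:R * h <= a + j%:R * h + h by rewrite lerDl ltW.
 have -> : U (a + j%:R * h) * h = itg (fun=> U (a + j%:R * h)) (a + j%:R * h) (a + j%:R * h + h).
  by rewrite itg_cst // addrAC subrr add0r.
 have -> : itg (fun=> U (a + j%:R * h)) (a + j%:R * h) (a + j%:R * h + h) - itg U (a + j%:R * h) (a + j%:R * h + h)
   = itg (fun x => U (a + j%:R * h) - U x) (a + j%:R * h) (a + j%:R * h + h).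
  rewrite -mulN1r -itgZ // -itgD //; last first.
   by move=> x; apply: cvgM; [exact: cvg_cst|exact: cU].
  by congr itg; apply/funext => x; rewrite mulN1r.
 have -> : e / (2 * pi) * h = e / (2 * pi) * (a + j%:R * h + h - (a + j%:R * h)) by rewrite addrAC subrr add0r.
 apply: itg_abs => //; first by move=> x; apply: cvgB; [exact: cvg_cst|exact: cU].
 move=> x /andP[x1 x2]; rewrite distrC; apply/ltW/hd.
  have : j%:R * h <= 2 * pi by rewrite -nh ler_pM2r // ler_nat ltnW.
  have : 0 <= j%:R * h by rewrite mulr_ge0 // ltW.
  by move=> g1 g2; apply/andP; split; lra.
 by rewrite ger0_norm; lra.
rewrite sumr_const card_ord -[leLHS]mulr_natl mulrCA nh divfK //.
by rewrite mulf_neq0 // gt_eqF.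
Qed.

Lemma cauchy_schwarz_sum (I : finType) (x y : I -> R) :
 \sum_i x i * y i <= Num.sqrt (\sum_i x i ^+ 2) * Num.sqrt (\sum_i y i ^+ 2).
Proof.
set X := \sum_i x i ^+ 2; set Y := \sum_i y i ^+ 2; set S := \sum_i _.
have X0 : 0 <= X by apply: sumr_ge0 => i _; exact: sqr_ge0.
have Y0 : 0 <= Y by apply: sumr_ge0 => i _; exact: sqr_ge0.
have H : \sum_i (X * y i - S * x i) ^+ 2 = X * (X * Y - S ^+ 2).
 transitivity (\sum_i (X ^+ 2 * (y i ^+ 2) - 2 * X * S * (x i * y i) + S ^+ 2 * x i ^+ 2)).
  by apply: eq_bigr => i _; ring.
 by rewrite big_split /= sumrB -!mulr_sumr -/X -/Y -/S; ring.
have [XE|Xn] := eqVneq X 0.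
 rewrite XE sqrtr0 mul0r /S big1 // => i _.
 have /eqP : x i ^+ 2 = 0.
  by apply: (psumr_eq0P _ XE) => // j _; exact: sqr_ge0.
 by rewrite sqrf_eq0 => /eqP ->; rewrite mul0r.
have XY : S ^+ 2 <= X * Y.
 rewrite -subr_ge0 -(@pmulr_rge0 _ X) ?lt_def ?Xn // -H.
 by apply: sumr_ge0 => i _; exact: sqr_ge0.
rewrite -sqrtrM // (le_trans (ler_norm _)) // -sqrtr_sqr ler_wsqrtr //.
Qed.

Definition nf (I : finType) (f : I -> R[i] -> R[i]) z := Num.sqrt (\sum_i cabs (f i z) ^+ 2).

Lemma nf_sqr (I : finType) (f : I -> R[i] -> R[i]) z : nf f z ^+ 2 = \sum_i cabs (f i z) ^+ 2.
Proof. by rewrite sqr_sqrtr // sumr_ge0 // => i _; exact: sqr_ge0. Qed.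

Lemma continuous_sum (I : finType) (F : I -> R -> R) :
 (forall i, continuous (F i)) -> continuous (fun x : R => \sum_i F i x).
Proof.
move=> h; apply: (big_closed (C := fun f : R -> R => continuous f)) => //; first exact: cst_continuous.
by move=> f g cf cg x; exact: cvgD (cf x) (cg x).
Qed.

Lemma rcont_cabs (p : R -> R[i]) : rcont p -> continuous (fun x => cabs (p x)).
Proof.
move=> rp; apply/contP => x e e0; have [d d0 hd] := (rcontP _).1 rp x e e0.
by exists d => // y /hd; apply: le_lt_trans; exact: cabs_lip.
Qed.

Lemma nf_circ_cont (I : finType) (f : I -> R[i] -> R[i]) r : (forall i, entire (f i)) ->
 continuous (fun x => nf f (circ r x)).
Proof.
move=> ef x; apply: (@continuous_comp _ _ _ (fun x => \sum_i cabs (f i (circ r x)) ^+ 2)).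
 apply: continuous_sum => i y; apply: cvgM; apply: rcont_cabs; apply: rcont_fcirc => z; exact/cdf_cca/ef.
exact: sqrt_continuous.
Qed.

Lemma ln_nf_cont (I : finType) (f : I -> R[i] -> R[i]) r : (forall i, entire (f i)) ->
 (forall z, 0 < nf f z) -> continuous (fun x => ln (nf f (circ r x))).
Proof.
move=> ef f0 x; apply: (@continuous_comp _ _ _ (fun x => nf f (circ r x))).
 exact: nf_circ_cont.
exact: continuous_ln.
Qed.

(* [z |-> (f (e^{2 pi i k / n} z))_k], tensored over [k], is a family of
  entire functions whose norm is the product of the norms at rotated points. *)
Lemma three_circles_prod r1 a r2 : 0 < r1 -> r1 < a -> a < r2 -> exists C : R,
 forall (I : finType) (f : I -> R[i] -> R[i]) (n : nat) (w : 'I_n -> R) (A B : R),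
  (forall i, entire (f i)) -> (forall z, 0 < nf f z) ->
  (forall z, cabs z = r1 -> \sum_(k < n) ln (nf f (circ 1 (w k) * z)) <= A) ->
  (forall z, cabs z = r2 -> \sum_(k < n) ln (nf f (circ 1 (w k) * z)) <= B) ->
  \sum_(k < n) ln (nf f (circ a (w k))) <=
   C + A + (ln a - ln r1) / (ln r2 - ln r1) * (B - A).
Proof.
move=> r10 ra1 ar2; have [C C0 hC] := hadamard r10 ra1 ar2.
exists (ln C) => I f n w A B ef f0 hA hB.
pose P z := \prod_(k < n) nf f (circ 1 (w k) * z).
have P0 z : 0 < P z by apply: prodr_gt0.
have PE z : P z = expR (\sum_(k < n) ln (nf f (circ 1 (w k) * z))).
 by rewrite expR_sum; apply: eq_bigr => k _; rewrite lnK // posrE.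
pose a' : R[i] := a%:C.
pose Fp (phi : {ffun 'I_n -> I}) z := \prod_(k < n) f (phi k) (circ 1 (w k) * z).
(* The scalar product of the tensor family with its own value at a': by Cauchy-Schwarz it is at most
   P(a') P(z) in modulus, with equality at z = a'. *)
pose g z := \sum_phi conjc (Fp phi a') * Fp phi z.
have eg : entire g.
 apply: entire_sum => phi; apply: entireM; first exact: entire_cst.
 apply: entire_prod => k; apply: (@entire_comp _ (fun z => circ 1 (w k) * z)) => //.
 by apply: entireM; [exact: entire_cst|exact: entire_id].
have gb z : cabs (g z) <= P a' * P z.
 apply: le_trans (cabs_sum _ _ _) _; rewrite /P -big_split /=.
 apply: (@le_trans _ _ (\prod_(k < n) \sum_i cabs (f i (circ 1 (w k) * a')) * cabs (f i (circ 1 (w k) * z)))).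
  rewrite bigA_distr_bigA /= ler_sum // => phi _.
  by rewrite cabsM cabs_conj !cabs_prod -big_split.
 apply: ler_prod => k _; apply/andP; split.
  by apply: sumr_ge0 => i _; rewrite mulr_ge0 ?cabs_ge0.
 exact: cauchy_schwarz_sum.
have ga : cabs (g a') = P a' ^+ 2.
 have -> : g a' = (P a' ^+ 2)%:C.
  have -> : g a' = \sum_phi (cabs (Fp phi a') ^+ 2)%:C.
   by apply: eq_bigr => phi _; rewrite mulrC mul_conj.
  rewrite -rmorph_sum; congr _%:C; rewrite /P -prodrXl.
  under [RHS]eq_bigr do rewrite nf_sqr.
  rewrite bigA_distr_bigA /=; apply: eq_bigr => phi _.
  by rewrite cabs_prod -prodrXl.
 by rewrite cabs_real ger0_norm // sqr_ge0.
have hg (r D : R) : (forall z, cabs z = r -> \sum_(k < n) ln (nf f (circ 1 (w k) * z)) <= D) ->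
  forall z, cabs z = r -> cabs (g z) <= expR (ln (P a') + D).
 move=> hD z /hD h; apply: le_trans (gb z) _; rewrite expRD lnK ?posrE //.
 by rewrite ler_pM2l // PE ler_expR.
have := hC g _ _ eg (hg _ _ hA) (hg _ _ hB); rewrite -/a' ga.
rewrite -ler_ln ?posrE ?exprn_gt0 ?mulr_gt0 ?expR_gt0 // lnM ?posrE ?expR_gt0 // expRK lnXn //.
rewrite PE expRK mulr2n => h.
have -> : \sum_(k < n) ln (nf f (circ a (w k))) = \sum_(k < n) ln (nf f (circ 1 (w k) * a')).
 by apply: eq_bigr => k _; rewrite /a' -circ0 circM mul1r addr0.
move: h; set S := \sum_(k < n) _.
have -> : S + B - (S + A) = B - A by ring.
lra.
Qed.

(* [2 pi] times the mean of [ln |f|] over the circle of radius [r]. *)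
Definition lmean (I : finType) (f : I -> R[i] -> R[i]) r :=
 itg (fun x => ln (nf f (circ r x))) (- pi) pi.

(** The bound for n equally spaced rotations is divided by n: the sums become Riemann sums of the
    circle means, and the constant [C] is divided by n as well. *)
Lemma lmean_convex (I : finType) (f : I -> R[i] -> R[i]) r1 a r2 :
 (forall i, entire (f i)) -> (forall z, 0 < nf f z) -> 0 < r1 -> r1 < a -> a < r2 ->
 lmean f a <= lmean f r1 + (ln a - ln r1) / (ln r2 - ln r1) * (lmean f r2 - lmean f r1).
Proof.
move=> ef f0 r10 ra1 ar2; have a0 := lt_trans r10 ra1; have r20 := lt_trans a0 ar2.
set th := _ / _; have p0 := @pi_gt0 R.
have th1 : th <= 1.
 by rewrite ler_pdivrMr ?mul1r ?lerD2r ?ler_ln ?(ltW ar2) // subr_gt0 ltr_ln // (lt_trans ra1).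
have [C hC] := three_circles_prod r10 ra1 ar2.
apply/ler_addgt0Pr => e e0.
have e4 : 0 < e / 4 by rewrite divr_gt0.
have pU r x : ln (nf f (circ r (x + pi *+ 2))) = ln (nf f (circ r x)) by rewrite circ_periodic.
have rs r := riemann_sum (ln_nf_cont (r := r) ef f0) (pU r) e4.
have [n1 h1] := rs r1; have [n2 h2] := rs r2; have [n3 h3] := rs a.
pose n4 := Num.bound (`|C| * (2 * pi) / (e / 4)).
pose n := (n1 + n2 + n3 + n4).+1.
pose h : R := 2 * pi / n%:R.
have h0 : 0 < h by rewrite divr_gt0 // mulr_gt0.
pose w (k : 'I_n) : R := k%:R * h.
have bound r (m : nat) : 0 < r -> (m < n)%N ->
  (forall n a, (m < n)%N -> - pi <= a <= pi ->
   `|(\sum_(k < n) ln (nf f (circ r (a + k%:R * (2 * pi / n%:R))))) * (2 * pi / n%:R) - lmean f r| <= e / 4) ->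
  forall z, cabs z = r -> \sum_(k < n) ln (nf f (circ 1 (w k) * z)) <= (lmean f r + e / 4) / h.
 move=> r0 mn hm z zr; have [x hx ->] := polar z; rewrite zr ler_pdivlMr //.
 have := hm n x mn hx; rewrite ler_norml => /andP[_]; rewrite lerBlDl.
 rewrite -/h; have -> // : \sum_(k < n) ln (nf f (circ 1 (w k) * circ r x)) =
   \sum_(k < n) ln (nf f (circ r (x + k%:R * h))).
 by apply: eq_bigr => k _; rewrite circM mul1r addrC.
have l1 : (n1 < n)%N by rewrite /n ltnS -!addnA leq_addr.
have l2 : (n2 < n)%N by rewrite /n ltnS -!addnA (leq_trans (leq_addr _ _) (leq_addl n1 _)).
have l3 : (n3 < n)%N by rewrite /n ltnS (leq_trans (leq_addl (n1 + n2) n3)) // leq_addr.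
have := hC I f n w _ _ ef f0 (bound _ _ r10 l1 h1) (bound _ _ r20 l2 h2).
rewrite -/th => H.
have : lmean f a - e / 4 <= (\sum_(k < n) ln (nf f (circ a (w k)))) * h.
 have := h3 n 0 l3; rewrite oppr_le0 (ltW p0) => /(_ isT).
 rewrite ler_norml => /andP[+ _]; under eq_bigr do rewrite add0r.
 by rewrite -/h -/(lmean f a) lerBrDl.
move/(ler_wpM2r (ltW h0)): H => H /le_trans/(_ H).
have Ch : C * h <= e / 4.
 apply: le_trans (ler_wpM2r (ltW h0) (ler_norm C)) _.
 have Cp : 0 <= `|C| * (2 * pi) / (e / 4) by rewrite divr_ge0 ?mulr_ge0 ?(ltW p0) // ltW.
 have := archi_boundP Cp; rewrite -/n4 ltr_pdivrMr // => hb.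
 rewrite /h mulrA ler_pdivrMr // (le_trans (ltW hb)) // [leRHS]mulrC.
 by rewrite ler_wpM2r ?(ltW e4) // ler_nat /n ltnW // ltnS leq_addl.
set L1 := lmean f r1; set L2 := lmean f r2.
have -> : (C + (L1 + e / 4) / h + th * ((L2 + e / 4) / h - (L1 + e / 4) / h)) * h =
  C * h + L1 + e / 4 + th * (L2 - L1) by field; rewrite gt_eqF.
by move: (th * (L2 - L1)) (L1) (lmean f a) (C * h) Ch e0; clear; move=> *; lra.
Qed.

Lemma lmean0 (I : finType) (f : I -> R[i] -> R[i]) (e : R) :
 (forall i, entire (f i)) -> (forall z, 0 < nf f z) -> 0 < e ->
 exists2 d : R, 0 < d & forall r, 0 < r -> r < d -> `|lmean f r - 2 * pi * ln (nf f 0)| <= e.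
Proof.
move=> ef f0 e0; have p0 := @pi_gt0 R.
have e1 : 0 < e / (2 * pi) by rewrite divr_gt0 // mulr_gt0.
have [d d0 hd] : exists2 d : R, 0 < d & forall z, cabs (z - 0) < d ->
  `|ln (nf f z) - ln (nf f 0)| < e / (2 * pi).
 apply: (epsc_comp (dist := fun z a => cabs (z - a)) (phi := @ln R) (u := nf f)) => //.
  apply: epsc_nf => i d /(cdf_cca (ef i 0))[d' d'0 hd']; by exists d'.
 exact/continuous_ln/f0.
exists d => // r r0 rd; have cl := ln_nf_cont (r := r) ef f0.
have cc : continuous (fun _ : R => - ln (nf f 0)) by move=> x; exact: cvg_cst.
have -> : lmean f r - 2 * pi * ln (nf f 0) = itg (fun x => ln (nf f (circ r x)) + - ln (nf f 0)) (- pi) pi.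
 by rewrite itgD // itg_cst ?Npi_le_pi //; congr (_ + _); ring.
have -> : e = e / (2 * pi) * (pi - - pi) by move: (pi : R) p0 => P P0; field; rewrite gt_eqF.
apply: itg_abs; rewrite ?Npi_le_pi //.
 by move=> x; apply: cvgD; [exact: cl|exact: cc].
by move=> x _; apply/ltW/hd; rewrite subr0 cabs_circ ger0_norm // ltW.
Qed.

(** A function convex in ln r and bounded near r = 0 cannot decrease: in the convexity inequality
    from a tiny radius [s], the weight of the bounded value at [s] tends to 0. *)
Lemma lmean_mono (I : finType) (f : I -> R[i] -> R[i]) a b :
 (forall i, entire (f i)) -> (forall z, 0 < nf f z) -> 0 < a -> a <= b -> lmean f a <= lmean f b.
Proof.
move=> ef f0 a0; rewrite le_eqVlt => /predU1P[->//|ab].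
have b0 := lt_trans a0 ab.
rewrite leNgt; apply/negP => h.
have [d d0 hd] := lmean0 ef f0 ltr01.
pose K := 2 * pi * ln (nf f 0) + 1.
pose x := lmean f a - lmean f b; have x0 : 0 < x by rewrite subr_gt0.
have lab : 0 < ln b - ln a by rewrite subr_gt0 ltr_ln.
pose M := `|K - lmean f b|.
pose s := Num.min (Num.min (d / 2) (a / 2)) (expR (ln a - (M + 1) * (ln b - ln a) / x)).
have s0 : 0 < s by rewrite (lt_min 0) (lt_min 0 (d / 2)) expR_gt0 !divr_gt0.
have [sd sa] : s <= d / 2 /\ s <= a / 2 by split; rewrite ge_min ge_min lexx ?orbT.
have lsa : ln s <= ln a - (M + 1) * (ln b - ln a) / x.
 by rewrite -[leRHS]expRK ler_ln ?posrE ?expR_gt0 // ge_min lexx orbT.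
have sK : lmean f s <= K.
 have sd' : s < d by move: sd d0; clear; lra.
 by have := hd s s0 sd'; rewrite ler_norml lerBlDl => /andP[].
have sa' : s < a by move: sa a0; clear; lra.
have := lmean_convex ef f0 s0 sa' ab; set th := _ / _ => H.
have l0 : 0 < ln b - ln s by rewrite subr_gt0 ltr_ln // (lt_trans sa').
have t1 : 1 - th = (ln b - ln a) / (ln b - ln s) by rewrite /th; field; rewrite gt_eqF.
have t10 : 0 <= 1 - th by rewrite t1 divr_ge0 // ltW.
have : x <= (1 - th) * M.
 have h1 : (1 - th) * (lmean f s - lmean f b) <= (1 - th) * M.
  by rewrite ler_wpM2l // /M (le_trans _ (ler_norm _)) // lerD2r.
 apply: le_trans h1; rewrite /x.
 by move: H; move: (lmean f a) (lmean f b) (lmean f s) (th); clear; move=> *; lra.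
rewrite t1 leNgt => /negP; apply.
rewrite mulrAC ltr_pdivrMr //.
have : (M + 1) * (ln b - ln a) / x <= ln b - ln s.
 by move: lsa (lab); move: (ln s) (ln a) (ln b) (_ / x); clear; move=> *; lra.
rewrite ler_pdivrMr // [ltRHS]mulrC => h2; apply: lt_le_trans h2.
by rewrite mulrC ltr_pM2r // ltrDl.
Qed.

Lemma lmean_ge0 (I : finType) (f : I -> R[i] -> R[i]) r :
 (forall i, entire (f i)) -> (forall z, 0 < nf f z) -> 0 < r ->
 2 * pi * ln (nf f 0) <= lmean f r.
Proof.
move=> ef f0 r0; apply/ler_addgt0Pr => e e0.
have [d d0 hd] := lmean0 ef f0 e0.
pose s := Num.min (d / 2) r; have s0 : 0 < s by rewrite (lt_min 0) r0 divr_gt0.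
have [sd sr] : s <= d / 2 /\ s <= r by split; rewrite ge_min lexx ?orbT.
have sd' : s < d by move: sd d0; clear; lra.
have := hd s s0 sd'; rewrite ler_norml lerBrDl => /andP[h _].
by have := lmean_mono ef f0 s0 sr; move: (lmean f r) (lmean f s) (2 * pi * _) h => *; lra.
Qed.
End LogMean.

(* The canonical sigma-finite structure of [\x] is shadowed by the one for probabilities. *)
Section SigmaFiniteProduct.
Context d1 d2 (T1 : measurableType d1) (T2 : measurableType d2) (R : realType).
Variables (m1 : {sigma_finite_measure set T1 -> \bar R}) (m2 : {sigma_finite_measure set T2 -> \bar R}).

Definition prodm : set (T1 * T2)%type -> \bar R := (m1 \x m2)%E.

HB.instance Definition _ := Measure.on prodm.

Let prodm_sigma_finite : sigma_finite setT prodm.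
Proof.
have /sigma_finiteP[F [FT ndF hF]] := sigma_finiteT m1.
have /sigma_finiteP[G [GT ndG hG]] := sigma_finiteT m2.
have mono (U : Type) (H : nat -> set U) : nondecreasing_seq H -> forall i j x, (i <= j)%N -> H i x -> H j x.
 by move=> nH i j x /nH/subsetPset; apply.
exists (fun n => F n `*` G n).
 apply/esym; rewrite -subTset => -[x y] _.
 have [i _ Fx] : (\bigcup_i F i) x by rewrite -FT.
 have [j _ Gy] : (\bigcup_i G i) y by rewrite -GT.
 exists (maxn i j) => //; split => /=.
  exact: (mono _ _ ndF _ _ _ (leq_maxl i j)).
 exact: (mono _ _ ndG _ _ _ (leq_maxr i j)).
move=> n; have [mF Fn] := hF n; have [mG Gn] := hG n.
split; first exact: measurableX.
rewrite /prodm product_measure1E // lte_mul_pinfty // ge0_fin_numE //.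
Qed.

HB.instance Definition _ := Measure_isSigmaFinite.Build _ _ _ prodm prodm_sigma_finite.
End SigmaFiniteProduct.

(** * Lebesgue measure on C^p and its rotations *)

Section LebesgueSpace.
Context {R : realType}.
Notation leb := (@lebesgue_measure R).

Lemma lebesgue_shift (c : R) (A : set (measurableTypeR R)) : measurable A ->
 pushforward leb (fun x : R => x + c : measurableTypeR R) A = leb A.
Proof.
move=> mA; apply/esym/lebesgue_measure_unique => //.
 by apply: measurable_funD => //; exact: mcst.
move=> ? _ [[a b]] _ <-; rewrite /= /pushforward.
have -> : (fun x : R => x + c) @^-1` `]a, b] = `]a - c, b - c]%classic.
 by apply/seteqP; split => x /=; rewrite !in_itv /= ltrBlDr lerBrDr.
rewrite !lebesgue_measure_itv /= !lte_fin ltrD2r; case: ifP => // _.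
by rewrite -!EFinB; congr EFin; ring.
Qed.

Lemma ge0_integral_shift (f : R -> \bar R) (c : R) : mfun f ->
 (forall x, 0 <= f x)%E -> (\int[leb]_x (f \o (fun x : R => x + c)%R) x = \int[leb]_x f x)%E.
Proof.
move=> mf f0.
have mc : mfun (fun x : R => x + c : measurableTypeR R).
 by apply: measurable_funD => //; exact: mcst.
transitivity (\int[pushforward leb (fun x : R => (x + c)%R : measurableTypeR R)]_x f x)%E.
 by rewrite ge0_integral_pushforward //= preimage_setT.
by apply: eq_measure_integral => //= A mA _; exact: lebesgue_shift.
Qed.

(** Borel measurability of a function of a sequence, expressed by substituting measurable
    coordinates; composites are then measurable by construction. *)
Definition ebor (g : (nat -> R) -> \bar R) := forall d (T : measurableType d) (X : nat -> T -> R),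
 (forall i, mfun (X i)) -> mfun (fun t => g (X^~ t)).

Definition rbor (g : (nat -> R) -> R) := forall d (T : measurableType d) (X : nat -> T -> R),
 (forall i, mfun (X i)) -> mfun (fun t => g (X^~ t)).

Definition upd (x : nat -> R) i v : nat -> R := fun j => if j == i then v else x j.
Definition consx (v : R) (x : nat -> R) : nat -> R := fun j => if j is j'.+1 then x j' else v.

Lemma lebesgue_space k : exists d (W : measurableType d)
 (mu : {sigma_finite_measure set W -> \bar R}) (X : nat -> W -> R),
 [/\ forall i, mfun (X i),
   forall g, ebor g -> (forall x, 0 <= g x)%E ->
    iint k (fun s => g (nth 0 s)) = (\int[mu]_w g (X^~ w))%E
  & forall g i phi, (i < k)%N -> ebor g -> (forall x, 0 <= g x)%E -> rbor phi ->
    (forall x v, phi (upd x i v) = phi x) ->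
    (\int[mu]_w g (upd (X^~ w) i (X i w + phi (X^~ w))) = \int[mu]_w g (X^~ w))%E].
Proof.
elim: k => [|k [d [W [mu [X [mX hX iX]]]]]].
 exists _, unit, (\d_tt : {sigma_finite_measure set unit -> \bar R}), (fun _ _ => 0); split => //.
  move=> g mg g0 /=; rewrite integral_dirac //= diracT mul1e; congr g; apply/funext => i; by rewrite nth_nil.
pose X' i (w : R * W) := if i is j.+1 then X j w.2 else w.1.
have X'E w : X'^~ w = consx w.1 (X^~ w.2) by apply/funext => -[].
have mX' i : mfun (X' i).
 by case: i => [|j]; [exact: measurable_fst|apply: measurableT_comp => //; exact: measurable_snd].
have bor_cons g v : ebor g -> ebor (fun x => g (consx v x)).
 move=> bg d' T Y mY; have -> : (fun t => g (consx v (Y^~ t))) =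
   (fun t => g ((fun i t => consx v (Y^~ t) i)^~ t)) by [].
 by apply: bg => -[|i] /=; [exact: mcst|exact: mY].
exists _, (measurableTypeR R * W)%type, (prodm leb mu), X'; split => //; rewrite /prodm.
- move=> g mg g0 /=; rewrite fubini_tonelli1 //=; last exact: mg.
 apply: eq_integral => x _; rewrite /fubini_F /=.
 transitivity (iint k (fun s => g (consx x (nth 0 s)))).
  by congr iint; apply/funext => s; congr g; apply/funext => -[].
 by rewrite (hX _ (bor_cons _ _ mg)) //; apply: eq_integral => w _; rewrite X'E.
- move=> g i phi ik bg g0 bphi hphi.
 have mG : mfun (fun w => g (upd (X'^~ w) i (X' i w + phi (X'^~ w)))).
  apply: (bg _ _ (fun j w => upd (X'^~ w) i (X' i w + phi (X'^~ w)) j)) => j.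
  rewrite /upd; case: (j == i) => //.
  by apply: measurable_funD => //; exact: bphi.
 have mG0 : mfun (fun w => g (X'^~ w)) by exact: bg.
 case: i ik hphi mG => [_|i ik] hphi mG.
  rewrite !fubini_tonelli2 //; apply: eq_integral => w _; rewrite /fubini_G /=.
  have mg1 : mfun (fun x : R => g (consx x (X^~ w))).
   apply: (bg _ _ (fun j x => consx x (X^~ w) j)) => -[|j] /=; first exact: measurable_id.
   exact: mcst.
  have -> : (fun x : R => g (X'^~ (x, w))) = (fun x => g (consx x (X^~ w))).
   by apply/funext => x; rewrite X'E.
  rewrite -[RHS](ge0_integral_shift (phi (consx 0 (X^~ w))) mg1) //.
  apply: eq_integral => x _; congr g; apply/funext => -[|j] //=.
  by rewrite /upd /= X'E -(hphi (consx x _) 0); congr (_ + phi _); apply/funext => -[].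
 rewrite !fubini_tonelli1 //; apply: eq_integral => x _; rewrite /fubini_F /=.
 transitivity (\int[mu]_w g (consx x (X^~ w)))%E; last first.
  by apply: eq_integral => w _; rewrite X'E.
 rewrite -(iX (fun y => g (consx x y)) i (fun y => phi (consx x y)) ik) //.
 + apply: eq_integral => w _; congr g; apply/funext => -[|j] //=.
 + exact: bor_cons.
 + move=> d' T Y mY.
  apply: (bphi _ _ (fun i t => consx x (Y^~ t) i)) => -[|j] /=; [exact: mcst|exact: mY].
 + move=> y v; rewrite -[RHS](hphi _ v); congr phi; apply/funext => -[|j] //=.
Qed.

Section ComplexCoordinates.
Variable p : nat.
Implicit Types (z : Cn R p).

Definition cmeas d (T : measurableType d) (z : T -> R[i]) :=
 mfun (fun t => Re (z t)) /\ mfun (fun t => Im (z t)).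

Lemma cmeas_cst d (T : measurableType d) (c : R[i]) : cmeas (fun _ : T => c).
Proof. by split; exact: mcst. Qed.

Lemma cmeasD d (T : measurableType d) (z w : T -> R[i]) : cmeas z -> cmeas w -> cmeas (fun t => z t + w t).
Proof.
move=> [z1 z2] [w1 w2]; split; under eq_fun do rewrite raddfD /=; exact: measurable_funD.
Qed.

Lemma cmeasM d (T : measurableType d) (z w : T -> R[i]) : cmeas z -> cmeas w -> cmeas (fun t => z t * w t).
Proof.
have ReM (u v : R[i]) : Re (u * v) =
 Re u * Re v - Im u * Im v by case: u; case: v.
have ImM (u v : R[i]) : Im (u * v) =
 Re u * Im v + Im u * Re v by case: u; case: v.
move=> [z1 z2] [w1 w2]; split.
 by under eq_fun do rewrite ReM; apply: measurable_funB; apply: measurable_funM.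
by under eq_fun do rewrite ImM; apply: measurable_funD; apply: measurable_funM.
Qed.

Lemma cmeas_rcont (f : R -> R[i]) : rcont f -> cmeas f.
Proof. by move=> [f1 f2]; split; apply: continuous_measurable_fun. Qed.

Lemma cmeas_comp d d' (T : measurableType d) (T' : measurableType d') (f : T -> R[i]) (g : T' -> T) :
 cmeas f -> mfun g -> cmeas (fun t => f (g t)).
Proof. by move=> [f1 f2] mg; split; [exact: (measurableT_comp f1 mg)|exact: (measurableT_comp f2 mg)]. Qed.

Definition cbor (g : Cn R p -> \bar R) := forall d (T : measurableType d)
 (z : 'I_p -> T -> R[i]), (forall k, cmeas (z k)) -> mfun (fun t => g (z^~ t)).

Definition pt (x : nat -> R) : Cn R p := fun k => Complex (x (2 * k)%N) (x (2 * k).+1).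

Lemma ebor_pt g : cbor g -> ebor (fun x => g (pt x)).
Proof. by move=> bg d T X mX; apply: (bg _ _ (fun k t => pt (X^~ t) k)) => k; split; exact: mX. Qed.

Definition rotc (j : 'I_p) (w : R[i]) z : Cn R p := fun k => if k == j then w * z k else z k.

Lemma cbor_rotc g j w : cbor g -> cbor (fun z => g (rotc j w z)).
Proof.
move=> bg d T z mz; apply: (bg _ _ (fun k t => rotc j w (z^~ t) k)) => k.
by rewrite /rotc; case: eqP => // _; apply: cmeasM => //; exact: cmeas_cst.
Qed.

Lemma cbor_shift g a : cbor g -> cbor (fun z => g (fun k => a k + z k)).
Proof.
move=> bg d T z mz; apply: (bg _ _ (fun k t => a k + z k t)) => k.
by apply: cmeasD => //; exact: cmeas_cst.
Qed.

Variables (d : measure_display) (W : measurableType d) (mu : {sigma_finite_measure set W -> \bar R}).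
Variable X : nat -> W -> R.
Hypothesis mX : forall i, mfun (X i).
Hypothesis iX : forall g i phi, (i < 2 * p)%N -> ebor g -> (forall x, 0 <= g x)%E -> rbor phi ->
 (forall x v, phi (upd x i v) = phi x) ->
 (\int[mu]_w g (upd (X^~ w) i (X i w + phi (X^~ w))) = \int[mu]_w g (X^~ w))%E.
Notation Zc w := (pt (X^~ w)).

Lemma leb_transvection g (j : 'I_p) (t : R) : cbor g -> (forall z, 0 <= g z)%E ->
 (\int[mu]_w g (fun k => if k == j then Complex (Re (Zc w k) + t * Im (Zc w k))%R (Im (Zc w k)) else Zc w k)
  = \int[mu]_w g (Zc w))%E /\
 (\int[mu]_w g (fun k => if k == j then Complex (Re (Zc w k)) (Im (Zc w k) + t * Re (Zc w k))%R else Zc w k)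
  = \int[mu]_w g (Zc w))%E.
Proof.
have jp : (2 * j < 2 * p)%N by rewrite ltn_pmul2l.
have jp1 : ((2 * j).+1 < 2 * p)%N.
 have := ltn_ord j; rewrite -(leq_pmul2l (isT : 0 < 2)%N) mulnS => h.
 by rewrite (leq_trans _ h).
have ne k : (2 * k == (2 * j).+1)%N = false by apply/negP => /eqP/(congr1 odd); rewrite /= !mul2n !odd_double.
have ne' k : ((2 * k).+1 == 2 * j)%N = false by apply/negP => /eqP/(congr1 odd); rewrite /= !mul2n !odd_double.
have eqk (k : 'I_p) : (2 * k == 2 * j)%N = (k == j) by rewrite eqn_pmul2l.
move=> bg g0; split.
 rewrite -[RHS](iX (g := fun x => g (pt x)) (i := (2 * j)%N) (phi := fun x => t * x (2 * j).+1)) //.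
 - apply: eq_integral => w _; congr g; apply/funext => k.
  by rewrite /pt /upd ne' eqk; case: eqP => // ->.
 - exact: ebor_pt.
 - by move=> d' T Y mY; apply: measurable_funM => //; exact: mcst.
 - by move=> x v; rewrite /upd [(_ == _)%N]eq_sym ne.
rewrite -[RHS](iX (g := fun x => g (pt x)) (i := (2 * j).+1) (phi := fun x => t * x (2 * j)%N)) //.
- apply: eq_integral => w _; congr g; apply/funext => k.
 by rewrite /pt /upd ne eqSS eqk; case: eqP => // ->.
- exact: ebor_pt.
- by move=> d' T Y mY; apply: measurable_funM => //; exact: mcst.
- by move=> x v; rewrite /upd ne.
Qed.

Lemma leb_shift g (a : Cn R p) : cbor g -> (forall z, 0 <= g z)%E ->
 (\int[mu]_w g (fun k => a k + Zc w k)%R = \int[mu]_w g (Zc w))%E.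
Proof.
move=> bg g0.
pose b i := if odd i then Im (nth 0 (codom a) i./2) else Re (nth 0 (codom a) i./2).
have bE (k : 'I_p) : a k = Complex (b (2 * k)%N) (b (2 * k).+1).
 rewrite /b mul2n /= odd_double /= uphalf_double doubleK.
 rewrite (nth_map k) ?size_enum_ord // nth_ord_enum.
 by case: (a k).
have H n : (n <= 2 * p)%N -> (\int[mu]_w g (pt (fun i => if (i < n)%N then b i + X i w else X i w)%R) = \int[mu]_w g (Zc w))%E.
 elim: n => [|n IH] hn; first by apply: eq_integral => w _; congr g.
 rewrite -(IH (ltnW hn)).
 pose g' (x : nat -> R) := g (pt (fun i => if (i < n)%N then b i + x i else x i)).
 rewrite -[RHS](iX (g := g') (i := n) (phi := fun=> b n)) //.
 - apply: eq_integral => w _; congr g; congr pt; apply/funext => i.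
  rewrite /upd ltnS leq_eqVlt; case: (eqVneq i n) => [->|ni] /=; last by [].
  by rewrite ltnn addrC.
 - move=> d' T Y mY; apply: (ebor_pt bg (X := fun i t => if (i < n)%N then b i + Y i t else Y i t)).
  by move=> i; case: (i < n)%N => //; apply: measurable_funD => //; exact: mcst.
 - by move=> x; exact: g0.
rewrite -(H (2 * p)%N) //; apply: eq_integral => w _; congr g; apply/funext => k.
rewrite /pt bE; have kp : (2 * k < 2 * p)%N by rewrite ltn_pmul2l.
have kp1 : ((2 * k).+1 < 2 * p)%N.
 have := ltn_ord k; rewrite -(leq_pmul2l (isT : 0 < 2)%N) mulnS => h.
 by rewrite (leq_trans _ h).
by rewrite kp kp1.
Qed.

(* A rotation is a product of three transvections. *)
Lemma leb_rot g (j : 'I_p) (w : R[i]) : cabs w = 1 -> cbor g -> (forall z, 0 <= g z)%E ->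
 (\int[mu]_x g (rotc j w (Zc x)) = \int[mu]_x g (Zc x))%E.
Proof.
case: w => c s hw bg g0.
have cs : c ^+ 2 + s ^+ 2 = 1 by have := cabs_sqr (Complex c s); rewrite hw expr1n.
have main c' s' h : c' ^+ 2 + s' ^+ 2 = 1 -> c' != -1 -> cbor h -> (forall z, 0 <= h z)%E ->
 (\int[mu]_x h (rotc j (Complex c' s') (Zc x)) = \int[mu]_x h (Zc x))%E.
 move=> cs' cn bh h0; have cn1 : 1 + c' != 0 by rewrite addrC addr_eq0.
 (* This is the tangent of half the angle, the parameter of the two outer shears. *)
 pose t := s' / (1 + c').
 have E1 : 1 - t * s' = c'.
  rewrite /t; have -> : s' / (1 + c') * s' = s' ^+ 2 / (1 + c') by rewrite mulrAC expr2.
  have -> : s' ^+ 2 = (1 - c') * (1 + c') by rewrite -[s' ^+ 2](addKr (c' ^+ 2)) cs'; ring.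
  by rewrite mulfK //; ring.
 pose shx t z : Cn R p := fun k => if k == j then Complex (Re (z k) + t * Im (z k)) (Im (z k)) else z k.
 pose shy t z : Cn R p := fun k => if k == j then Complex (Re (z k)) (Im (z k) + t * Re (z k)) else z k.
 have bshx u f : cbor f -> cbor (fun z => f (shx u z)).
  move=> bf d' T z mz; apply: (bf _ _ (fun k x => shx u (z^~ x) k)) => k.
  rewrite /shx; case: eqP => // _; have [m1 m2] := mz k; split => //=.
  by apply: measurable_funD => //; apply: measurable_funM => //; exact: mcst.
 have bshy u f : cbor f -> cbor (fun z => f (shy u z)).
  move=> bf d' T z mz; apply: (bf _ _ (fun k x => shy u (z^~ x) k)) => k.
  rewrite /shy; case: eqP => // _; have [m1 m2] := mz k; split => //=.
  by apply: measurable_funD => //; apply: measurable_funM => //; exact: mcst.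
 rewrite -[RHS](leb_transvection j (- t) bh h0).1 -/(shx _ _).
 rewrite -[RHS](leb_transvection j s' (bshx (- t) _ bh) (fun _ => h0 _)).2.
 rewrite -[RHS](leb_transvection j (- t) (bshy s' _ (bshx (- t) _ bh)) (fun _ => h0 _)).1.
 apply: eq_integral => x _; congr h; apply/funext => k.
 rewrite /shx /shy /rotc; case: eqP => // _.
 have ts : t * (1 + c') = s' by rewrite /t divfK.
 case: (Zc x k) => a b /=; move: E1 ts; clearbody t; clear => <- ts.
 have e : t * (2 - t * s') = s' by rewrite -[RHS]ts; ring.
 apply/eqP; rewrite eq_complex /=; apply/andP; split; apply/eqP; [rewrite -{2}e|]; ring.
(* The half turn, for which the tangent is infinite, is the square of a quarter turn. *)
have [cE|] := eqVneq c (-1); last by move=> cn; exact: main.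
have sE : s = 0.
 by move: cs; rewrite cE sqrrN expr1n -[RHS]addr0 => /addrI/eqP; rewrite sqrf_eq0 => /eqP.
have i1 : (0 : R) ^+ 2 + 1 ^+ 2 = 1 by rewrite expr0n expr1n add0r.
have n1 : (0 : R) != -1 by rewrite eq_sym oppr_eq0 oner_eq0.
rewrite -[RHS](main 0 1 g i1 n1 bg g0) -[RHS](main 0 1 _ i1 n1 (cbor_rotc j (Complex 0 1) bg) (fun _ => g0 _)).
apply: eq_integral => x _; congr g; apply/funext => k.
rewrite /rotc; case: eqP => // _; rewrite cE sE mulrA; congr (_ * _).
by complex_ring.
Qed.

End ComplexCoordinates.
End LebesgueSpace.

(** * Continuous functions on C^p *)

Section CoordinateContinuity.
Context {R : realType} {p : nat}.
Implicit Types (z w a : Cn R p).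

Definition cdist z a : R := cvnorm (fun k => z k - a k).
Definition cont (g : Cn R p -> R) := forall a, epsc cdist g a.

Lemma cvnormE z : cvnorm z = Num.sqrt (\sum_k cabs (z k) ^+ 2).
Proof. by congr Num.sqrt; apply: eq_bigr => k _; rewrite cabs_sqr. Qed.

Lemma cvnorm_ge0 z : 0 <= cvnorm z. Proof. exact: sqrtr_ge0. Qed.

Lemma cvnorm_sqr z : cvnorm z ^+ 2 = \sum_k cabs (z k) ^+ 2.
Proof. by rewrite cvnormE sqr_sqrtr // sumr_ge0 // => k _; exact: sqr_ge0. Qed.

Lemma cabs_le_cvnorm z k : cabs (z k) <= cvnorm z.
Proof.
rewrite -(@ler_pXn2r _ 2) ?nnegrE ?cabs_ge0 ?cvnorm_ge0 // cvnorm_sqr (bigD1 k) //= lerDl.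
by apply: sumr_ge0 => i _; exact: sqr_ge0.
Qed.

Lemma cvnormZ (c : R[i]) z : cvnorm (fun k => c * z k) = cabs c * cvnorm z.
Proof.
apply/eqP; rewrite -(@eqrXn2 _ 2) ?mulr_ge0 ?cabs_ge0 ?cvnorm_ge0 //.
rewrite exprMn !cvnorm_sqr mulr_sumr; apply/eqP/eq_bigr => k _.
by rewrite cabsM exprMn.
Qed.

Lemma cvnorm_le z w : (forall k, cabs (z k) <= cabs (w k)) -> cvnorm z <= cvnorm w.
Proof.
move=> h; rewrite !cvnormE ler_wsqrtr //; apply: ler_sum => k _.
by rewrite ler_pXn2r ?nnegrE ?cabs_ge0.
Qed.

Lemma cvnormD z w : cvnorm (fun k => z k + w k) <= cvnorm z + cvnorm w.
Proof.
rewrite -(@ler_pXn2r _ 2) ?nnegrE ?addr_ge0 ?cvnorm_ge0 // sqrrD !cvnorm_sqr.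
apply: (@le_trans _ _ (\sum_k (cabs (z k) + cabs (w k)) ^+ 2)).
 by apply: ler_sum => k _; rewrite ler_pXn2r ?nnegrE ?addr_ge0 ?cabs_ge0 // cabsD.
under eq_bigr do rewrite sqrrD mulr2n.
rewrite !big_split /= lerD2r lerD2l mulr2n.
by apply: lerD; rewrite !cvnormE cauchy_schwarz_sum.
Qed.

Lemma cvnorm_eq z w : (forall k, cabs (z k) = cabs (w k)) -> cvnorm z = cvnorm w.
Proof. by move=> h; apply/le_anti; rewrite !cvnorm_le // => k; rewrite h. Qed.

Lemma sum_sqr_le (I : finType) (x : I -> R) : (forall i, 0 <= x i) -> \sum_i x i ^+ 2 <= (\sum_i x i) ^+ 2.
Proof.
move=> x0; rewrite expr2 mulr_suml; apply: ler_sum => k _; rewrite expr2 ler_wpM2l //.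
by rewrite (bigD1 k) //= lerDl sumr_ge0.
Qed.

Lemma cvnorm_sum z : cvnorm z <= \sum_k cabs (z k).
Proof.
rewrite -(@ler_pXn2r _ 2) ?nnegrE ?cvnorm_ge0 ?sumr_ge0 // => [|k _]; last exact: cabs_ge0.
by rewrite cvnorm_sqr sum_sqr_le // => k; exact: cabs_ge0.
Qed.

Lemma sum_cabs_gt0 z : 0 < 1 + \sum_k cabs (z k).
Proof. by rewrite ltr_pwDl // sumr_ge0 // => k _; exact: cabs_ge0. Qed.

Lemma cabs_lin c z : cabs (\sum_k c k * z k) <= (\sum_k cabs (c k)) * cvnorm z.
Proof.
rewrite (le_trans (cabs_sum _ _ _)) // mulr_suml; apply: ler_sum => k _.
by rewrite cabsM ler_wpM2l ?cabs_ge0 ?cabs_le_cvnorm.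
Qed.

Lemma cdist_coord z a (e : R) : 0 < e -> (forall k, cabs (z k - a k) < e / p.+1%:R) -> cdist z a < e.
Proof.
move=> e0 h; apply: (le_lt_trans (cvnorm_sum _)).
apply: (@le_lt_trans _ _ (\sum_(k < p) e / p.+1%:R)); first by apply: ler_sum => k _; exact: ltW.
by rewrite sumr_const card_ord -[_ *+ p]mulr_natr mulrAC ltr_pdivrMr // ltr_pM2l // ltr_nat.
Qed.

Lemma cont_bounded g r : cont g -> exists M : R, forall z, cvnorm z <= r -> `|g z| <= M.
Proof.
move=> cg; pose Z (v : 'rV[R]_(p + p)) : Cn R p :=
 fun k => Complex (v ord0 (lshift p k)) (v ord0 (rshift p k)).
pose A : set 'rV[R]_(p + p) := [set v | forall i, `[- `|r|, `|r|]%classic (v ord0 i)].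
have cA : compact A by apply: (rV_compact (A := fun=> `[- `|r|, `|r|]%classic)) => i; exact: segment_compact.
have A0 : A !=set0 by exists 0 => i; rewrite /= in_itv /= mxE oppr_le0 !normr_ge0.
have cf : {within A, continuous (fun v => `|g (Z v)|)}.
 apply: continuous_subspaceT => v.
 suff cv : {for v, continuous (fun v => g (Z v))} by exact: cvg_norm cv.
 have FF : Filter (nbhs v) := nbhs_filter v.
 apply/(@cvgrPdist_lt _ _ _ (nbhs v) FF) => e e0; have [d d0 hd] := cg (Z v) e e0.
 rewrite -nbhs_ballE; exists (d / p.+1%:R / 2) => /=.
  by rewrite divr_gt0 // divr_gt0 // ltr0n.
 move=> w vw; rewrite distrC; apply/hd/cdist_coord => // k.
 apply: le_lt_trans (cabs_le_ReIm _) _; rewrite !raddfB /= [ltRHS]splitr.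
 by case: vw => _ vw; apply: ltrD; rewrite distrC; exact: vw.
have [c _ hc] := EVT_max_rV A0 cA cf; exists `|g (Z c)| => z zr.
have zE : z = Z (\row_i match fintype.split i with inl k => Re (z k) | inr k => Im (z k) end).
 by apply/funext => k; rewrite /Z !mxE !(unsplitK (inl k)) !(unsplitK (inr k)); case: (z k).
rewrite zE; apply: hc; rewrite inE => i /=; rewrite in_itv /= -ler_norml mxE.
by case: (fintype.split i) => k; rewrite (le_trans _ (ler_norm r)) // (le_trans _ zr) //
 (le_trans _ (cabs_le_cvnorm z k)) // ?cabs_Re ?cabs_Im.
Qed.

(* Rounding the coordinates to the grid [n.+1^-1 Z] turns [g] into a countably valued function. *)
Lemma cont_cbor g : cont g -> cbor (fun z => (g z)%:E).
Proof.
move=> cg d T z mz; apply/measurable_EFinP.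
pose rd n (x : R) : R := (Num.floor (n.+1%:R * x))%:~R / n.+1%:R.
pose rz n (t : T) : Cn R p := fun k => Complex (rd n (Re (z k t))) (rd n (Im (z k t))).
have rdE n x : `|rd n x - x| <= n.+1%:R^-1.
 have n0 : 0 < n.+1%:R :> R by rewrite ltr0n.
 rewrite /rd ler_norml; have /andP[h1 h2] := mem_rg1_floor (n.+1%:R * x).
 apply/andP; split.
  rewrite lerBrDl -(ler_pM2r n0) mulrDl divfK ?gt_eqF // mulNr mulVf ?gt_eqF //.
  by rewrite [x * _]mulrC lerBlDr; exact: ltW.
 rewrite lerBlDr -(ler_pM2r n0) mulrDl divfK ?gt_eqF // mulVf ?gt_eqF //.
 by rewrite (le_trans h1) // mulrC lerDr.
apply: (measurable_fun_cvg (h := fun n t => g (rz n t))).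
 move=> n; pose fl t : {ffun 'I_p -> int * int} :=
  [ffun k => (Num.floor (n.+1%:R * Re (z k t)), Num.floor (n.+1%:R * Im (z k t)))].
 pose hh (v : {ffun 'I_p -> int * int}) := g (fun k => Complex ((v k).1%:~R / n.+1%:R) ((v k).2%:~R / n.+1%:R)).
 have -> : (fun t => g (rz n t)) = hh \o fl.
  by apply/funext => t /=; congr g; apply/funext => k; rewrite ffunE.
 have mfloor (x : T -> R) m : mfun x -> measurable [set t | Num.floor (n.+1%:R * x t) = m].
  move=> mx; have -> : [set t | Num.floor (n.+1%:R * x t) = m] =
    setT `&` (fun t => n.+1%:R * x t) @^-1` `[m%:~R, (m + 1)%:~R[%classic.
   apply/seteqP; split => t /=; rewrite in_itv /=.
    by move=> <-; split => //; rewrite intrD; exact: mem_rg1_floor.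
   by move=> [_ /floor_def].
  by have mc : mfun (fun t => n.+1%:R * x t);
   [apply: measurable_funM => //; exact: mcst|exact: mc].
 have mfl v : measurable [set t | fl t = v].
  have -> : [set t | fl t = v] = \bigcap_(k in [set: 'I_p])
    ([set t | Num.floor (n.+1%:R * Re (z k t)) = (v k).1] `&`
    [set t | Num.floor (n.+1%:R * Im (z k t)) = (v k).2]).
   apply/seteqP; split => t /=; first by move=> <- k _ /=; rewrite ffunE.
   move=> H; apply/ffunP => k; have [] := H k I.
   by rewrite /= ffunE; case: (v k) => a b /= -> ->.
  apply: fin_bigcap_measurable => // k _.
  by apply: measurableI; apply: mfloor; case: (mz k).
 move=> _ B mB; rewrite setTI.
 have -> : (hh \o fl) @^-1` B = \bigcup_v (if hh v \in B then [set t | fl t = v] else set0).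
  apply/seteqP; split => t /=; first by move=> Bt; exists (fl t) => //; rewrite ifT // inE.
  by move=> [v _]; case: ifP => //=; rewrite inE => + ->.
 apply: countable_bigcupT_measurable; first exact: countableP.
 by move=> v; case: ifP.
move=> t _; apply/cvgrPdist_lt => e e0; have [dl dl0 hd] := cg (z^~ t) e e0.
pose e' := dl / p.+1%:R / 2; have e'0 : 0 < e' by rewrite divr_gt0 // divr_gt0 // ltr0n.
near=> n; rewrite distrC; apply/hd/cdist_coord => // k.
apply: le_lt_trans (cabs_le_ReIm _) _; rewrite !raddfB /= [ltRHS]splitr.
have ne : n.+1%:R^-1 < e' by near: n; exact: near_infty_natSinv_lt (PosNum e'0).
by apply: ltrD; exact: le_lt_trans (rdE _ _) ne.
Unshelve. all: by end_near.
Qed.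

Lemma cont_cvnorm : cont cvnorm.
Proof.
move=> a e e0; exists e => // z; apply: le_lt_trans; rewrite ler_norml /cdist.
have h1 := cvnormD a (fun k => z k - a k); have h2 := cvnormD z (fun k => a k - z k).
have e1 : (fun k => a k + (z k - a k)) = z by apply/funext => k; rewrite addrC subrK.
have e2 : (fun k => z k + (a k - z k)) = a by apply/funext => k; rewrite addrC subrK.
have e3 : cvnorm (fun k => a k - z k) = cvnorm (fun k => z k - a k).
 by apply: cvnorm_eq => k; rewrite cabsBC.
by move: h1 h2; rewrite e1 e2 e3; clear; move=> *; apply/andP; split; lra.
Qed.

End CoordinateContinuity.

(** * Averaging over a measure-preserving circle action *)

Section CircleAverage.
Context {R : realType}.
Notation leb := (@lebesgue_measure R).
Let I : set R := `[- pi, pi]%classic.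

Definition cint (g : R -> \bar R) : \bar R := (\int[leb]_(x in I) g x)%E.

Variables (p : nat) (d : measure_display) (W : measurableType d).
Variable mu : {sigma_finite_measure set W -> \bar R}.
Variable Z : W -> Cn R p.
Hypothesis mZ : forall k, cmeas (fun w => Z w k).

Variable A : R -> Cn R p -> Cn R p.
Hypothesis mA : forall d' (T : measurableType d') (x : T -> R) (z : 'I_p -> T -> R[i]),
 mfun x -> (forall k, cmeas (z k)) -> forall k, cmeas (fun t => A (x t) (z^~ t) k).
Hypothesis iA : forall x g, cbor g -> (forall z, 0 <= g z)%E ->
 (\int[mu]_w g (A x (Z w)) = \int[mu]_w g (Z w))%E.

(** Each map [A x] preserves the integral; integrating over [x] and exchanging the integrals by
    Tonelli replaces [g] by its means over orbits. *)
Lemma circ_avg g : cbor g -> (forall z, 0 <= g z)%E ->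
 ((2 * pi)%:E * \int[mu]_w g (Z w) = \int[mu]_w cint (fun x => g (A x (Z w))))%E /\
 mfun (fun w => cint (fun x => g (A x (Z w)))).
Proof.
move=> bg g0; have mI : measurable I by exact: measurable_itv.
pose f (y : R * W) := ((fun x => g (A x (Z y.2))) \_ I) y.1.
have f0 y : (0 <= f y)%E by rewrite /f patchE; case: ifP.
have mf : mfun (f : measurableTypeR R * W -> \bar R).
 have -> : f = (fun y => g (A y.1 (Z y.2))) \_ [set y | I y.1].
  by apply/funext => y; rewrite /f !patchE; congr (if _ then _ else _); apply/idP/idP; rewrite !inE.
 apply/(measurable_restrictT _ _).1.
  by rewrite -[X in measurable X]setTI; exact: (measurable_fst measurableT _ mI).
 apply: measurable_funTS; apply: (bg _ _ (fun k y => A y.1 (Z y.2) k)).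
 apply: mA => [|k]; first exact: measurable_fst.
 by apply: (cmeas_comp (mZ k)); exact: measurable_snd.
split; last first.
 have -> : (fun w => cint (fun x => g (A x (Z w)))) = (fun w => \int[leb]_x f (x, w))%E.
  by apply/funext => w; rewrite /cint integral_mkcond.
 have := @measurable_fun_fubini_tonelli_G _ _ _ _ _ leb f mf f0; exact.
have : (\int[leb]_x \int[mu]_w f (x, w) = \int[mu]_w \int[leb]_x f (x, w))%E.
 exact: fubini_tonelli.
rewrite /f /=.
under [in X in X = _ -> _]eq_integral => x _.
 have -> : (\int[mu]_y ((fun x0 : R => g (A x0 (Z y))) \_ I) x = ((fun=> \int[mu]_w g (Z w)) \_ I) x)%E.
  rewrite patchE; case: ifP => xI; last first.
   by rewrite integral0_eq // => w _; rewrite patchE xI.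
  by rewrite -(iA x) //; apply: eq_integral => w _; rewrite patchE xI.
 over.
rewrite -integral_mkcond integral_cst // => H.
transitivity ((\int[mu]_w g (Z w)) * leb I)%E.
 rewrite muleC; congr (_ * _)%E; rewrite lebesgue_measure_itv /= lte_fin.
 have p0 := @pi_gt0 R; rewrite ifT; last by move: (pi : R) p0 => q; lra.
 by rewrite -EFinB; congr EFin; ring.
rewrite H; apply: eq_integral => w _; by rewrite /cint [in RHS]integral_mkcond.
Qed.

End CircleAverage.

Section CoordinateProduct.
Context {R : realType} {p : nat}.
Implicit Types (z w a l : Cn R p).

Definition lmul l z : Cn R p := fun k => l k * z k.
Definition csc (c : R[i]) z : Cn R p := fun k => c * z k.

Lemma cbor_lmul g l : cbor g -> cbor (fun z => g (lmul l z)).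
Proof.
move=> bg d T z mz; apply: (bg _ _ (fun k t => lmul l (z^~ t) k)) => k.
by apply: cmeasM => //; exact: cmeas_cst.
Qed.

Lemma rotc_lmul (I : (Cn R p -> \bar R) -> \bar R) :
 (forall j c g, cabs c = 1 -> cbor g -> (forall z, 0 <= g z)%E -> I (fun z => g (rotc j c z)) = I g) ->
 forall l g, (forall k, cabs (l k) = 1) -> cbor g -> (forall z, 0 <= g z)%E -> I (fun z => g (lmul l z)) = I g.
Proof.
move=> hI l g l1 bg g0.
pose L n : Cn R p := fun k => if (k < n)%N then l k else 1.
have H n : (n <= p)%N -> I (fun z => g (lmul (L n) z)) = I g.
 elim: n => [|n IH] hn.
  by congr I; apply/funext => z; congr g; apply/funext => k; rewrite /lmul /L ltn0 mul1r.
 rewrite -(IH (ltnW hn)) -(hI (Ordinal hn) (l (Ordinal hn)) _ (l1 _) (cbor_lmul (L n) bg)) //.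
 congr I; apply/funext => z; congr g; apply/funext => k; rewrite /lmul /L /rotc.
 rewrite ltnS leq_eqVlt -val_eqE /=; case: (eqVneq (k : nat) n) => [kn|] //=.
 have -> : k = Ordinal hn by exact/val_inj.
 by rewrite ltnn mul1r.
rewrite -(H p) //; congr I; apply/funext => z; congr g; apply/funext => k.
by rewrite /lmul /L ltn_ord.
Qed.

Lemma cmeas_csc d' (T : measurableType d') (x : T -> R) (z : 'I_p -> T -> R[i]) :
 mfun x -> (forall k, cmeas (z k)) -> forall k, cmeas (fun t => csc (circ 1 (x t)) (z^~ t) k).
Proof.
by move=> mx mz k; apply: cmeasM => //; apply: (cmeas_comp _ mx); apply: cmeas_rcont; exact: rcont_circ.
Qed.

End CoordinateProduct.

Section BoxVolume.
Context {R : realType}.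

Lemma iint_ext k (f g : seq R -> \bar R) : (forall s, size s = k -> f s = g s) -> iint k f = iint k g.
Proof.
elim: k f g => [|k IH] f g h /=; first exact: h.
by apply: eq_integral => x _; apply: IH => s sk; apply: h; rewrite /= sk.
Qed.

Lemma iint_box k (a b : R) : a < b ->
 iint k (fun s : seq R => if all (fun x => a < x < b) s then 1%E else 0%E) = ((b - a) ^+ k)%:E.
Proof.
move=> ab; elim: k => [|k IH] //=.
transitivity (\int[@lebesgue_measure R]_(x in `]a, b[%classic) ((b - a) ^+ k)%:E)%E.
 rewrite [in RHS]integral_mkcond; apply: eq_integral => x _; rewrite patchE.
 case: ifPn; rewrite ?inE ?notin_setE /= in_itv /= => h; first by rewrite h -IH.
 have -> : (a < x < b) = false by apply/negP.
 have: forall k, iint k (fun _ : seq R => 0%E : \bar R) = 0%E; last exact.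
 by elim=> //= n IHn; rewrite IHn integral0.
rewrite integral_cst //= lebesgue_measure_itv /= lte_fin ab -EFinB -EFinM.
by rewrite -exprSr.
Qed.

End BoxVolume.

(** * A probability model of the unit sphere *)

Section SphereSpace.
Context {R : realType}.

Lemma cbor_if p (b : Cn R p -> bool) g h :
 (forall d (T : measurableType d) (z : 'I_p -> T -> R[i]), (forall k, cmeas (z k)) ->
   mfun (fun t => b (z^~ t))) ->
 cbor g -> cbor h -> cbor (fun z => if b z then g z else h z).
Proof.
by move=> bb bg bh d T z mz; apply: measurable_fun_ifT; [exact: bb|exact: bg|exact: bh].
Qed.

Lemma cbor_cst p (c : \bar R) : cbor (fun _ : Cn R p => c).
Proof. by move=> d T z mz; exact: mcst. Qed.

Lemma cmeas_if d (T : measurableType d) (b : T -> bool) (z w : T -> R[i]) :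
 mfun b -> cmeas z -> cmeas w -> cmeas (fun t => if b t then z t else w t).
Proof.
move=> mb [z1 z2] [w1 w2]; split.
 have -> : (fun t => Re (if b t then z t else w t)) = (fun t => if b t then Re (z t) else Re (w t)).
  by apply/funext => t; case: ifP.
 exact: measurable_fun_ifT.
have -> : (fun t => Im (if b t then z t else w t)) = (fun t => if b t then Im (z t) else Im (w t)).
 by apply/funext => t; case: ifP.
exact: measurable_fun_ifT.
Qed.

Lemma meas_cvnorm p d (T : measurableType d) (z : 'I_p -> T -> R[i]) :
 (forall k, cmeas (z k)) -> mfun (fun t => cvnorm (z^~ t)).
Proof. by move=> mz; apply/measurable_EFinP; exact: (cont_cbor cont_cvnorm). Qed.

Lemma all_nth_iota k (P : pred R) s : size s = k -> all (fun i => P (nth 0 s i)) (iota 0 k) = all P s.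
Proof. by move=> <-; rewrite -[in RHS](mkseq_nth 0 s) /mkseq all_map. Qed.

Lemma cvnorm_csc_circ p x (z : Cn R p) : cvnorm (csc (circ 1 x) z) = cvnorm z.
Proof. by rewrite /csc cvnormZ cabs_circ normr1 mul1r. Qed.

Local Notation ind b := (if b%R then 1 else 0)%E.
Local Notation dot z := (0 < cvnorm z < 1)%R.

Lemma ind_ge0 (b : bool) (x : \bar R) : (0 <= x -> 0 <= if b then x else 0)%E. Proof. by case: b. Qed.

Lemma ind_le (b c : bool) : (b -> c) -> (ind b <= ind c :> \bar R)%E.
Proof. by case: b => [->|_] //; exact: ind_ge0. Qed.

Lemma meas_ind d (T : measurableType d) (b : T -> bool) : mfun b ->
 mfun (fun t => ind (b t) : \bar R).
Proof. by move=> mb; exact: measurable_fun_ifT. Qed.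

(* A probability space carrying a random point [Z], uniformly distributed on the unit sphere
  of C^p.  The last clause is the submean value property for [- h], in the form in which it
  follows from the translation invariance of Lebesgue measure. *)
Definition sphere_model p d (W : measurableType d) (P : probability W R) (Z : W -> Cn R p) :=
 [/\ (forall k, cmeas (fun w => Z w k)), (forall w, cvnorm (Z w) = 1),
  (forall r g, cbor g -> (forall z, 0 <= g z)%E ->
   sphere_int p r g = \int[P]_w g (csc r%:C (Z w)))%E,
  (forall j (c : R[i]) g, (cabs c = 1)%R -> cbor g -> (forall z, 0 <= g z)%E ->
   \int[P]_w g (rotc j c (Z w)) = \int[P]_w g (Z w))%E
 & forall a, exists2 kap : R, 0 < kap & forall h, cbor h -> (forall z, 0 <= h z)%E ->
   (forall z, dot z -> (cint (fun x => h (csc (circ 1 x) (csc (((cvnorm z)^-1)%R%:C)%C z)))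
     <= cint (fun x => h (csc (circ 1 x) z)))%E) ->
   (forall z, cvnorm z < cvnorm a + 1 ->
    (cint (fun x => h (fun k => a k + csc (circ 1 x) z k)%R) <= (2 * pi)%:E * h a)%E) ->
   (\int[P]_w h (Z w) <= kap%:E * h a)%E].

(** Lebesgue measure is represented on an abstract space because [iint] is an iterated integral, not
    the integral of a measure on C^p. *)
Definition euclid_model p d (W : measurableType d) (mu : {sigma_finite_measure set W -> \bar R})
  (Z : W -> Cn R p) :=
 [/\ (forall k, cmeas (fun w => Z w k)),
  (forall g, cbor g -> (forall z, 0 <= g z)%E ->
   iint (2 * p) (fun s => g (pt_of_seq p s)) = \int[mu]_w g (Z w))%E,
  (forall j (c : R[i]) g, (cabs c = 1)%R -> cbor g -> (forall z, 0 <= g z)%E ->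
   \int[mu]_w g (rotc j c (Z w)) = \int[mu]_w g (Z w))%E,
  (forall g a, cbor g -> (forall z, 0 <= g z)%E ->
   \int[mu]_w g (fun k => a k + Z w k)%R = \int[mu]_w g (Z w))%E
 & [/\ (forall rho : R, 0 < rho -> (\int[mu]_w ind (cvnorm (Z w) < rho) < +oo)%E),
  ((0 < p)%N -> (0 < \int[mu]_w ind (dot (Z w)))%E)
 & ((0 < p)%N -> (\int[mu]_w ind (cvnorm (Z w) == 0) = 0)%E)]].

Lemma meas_cvnorm_lt p (c : R) d' (T : measurableType d') (z : 'I_p -> T -> R[i]) : (forall k, cmeas (z k)) ->
 mfun (fun t => cvnorm (z^~ t) < c).
Proof.
by move=> mz; apply: measurable_fun_ltr; [exact: meas_cvnorm|exact: mcst].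
Qed.

Lemma meas_dot p d (T : measurableType d) (z : 'I_p -> T -> R[i]) : (forall k, cmeas (z k)) ->
 mfun (fun t => dot (z^~ t)).
Proof.
move=> mz; apply: measurable_and; last exact: meas_cvnorm_lt.
by apply: measurable_fun_ltr; [exact: mcst|exact: meas_cvnorm].
Qed.

Definition cube p (a b : R) (x : nat -> R) := all (fun i => a < x i < b) (iota 0 (2 * p)).

Lemma meas_cube p a b d (T : measurableType d) (Y : nat -> T -> R) : (forall i, mfun (Y i)) ->
 mfun (fun t => cube p a b (Y^~ t)).
Proof.
move=> mY; rewrite /cube; elim: (iota _ _) => [|i l IH] /=; first exact: mcst.
by apply: measurable_and => //; apply: measurable_and; apply: measurable_fun_ltr => //; exact: mcst.
Qed.

Lemma ball_cube p rho x : cvnorm (pt x : Cn R p) < rho -> cube p (- rho) rho x.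
Proof.
move=> zr; apply/allP => i; rewrite mem_iota /= add0n => ip.
have kp : (i./2 < p)%N by move: ip; rewrite -{1}(odd_double_half i) -muln2; clear; lia.
have h := le_lt_trans (cabs_le_cvnorm (pt x) (Ordinal kp)) zr.
have := le_lt_trans (cabs_Im _) h; have := le_lt_trans (cabs_Re _) h; rewrite /pt /= !ltr_norml.
have : i = (odd i + 2 * i./2)%N by rewrite mul2n odd_double_half.
by case: (odd i); rewrite ?add1n ?add0n => <-.
Qed.

Lemma meas_cvnormV p d (T : measurableType d) (z : 'I_p -> T -> R[i]) : (forall k, cmeas (z k)) ->
 mfun (fun t => expR (- ln (cvnorm (z^~ t)))).
Proof.
move=> mz; apply: (measurableT_comp (@measurable_expR R)); apply: measurable_funN.
by apply: (measurableT_comp (@measurable_ln R)); exact: meas_cvnorm.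
Qed.

Lemma euclid_space p : exists d (W : measurableType d) (mu : {sigma_finite_measure set W -> \bar R})
  (Z : W -> Cn R p), euclid_model mu Z.
Proof.
have [d [W [mu [X [mX hX iX]]]]] := @lebesgue_space R (2 * p).
pose Zc w : Cn R p := pt (X^~ w).
have mZc k : cmeas (fun w => Zc w k) by split; exact: mX.
exists d, W, mu, Zc.
have hI g : cbor g -> (forall z, 0 <= g z)%E -> iint (2 * p) (fun s => g (pt_of_seq p s)) = (\int[mu]_w g (Zc w))%E.
 by move=> bg g0; rewrite (hX (fun x => g (pt x)) (ebor_pt bg)).
have shI g a : cbor g -> (forall z, 0 <= g z)%E ->
  (\int[mu]_w g (fun k => a k + Zc w k)%R = \int[mu]_w g (Zc w))%E by exact: leb_shift.
have mlt := @meas_cvnorm_lt p.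
have boxI a b : a < b -> (\int[mu]_w ind (cube p a b (X^~ w)) = ((b - a) ^+ (2 * p))%:E)%E.
 move=> ab; rewrite -(hX (fun x => ind (cube p a b x))).
 - by rewrite -(iint_box _ ab); apply: iint_ext => s ss; rewrite /cube (all_nth_iota (fun x => a < x < b)).
 - by move=> d' T Y mY; exact/meas_ind/meas_cube.
 - by move=> x; case: ifP.
have mboxX a b : mfun (fun w => ind (cube p a b (X^~ w))%E : \bar R).
 exact/meas_ind/meas_cube.
have volfin rho : 0 < rho -> (\int[mu]_w ind (cvnorm (Zc w) < rho) < +oo)%E.
 move=> r0; apply: (@le_lt_trans _ _ (\int[mu]_w ind (cube p (- rho) rho (X^~ w)))%E).
  apply: ge0_le_integral => //.
  - by move=> w _; case: ifP.
  - exact/meas_ind/mlt.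
  - by move=> w _; exact/ind_le/ball_cube.
 by rewrite boxI ?ltry //; move: r0; clear; lra.
have V0 : (0 < p)%N -> (0 < \int[mu]_w (ind (dot (Zc w))))%E.
 move=> p0.
 (* The open cube of side [c] with a corner at 0 lies in the punctured unit ball: every coordinate
    there has modulus below 2c = 1/(p + 1). *)
 pose c : R := (2 * p.+1%:R)^-1; have c0 : 0 < c by rewrite invr_gt0 mulr_gt0 // ltr0n.
 apply: (@lt_le_trans _ _ (\int[mu]_w ind (cube p 0 c (X^~ w)))%E).
  by rewrite boxI // lte_fin subr0 exprn_gt0.
 apply: ge0_le_integral => //; first by move=> w _; case: ifP.
  exact/meas_ind/meas_dot.
 move=> w _; apply: ind_le => /allP h; apply/andP; split.
  apply: lt_le_trans (cabs_le_cvnorm _ (Ordinal p0)); rewrite cabs_gt0; apply/eqP => E.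
  have /h : 0%N \in iota 0 (2 * p) by rewrite mem_iota /= muln_gt0.
  by move: E => /(congr1 (@complex.Re R)) /=; rewrite /Zc /pt /= muln0 => -> ; rewrite ltxx.
 have -> : cvnorm (Zc w) = cdist (Zc w) (fun=> 0) by apply: cvnorm_eq => k; rewrite subr0.
 apply: cdist_coord => // k; rewrite subr0; apply: le_lt_trans (cabs_le_ReIm _) _.
 have kp : (2 * k)%N \in iota 0 (2 * p) by rewrite mem_iota /= ltn_pmul2l.
 have kp1 : (2 * k).+1 \in iota 0 (2 * p).
  by rewrite mem_iota /= add0n; have := ltn_ord k; clear; lia.
 have /andP[a1 a2] := h _ kp; have /andP[b1 b2] := h _ kp1.
 rewrite /Zc /pt /= !gtr0_norm //; apply: (@lt_le_trans _ _ (c + c)); first exact: ltrD.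
 suff -> : c + c = 1 / p.+1%:R by [].
 by rewrite /c; move: (p.+1%:R : R) (pnatr_eq0 R p.+1) => P /= h'; field; rewrite h'.
have null : (0 < p)%N -> (\int[mu]_w ind (cvnorm (Zc w) == 0) = 0)%E.
 move=> p0.
 apply/eqP; rewrite eq_le integral_ge0 ?andbT; last by move=> w _; case: ifP.
 apply/lee_addgt0Pr => e e0; rewrite add0e; pose c : R := Num.min e 1 / 2.
 have c0 : 0 < c by rewrite divr_gt0 // (lt_min 0) e0 ltr01.
 have cc : 2 * c <= e /\ 2 * c <= 1 by rewrite /c mulrC divfK ?pnatr_eq0 // !ge_min !lexx orbT.
 apply: (@le_trans _ _ (\int[mu]_w ind (cube p (- c) c (X^~ w)))%E).
  apply: ge0_le_integral => //.
  - by move=> w _; case: ifP.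
  - by apply/meas_ind/measurable_fun_eqr; [exact: meas_cvnorm|exact: mcst].
  - by move=> w _; apply: ind_le => /eqP h; rewrite ball_cube // h.
 rewrite boxI; last by rewrite gtrN.
 rewrite lee_fin opprK; have -> : c + c = 2 * c by ring.
 apply: le_trans cc.1; rewrite -{2}[2 * c]expr1; apply: ler_wiXn2l => //; last by rewrite muln_gt0.
 - by rewrite mulr_ge0 // ltW.
 - exact: cc.2.
split => //; first by move=> j c g c1 bg g0; exact: leb_rot.
Qed.

Lemma sphere_space p : (0 < p)%N -> exists d (W : measurableType d) (P : probability W R)
  (Z : W -> Cn R p), sphere_model P Z.
Proof.
move=> p0; have [d [W [mu [Zc [mZc hI lrot shI [volfin vpos vnull]]]]]] := euclid_space p.
have rotI l g : (forall k, cabs (l k) = 1) -> cbor g -> (forall z, 0 <= g z)%E ->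
  (\int[mu]_w g (lmul l (Zc w)) = \int[mu]_w g (Zc w))%E.
 by apply: (rotc_lmul (I := fun g => \int[mu]_w g (Zc w))%E).
have mlt := @meas_cvnorm_lt p.
have mD d' (T : measurableType d') (z : 'I_p -> T -> R[i]) : (forall k, cmeas (z k)) ->
  mfun (fun t => 0 < cvnorm (z^~ t) < 1).
 move=> mz; apply: measurable_and; last exact: mlt.
 by apply: measurable_fun_ltr; [exact: mcst|exact: meas_cvnorm].
pose V : \bar R := (\int[mu]_w (ind (dot (Zc w))))%E.
have mV : mfun (fun w => ind (dot (Zc w)) : \bar R).
 exact/meas_ind/mD.
have Vfin : (V < +oo)%E.
 apply: le_lt_trans (volfin 1 ltr01); apply: ge0_le_integral => //.
 - by move=> w _; case: ifP.
 - exact/meas_ind/mlt.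
 - by move=> w _; apply: ind_le => /andP[].
have null := vnull p0.
have mDs : measurable [set w | dot (Zc w)].
 have := mD _ _ (fun k w => Zc w k) mZc measurableT [set true]; rewrite setTI; exact.
have V0 := vpos p0; have Vreal : V = (fine V)%:E by rewrite fineK // ge0_fin_numE // ltW.
have fV0 : 0 < fine V by rewrite -lte_fin -Vreal.
have kge : 0 <= (fine V)^-1 by rewrite invr_ge0 ltW.
(* The probability is Lebesgue measure on the punctured unit ball, normalized; the random point will
   be the radial projection. *)
pose Pm := mscale (NngNum kge) (mrestr mu mDs).
have P1 : Pm setT = 1%E.
 rewrite /Pm /mscale /= /mrestr setTI; have -> : mu [set w | dot (Zc w)] = V.
  rewrite -[in LHS](setIT [set w | _]) -integral_indic // /V; apply: eq_integral => w _.
  rewrite indicE; have -> : (w \in [set w | dot (Zc w)]) = dot (Zc w).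
   by apply/idP/idP; rewrite inE.
  by case: ifP.
 by rewrite Vreal -EFinM mulVf // gt_eqF.
pose P : probability W R := HB.pack Pm (Measure_isProbability.Build _ _ _ Pm P1).
pose k := (fine V)^-1.
have intP f : mfun f -> (forall w, 0 <= f w)%E ->
  (\int[P]_w f w = k%:E * \int[mu]_w (if dot (Zc w) then f w else 0))%E.
 move=> mf f0; rewrite /P /= ge0_integral_mscale //=; congr (_ * _)%E.
 rewrite (@ge0_negligible_integral _ _ _ _ setT (~` [set w | dot (Zc w)])) //; last 2 first.
 - exact: measurableC.
 - by change (mu (~` [set w | dot (Zc w)] `&` [set w | dot (Zc w)]) = 0%E); rewrite setICl measure0.
 rewrite setTD setCK (@eq_measure_integral _ _ _ _ mu); last first.
  by move=> A mA AD; rewrite /mrestr; congr (mu _); apply/setIidPl.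
 rewrite integral_mkcond; apply: eq_integral => w _; rewrite patchE.
 have -> // : (w \in [set w | dot (Zc w)]) = dot (Zc w).
 by apply/idP/idP; rewrite inE.
(* The factor 1/|z| is written exp(- ln |z|), which is measurable as a composite; the two agree away
   from 0. *)
pose sc (z : Cn R p) : R[i] := ((expR (- ln (cvnorm z)))%:C)%C.
have scE z : 0 < cvnorm z -> sc z = ((cvnorm z)^-1%:C)%C by move=> z0; rewrite /sc expRN lnK.
have msc d' (T : measurableType d') (z : 'I_p -> T -> R[i]) : (forall k, cmeas (z k)) -> cmeas (fun t => sc (z^~ t)).
 by move=> mz; split; [exact: meas_cvnormV|exact: mcst].
have bS g c : cbor g -> cbor (fun z => g (csc (c * sc z) z)).
 move=> bg d' T z mz; apply: (bg _ _ (fun k t => csc (c * sc (z^~ t)) (z^~ t) k)) => i.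
 by apply: cmeasM => //; apply: cmeasM; [exact: cmeas_cst|exact: msc].
(* Off the punctured ball, negligible for [P], a constant unit vector keeps the norm equal to 1
   everywhere. *)
pose Z w : Cn R p := if dot (Zc w) then csc (sc (Zc w)) (Zc w) else (fun k => (k == Ordinal p0)%:R).
have ZD w : dot (Zc w) -> Z w = csc (sc (Zc w)) (Zc w) by rewrite /Z => ->.
have mZ i : cmeas (fun w => Z w i).
 have [m1 m2] : cmeas (fun w => csc (sc (Zc w)) (Zc w) i).
  by apply: cmeasM => //; exact: (msc _ _ (fun k w => Zc w k)).
 have mb := mD _ _ (fun k w => Zc w k) mZc.
 have -> : (fun w => Z w i) = (fun w => if dot (Zc w) then csc (sc (Zc w)) (Zc w) i else (i == Ordinal p0)%:R).
  by apply/funext => w; rewrite /Z; case: ifP.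
 by apply: cmeas_if => //; exact: cmeas_cst.
have cZ g c : cbor g -> mfun (fun w => g (csc c (Z w))).
 move=> bg; apply: (bg _ _ (fun k w => csc c (Z w) k)) => i.
 by apply: cmeasM => //; exact: cmeas_cst.
have cZ1 g : cbor g -> mfun (fun w => g (Z w)) by move=> bg; exact: (bg _ _ (fun k w => Z w k)).
have ifD (g : Cn R p -> \bar R) : cbor g -> cbor (fun z => if dot z then g z else 0%E).
 by move=> bg; apply: cbor_if; [exact: mD|done|exact: cbor_cst].
exists _, W, P, Z; rewrite /sphere_model; split => //.
- move=> w; rewrite /Z; case: ifPn => [/andP[z0 _]|_].
  by rewrite /csc cvnormZ scE // cabs_real ger0_norm ?invr_ge0 ?ltW // mulVf // gt_eqF.
 rewrite cvnormE (bigD1 (Ordinal p0)) //= ?eqxx ?mulr1n cabs1 expr1n big1 ?addr0 ?sqrtr1 // => i /negbTE ->.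
 by rewrite cabs0 expr0n.
- move=> r g bg g0; rewrite /sphere_int.
 have -> : iint (2 * p) (fun s : seq R => ind (cvnorm (pt_of_seq p s) < 1)) = V.
  rewrite (hI (fun z => ind (cvnorm z < 1))); last 2 first.
  - by apply: cbor_if; [exact: mlt|exact: cbor_cst|exact: cbor_cst].
  - by move=> z; case: ifP.
  have -> : V = (V + \int[mu]_w ind (cvnorm (Zc w) == 0))%E by rewrite null adde0.
  rewrite /V -ge0_integralD //; last 3 first.
  - by move=> w _; case: ifP.
  - by move=> w _; case: ifP.
  - by apply/meas_ind/measurable_fun_eqr; [exact: meas_cvnorm|exact: mcst].
  apply: eq_integral => w _; have [->|z0] := eqVneq (cvnorm (Zc w)) 0.
   by rewrite ltxx /= ltr01 add0e.
  by rewrite adde0; have -> : 0 < cvnorm (Zc w) by rewrite lt_neqAle eq_sym z0 cvnorm_ge0.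
 rewrite intP //; last exact: cZ.
 rewrite muleC; congr (_ * _)%E.
 transitivity (\int[mu]_w (if dot (Zc w) then g (csc (r%:C * sc (Zc w))%R (Zc w)) else 0))%E; last first.
  apply: eq_integral => w _; case: ifP => // h; congr g; rewrite ZD //.
  by apply/funext => i; rewrite /csc mulrA.
 rewrite -(hI (fun z => if dot z then g (csc (r%:C * sc z) z) else 0%E)); last 2 first.
 - exact/ifD/bS.
 - by move=> z; exact: ind_ge0.
 congr iint; apply/funext => s; rewrite andbC; case: ifPn => // /andP[h _]; congr g; apply/funext => i.
 by rewrite /csc scE // -(rmorphM (@real_complex R)).
- move=> j c g c1 bg g0; have mr := cZ1 _ (cbor_rotc j c bg).
 have mg := cZ1 _ bg.
 rewrite !intP //; congr (_ * _)%E.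
 pose G z := if dot z then g (csc (1 * sc z) z) else 0%E.
 have bG : cbor G by exact/ifD/bS.
 transitivity (\int[mu]_w G (Zc w))%E; last first.
  by apply: eq_integral => w _; rewrite /G; case: ifP => // h; rewrite mul1r ZD.
 rewrite -(lrot j c G c1 bG); last by move=> z; exact: ind_ge0.
 have nr z : cvnorm (rotc j c z) = cvnorm z.
  by apply: cvnorm_eq => i; rewrite /rotc; case: eqP => // _; rewrite cabsM c1 mul1r.
 apply: eq_integral => w _; rewrite /G nr; case: ifP => // h; rewrite mul1r ZD //; congr g.
 by apply/funext => i; rewrite /rotc /csc /sc nr; case: eqP => // _; exact: mulrCA.
(* The circle means of [h] decrease with the radius, so the mean over the sphere is at most the mean
   over the ball. That ball lies in the ball of center [a] and radius [rho], where the mean value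
   inequality at [a] applies; [kap] is a ratio of volumes. *)
move=> a; pose rho := cvnorm a + 1; have r0 : 0 < rho by rewrite ltr_wpDl ?cvnorm_ge0.
pose vol := (\int[mu]_w ind (cvnorm (Zc w) < rho))%E.
have vol0 : (0 <= vol)%E by apply: integral_ge0 => w _; case: ifP.
have volr : vol = (fine vol)%:E by rewrite fineK // ge0_fin_numE // volfin.
have fvol0 : 0 <= fine vol by rewrite fine_ge0.
exists (k * (fine vol + 1)); first by rewrite mulr_gt0 ?invr_gt0 // ltr_wpDl.
move=> h bh h0 hA hB.
have mh := cZ1 _ bh.
rewrite intP // EFinM -muleA; apply: lee_pmul => //.
 by apply: integral_ge0 => w _; exact: ind_ge0.
have twopi : (0 < (2 * pi)%:E :> \bar R)%E by rewrite lte_fin mulr_gt0 ?pi_gt0.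
have iA x g : cbor g -> (forall z, 0 <= g z)%E -> (\int[mu]_w g (csc (circ 1 x) (Zc w)) = \int[mu]_w g (Zc w))%E.
 by move=> bg g0; rewrite -(rotI (fun=> circ 1 x) g) // => i; rewrite cabs_circ normr1.
have cavg := circ_avg mZc (A := fun x => csc (circ 1 x)) (@cmeas_csc R p) iA.
pose G1 z := if dot z then h (csc (1 * sc z) z) else 0%E.
pose G2 z := if dot z then h z else 0%E.
pose G3 z := if cvnorm (fun i => - a i + z i) < rho then h z else 0%E.
pose G4 z := if cvnorm z < rho then h (fun i => a i + z i) else 0%E.
have bG1 : cbor G1 by exact/ifD/bS.
have bG2 : cbor G2 by exact/ifD.
have bG4 : cbor G4 by apply: cbor_if; [exact: mlt|exact: cbor_shift|exact: cbor_cst].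
have bG3 : cbor G3.
 apply: cbor_if; [|exact: bh|exact: cbor_cst].
 move=> d' T z mz; apply: (mlt rho _ _ (fun k t => - a k + z k t)) => i.
 by apply: cmeasD => //; exact: cmeas_cst.
have [G10 G20 G30 G40] : [/\ forall z, (0 <= G1 z)%E, forall z, (0 <= G2 z)%E, forall z, (0 <= G3 z)%E & forall z, (0 <= G4 z)%E].
 by split=> z; exact: ind_ge0.
have mcZ g : cbor g -> mfun (fun w => g (Zc w)) by move=> bg; exact: (bg _ _ (fun k w => Zc w k)).
have -> : (\int[mu]_w (if dot (Zc w) then h (Z w) else 0) = \int[mu]_w G1 (Zc w))%E.
 by apply: eq_integral => w _; rewrite /G1; case: ifP => // hw; rewrite mul1r ZD.
rewrite -(lee_pmul2l _ twopi) // (cavg _ bG1 G10).1.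
apply: (@le_trans _ _ (\int[mu]_w cint (fun x => G2 (csc (circ 1 x) (Zc w))))%E).
 apply: ge0_le_integral => //.
 - by move=> w _; apply: integral_ge0.
 - exact: (cavg _ bG1 G10).2.
 - exact: (cavg _ bG2 G20).2.
 move=> w _; have [hw|hw] := boolP (dot (Zc w)); last first.
  rewrite /cint !integral0_eq // => x _; [rewrite /G2|rewrite /G1];
   by rewrite cvnorm_csc_circ (negbTE hw).
 have := hA _ hw; congr (_ <= _)%E; apply: eq_integral => x _; [rewrite /G1|rewrite /G2];
  rewrite cvnorm_csc_circ hw //.
 congr h; apply/funext => i; rewrite /csc /sc cvnorm_csc_circ expRN lnK ?posrE; last by case/andP: hw.
 by rewrite mul1r mulrCA.
rewrite -(cavg _ bG2 G20).1.
apply: (@le_trans _ _ ((2 * pi)%:E * \int[mu]_w G3 (Zc w))%E).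
 rewrite lee_pmul2l //; apply: ge0_le_integral => //; [exact: mcZ|exact: mcZ|].
 move=> w _; rewrite /G2 /G3; case: ifPn => [/andP[_ hw]|_]; last exact: ind_ge0.
 rewrite ifT //; apply: le_lt_trans (cvnormD _ _) _.
 have -> : cvnorm (fun i => - a i) = cvnorm a by apply: cvnorm_eq => i; rewrite cabsN.
 by rewrite ltrD2l.
rewrite -(shI G3 a bG3 G30) //.
have -> : (\int[mu]_w G3 (fun i => a i + Zc w i)%R = \int[mu]_w G4 (Zc w))%E.
 apply: eq_integral => w _; rewrite /G3 /G4; congr (if _ < _ then _ else _).
 by congr cvnorm; apply/funext => i; rewrite addKr.
rewrite (cavg _ bG4 G40).1.
apply: (@le_trans _ _ (\int[mu]_w ((2 * pi)%:E * h a * ind (cvnorm (Zc w) < rho)))%E).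
 apply: ge0_le_integral => //.
 - by move=> w _; apply: integral_ge0.
 - exact: (cavg _ bG4 G40).2.
 - apply: emeasurable_funM; first exact: mcst.
  by apply/meas_ind/(mlt _ _ _ (fun k w => Zc w k)).
 move=> w _; case: ifPn => hw.
  rewrite mule1; apply: le_trans (hB _ hw); apply: eqW.
  by apply: eq_integral => x _; rewrite /G4 cvnorm_csc_circ hw.
 by rewrite mule0 /cint integral0_eq // => x _; rewrite /G4 cvnorm_csc_circ (negbTE hw).
rewrite ge0_integralZl //; last 3 first.
- by apply/meas_ind/(mlt _ _ _ (fun k w => Zc w k)).
- by move=> w _; case: ifP.
- by rewrite mule_ge0 // ltW.
rewrite -/vol -muleA; apply: lee_pmul => //; [exact: ltW|exact: mule_ge0|].
by rewrite muleC; apply: lee_pmul => //; rewrite volr lee_fin lerDl.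
Qed.
End SphereSpace.

(** * Locally bounded Borel functions and their spherical expectations *)

Section BoundedBorel.
Context {R : realType} {p : nat}.
Implicit Types (z a l : Cn R p) (g h : Cn R p -> R).

(** On the unit sphere such functions are bounded, so that expectations are real numbers and obey
    the linear rules. *)
Definition bm g := cbor (fun z => (g z)%:E) /\
 forall r, exists M : R, forall z, cvnorm z <= r -> `|g z| <= M.

Lemma bm_cont g : cont g -> bm g.
Proof. by move=> cg; split; [exact: cont_cbor|move=> r; exact: cont_bounded]. Qed.

Lemma bm_meas g : cbor (fun z => (g z)%:E) -> forall d (T : measurableType d) (z : 'I_p -> T -> R[i]),
 (forall k, cmeas (z k)) -> mfun (fun t => g (z^~ t)).
Proof. by move=> bg d T z mz; apply/measurable_EFinP; exact: (bg _ _ z). Qed.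

Lemma bm_cst (c : R) : bm (fun=> c).
Proof. by split; [exact: cbor_cst|exists `|c|]. Qed.

Lemma bmD g h : bm g -> bm h -> bm (fun z => g z + h z).
Proof.
move=> [bg hg] [bh hh]; split.
 by move=> d T z mz; apply/measurable_EFinP/measurable_funD; exact: bm_meas.
move=> r; have [M hM] := hg r; have [N hN] := hh r; exists (M + N) => z zr.
by rewrite (le_trans (ler_normD _ _)) // lerD ?hM ?hN.
Qed.

Lemma bmM g h : bm g -> bm h -> bm (fun z => g z * h z).
Proof.
move=> [bg hg] [bh hh]; split.
 by move=> d T z mz; apply/measurable_EFinP/measurable_funM; exact: bm_meas.
move=> r; have [M hM] := hg r; have [N hN] := hh r; exists (M * N) => z zr.
by rewrite normrM ler_pM ?hM ?hN.
Qed.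

Lemma bmZ (c : R) g : bm g -> bm (fun z => c * g z).
Proof. by apply: bmM; exact: bm_cst. Qed.

Lemma bmN g : bm g -> bm (fun z => - g z).
Proof. by move=> /(bmZ (-1)); under eq_fun do rewrite mulN1r. Qed.

Lemma bmB g h : bm g -> bm h -> bm (fun z => g z - h z).
Proof. by move=> bg /bmN; exact: bmD. Qed.

Lemma bm_sum I (r : seq I) (P : pred I) (g : I -> Cn R p -> R) :
 (forall i, bm (g i)) -> bm (fun z => \sum_(i <- r | P i) g i z).
Proof. by move=> h; apply: (big_closed (C := bm)) => //; [exact: bm_cst|exact: bmD]. Qed.

Lemma bm_abs g : bm g -> bm (fun z => `|g z|).
Proof.
move=> [bg hg]; split.
 by move=> d T z mz; apply/measurable_EFinP; apply: measurableT_comp => //; exact: bm_meas.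
by move=> r; have [M hM] := hg r; exists M => z zr; rewrite normr_id hM.
Qed.

Lemma bm_max g h : bm g -> bm h -> bm (fun z => Num.max (g z) (h z)).
Proof.
move=> [bg hg] [bh hh]; split.
 by move=> d T z mz; apply/measurable_EFinP/measurable_maxr; exact: bm_meas.
move=> r; have [M hM] := hg r; have [N hN] := hh r; exists (Num.max M N) => z zr.
by rewrite le_max maxEle; case: ifP => _; rewrite ?hM ?hN ?orbT.
Qed.

Lemma bm_comp g (A : Cn R p -> Cn R p) :
 (forall d (T : measurableType d) (z : 'I_p -> T -> R[i]), (forall k, cmeas (z k)) ->
   forall k, cmeas (fun t => A (z^~ t) k)) ->
 (forall r, exists s, forall z, cvnorm z <= r -> cvnorm (A z) <= s) -> bm g -> bm (fun z => g (A z)).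
Proof.
move=> mA bA [bg hg]; split; first by move=> d T z mz; apply: (bg _ _ (fun k t => A (z^~ t) k)); exact: mA.
by move=> r; have [s hs] := bA r; have [M hM] := hg s; exists M => z /hs /hM.
Qed.

Lemma cvnorm_lmul_le l z (c : R) : 0 <= c -> (forall k, cabs (l k) <= c) -> cvnorm (lmul l z) <= c * cvnorm z.
Proof.
move=> c0 lc; rewrite -{1}(ger0_norm c0) -cabs_real -cvnormZ; apply: cvnorm_le => k.
by rewrite !cabsM cabs_real ger0_norm // ler_wpM2r ?cabs_ge0.
Qed.

Lemma cvnorm_lmul l z : cvnorm (lmul l z) <= (1 + \sum_k cabs (l k)) * cvnorm z.
Proof.
apply: cvnorm_lmul_le (ltW (sum_cabs_gt0 l)) _ => k.
by rewrite (bigD1 k) //= addrCA lerDl addr_ge0 // sumr_ge0 // => i _; exact: cabs_ge0.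
Qed.

Lemma bm_lmul g l : bm g -> bm (fun z => g (lmul l z)).
Proof.
apply: bm_comp => [d T z mz k|r]; first by apply: cmeasM => //; exact: cmeas_cst.
exists ((1 + \sum_k cabs (l k)) * `|r|) => z zr; apply: le_trans (cvnorm_lmul l z) _.
by rewrite ler_wpM2l ?(ltW (sum_cabs_gt0 _)) // (le_trans zr) ?ler_norm.
Qed.

Lemma bm_csc g c : bm g -> bm (fun z => g (csc c z)).
Proof. exact: (bm_lmul (fun=> c)). Qed.

Lemma bm_lower g : bm g -> exists2 M : R, 0 <= M & forall z, cvnorm z = 1 -> 0 <= g z + M.
Proof.
move=> [_ /(_ 1)[M gM]]; exists `|M| => // z z1; rewrite -lerBlDr sub0r lerNl (le_trans _ (ler_norm M)) //.
by rewrite (le_trans (ler_norm _)) // normrN gM // z1.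
Qed.

Lemma bm_pos K g : bm g -> cbor (fun z => (Num.max 0 (g z + K))%:E).
Proof.
move=> bg; have [] // : bm (fun z => Num.max 0 (g z + K)).
by apply: bm_max; [exact: bm_cst|apply: bmD => //; exact: bm_cst].
Qed.

Variables (d : measure_display) (W : measurableType d) (P : probability W R) (Z : W -> Cn R p).
Hypothesis mod : sphere_model P Z.

Definition Esph g : R := fine (\int[P]_w (g (Z w))%:E).
Local Notation Ex := Esph.

Lemma bm_measZ g : bm g -> mfun (fun w : W => (g (Z w))%:E).
Proof. by case: mod => mZ _ _ _ _ [bg _]; exact: (bg _ _ (fun k w => Z w k) mZ). Qed.

Lemma bm_integrable g : bm g -> P.-integrable setT (fun w : W => (g (Z w))%:E).
Proof.
move=> bg; have mg := bm_measZ bg; case: mod => mZ nZ _ _ _; case: bg => _ /(_ 1)[M hM].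
apply: (@le_integrable _ _ _ P setT measurableT _ (fun=> `|M|%:E)) => //.
 by move=> w _; rewrite lee_fin normr_id (le_trans _ (ler_norm M)) // hM // nZ.
exact: finite_measure_integrable_cst.
Qed.

Lemma ExE g : bm g -> (\int[P]_w (g (Z w))%:E = (Ex g)%:E)%E.
Proof. by move=> bg; rewrite fineK //; apply: integrable_fin_num => //; exact: bm_integrable. Qed.

Lemma ExD g h : bm g -> bm h -> Ex (fun z => g z + h z) = Ex g + Ex h.
Proof.
move=> bg bh; apply: EFin_inj; rewrite EFinD -!ExE //; last exact: bmD.
under eq_integral do rewrite EFinD.
by rewrite integralD //; exact: bm_integrable.
Qed.

Lemma ExZ (c : R) g : bm g -> Ex (fun z => c * g z) = c * Ex g.
Proof.
move=> bg; apply: EFin_inj; rewrite EFinM -!ExE //; last exact: bmZ.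
under eq_integral do rewrite EFinM.
by rewrite integralZl //; exact: bm_integrable.
Qed.

Lemma ExN g : bm g -> Ex (fun z => - g z) = - Ex g.
Proof. by move=> bg; rewrite -mulN1r -ExZ //; congr Ex; apply/funext => z; rewrite mulN1r. Qed.

Lemma ExB g h : bm g -> bm h -> Ex (fun z => g z - h z) = Ex g - Ex h.
Proof. by move=> bg bh; rewrite ExD ?ExN //; exact: bmN. Qed.

Lemma Ex_cst (c : R) : Ex (fun=> c) = c.
Proof. by rewrite /Esph integral_cst //= probability_setT mule1. Qed.

Lemma Ex_sum I (r : seq I) (Q : pred I) (g : I -> Cn R p -> R) : (forall i, bm (g i)) ->
 Ex (fun z => \sum_(i <- r | Q i) g i z) = \sum_(i <- r | Q i) Ex (g i).
Proof.
move=> bg; elim: r => [|i r IH]; first by rewrite big_nil; under [X in Ex X]eq_fun do rewrite big_nil; exact: Ex_cst.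
rewrite big_cons; under [X in Ex X]eq_fun do rewrite big_cons.
by case: (Q i) => //; rewrite ExD ?IH //; exact: bm_sum.
Qed.

Lemma Ex_le g h : bm g -> bm h -> (forall z, cvnorm z = 1 -> g z <= h z) -> Ex g <= Ex h.
Proof.
move=> bg bh gh; case: mod => mZ nZ _ _ _; rewrite -lee_fin -!ExE //; apply: le_integral => //.
- exact: bm_integrable.
- exact: bm_integrable.
by move=> w _; rewrite lee_fin gh.
Qed.

Lemma Ex_eq g h : bm g -> bm h -> (forall z, cvnorm z = 1 -> g z = h z) -> Ex g = Ex h.
Proof. by move=> bg bh gh; apply/le_anti/andP; split; apply: Ex_le => // z /gh ->. Qed.

Lemma Ex_ge0 g : bm g -> (forall z, cvnorm z = 1 -> 0 <= g z) -> 0 <= Ex g.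
Proof. by move=> bg g0; rewrite -(Ex_cst 0); apply: Ex_le => //; exact: bm_cst. Qed.

(* Adding a bound turns a function of [bm] into a nonnegative one, for which Tonelli applies. *)
Lemma Ex_shift g M : bm g -> (forall z, cvnorm z = 1 -> 0 <= g z + M) ->
 ((Ex g + M)%:E = \int[P]_w (Num.max 0 (g (Z w) + M))%:E)%E.
Proof.
move=> bg gM; case: (mod) => mZ nZ _ _ _.
rewrite -[M in LHS](Ex_cst M) -ExD //; last exact: bm_cst.
rewrite -ExE; last by apply: bmD => //; exact: bm_cst.
by apply: eq_integral => w _; rewrite max_r // gM.
Qed.

Lemma cint_itg (f : R -> R) : continuous f -> cint (fun x => (f x)%:E) = (itg f (- pi) pi)%:E.
Proof.
move=> cf; rewrite /itg /Rintegral fineK //; apply: integrable_fin_num => //.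
exact: cont_integrable.
Qed.

(** An inequality between circle means, known orbit by orbit, becomes one between spherical
    means. *)
Lemma Ex_avg_le g h (A : R -> Cn R p -> Cn R p) : bm g -> bm h ->
 (forall d' (T : measurableType d') (x : T -> R) (z : 'I_p -> T -> R[i]),
  mfun x -> (forall k, cmeas (z k)) -> forall k, cmeas (fun t => A (x t) (z^~ t) k)) ->
 (forall x f, cbor f -> (forall z, 0 <= f z)%E -> (\int[P]_w f (A x (Z w)) = \int[P]_w f (Z w))%E) ->
 (forall x z, cvnorm (A x z) = cvnorm z) ->
 (forall z, cvnorm z = 1 -> [/\ continuous (fun x => g (A x z)), continuous (fun x => h (A x z))
   & itg (fun x => g (A x z)) (- pi) pi <= itg (fun x => h (A x z)) (- pi) pi]) ->
 Ex g <= Ex h.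
Proof.
move=> bg bh mA iA nA gh; case: (mod) => mZ nZ _ _ _.
have [M M0 gM] := bm_lower bg; have [N N0 hN] := bm_lower bh; pose K := M + N.
have K1 z : cvnorm z = 1 -> 0 <= g z + K by move=> /gM h1; rewrite addrA addr_ge0.
have K2 z : cvnorm z = 1 -> 0 <= h z + K by move=> /hN h1; rewrite addrCA addr_ge0.
rewrite -(lerD2r K) -lee_fin !Ex_shift //.
have tp : (0 < (2 * pi)%:E :> \bar R)%E by rewrite lte_fin mulr_gt0 ?pi_gt0.
have s0 (f : _ -> R) : (forall z, (0 <= (Num.max 0 (f z + K))%:E)%E) by move=> z; rewrite lee_fin le_max lexx.
rewrite -(lee_pmul2l _ tp) //.
have [e1 m1] := circ_avg mZ mA iA (bm_pos K bg) (s0 g); have [e2 m2] := circ_avg mZ mA iA (bm_pos K bh) (s0 h).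
rewrite e1 e2; apply: ge0_le_integral => //.
 by move=> w _; apply: integral_ge0.
move=> w _; have [c1 c2 le] := gh _ (nZ w).
have E (f : _ -> R) : (forall z, cvnorm z = 1 -> 0 <= f z + K) -> continuous (fun x => f (A x (Z w))) ->
  cint (fun x => (Num.max 0 (f (A x (Z w)) + K))%:E) = (itg (fun x => f (A x (Z w))) (- pi) pi + K * (pi - - pi))%:E.
 move=> f0 cf; have cK : continuous (fun _ : R => K) by move=> x; exact: cvg_cst.
 rewrite -itg_cst ?Npi_le_pi // -itgD // -cint_itg; last by move=> x; apply: cvgD; [exact: cf|exact: cK].
 by congr cint; apply/funext => x; rewrite max_r // f0 // nA nZ.
by rewrite !E // lee_fin lerD2r.
Qed.

Lemma Ex_lmul g l : bm g -> (forall k, cabs (l k) = 1) -> Ex (fun z => g (lmul l z)) = Ex g.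
Proof.
move=> bg l1; case: (mod) => mZ nZ _ rZ _; have [M _ K1] := bm_lower bg.
have nl z : cvnorm (lmul l z) = cvnorm z.
 by apply: cvnorm_eq => k; rewrite cabsM l1 mul1r.
apply: (addIr M); apply: EFin_inj; rewrite !Ex_shift //; last 2 first.
- exact: bm_lmul.
- by move=> z z1; apply: K1; rewrite nl.
apply: (@rotc_lmul _ _ (fun f => \int[P]_w f (Z w))%E rZ l _ _ (bm_pos M bg)) => //.
by move=> z; rewrite lee_fin le_max lexx.
Qed.

End BoundedBorel.

(** * A working class of holomorphic functions *)

Section HolClass.
Context {R : realType} {p : nat}.
Implicit Types (z a l : Cn R p) (G H : Cn R p -> R[i]).

(* A class of functions containing the holomorphic ones and trivially closed under ring
  operations: continuity, holomorphy along entire curves, Lipschitz at the origin. *)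
Definition hol G := [/\ (forall a (e : R), 0 < e -> exists2 d : R, 0 < d &
   forall z, cdist z a < d -> cabs (G z - G a) < e),
  (forall gam : 'I_p -> R[i] -> R[i], (forall k, entire (gam k)) -> entire (fun s => G (fun k => gam k s)))
 & exists C d : R, [/\ 0 < C, 0 < d & forall z, cvnorm z < d -> cabs (G z - G (fun=> 0)) <= C * cvnorm z]].

Lemma hol_cst c : hol (fun=> c).
Proof.
split=> [a e e0|gam _|]; first by exists 1 => // z _; rewrite subrr cabs0.
 exact: entire_cst.
by exists 1, 1; split => // z _; rewrite subrr cabs0 mul1r cvnorm_ge0.
Qed.

Lemma holD G H : hol G -> hol H -> hol (fun z => G z + H z).
Proof.
move=> [cG eG [C [d [C0 d0 hG]]]] [cH eH [C' [d' [C'0 d'0 hH]]]]; split.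
- move=> a e e0; have e2 : 0 < e / 2 by rewrite divr_gt0.
 have [x x0 hx] := cG a _ e2; have [y y0 hy] := cH a _ e2.
 exists (Num.min x y); first by rewrite (lt_min 0) x0.
 move=> z; rewrite lt_min => /andP[/hx h1 /hy h2]; rewrite opprD addrACA.
 by rewrite (le_lt_trans (cabsD _ _)) // [e]splitr ltrD.
- by move=> gam hg; apply: entireD; [exact: eG|exact: eH].
exists (C + C'), (Num.min d d'); split; first exact: addr_gt0.
 by rewrite (lt_min 0) d0.
move=> z; rewrite lt_min => /andP[/hG h1 /hH h2]; rewrite opprD addrACA.
by rewrite (le_trans (cabsD _ _)) // [leRHS]mulrDl lerD.
Qed.

Lemma holM G H : hol G -> hol H -> hol (fun z => G z * H z).
Proof.
move=> [cG eG [C [d [C0 d0 hG]]]] [cH eH [C' [d' [C'0 d'0 hH]]]].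
have key z a : cabs (G z * H z - G a * H a) <=
  cabs (G z - G a) * cabs (H z - H a) + cabs (G a) * cabs (H z - H a) + cabs (G z - G a) * cabs (H a).
 have -> : G z * H z - G a * H a = (G z - G a) * (H z - H a) + G a * (H z - H a) + (G z - G a) * H a by ring.
 by rewrite -!cabsM (le_trans (cabsD _ _)) // lerD2r cabsD.
split.
- move=> a e e0; pose K := cabs (G a) + cabs (H a) + 1.
 have K0 : 0 < K by rewrite ltr_wpDl ?addr_ge0 ?cabs_ge0.
 pose e' := Num.min 1 (e / (2 * K)); have e'0 : 0 < e' by rewrite (lt_min 0) ltr01 divr_gt0 // mulr_gt0.
 have [x x0 hx] := cG a _ e'0; have [y y0 hy] := cH a _ e'0.
 exists (Num.min x y); first by rewrite (lt_min 0) x0.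
 move=> z; rewrite lt_min => /andP[/hx h1 /hy h2].
 apply: le_lt_trans (key z a) _.
 have e'1 : e' <= 1 by rewrite ge_min lexx.
 have e'2 : e' * K <= e / 2.
  rewrite (@le_trans _ _ (e / (2 * K) * K)) ?ler_wpM2r ?(ltW K0) // ?ge_min ?lexx ?orbT //.
  by rewrite invfM mulrA mulfVK ?gt_eqF.
 apply: (@le_lt_trans _ _ (e' * K)).
  have i1 : cabs (G z - G a) * cabs (H z - H a) <= e'.
   by rewrite -[leRHS]mulr1 ler_pM ?cabs_ge0 ?(ltW h1) // (le_trans (ltW h2)).
  have i2 : cabs (G a) * cabs (H z - H a) <= cabs (G a) * e' by rewrite ler_wpM2l ?cabs_ge0 ?ltW.
  have i3 : cabs (G z - G a) * cabs (H a) <= e' * cabs (H a) by rewrite ler_wpM2r ?cabs_ge0 ?ltW.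
  apply: le_trans (lerD (lerD i1 i2) i3) _; rewrite /K; apply: eqW; ring.
 by move: e'2 e0; move: (e' * K); clear => *; lra.
- by move=> gam hg; apply: entireM; [exact: eG|exact: eH].
pose K0 := G (fun=> 0); pose K1 := H (fun=> 0).
exists (C * C' + cabs K0 * C' + C * cabs K1), (Num.min 1 (Num.min d d')); split.
- by rewrite -addrA ltr_pwDl ?mulr_gt0 // addr_ge0 // mulr_ge0 ?cabs_ge0 // ltW.
- by rewrite (lt_min 0) ltr01 (lt_min 0) d0.
move=> z; rewrite !lt_min => /and3P[z1 /hG h1 /hH h2]; apply: le_trans (key z _) _.
rewrite [leRHS]mulrDl [X in _ <= X + _]mulrDl -/K0 -/K1; apply: lerD; first apply: lerD.
- apply: (@le_trans _ _ ((C * cvnorm z) * (C' * cvnorm z))); first by rewrite ler_pM ?cabs_ge0.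
 rewrite mulrACA -[leRHS]mulr1 -[leRHS]mulrA ler_wpM2l ?mulr_ge0 ?(ltW C0) ?(ltW C'0) //.
 by rewrite ler_wpM2l ?cvnorm_ge0 // ltW.
- by rewrite -mulrA ler_wpM2l ?cabs_ge0.
by rewrite mulrAC ler_wpM2r ?cabs_ge0.
Qed.

Lemma hol_sum I (r : seq I) (P : pred I) (F : I -> Cn R p -> R[i]) :
 (forall i, hol (F i)) -> hol (fun z => \sum_(i <- r | P i) F i z).
Proof. by move=> h; apply: (big_closed (C := hol)) => //; [exact: hol_cst|exact: holD]. Qed.

Lemma hol_prod I (r : seq I) (P : pred I) (F : I -> Cn R p -> R[i]) :
 (forall i, hol (F i)) -> hol (fun z => \prod_(i <- r | P i) F i z).
Proof. by move=> h; apply: (big_closed (C := hol)) => //; [exact: hol_cst|exact: holM]. Qed.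

Lemma hol_lmul G l : hol G -> hol (fun z => G (lmul l z)).
Proof.
move=> [cG eG [C [d [C0 d0 hG]]]].
pose s := 1 + \sum_k cabs (l k); have s0 : 0 < s := sum_cabs_gt0 l; have sb := cvnorm_lmul l.
have s1 z a : cdist (lmul l z) (lmul l a) <= s * cdist z a.
 apply: le_trans (sb _); apply: eqW; congr cvnorm.
 by apply/funext => k; rewrite /lmul mulrBr.
split.
- move=> a e /(cG (lmul l a) e)[x x0 hx]; exists (x / s); first by rewrite divr_gt0.
 by move=> z zx; apply/hx/(le_lt_trans (s1 _ _)); rewrite mulrC -ltr_pdivlMr.
- move=> gam hg; apply: (eG (fun k u => l k * gam k u)) => k.
 by apply: entireM => //; exact: entire_cst.
have l0 : lmul l (fun=> 0) = (fun=> 0) by apply/funext => k; rewrite /lmul mulr0.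
exists (C * s), (d / s); split; rewrite ?mulr_gt0 ?divr_gt0 ?invr_gt0 // => z zd.
rewrite l0 (le_trans (hG _ _)) ?ler_wpM2l ?(ltW C0) ?sb // -?mulrA //.
 by rewrite (le_lt_trans (sb _)) // mulrC -ltr_pdivlMr.
by rewrite ler_wpM2l ?(ltW C0).
Qed.

Lemma holomorphic_hol G : holomorphic G -> hol G.
Proof.
move=> hG; have cG a (e : R) : 0 < e -> exists2 d : R, 0 < d & forall z, cdist z a < d -> cabs (G z - G a) < e.
 move=> e0; have [c hc] := hG a; have [d [d0 hd]] := hc 1 ltr01.
 pose S := 1 + \sum_k cabs (c k); have S0 : 0 < S := sum_cabs_gt0 c.
 exists (Num.min d (e / S)); first by rewrite (lt_min 0) d0 divr_gt0.
 move=> z; rewrite lt_min => /andP[/hd h1]; rewrite ltr_pdivlMr // => h2; apply: le_lt_trans h2.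
 have := cabs_dist (G z - G a) (\sum_k c k * (z k - a k)); rewrite -/(cdist z a) in h1 *.
 have h3 := cabs_lin c (fun k => z k - a k).
 move=> /le_trans; apply; rewrite /S mulrDr mulr1 [_ * \sum_k _]mulrC addrC.
 by apply: lerD => //; move: h1; rewrite mul1r.
split => //.
 move=> gam eg s; have [c hc] := hG (fun k => gam k s).
 (* the derivative along the curve is [sum_k c_k * gam_k'(s)] *)
 have ex k : exists ph : R[i] -> R[i], cca ph s /\ cnear s (fun w => gam k w = gam k s + ph w * (w - s)).
  by case: (eg k s) => ph c1 c2; exists ph.
 have [phi hphi] := choice ex.
 pose B := 1 + \sum_k (cabs (phi k s) + 1).
 have B0 : 0 < B by rewrite ltr_pwDl // sumr_ge0 // => k _; rewrite addr_ge0 ?cabs_ge0.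
 pose L := 1 + \sum_k cabs (c k); have L0 : 0 < L := sum_cabs_gt0 c.
 have near_all (Q : 'I_p -> R[i] -> Prop) : (forall k, cnear s (Q k)) -> cnear s (fun w => forall k, Q k w).
  move=> hQ; have ex' k : exists d : R, 0 < d /\ forall w, cabs (w - s) < d -> Q k w.
   by case: (hQ k) => d d0 ?; exists d.
  have [d hd] := choice ex'.
  exists (\big[Num.min/1]_k d k).
   by elim/big_ind: _ => // [x y x0 y0|k _]; [rewrite (lt_min 0) x0|case: (hd k)].
  by move=> w hw k; apply: (hd k).2; apply: lt_le_trans hw _; exact: bigmin_le_cond.
 apply: (@cdfP _ _ _ (\sum_k c k * phi k s)) => e e0.
 pose e1 := Num.min 1 (e / (2 * L)); have e10 : 0 < e1 by rewrite (lt_min 0) ltr01 divr_gt0 // mulr_gt0.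
 pose e2 := e / (2 * B); have e20 : 0 < e2 by rewrite divr_gt0 // mulr_gt0.
 have [d [d0 hd]] := hc e2 e20.
 have n1 := near_all _ (fun k => (hphi k).2).
 have n2 := near_all _ (fun k => (hphi k).1 _ e10).
 have n3 : cnear s (fun w => cabs (w - s) < d / B) by exists (d / B); rewrite ?divr_gt0.
 apply: (cnear_imp (cnearI n1 (cnearI n2 n3))) => w [g1 [g2 g3]].
 have dist_le : cvnorm (fun k => gam k w - gam k s) <= B * cabs (w - s).
  apply: (le_trans (cvnorm_sum _)); apply: (@le_trans _ _ (\sum_k (cabs (phi k s) + 1) * cabs (w - s))).
   apply: ler_sum => k _; rewrite g1 addrAC subrr add0r cabsM ler_wpM2r ?cabs_ge0 //.
   by rewrite (le_trans (cabs_dist _ (phi k s))) // lerD2l (le_trans (ltW (g2 k))) // ge_min lexx.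
  by rewrite -mulr_suml ler_wpM2r ?cabs_ge0 // lerDr.
 have := hd (fun k => gam k w) _; rewrite -/(cdist _ _) => /(_ (le_lt_trans dist_le _)) H.
 have {H} := H _; rewrite mulrC -ltr_pdivlMr // => /(_ g3) H.
 set E1 := \sum_k c k * (gam k w - gam k s) in H.
 have -> : G (fun k => gam k w) - G (fun k => gam k s) - (\sum_k c k * phi k s) * (w - s) =
   (G (fun k => gam k w) - G (fun k => gam k s) - E1) + \sum_k c k * (phi k w - phi k s) * (w - s).
  rewrite /E1; have -> : \sum_k c k * (gam k w - gam k s) = \sum_k (c k * phi k s * (w - s) + c k * (phi k w - phi k s) * (w - s)).
   by apply: eq_bigr => k _; rewrite g1; ring.
  by rewrite big_split /= mulr_suml; ring.
 apply: le_trans (cabsD _ _) _; rewrite [e]splitr [leRHS]mulrDl; apply: lerD.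
  apply: le_trans H _; apply: le_trans (ler_wpM2l (ltW e20) dist_le) _.
  by rewrite /e2 mulrA ler_wpM2r ?cabs_ge0 // invfM mulrA mulfVK ?gt_eqF.
 rewrite -mulr_suml cabsM ler_wpM2r ?cabs_ge0 // (le_trans (cabs_sum _ _ _)) //.
 apply: (@le_trans _ _ (\sum_k cabs (c k) * e1)).
  by apply: ler_sum => k _; rewrite cabsM ler_wpM2l ?cabs_ge0 // ltW.
 rewrite -mulr_suml; apply: (@le_trans _ _ (L * e1)); first by rewrite ler_wpM2r ?(ltW e10) // /L lerDr.
 apply: (@le_trans _ _ (L * (e / (2 * L)))); first by rewrite ler_wpM2l ?(ltW L0) // ge_min lexx orbT.
 by rewrite mulrC invfM mulrA mulfVK ?gt_eqF.
have [c hc] := hG (fun=> 0); have [d [d0 hd]] := hc 1 ltr01.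
exists (1 + \sum_k cabs (c k)), d; split => //.
 exact: sum_cabs_gt0.
move=> z zd; have e : (fun k => z k - 0) = z by apply/funext => k; rewrite subr0.
have := hd z; rewrite e => /(_ zd) h1.
have /le_trans -> // := cabs_dist (G z - G (fun=> 0)) (\sum_k c k * (z k - 0)).
by rewrite [leRHS]mulrDl addrC lerD // (le_trans (cabs_lin _ _)) // e.
Qed.

End HolClass.

(** * Regularized logarithms of families of functions *)

Section LogFamily.
Context {R : realType} {p : nat} {I : finType}.
Implicit Types (z a l : Cn R p) (G : I -> Cn R p -> R[i]).

Definition nfd G (d : R) z := Num.sqrt (\sum_i cabs (G i z) ^+ 2 + d ^+ 2).
Definition lg G d z := ln (nfd G d z).

(** The regularizing constant becomes one more component; the enlarged family has no zeros, as the
    results on [nf] demand. *)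
Definition optf G (d : R) (o : option I) : Cn R p -> R[i] :=
 if o is Some i then G i else fun=> d%:C.

Lemma sum_option (F : option I -> R) : \sum_o F o = \sum_i F (Some i) + F None.
Proof.
rewrite (bigD1 None) //= addrC; congr (_ + _).
rewrite (reindex_omap Some id) /=; last by case.
by apply: eq_bigl => i; rewrite eqxx.
Qed.

Lemma nfd_opt G d z : nfd G d z = Num.sqrt (\sum_o cabs (optf G d o z) ^+ 2).
Proof. by rewrite sum_option /= cabs_real real_normK // num_real. Qed.

Lemma nfd_sqr_ge0 G d z : 0 <= \sum_i cabs (G i z) ^+ 2 + d ^+ 2.
Proof. by rewrite addr_ge0 ?sqr_ge0 // sumr_ge0 // => i _; exact: sqr_ge0. Qed.

Lemma nfd_ge G d z : `|d| <= nfd G d z.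
Proof.
rewrite -(@ler_pXn2r _ 2) ?nnegrE ?sqrtr_ge0 // sqr_sqrtr ?nfd_sqr_ge0 // real_normK ?num_real //.
by rewrite lerDr sumr_ge0 // => i _; exact: sqr_ge0.
Qed.

Lemma nfd_ge_comp G d z i : cabs (G i z) <= nfd G d z.
Proof.
rewrite -(@ler_pXn2r _ 2) ?nnegrE ?sqrtr_ge0 ?cabs_ge0 // [leRHS]sqr_sqrtr ?nfd_sqr_ge0 //.
by rewrite (bigD1 i) //= -addrA lerDl addr_ge0 ?sqr_ge0 // sumr_ge0 // => j _; exact: sqr_ge0.
Qed.

Lemma nfd_le_sum G d z : nfd G d z <= \sum_i cabs (G i z) + `|d|.
Proof.
have S0 : 0 <= \sum_i cabs (G i z) by rewrite sumr_ge0 // => i _; exact: cabs_ge0.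
rewrite -(@ler_pXn2r _ 2) ?nnegrE ?sqrtr_ge0 ?addr_ge0 // sqr_sqrtr ?nfd_sqr_ge0 // sqrrD.
rewrite real_normK ?num_real // lerD2r -[leLHS]addr0 lerD ?mulrn_wge0 ?mulr_ge0 //.
by apply: sum_sqr_le => i; exact: cabs_ge0.
Qed.

Lemma nfd_gt0 G d z : 0 < d -> 0 < nfd G d z.
Proof. by move=> d0; apply: lt_le_trans (nfd_ge G d z); rewrite gtr0_norm. Qed.

Lemma lg_ge G d z : 0 < d -> ln d <= lg G d z.
Proof.
move=> d0; rewrite /lg ler_ln ?posrE ?nfd_gt0 // -{1}(gtr0_norm d0); exact: nfd_ge.
Qed.

Lemma nfd_le_d G d d' z : 0 <= d -> d <= d' -> nfd G d z <= nfd G d' z.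
Proof.
by move=> d0 dd; rewrite ler_wsqrtr // lerD2l ler_pXn2r ?nnegrE // (le_trans d0).
Qed.

Variables (G : I -> Cn R p -> R[i]) (d : R).
Hypotheses (hG : forall i, hol (G i)) (d0 : 0 < d).

Lemma hol_optf o : hol (optf G d o).
Proof. by case: o => [i|]; [exact: hG|exact: hol_cst]. Qed.

Lemma cont_lg : cont (lg G d).
Proof.
move=> a; apply: (epsc_comp (phi := @ln R)); last exact/continuous_ln/nfd_gt0.
have -> : nfd G d = (fun z => Num.sqrt (\sum_o cabs (optf G d o z) ^+ 2)).
 by apply/funext => z; exact: nfd_opt.
by apply: epsc_nf => o; case: (hol_optf o) => h _ _; exact: (h a).
Qed.

Lemma bm_lg : bm (lg G d). Proof. exact/bm_cont/cont_lg. Qed.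

Section Curve.
Variable gam : 'I_p -> R[i] -> R[i].
Hypothesis hgam : forall k, entire (gam k).

Let f (o : option I) (s : R[i]) := optf G d o (fun k => gam k s).
Let ef o : entire (f o). Proof. by case: (hol_optf o) => _ + _; exact. Qed.
Let nfE s : nf f s = nfd G d (fun k => gam k s). Proof. by rewrite nfd_opt. Qed.
Let f0 s : 0 < nf f s. Proof. by rewrite nfE nfd_gt0. Qed.

Definition lgm r := itg (fun x => lg G d (fun k => gam k (circ r x))) (- pi) pi.

Let lgmE r : lgm r = lmean f r.
Proof.
rewrite /lgm /lmean; suff -> : (fun x => ln (nf f (circ r x))) = (fun x => lg G d (fun k => gam k (circ r x))) by [].
by apply/funext => x; rewrite nfE.
Qed.

Lemma lg_circ_cont r : continuous (fun x => lg G d (fun k => gam k (circ r x))).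
Proof.
have -> : (fun x => lg G d (fun k => gam k (circ r x))) = (fun x => ln (nf f (circ r x))).
 by apply/funext => x; rewrite nfE.
exact: ln_nf_cont.
Qed.

Lemma lgm_mono (a b : R) : 0 < a -> a <= b -> lgm a <= lgm b.
Proof. by rewrite !lgmE; exact: lmean_mono. Qed.

Lemma lgm_ge0 r : 0 < r -> 2 * pi * lg G d (fun k => gam k 0) <= lgm r.
Proof. by rewrite lgmE => r0; have := lmean_ge0 ef f0 r0; rewrite nfE. Qed.

Lemma lgm_convex (r1 a r2 : R) : 0 < r1 -> r1 < a -> a < r2 ->
 lgm a <= lgm r1 + (ln a - ln r1) / (ln r2 - ln r1) * (lgm r2 - lgm r1).
Proof. by rewrite !lgmE; exact: lmean_convex. Qed.

End Curve.
End LogFamily.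

(** * Spherical means of regularized logarithms *)

Section SphereMeans.

Lemma itgB {R : realType} (f g : R -> R) (a b : R) : continuous f -> continuous g ->
 itg (fun x => f x - g x) a b = itg f a b - itg g a b.
Proof.
move=> cf cg; have cm : continuous (fun x => -1 * g x) by move=> x; apply: cvgM; [exact: cvg_cst|exact: cg].
by under [X in itg X]eq_fun do rewrite -mulN1r; rewrite itgD // itgZ // mulN1r.
Qed.
Context {R : realType} {p : nat} {dd : measure_display} {W : measurableType dd}.
Variables (P : probability W R) (Z : W -> Cn R p).
Hypothesis mod : sphere_model P Z.
Notation Ex := (Esph P Z).
Implicit Types (z a l : Cn R p).

Definition rc (t : R) : R[i] := t%:C.

Section OneFamily.
Context {I : finType}.
Variables (G : I -> Cn R p -> R[i]) (d : R).
Hypotheses (hG : forall i, hol (G i)) (d0 : 0 < d).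

Definition mlg l := Ex (fun z => lg G d (lmul l z)).

Let blg l : bm (fun z => lg G d (lmul l z)).
Proof. exact/bm_lmul/bm_lg. Qed.

Lemma mlg_unit l u : (forall k, cabs (u k) = 1) -> mlg (fun k => l k * u k) = mlg l.
Proof.
move=> u1; rewrite /mlg -(Ex_lmul mod (blg l) u1); congr Ex.
by apply/funext => z; congr lg; apply/funext => k; rewrite /lmul mulrA.
Qed.

Lemma mlg_cabs l : mlg l = mlg (fun k => rc (cabs (l k))).
Proof.
have ex k : exists u, cabs u = 1 /\ l k = rc (cabs (l k)) * u.
 by have [x _ lx] := polar (l k); exists (circ 1 x); split; [rewrite cabs_circ normr1|rewrite {1}lx circE].
have [u hu] := choice ex.
rewrite -(mlg_unit (fun k => rc (cabs (l k))) (u := u)); last by move=> k; case: (hu k).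
by congr mlg; apply/funext => k; case: (hu k).
Qed.

Lemma mlg_coord l j (s t : R) : 0 < s -> s <= t ->
 mlg (fun k => if k == j then rc s else l k) <= mlg (fun k => if k == j then rc t else l k).
Proof.
move=> s0 st; case: (mod) => mZ nZ _ rZ _.
apply: (Ex_avg_le mod (blg (fun k => if k == j then rc s else l k)) (blg (fun k => if k == j then rc t else l k)) (A := fun x => rotc j (circ 1 x))).
- move=> d' T x z mx mz k; rewrite /rotc; case: eqP => // _.
 by apply: cmeasM => //; apply: (cmeas_comp _ mx); apply: cmeas_rcont; exact: rcont_circ.
- by move=> x f bf f0; apply: rZ => //; rewrite cabs_circ normr1.
- by move=> x z; apply: cvnorm_eq => k; rewrite /rotc; case: eqP => // _; rewrite cabsM cabs_circ normr1 mul1r.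
move=> z _; pose gam k (u : R[i]) := if k == j then z k * u else l k * z k.
have eg k : entire (gam k).
 rewrite /gam; case: eqP => _; last exact: entire_cst.
 by apply: entireM; [exact: entire_cst|exact: entire_id].
have E r x : lmul (fun k => if k == j then rc r else l k) (rotc j (circ 1 x) z) = (fun k => gam k (circ r x)).
 apply/funext => k; rewrite /lmul /rotc /gam; case: eqP => // _.
 by rewrite [in RHS]circE mulrA [RHS]mulrC.
pose F r x := lg G d (fun k => gam k (circ r x)).
have H : [/\ continuous (F s), continuous (F t) & itg (F s) (- pi) pi <= itg (F t) (- pi) pi].
 by split; [exact: (lg_circ_cont hG d0 eg)|exact: (lg_circ_cont hG d0 eg)|exact: (lgm_mono hG d0 eg)].
have E' r : F r = (fun x => lg G d (lmul (fun k => if k == j then rc r else l k) (rotc j (circ 1 x) z))).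
 by apply/funext => x; rewrite /F E.
by move: H E'; move: F => F; clear -F; move=> H E'; rewrite (E' s) (E' t) in H.
Qed.

(** The mean depends only on the moduli of the [l k], by rotation invariance, and grows in each by
    monotonicity of circle means; the coordinates are raised one at a time. *)
Lemma mlg_mono l l' : (forall k, 0 < cabs (l k)) -> (forall k, cabs (l k) <= cabs (l' k)) -> mlg l <= mlg l'.
Proof.
move=> l0 ll; rewrite (mlg_cabs l) (mlg_cabs l').
pose L n : Cn R p := fun k => rc (if (k < n)%N then cabs (l' k) else cabs (l k)).
have H n : (n <= p)%N -> mlg (fun k => rc (cabs (l k))) <= mlg (L n).
 elim: n => [_|n IH hn]; first by apply: eqW; congr mlg.
 apply: le_trans (IH (ltnW hn)) _; pose j := Ordinal hn.
 have e1 : L n = (fun k => if k == j then rc (cabs (l j)) else L n k).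
  by apply/funext => k; case: eqP => // ->; rewrite /L /= ltnn.
 have e2 : L n.+1 = (fun k => if k == j then rc (cabs (l' j)) else L n k).
  apply/funext => k; case: eqP => [->|kj]; first by rewrite /L /= ltnSn.
  rewrite /L ltnS [(k <= n)%N]leq_eqVlt; case: (eqVneq (k : nat) n) => // kn.
  by case: kj; apply/val_inj.
 by rewrite e1 e2; exact: mlg_coord.
apply: le_trans (H p (leqnn p)) _; apply: eqW.
by congr mlg; apply/funext => k; rewrite /L ltn_ord.
Qed.

Definition mt (t : R) := mlg (fun=> rc t).

Lemma mtE t : mt t = Ex (fun z => lg G d (csc (rc t) z)). Proof. by []. Qed.

Lemma bm_lg_csc t : bm (fun z => lg G d (csc (rc t) z)). Proof. exact: blg. Qed.

Let cscE (z : Cn R p) t x : csc (rc t) (csc (circ 1 x) z) = (fun k => z k * circ t x).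
Proof. by apply/funext => k; rewrite /csc [in RHS]circE mulrA [RHS]mulrC. Qed.

Let ez (z : Cn R p) k : entire (fun u => z k * u).
Proof. by apply: entireM; [exact: entire_cst|exact: entire_id]. Qed.

Lemma mt_mono s t : 0 < s -> s <= t -> mt s <= mt t.
Proof.
by move=> s0 st; apply: mlg_mono => k; rewrite !cabs_real ?normr_gt0 ?gt_eqF // !ger0_norm // ltW // (lt_le_trans s0).
Qed.

Lemma mt_convex (r1 a r2 : R) : 0 < r1 -> r1 < a -> a < r2 ->
 mt a <= mt r1 + (ln a - ln r1) / (ln r2 - ln r1) * (mt r2 - mt r1).
Proof.
move=> r10 ra ar; set th := _ / _; case: (mod) => mZ nZ _ rZ _.
have bh : bm (fun z => lg G d (csc (rc r1) z) + th * (lg G d (csc (rc r2) z) - lg G d (csc (rc r1) z))).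
 by apply: bmD; [exact: bm_lg_csc|apply/bmZ/bmB; exact: bm_lg_csc].
have <- : Ex (fun z => lg G d (csc (rc r1) z) + th * (lg G d (csc (rc r2) z) - lg G d (csc (rc r1) z)))
  = mt r1 + th * (mt r2 - mt r1).
 by rewrite (ExD mod) ?(ExZ mod) ?(ExB mod) //; do ?[apply: bmZ|apply: bmB]; exact: bm_lg_csc.
apply: (Ex_avg_le mod (bm_lg_csc a) bh (A := fun x => csc (circ 1 x))).
- by move=> d' T x z mx mz; exact: cmeas_csc.
- move=> x f bf f0; apply: (@rotc_lmul _ _ (fun f => \int[P]_w f (Z w))%E rZ (fun=> circ 1 x)) => //.
 by move=> k; rewrite cabs_circ normr1.
- by move=> x z; rewrite cvnorm_csc_circ.
move=> z _; have c t : continuous (fun x => lg G d (csc (rc t) (csc (circ 1 x) z))).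
 by under eq_fun do rewrite cscE; exact: (lg_circ_cont hG d0 (ez z)).
have ce : continuous (fun x => lg G d (csc (rc r2) (csc (circ 1 x) z)) - lg G d (csc (rc r1) (csc (circ 1 x) z))).
 by move=> x; apply: cvgB; exact: c.
have cc : continuous (fun x => th * (lg G d (csc (rc r2) (csc (circ 1 x) z)) - lg G d (csc (rc r1) (csc (circ 1 x) z)))).
 by move=> x; apply: cvgM; [exact: cvg_cst|exact: ce].
have cm : continuous (fun x => -1 * lg G d (csc (rc r1) (csc (circ 1 x) z))).
 by move=> x; apply: cvgM; [exact: cvg_cst|exact: c].
split => //; first by move=> x; apply: cvgD; [exact: c|exact: cc].
rewrite itgD // itgZ //.
have e t : (fun x => lg G d (csc (rc t) (csc (circ 1 x) z))) = (fun x => lg G d (fun k => z k * circ t x)).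
 by apply/funext => x; rewrite cscE.
have E t : itg (fun x => lg G d (csc (rc t) (csc (circ 1 x) z))) (- pi) pi = lgm G d (fun k u => z k * u) t :=
 congr1 (fun f => itg f (- pi) pi) (e t).
rewrite (itgB _ _ (c r2) (c r1)).
by rewrite !E; exact: (lgm_convex hG d0 (ez z)).
Qed.

End OneFamily.

(** [M - lg] is nonnegative on the ball considered and minus it is plurisubharmonic, so its
    spherical mean is at most [kap] times its value at [a]. As [kap] is chosen before the family and
    the regularization, the bound is uniform in both. *)
Lemma mean_lower a : exists2 kap : R, 0 < kap & forall (I : finType) (G : I -> Cn R p -> R[i]) (d M : R),
 (forall i, hol (G i)) -> 0 < d -> (forall z, cvnorm z <= 2 * cvnorm a + 1 -> lg G d z <= M) ->
 M - kap * (M - lg G d a) <= Ex (lg G d).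
Proof.
case: (mod) => mZ nZ _ _ /(_ a)[kap k0 hk]; exists kap => // I G d M hG d0 hM.
have b1 := bm_lg hG d0.
have bM : bm (fun z => M - lg G d z) by apply: bmB => //; exact: bm_cst.
have bh : bm (fun z => Num.max 0 (M - lg G d z)) by apply: bm_max => //; exact: bm_cst.
have ca := cvnorm_ge0 a.
have p1 z : cvnorm z <= 2 * cvnorm a + 1 -> Num.max 0 (M - lg G d z) = M - lg G d z.
 by move=> hz; rewrite max_r // subr_ge0 hM.
have ea : cvnorm a <= 2 * cvnorm a + 1 by lra.
have cs (f : R -> R) : continuous f -> (forall x, 0 <= M - f x) ->
  cint (fun x => (Num.max 0 (M - f x))%:E) = (2 * pi * M - itg f (- pi) pi)%:E.
 move=> cf f0; have cK : continuous (fun _ : R => M) by move=> x; exact: cvg_cst.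
 under eq_fun do rewrite max_r //; rewrite cint_itg; last by move=> x; exact: cvgB (cK x) (cf x).
 by rewrite itgB // itg_cst ?Npi_le_pi //; congr (_ - _)%:E; ring.
have ez (z : Cn R p) k : entire (fun u => z k * u).
 by apply: entireM; [exact: entire_cst|exact: entire_id].
have main : Ex (fun z => M - lg G d z) <= kap * (M - lg G d a).
 rewrite -lee_fin -(ExE mod) //.
 under eq_integral => w _ do (rewrite -p1; last by rewrite nZ; lra).
 rewrite EFinM -[(M - lg G d a)](p1 a) //.
 apply: (hk (fun z => (Num.max 0 (M - lg G d z))%:E)).
 - by case: bh.
 - by move=> z; rewrite lee_fin le_max lexx.
 - move=> z /andP[z0 z1].
  have E r x : csc (circ 1 x) (csc (rc r) z) = (fun k => z k * circ r x).
   by apply/funext => k; rewrite /csc [in RHS]circE mulrCA mulrA [RHS]mulrC mulrC.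
  have E1 x : csc (circ 1 x) z = (fun k => z k * circ 1 x) by apply/funext => k; rewrite /csc mulrC.
  have nE r x : cvnorm (fun k => z k * circ r x) = `|r| * cvnorm z.
   by rewrite -(cabs_circ r x) -cvnormZ; apply: cvnorm_eq => k; rewrite mulrC.
  have zr x : cvnorm (fun k => z k * circ (cvnorm z)^-1 x) <= 2 * cvnorm a + 1.
   by rewrite nE ger0_norm ?invr_ge0 ?cvnorm_ge0 // mulVf ?gt_eqF //; lra.
  have z1r x : cvnorm (fun k => z k * circ 1 x) <= 2 * cvnorm a + 1.
   by rewrite nE normr1 mul1r; move: z1 ca; move: (cvnorm z) (cvnorm a) => x1 x2; lra.
  under [X in (cint X <= _)%E]eq_fun do rewrite E; under [X in (_ <= cint X)%E]eq_fun do rewrite E1.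
  rewrite !cs; try exact: (lg_circ_cont hG d0 (ez z)); try by move=> x; rewrite subr_ge0 hM.
  rewrite lee_fin lerD2l lerN2; apply: (lgm_mono hG d0 (ez z)) => //.
  by rewrite invf_ge1 // ltW.
 move=> z zr; pose gam k (u : R[i]) := a k + z k * u.
 have eg k : entire (gam k) by apply: entireD; [exact: entire_cst|exact: ez].
 have E x : (fun k => a k + csc (circ 1 x) z k) = (fun k => gam k (circ 1 x)).
  by apply/funext => k; rewrite /gam /csc [_ * z k]mulrC.
 have bd x : cvnorm (fun k => gam k (circ 1 x)) <= 2 * cvnorm a + 1.
  by rewrite -E (le_trans (cvnormD _ _)) // cvnorm_csc_circ; move: zr; move: (cvnorm z) (cvnorm a) => x1 x2; lra.
 under [X in cint X]eq_fun do rewrite E.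
 rewrite cs; try exact: (lg_circ_cont hG d0 eg); try by move=> x; rewrite subr_ge0 hM.
 rewrite p1 // -EFinM lee_fin mulrBr lerD2l lerN2.
 have := lgm_ge0 hG d0 eg ltr01; congr (_ * lg G d _ <= _).
 by apply/funext => k; rewrite /gam mulr0 addr0.
move: main; rewrite (ExB mod) ?(Ex_cst P Z) //; last exact: bm_cst.
by move: (Ex _) (kap * _) => x y; lra.
Qed.

End SphereMeans.

(** * Smoothing along complex one-parameter groups *)

Section PlaneMeans.
Context {R : realType} {d1 : measure_display} {W1 : measurableType d1}.
Variables (mu : {sigma_finite_measure set W1 -> \bar R}) (Z1 : W1 -> 'I_1 -> R[i]).
Hypothesis pl : euclid_model mu Z1.
Implicit Types (f g : R[i] -> R) (x : R[i]).

Let ze w := Z1 w ord0.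

Definition borel1 f := cbor (fun v : 'I_1 -> R[i] => (f (v ord0))%:E).

Definition pb f := [/\ forall x, 0 <= f x, exists K : R, forall x, f x <= K,
 forall x, 2 <= cabs x -> f x = 0 & borel1 f].

Lemma cvnorm1 (v : 'I_1 -> R[i]) : cvnorm v = cabs (v ord0).
Proof. by rewrite cvnormE big_ord1 sqrtr_sqr ger0_norm ?cabs_ge0. Qed.

Lemma borel1_meas f : borel1 f -> forall d (T : measurableType d) (z : T -> R[i]), cmeas z ->
 mfun (fun t => f (z t)).
Proof.
by move=> bf d T z mz; apply/measurable_EFinP; apply: (bf _ _ (fun (_ : 'I_1) t => z t)).
Qed.

Lemma borel1P f : (forall d (T : measurableType d) (z : T -> R[i]), cmeas z -> mfun (fun t => f (z t))) ->
 borel1 f.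
Proof. by move=> h d T z mz; apply/measurable_EFinP; exact: h. Qed.

Lemma cmeas_ze : cmeas ze. Proof. by case: pl => mZ _ _ _ _; exact: mZ. Qed.

Definition pint f : R := fine (\int[mu]_w (f (ze w))%:E).

Let mpb f : pb f -> mfun (fun w => (f (ze w))%:E).
Proof. by move=> [_ _ _ bf]; apply/measurable_EFinP; apply: borel1_meas => //; exact: cmeas_ze. Qed.

Lemma pintE f : pb f -> (\int[mu]_w (f (ze w))%:E = (pint f)%:E)%E.
Proof.
move=> bf; have mf := mpb bf; case: bf => f0 [K fK] fs _; rewrite fineK // ge0_fin_numE; last first.
 by apply: integral_ge0 => w _; rewrite lee_fin.
case: pl => mZ _ _ _ [/(_ 2 (ltr0n _ 2))vol _ _].
have K0 : 0 <= K by apply: le_trans (f0 0) (fK 0).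
have mb : mfun (fun w => cvnorm (Z1 w) < 2) by exact: (meas_cvnorm_lt 2 (z := fun k w => Z1 w k)).
apply: (@le_lt_trans _ _ (\int[mu]_w (K%:E * (if (cvnorm (Z1 w) < 2)%R then 1 else 0)))%E).
 apply: ge0_le_integral => //.
 - by move=> w _; rewrite lee_fin.
 - by apply: emeasurable_funM => //; apply: measurable_fun_ifT.
 move=> w _; rewrite cvnorm1; case: ltP => h; first by rewrite mule1 lee_fin.
 by rewrite mule0 /ze fs.
rewrite ge0_integralZl //; first by rewrite lte_mul_pinfty.
- by apply: measurable_fun_ifT.
- by move=> w _; case: ifP.
Qed.

Lemma pint_ge0 f : pb f -> 0 <= pint f.
Proof. by move=> bf; rewrite -lee_fin -pintE //; apply: integral_ge0 => w _; rewrite lee_fin; case: bf. Qed.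

Lemma pint_le f g : pb f -> pb g -> (forall x, f x <= g x) -> pint f <= pint g.
Proof.
move=> bf bg fg; rewrite -lee_fin -!pintE //; apply: ge0_le_integral => //.
- by move=> w _; rewrite lee_fin; case: bf.
- exact: mpb.
- exact: mpb.
- by move=> w _; rewrite lee_fin.
Qed.

Lemma pbD f g : pb f -> pb g -> pb (fun x => f x + g x).
Proof.
move=> [f0 [K fK] fs bf] [g0 [L gL] gs bg]; split.
- by move=> x; exact: addr_ge0.
- by exists (K + L) => x; exact: lerD.
- by move=> x hx; rewrite fs ?gs ?addr0.
- by apply: borel1P => d T z mz; apply: measurable_funD; exact: borel1_meas.
Qed.

Lemma pbM f g : pb f -> (forall x, 0 <= g x) -> (exists K : R, forall x, cabs x < 2 -> g x <= K) -> borel1 g ->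
 pb (fun x => f x * g x).
Proof.
move=> [f0 [K fK] fs bf] g0 [L gL] bg; split.
- by move=> x; exact: mulr_ge0.
- exists (Num.max 0 (K * L)) => x; rewrite le_max; case: (ltP (cabs x) 2) => h.
  by rewrite (ler_pM (f0 _) (g0 _) (fK _) (gL _ h)) orbT.
 by rewrite fs // mul0r lexx.
- by move=> x hx; rewrite fs ?mul0r.
- by apply: borel1P => d T z mz; apply: measurable_funM; exact: borel1_meas.
Qed.

Lemma borel1_cst (c : R) : borel1 (fun=> c).
Proof. by apply: borel1P => d T z mz; exact: mcst. Qed.

Lemma pbZ (c : R) f : 0 <= c -> pb f -> pb (fun x => c * f x).
Proof.
move=> c0 bf; have := pbM bf (g := fun=> c) (fun=> c0) _ (borel1_cst c).
have -> : (fun x => c * f x) = (fun x => f x * c) by apply/funext => x; rewrite mulrC.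
by apply; exists c.
Qed.

Lemma pintD f g : pb f -> pb g -> pint (fun x => f x + g x) = pint f + pint g.
Proof.
move=> bf bg; apply: EFin_inj; rewrite EFinD -!pintE //; last exact: pbD.
under eq_integral do rewrite EFinD.
rewrite ge0_integralD //; [|exact: mpb| |exact: mpb]; move=> w _; rewrite lee_fin; [by case: bf|by case: bg].
Qed.

Lemma pintZ (c : R) f : 0 <= c -> pb f -> pint (fun x => c * f x) = c * pint f.
Proof.
move=> c0 bf; apply: EFin_inj; rewrite EFinM -!pintE //; last exact: pbZ.
under eq_integral do rewrite EFinM.
by rewrite ge0_integralZl //; [exact: mpb|move=> w _; rewrite lee_fin; case: bf].
Qed.

Lemma pint_shift f x : pb f -> (\int[mu]_w (f (x + ze w)%R)%:E = (pint f)%:E)%E.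
Proof.
move=> bf; rewrite -pintE //; case: (pl) => _ _ _ sh _; case: bf => f0 _ _ bf.
rewrite -(sh (fun v => (f (v ord0))%:E) (fun=> x)) // => z; by rewrite lee_fin.
Qed.

(** A radial 1-Lipschitz kernel on the unit disc. Its translates by at most 1 stay in the disc of
    radius 2, whose indicator is [disc]. *)
Definition bump x : R := Num.max 0 (1 - cabs x).
Definition disc x : R := if cabs x < 2 then 1 else 0.

Lemma borel1_cabs : borel1 cabs.
Proof.
apply: borel1P => d T z mz; have := meas_cvnorm (z := fun (_ : 'I_1) => z) (fun=> mz).
by under eq_fun do rewrite cvnorm1.
Qed.

Lemma pb_bump : pb bump.
Proof.
split.
- by move=> x; rewrite /bump le_max lexx.
- by exists 1 => x; rewrite /bump ge_max ler01 gerBl cabs_ge0.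
- by move=> x hx; rewrite /bump max_l // subr_le0 (le_trans _ hx) // ler1n.
- apply: borel1P => d T z mz; apply: measurable_maxr; first exact: mcst.
 by apply: measurable_funB; [exact: mcst|exact: (borel1_meas borel1_cabs)].
Qed.

Lemma pb_disc : pb disc.
Proof.
split.
- by move=> x; rewrite /disc; case: ifP.
- by exists 1 => x; rewrite /disc; case: ifP.
- by move=> x hx; rewrite /disc ltNge hx.
- apply: borel1P => d T z mz; apply: measurable_fun_ifT; [|exact: mcst|exact: mcst].
 by apply: measurable_fun_ltr; [exact: (borel1_meas borel1_cabs)|exact: mcst].
Qed.

Lemma bump_lip x y : bump x - bump y <= cabs (x - y).
Proof.
rewrite /bump lerBlDr; have h := cabs_dist y x; rewrite cabsBC in h.
have h1 := cabs_ge0 (x - y); have h2 : 0 <= Num.max 0 (1 - cabs y) by rewrite le_max lexx.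
have h3 : 1 - cabs y <= Num.max 0 (1 - cabs y) by rewrite le_max lexx orbT.
by rewrite ge_max addr_ge0 //=; move: h h1 h2 h3; move: (Num.max 0 (1 - cabs y)) (cabs (x - y)) (cabs x) (cabs y) => *; lra.
Qed.

Lemma pint_bump_gt0 : 0 < pint bump.
Proof.
rewrite lt_neqAle eq_sym pint_ge0 ?andbT; last exact: pb_bump.
(* otherwise [bump], hence the indicator of the unit disc, would vanish almost everywhere *)
apply/negP => /eqP h0; have := pintE pb_bump; rewrite h0.
have mb := mpb pb_bump.
case: (pl) => mZ _ _ _ [vol /(_ isT) pos _] h1.
have : (\int[mu]_w (if (0 < cvnorm (Z1 w) < 1)%R then 1 else 0) = 0)%E; last by move=> e; rewrite e ltxx in pos.
have ae0 : ae_eq mu setT (fun w => (bump (ze w))%:E) (cst 0%E).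
 apply/(ae_eq_integral_abs mu measurableT mb); rewrite -[RHS]h1; apply: eq_integral => w _.
 by rewrite gee0_abs // lee_fin; case: pb_bump.
rewrite (ge0_ae_eq_integral (g := fun=> 0%E)) ?integral0 //.
- apply: measurable_fun_ifT => //; apply: measurable_and.
  by apply: measurable_fun_ltr; [exact: mcst|exact: (meas_cvnorm (z := fun k w => Z1 w k))].
 exact: (meas_cvnorm_lt 1 (z := fun k w => Z1 w k)).
- by move=> w _; case: ifP.
apply: filterS ae0 => w /= /(_ I) bw _; case: ifPn => // /andP[_]; rewrite cvnorm1 => h.
have : bump (ze w) = 0 by apply: EFin_inj.
by rewrite /bump max_r; [move/eqP; rewrite subr_eq0 => /eqP e; rewrite /ze -e ltxx in h|rewrite subr_ge0 ltW].
Qed.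

Section Smoothing.
Context {p : nat} {dd : measure_display} {W : measurableType dd}.
Variables (P : probability W R) (Z : W -> Cn R p).
Hypothesis mod : sphere_model P Z.
Notation Ex := (Esph P Z).
Variables (th : 'I_p -> R) (rho b : R).
Hypotheses (rho0 : 0 < rho) (thb : forall k, `|th k| <= b).

Definition ez x : Cn R p := fun k => cexp (rc (rho * th k) * x).

(** [ez x] multiplies the k-th coordinate by exp(rho theta_k x): a rotation for imaginary [x], a
    dilation for real [x]. Averaging along this entire curve turns translations of the torus into
    translations of the plane. *)
Definition sm (k : R[i] -> R) (u : Cn R p -> R) z : R := pint (fun x => k x * u (lmul (ez x) z)).

Lemma cabs_ez x k : cabs (ez x k) = expR (rho * th k * Re x).
Proof. by rewrite /ez cabs_cexp; case: x => x y /=; rewrite mul0r subr0. Qed.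

Lemma cabs_ez_bound x k (s : R) : cabs x <= s -> expR (- (b * rho * s)) <= cabs (ez x k) <= expR (b * rho * s).
Proof.
move=> xs; rewrite cabs_ez !ler_expR -ler_norml !normrM (ger0_norm (ltW rho0)).
rewrite [b * rho]mulrC; apply: ler_pM; rewrite ?mulr_ge0 ?(ltW rho0) //.
 by rewrite ler_wpM2l ?(ltW rho0).
exact: le_trans (cabs_Re x) xs.
Qed.

Lemma cmeas_cexp d (T : measurableType d) (x : T -> R[i]) : cmeas x -> cmeas (fun t => cexp (x t)).
Proof.
move=> [x1 x2]; have me := measurableT_comp (@measurable_expR R) x1.
have mc : mfun (@cos R) by apply: continuous_measurable_fun; exact: continuous_cos.
have ms : mfun (@sin R) by apply: continuous_measurable_fun; exact: continuous_sin.
split; apply: measurable_funM => //; [exact: (measurableT_comp mc x2)|exact: (measurableT_comp ms x2)].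
Qed.

Lemma cmeas_ez d (T : measurableType d) (x : T -> R[i]) : cmeas x -> forall k, cmeas (fun t => ez (x t) k).
Proof. by move=> mx k; apply: cmeas_cexp; apply: cmeasM => //; exact: cmeas_cst. Qed.

Lemma pb_sm k u z : pb k -> bm u -> (forall z, 0 <= u z) -> pb (fun x => k x * u (lmul (ez x) z)).
Proof.
move=> bk bu u0; apply: pbM => //.
 have [M hM] := bu.2 (expR (b * rho * 2) * cvnorm z); exists M => x hx.
 apply: le_trans (ler_norm _) (hM _ _); apply: cvnorm_lmul_le (expR_ge0 _) _ => j.
 by have /andP[] := cabs_ez_bound j (ltW hx).
apply: borel1P => d T x mx; apply: (bm_meas bu.1 (z := fun j t => lmul (ez (x t)) z j)) => j.
by apply: cmeasM; [exact: cmeas_ez|exact: cmeas_cst].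
Qed.

Lemma bm_sm k u : pb k -> bm u -> (forall z, 0 <= u z) -> bm (sm k u).
Proof.
move=> bk bu u0; split.
 move=> d T z mz; have -> : (fun t => (sm k u (z^~ t))%:E) =
   (fun t => \int[mu]_w (k (ze w) * u (lmul (ez (ze w)) (z^~ t)))%:E)%E.
  by apply/funext => t; rewrite /sm -pintE //; exact: pb_sm.
 pose f (y : T * W1) := (k (ze y.2) * u (lmul (ez (ze y.2)) (z^~ y.1)))%:E.
 have m2 : cmeas (fun y : T * W1 => ze y.2) by apply: (cmeas_comp cmeas_ze); exact: measurable_snd.
 have mf : mfun f.
  apply/measurable_EFinP/measurable_funM; first by apply: borel1_meas m2; case: bk.
  apply: (bm_meas bu.1 (z := fun j (y : T * W1) => lmul (ez (ze y.2)) (z^~ y.1) j)) => j.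
  by apply: cmeasM; [exact: cmeas_ez|apply: (cmeas_comp (mz j)); exact: measurable_fst].
 have f0 y : (0 <= f y)%E by rewrite lee_fin mulr_ge0 //; case: bk.
 have := @measurable_fun_fubini_tonelli_F _ _ _ _ _ mu f mf f0; exact.
move=> r; have [M hM] := bu.2 (expR (b * rho * 2) * r).
exists (`|M| * pint k) => z zr; have := pb_sm z bk bu u0 => pk.
rewrite ger0_norm /sm; last exact: pint_ge0.
rewrite -pintZ //; apply: pint_le => //; first exact: pbZ.
move=> x; case: (ltP (cabs x) 2) => hx; last by case: bk => _ _ h _; rewrite h // mul0r mulr0.
rewrite mulrC ler_wpM2r //; first by case: bk.
rewrite (le_trans _ (ler_norm M)) // (le_trans (ler_norm _)) // hM //.
apply: (@le_trans _ _ (expR (b * rho * 2) * cvnorm z)); last by rewrite ler_wpM2l ?expR_ge0.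
by apply: cvnorm_lmul_le (expR_ge0 _) _ => j; have /andP[] := cabs_ez_bound j (ltW hx).
Qed.

Lemma Ex_sm k u (t X : R) : pb k -> bm u -> (forall z, 0 <= u z) ->
 (forall x, cabs x < 2 -> Ex (fun z => u (lmul (ez x) (csc (rc t) z))) <= X) ->
 Ex (fun z => sm k u (csc (rc t) z)) <= pint k * X.
Proof.
move=> bk bu u0 hX; have k0 : forall x, 0 <= k x by case: bk.
have X0 : 0 <= X.
 apply: le_trans (hX 0 _); last by rewrite cabs0.
 by apply: (Ex_ge0 mod) => //; exact: (bm_csc (rc t) (bm_lmul (ez 0) bu)).
rewrite -lee_fin -(ExE mod); last by apply: bm_csc; exact: bm_sm.
have -> : (\int[P]_w (sm k u (csc (rc t) (Z w)))%:E =
  \int[P]_w \int[mu]_w1 (k (ze w1) * u (lmul (ez (ze w1)) (csc (rc t) (Z w))))%:E)%E.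
 by apply: eq_integral => w _; rewrite (pintE (pb_sm _ bk bu u0)).
case: (mod) => mZ nZ _ _ _.
pose f (y : W * W1) := (k (ze y.2) * u (lmul (ez (ze y.2)) (csc (rc t) (Z y.1))))%:E.
have m2 : cmeas (fun y : W * W1 => ze y.2) by apply: (cmeas_comp cmeas_ze); exact: measurable_snd.
have mf : mfun f.
 apply/measurable_EFinP/measurable_funM; first by apply: borel1_meas m2; case: bk.
 apply: (bm_meas bu.1 (z := fun j (y : W * W1) => lmul (ez (ze y.2)) (csc (rc t) (Z y.1)) j)) => j.
 apply: cmeasM; first exact: cmeas_ez.
 by apply: cmeasM; [exact: cmeas_cst|apply: (cmeas_comp (mZ j)); exact: measurable_fst].
have f0 y : (0 <= f y)%E by rewrite lee_fin mulr_ge0.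
have -> : (\int[P]_w \int[mu]_w1 f (w, w1) = \int[mu]_w1 \int[P]_w f (w, w1))%E.
 exact: (@fubini_tonelli _ _ _ _ _ P mu f mf f0).
have bE x : bm (fun z => u (lmul (ez x) (csc (rc t) z))) by exact: (bm_csc (rc t) (bm_lmul (ez x) bu)).
apply: (@le_trans _ _ (\int[mu]_w1 (X * k (ze w1))%:E)%E).
 apply: ge0_le_integral => //.
 - by move=> w1 _; apply: integral_ge0.
 - have := @measurable_fun_fubini_tonelli_G _ _ _ _ _ P f mf f0; exact.
 - by apply/measurable_EFinP/measurable_funM; [exact: mcst|apply: borel1_meas cmeas_ze; case: bk].
 move=> w1 _; rewrite /f /=; under eq_integral do rewrite EFinM.
 have mE : mfun (fun w => (u (lmul (ez (ze w1)) (csc (rc t) (Z w))))%:E) := bm_measZ mod (bE _).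
 rewrite ge0_integralZl // ?lee_fin //; last by move=> w _; rewrite lee_fin.
 rewrite (ExE mod (bE _)) // -EFinM lee_fin; case: (ltP (cabs (ze w1)) 2) => hx; first by rewrite mulrC ler_wpM2r ?hX.
 by case: bk => _ _ h _; rewrite h // mul0r mulr0.
by rewrite (pintE (pbZ X0 bk)) pintZ // lee_fin mulrC.
Qed.

(* Subharmonicity: the bump is radial. *)
Lemma sm_submean (I : finType) (G : I -> Cn R p -> R[i]) (d L : R) z : (forall i, hol (G i)) -> 0 < d ->
 (forall z, 0 <= lg G d z + L) -> pint bump * (lg G d z + L) <= sm bump (fun z => lg G d z + L) z.
Proof.
move=> hG d0 u0; pose u z := lg G d z + L.
have bu : bm u by apply: bmD; [exact: bm_lg|exact: bm_cst].
have bk := pb_bump; have pk := pb_sm z bk bu u0.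
have tp : 0 < 2 * pi :> R by rewrite mulr_gt0 ?pi_gt0.
rewrite -(ler_pM2l tp) -lee_fin [(2 * pi * sm _ _ _)%:E]EFinM /sm -pintE //.
pose g (v : 'I_1 -> R[i]) : \bar R := (bump (v ord0) * u (lmul (ez (v ord0)) z))%:E.
have bg : cbor g by case: pk.
have g0 y : (0 <= g y)%E by rewrite lee_fin mulr_ge0 //; [case: bk|exact: u0].
case: (pl) => mZ1 _ rot _ _.
have iA (x : R) (f : ('I_1 -> R[i]) -> \bar R) : cbor f -> (forall v, 0 <= f v)%E ->
  (\int[mu]_w f (csc (circ 1 x) (Z1 w)) = \int[mu]_w f (Z1 w))%E.
 move=> bf f0; rewrite -(rot ord0 (circ 1 x) f) //; last by rewrite cabs_circ normr1.
 by apply: eq_integral => w _; congr f; apply/funext => k; rewrite (ord1 k).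
have [-> mc] := circ_avg mZ1 (A := fun x : R => csc (circ 1 x)) (@cmeas_csc R 1) iA bg g0.
have bz := pbZ (u0 z) bk.
have -> : 2 * pi * (pint bump * (lg G d z + L)) = 2 * pi * pint (fun x => (lg G d z + L) * bump x).
 by rewrite pintZ // [pint bump * _]mulrC.
rewrite EFinM -(pintE bz) -ge0_integralZl_EFin //; last 3 first.
- by move=> w _; rewrite lee_fin; case: bz.
- exact: mpb bz.
- exact: ltW.
apply: ge0_le_integral => //.
- by move=> w _; rewrite mule_ge0 ?lee_fin ?(ltW tp) //; case: bz.
- by apply: emeasurable_funM; [exact: mcst|exact: mpb bz].
move=> w _; pose gam k (y : R[i]) := cexp (rc (rho * th k) * (y * ze w)) * z k.
have eg k : entire (gam k).
 apply: entireM; last exact: entire_cst.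
 apply: (entire_comp (f := fun y => rc (rho * th k) * (y * ze w))); last exact: entire_cexp.
 apply: entireM; first exact: entire_cst.
 by apply: entireM; [exact: entire_id|exact: entire_cst].
have cc : continuous (fun _ : R => L) by move=> x; exact: cvg_cst.
have lc := lg_circ_cont (r := 1) hG d0 eg.
have ca : continuous (fun x : R => lg G d (fun k => gam k (circ 1 x)) + L).
 by move=> x; apply: cvgD; [exact: lc|exact: cc].
have cb : continuous (fun x : R => bump (ze w) * (lg G d (fun k => gam k (circ 1 x)) + L)).
 by move=> x; apply: cvgM; [exact: cvg_cst|exact: ca].
have -> : (fun x : R => g (csc (circ 1 x) (Z1 w))) = (fun x : R => (bump (ze w) * (lg G d (fun k => gam k (circ 1 x)) + L))%:E).
 by apply/funext => x; rewrite /g /csc /bump cabsM cabs_circ normr1 mul1r.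
rewrite cint_itg // itgZ // itgD // itg_cst ?Npi_le_pi // -EFinM lee_fin.
have := lgm_ge0 hG d0 eg ltr01; rewrite /lgm.
have -> : (fun k => gam k 0) = z by apply/funext => k; rewrite /gam mul0r mulr0 cexp0 mul1r.
move=> h; rewrite mulrA [X in X <= _]mulrC ler_wpM2l //; first by case: bk.
by rewrite mulrDr; apply: lerD => //; apply: eqW; ring.
Qed.

Lemma smD k u v z : pb k -> bm u -> (forall z, 0 <= u z) -> bm v -> (forall z, 0 <= v z) ->
 sm k (fun z => u z + v z) z = sm k u z + sm k v z.
Proof.
move=> bk bu u0 bv v0; rewrite /sm -pintD; [|exact: pb_sm|exact: pb_sm].
by congr pint; apply/funext => x; rewrite mulrDr.
Qed.

Lemma smZ k u (c : R) z : pb k -> bm u -> (forall z, 0 <= u z) -> 0 <= c ->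
 sm k (fun z => c * u z) z = c * sm k u z.
Proof.
move=> bk bu u0 c0; rewrite /sm -pintZ //; last exact: pb_sm.
by congr pint; apply/funext => x; rewrite mulrCA.
Qed.

Lemma sm_cst k (c : R) z : pb k -> 0 <= c -> sm k (fun=> c) z = c * pint k.
Proof. by move=> bk c0; rewrite /sm -pintZ //; congr pint; apply/funext => x; rewrite mulrC. Qed.

(** In the parameter x the rotation is the translation by i s, which may be moved from [u] to the
    kernel; there it costs at most [s] on the disc of radius 2, by the Lipschitz bound. *)
Lemma sm_shift u (s : R) z : bm u -> (forall z, 0 <= u z) -> 0 <= s -> s <= 1 ->
 `|sm bump u (lmul (fun k => circ 1 (rho * s * th k)) z) - sm bump u z| <= s * sm disc u z.
Proof.
move=> bu u0 s0 s1; pose y : R[i] := 'i%C * rc s.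
have cy : cabs y = s by rewrite cabsM cabs_real ger0_norm // /cabs /= expr0n expr1n add0r sqrtr1 mul1r.
pose k1 x := bump (x - y).
have [b0 [K bK] bs bb] := pb_bump.
have bk1 : pb k1.
 split; [by move=> x; exact: b0|by exists K => x; exact: bK| |].
  move=> x hx; rewrite /k1 /bump max_l // subr_le0.
  by have := cabs_dist x y; rewrite cy; move: hx s1; move: (cabs x) (cabs (x - y)) => *; lra.
 by apply: borel1P => d T x mx; apply: (borel1_meas bb); apply: cmeasD => //; exact: cmeas_cst.
have E : sm bump u (lmul (fun k => circ 1 (rho * s * th k)) z) = sm k1 u z.
 apply: EFin_inj; rewrite {2}/sm -(pint_shift y (pb_sm z bk1 bu u0)) /sm -pintE; last first.
  by apply: pb_sm => //; exact: pb_bump.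
 apply: eq_integral => w _; rewrite /k1 addrAC subrr add0r; congr (_ * u _)%:E.
 apply/funext => k; rewrite /lmul /ez mulrA; congr (_ * _).
 by rewrite mulrDr addrC cexpD -cexp_imag; congr (_ * cexp _); rewrite /y /rc !rmorphM /=; ring.
have bD := pb_disc; have bB := pb_bump; have pD := pb_sm z bD bu u0.
have k1E x : k1 x <= bump x + s * disc x.
 rewrite /disc; case: ltP => hx.
  by rewrite mulr1 addrC -lerBlDr (le_trans (bump_lip _ _)) // addrAC subrr add0r cabsN cy.
 by case: bk1 => _ _ h _; rewrite h // mulr0 addr0.
have k1E' x : bump x <= k1 x + s * disc x.
 rewrite /disc; case: ltP => hx.
  by rewrite mulr1 addrC -lerBlDr (le_trans (bump_lip _ _)) // opprB addrC subrK cy.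
 by rewrite bs // mulr0 addr0; case: bk1.
have cmp k k' : pb k -> pb k' -> (forall x, k x <= k' x + s * disc x) -> sm k u z <= sm k' u z + s * sm disc u z.
 move=> bk bk' h; have pk' := pb_sm z bk' bu u0.
 rewrite /sm -pintZ // -pintD //; last exact: pbZ.
 apply: pint_le; [exact: pb_sm|by apply: pbD => //; exact: pbZ|].
 by move=> x; rewrite mulrA -mulrDl ler_wpM2r.
have c1 := cmp _ _ bk1 bB k1E; have c2 := cmp _ _ bB bk1 k1E'.
by rewrite E ler_norml; move: c1 c2; move: (sm k1 u z) (sm bump u z) (s * _) => *; apply/andP; split; lra.
Qed.

Lemma arith1 (x y u g e kk : R) : x + (y + g * kk) = u + e * kk -> x = u + e * kk - y - g * kk.
Proof. lra. Qed.
Lemma arith2 (kk q0 W0 V0 e g sw sv : R) :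
 kk * (q0 * W0 + e - V0 - g) - (q0 * sw + e * kk - sv - g * kk) = (sv - kk * V0) - q0 * (sw - kk * W0).
Proof. by ring. Qed.
Lemma arith3 (x y : R) : 0 <= x -> 0 <= y -> - (x + y) <= y - x <= x + y.
Proof. by move=> *; apply/andP; split; lra. Qed.
Lemma arith4 (E kk M X L : R) : E <= kk * (X + L) -> E - kk * (M + L) <= kk * (X - M).
Proof. lra. Qed.
Lemma arith5 (q0 x y kk u v0 : R) : 0 <= q0 -> x <= kk * u -> y <= kk * v0 -> q0 * x + y <= kk * (q0 * u + v0).
Proof. by move=> h /(ler_wpM2l h) h1 h2; rewrite mulrDr [kk * (q0 * _)]mulrCA; exact: lerD. Qed.
Lemma arith6 (x X Y y : R) : x - y = (x - X) + ((X - Y) + (Y - y)).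
Proof. by ring. Qed.
Lemma arith7 (C0 q0 x x' y y' : R) : 0 <= q0 -> x <= x' -> y' <= y -> C0 + q0 * x - y <= C0 + q0 * x' - y'.
Proof. by move=> h /(ler_wpM2l h) h1 h2; apply: lerB => //; rewrite lerD2l. Qed.
Lemma arith8 (x y kk M N s0 : R) : y <= kk * M -> s0 * x <= N -> y + (s0 * x + y) <= 2 * kk * M + N.
Proof. lra. Qed.

Section Modulus.
Local Opaque lg sm mt Esph.
Variables (I1 I2 : finType) (F : I1 -> Cn R p -> R[i]) (Psi : I2 -> Cn R p -> R[i]).
Variables (da db C q t s : R).
Hypotheses (hF : forall i, hol (F i)) (hPsi : forall i, hol (Psi i)) (da0 : 0 < da) (db0 : 0 < db).
Hypotheses (q0 : 0 <= q) (t0 : 0 < t) (s0 : 0 <= s) (s1 : s <= 1) (b0 : 0 <= b).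
Notation w := (lg F da).
Notation v := (lg Psi db).
Let a z : R := C + q * w z - v z.
Hypothesis a0 : forall z, 0 <= a z.
Notation mw := (mt P Z F da).
Notation mv := (mt P Z Psi db).
Let T := t * expR (b * rho * 2).
Let T' := t * expR (- (b * rho * 2)).

Let bw : bm w. Proof. exact: bm_lg. Qed.
Let bv : bm v. Proof. exact: bm_lg. Qed.
Let ba : bm a. Proof. by apply: bmB => //; apply: bmD; [exact: bm_cst|exact: bmZ]. Qed.
Let L1 := `|ln da|.
Let L2 := `|ln db| + `|C|.
Let w1 z := w z + L1.
Let v1 z := v z + L2.
Let w10 z : 0 <= w1 z.
Proof.
rewrite /w1 -lerBlDr sub0r (le_trans _ (lg_ge F z da0)) // lerNl /L1 -normrN; exact: ler_norm.
Qed.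
Let v10 z : 0 <= v1 z.
Proof.
rewrite /v1 -lerBlDr sub0r (le_trans _ (lg_ge Psi z db0)) // lerNl /L2 -normrN (le_trans (ler_norm _)) //.
by rewrite lerDl.
Qed.
Let bw1 : bm w1. Proof. by apply: bmD => //; exact: bm_cst. Qed.
Let bv1 : bm v1. Proof. by apply: bmD => //; exact: bm_cst. Qed.
Let k := pint bump.
Let H z := q * (sm bump w1 z - k * w1 z) + (sm bump v1 z - k * v1 z).

(** Both smoothing errors are nonnegative by subharmonicity, so the error for the difference [a] is
    at most their sum. The constants [L1] and [L2] serve to make the two logarithms nonnegative. *)
Let Hle z : `|k * a z - sm bump a z| <= H z.
Proof.
have bB := pb_bump.
have hw := sm_submean z hF da0 w10; have hv := sm_submean z hPsi db0 v10.
have CL : 0 <= C + L2.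
 by rewrite /L2 addrCA addr_ge0 //; have := ler_norm (- C); rewrite normrN; move: C `|C| => x y; lra.
have L10 : 0 <= L1 by exact: normr_ge0.
have e : sm bump (fun z => a z + (v1 z + q * L1)) z = sm bump (fun z => q * w1 z + (C + L2)) z.
 by congr (sm bump _ z); apply/funext => y; rewrite /a /v1 /w1; ring.
have bc (c : R) : bm (fun _ : Cn R p => c) by exact: bm_cst.
have qL : 0 <= q * L1 by exact: mulr_ge0.
have bvq : bm (fun z => v1 z + q * L1) by exact: bmD.
have vq0 y : 0 <= v1 y + q * L1 by exact: addr_ge0.
have bwq : bm (fun z => q * w1 z) by exact: bmZ.
have wq0 y : 0 <= q * w1 y by exact: mulr_ge0.
move: e; rewrite (smD z bB ba a0 bvq vq0) (smD z bB bv1 v10 (bc _) (fun=> qL)) (sm_cst z bB qL).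
rewrite (smD z bB bwq wq0 (bc _) (fun=> CL)) (smZ z bB bw1 w10 q0) (sm_cst z bB CL) => e.
have e2 : a z = q * w1 z + (C + L2) - v1 z - q * L1 by rewrite /a /v1 /w1; ring.
have hw' := ler_wpM2l q0 hw.
have -> : k * a z - sm bump a z = (sm bump v1 z - k * v1 z) - q * (sm bump w1 z - k * w1 z).
 have -> : sm bump a z = q * sm bump w1 z + (C + L2) * k - sm bump v1 z - q * L1 * k.
  exact: arith1 e.
 by rewrite e2; exact: arith2.
rewrite ler_norml /H; have x0 : 0 <= q * (sm bump w1 z - k * w1 z) by rewrite mulr_ge0 // subr_ge0.
have y0 : 0 <= sm bump v1 z - k * v1 z by rewrite subr_ge0.
exact: arith3.
Qed.

Let bsw1 : bm (sm bump w1). Proof. by apply: bm_sm => //; exact: pb_bump. Qed.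
Let bsv1 : bm (sm bump v1). Proof. by apply: bm_sm => //; exact: pb_bump. Qed.
Let bsa : bm (sm bump a). Proof. by apply: bm_sm => //; exact: pb_bump. Qed.
Let bH : bm H.
Proof. by apply: bmD; [apply: bmZ|]; apply: bmB => //; exact: bmZ. Qed.

Let mlg_bounds (I : finType) (G : I -> Cn R p -> R[i]) (d : R) x : (forall i, hol (G i)) -> 0 < d -> cabs x < 2 ->
 mt P Z G d T' <= Ex (fun z => lg G d (lmul (ez x) (csc (rc t) z))) <= mt P Z G d T.
Proof.
move=> hG d0 /ltW x2.
have -> : Ex (fun z => lg G d (lmul (ez x) (csc (rc t) z))) = mlg P Z G d (fun j => ez x j * rc t).
 by congr Ex; apply/funext => z; congr lg; apply/funext => j; rewrite /lmul /csc mulrA.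
have tt : cabs (rc t) = t by rewrite cabs_real gtr0_norm.
have bd j := cabs_ez_bound j x2.
apply/andP; split; apply: (mlg_mono mod hG d0) => j.
- by rewrite cabs_real normr_gt0 mulf_neq0 // gt_eqF ?expR_gt0.
- by rewrite cabs_real /T' gtr0_norm ?mulr_gt0 ?expR_gt0 // cabsM tt mulrC ler_wpM2r ?(ltW t0) //; case/andP: (bd j).
- by rewrite cabsM tt mulr_gt0 // cabs_gt0 cexp_neq0.
- by rewrite cabs_real /T gtr0_norm ?mulr_gt0 ?expR_gt0 // cabsM tt [leRHS]mulrC ler_wpM2r ?(ltW t0) //; case/andP: (bd j).
Qed.

Let ExH : Ex (fun z => H (csc (rc t) z)) <= k * (q * (mw T - mw t) + (mv T - mv t)).
Proof.
have bB := pb_bump.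
have key (I : finType) (G : I -> Cn R p -> R[i]) (d L : R) : (forall i, hol (G i)) -> 0 < d ->
  (forall z, 0 <= lg G d z + L) ->
  Ex (fun z => sm bump (fun z => lg G d z + L) (csc (rc t) z) - k * (lg G d (csc (rc t) z) + L))
   <= k * (mt P Z G d T - mt P Z G d t).
 move=> hG d0 u0; have bl := bm_lg hG d0.
 have bu : bm (fun z => lg G d z + L) by apply: bmD => //; exact: bm_cst.
 have bs : bm (sm bump (fun z => lg G d z + L)) by exact: bm_sm.
 have b1 : bm (fun z => lg G d (csc (rc t) z)) := bm_csc (rc t) bl.
 have b2 : bm (fun z => lg G d (csc (rc t) z) + L) := bm_csc (rc t) bu.
 rewrite (ExB mod (bm_csc (rc t) bs) (bmZ k b2)) (ExZ mod _ b2).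
 rewrite (ExD mod b1 (bm_cst L)) (Ex_cst P Z) -mtE.
 have := Ex_sm (t := t) (X := mt P Z G d T + L) bB bu u0 _; rewrite -/k => h.
 have {h} h : Ex (fun z => sm bump (fun z => lg G d z + L) (csc (rc t) z)) <= k * (mt P Z G d T + L).
  apply: h => x x2; have b3 : bm (fun z => lg G d (lmul (ez x) (csc (rc t) z))) := bm_csc (rc t) (bm_lmul (ez x) bl).
  rewrite (ExD mod b3 (bm_cst L)) (Ex_cst P Z) lerD2r.
  by case/andP: (mlg_bounds hG d0 x2).
 exact: arith4 h.
have kw := key _ _ _ _ hF da0 w10; have kv := key _ _ _ _ hPsi db0 v10.
have c1 : bm (fun z => sm bump w1 (csc (rc t) z) - k * w1 (csc (rc t) z)) by apply: bmB; [exact: bm_csc|apply: bmZ; exact: bm_csc].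
have c2 : bm (fun z => sm bump v1 (csc (rc t) z) - k * v1 (csc (rc t) z)) by apply: bmB; [exact: bm_csc|apply: bmZ; exact: bm_csc].
rewrite /H (ExD mod (bmZ q c1) c2) (ExZ mod q c1).
exact: arith5 q0 kw kv.
Qed.

(** The difference passes through the smoothings at both points. The two smoothing errors are
    controlled by the growth of the means from [t] to [T], and the shift of the smoothing by [s]
    times the mean of [a] near the radius [t]. *)
Lemma modulus : k * Ex (fun z => `|a (lmul (fun j => circ 1 (rho * s * th j)) (csc (rc t) z)) - a (csc (rc t) z)|) <=
 2 * k * (q * (mw T - mw t) + (mv T - mv t)) + s * (pint disc * (C + q * mw T - mv T')).
Proof.
pose lam : Cn R p := fun j => circ 1 (rho * s * th j); rewrite -/lam.
have k0 : 0 <= k := ltW pint_bump_gt0.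
have lam1 j : cabs (lam j) = 1 by rewrite cabs_circ normr1.
have lc z : lmul lam (csc (rc t) z) = csc (rc t) (lmul lam z) by apply/funext => j; rewrite /lmul /csc mulrCA.
have bsd : bm (sm disc a) by apply: bm_sm => //; exact: pb_disc.
have bHt : bm (fun z => H (csc (rc t) z)) by exact: bm_csc.
have bHl : bm (fun z => H (csc (rc t) (lmul lam z))) by exact: (bm_lmul lam bHt).
have bst : bm (fun z => s * sm disc a (csc (rc t) z)) by apply: bmZ; exact: bm_csc.
have bdif : bm (fun z => `|a (lmul lam (csc (rc t) z)) - a (csc (rc t) z)|).
 apply/bm_abs/bmB; last exact: bm_csc.
 by under eq_fun do rewrite lc; exact: (bm_lmul lam (bm_csc (rc t) ba)).
rewrite -(ExZ mod k bdif).
apply: (@le_trans _ _ (Ex (fun z => H (csc (rc t) (lmul lam z)) + (s * sm disc a (csc (rc t) z) + H (csc (rc t) z))))).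
 apply: (Ex_le mod); [exact: bmZ|by apply: bmD => //; exact: bmD|].
 move=> z _; rewrite -{1}(ger0_norm k0) -normrM mulrBr lc; set x := csc _ (lmul _ _); set y := csc _ z.
 have h1 := Hle x; have h3 := sm_shift y ba a0 s0 s1.
 have e : lmul (fun j => circ 1 (rho * s * th j)) y = x by rewrite /y lc.
 rewrite e in h3.
 rewrite (arith6 _ (sm bump a x) (sm bump a y)).
 rewrite (le_trans (ler_normD _ _)) // lerD // (le_trans (ler_normD _ _)) // lerD //.
 by rewrite distrC.
rewrite (ExD mod bHl (bmD bst bHt)) (ExD mod bst bHt) (ExZ mod s (bm_csc (rc t) bsd)) (Ex_lmul mod bHt lam1).
have hd : Ex (fun z => sm disc a (csc (rc t) z)) <= pint disc * (C + q * mw T - mv T').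
 apply: Ex_sm => //; first exact: pb_disc.
 move=> x x2; have /andP[_ hw] := mlg_bounds hF da0 x2; have /andP[hv _] := mlg_bounds hPsi db0 x2.
 have cw : bm (fun z => w (lmul (ez x) (csc (rc t) z))) := bm_csc (rc t) (bm_lmul (ez x) bw).
 have cv : bm (fun z => v (lmul (ez x) (csc (rc t) z))) := bm_csc (rc t) (bm_lmul (ez x) bv).
 rewrite /a (ExB mod (bmD (bm_cst C) (bmZ q cw)) cv) (ExD mod (bm_cst C) (bmZ q cw)) (Ex_cst P Z) (ExZ mod q cw).
 exact: arith7 q0 hw hv.
have hE := ExH; have hs := ler_wpM2l s0 hd.
exact: arith8 hE hs.
Qed.

End Modulus.
End Smoothing.
End PlaneMeans.

(** * Uniqueness on the torus *)

Section Uniqueness.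
Context {R : realType}.
Implicit Types (x y z : R[i]).

Lemma entire_circle_zero (f : R[i] -> R[i]) : entire f -> (forall z, cabs z = 1 -> f z = 0) -> forall z, f z = 0.
Proof.
move=> ef f1.
have real g (a : R) : entire g -> (forall z, cabs z = 1 -> g z = 0) -> 0 < a -> g (rc a) = 0.
 move=> eg g1 a0; have a1 : a < a + 1 by rewrite ltrDl.
 apply: (coef_zero eg a0 a1) => k; rewrite (coef_const k eg (lt_trans a0 a1) ltr01); apply: cabs_le0.
 by apply: le_trans (coef_bound k (M := 0) eg ltr01 _) _ => [z /g1 ->|]; rewrite ?cabs0 // mul0r mulr0.
move=> z; have [->|z0] := eqVneq z 0.
 apply/eqP; rewrite -cabs_eq0; apply: contraT; rewrite cabs_eq0 -cabs_gt0 => f0.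
 have [d d0 /(_ (rc (d / 2)))] := cdf_cca (ef 0) f0.
 rewrite real ?divr_gt0 // sub0r cabsN subr0 cabs_real ger0_norm ?divr_ge0 ?ltW //; lra.
have [x _ zx] := polar z.
rewrite zx circE; apply: (real (fun y => f (y * circ 1 x)) (cabs z)).
- by apply: (entire_comp (f := fun y => y * circ 1 x)) => //; apply: entireM; [exact: entire_id|exact: entire_cst].
- by move=> y y1; apply: f1; rewrite cabsM y1 cabs_circ normr1 mulr1.
- by rewrite cabs_gt0.
Qed.

(** Coordinates are freed from the unit circle one at a time, by the identity theorem in one
    variable. *)
Lemma torus_zero p (G : Cn R p -> R[i]) : hol G ->
 (forall th : 'I_p -> R, G (fun k => circ 1 (th k)) = 0) -> forall z : Cn R p, G z = 0.
Proof.
move=> hG G0.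
have H n : (n <= p)%N -> forall z : Cn R p, (forall k : 'I_p, (n <= k)%N -> cabs (z k) = 1) -> G z = 0.
 elim: n => [_ z z1|n IH hn z z1].
  have ex k : exists x : R, z k = circ 1 x by have [x _] := polar (z k); rewrite z1 // => ->; exists x.
  have [th hth] := choice ex; have -> : z = (fun k => circ 1 (th k)) by apply/funext.
  exact: G0.
 pose j := Ordinal hn; pose gam k (y : R[i]) := if k == j then y else z k.
 have eg k : entire (gam k) by rewrite /gam; case: eqP => _; [exact: entire_id|exact: entire_cst].
 case: (hG) => _ /(_ gam eg) e _.
 have -> : z = (fun k => gam k (z j)) by apply/funext => k; rewrite /gam; case: eqP => // ->.
 apply: (entire_circle_zero e) => y y1; apply: (IH (ltnW hn)) => k nk.
 rewrite /gam; case: eqP => // kj; apply: z1; rewrite ltn_neqAle nk andbT.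
 by apply/eqP => nk'; apply: kj; apply/val_inj.
by move=> z; apply: (H p (leqnn p)) => k; rewrite leqNgt ltn_ord.
Qed.

End Uniqueness.

Section DeterminantPoints.
Context {K : fieldType}.

(** Points are added one by one. While the rank is below [h], a column of the cokernel is a nonzero
    combination of the functions that vanishes at all points chosen; independence supplies a point
    where it does not. *)
Lemma det_points (X : Type) (h : nat) (f : 'I_h -> X -> K) :
 (forall c : 'I_h -> K, (forall x, \sum_i c i * f i x = 0) -> forall i, c i = 0) ->
 exists x : 'I_h -> X, \det (\matrix_(k, i) f i (x k)) != 0.
Proof.
move=> ind.
have H n : (n <= h)%N -> exists x : 'I_n -> X, \rank (\matrix_(k < n, i < h) f i (x k)) = n.
 elim: n => [_|n IH hn].
  by exists (fun k : 'I_0 => match k with Ordinal _ lt => False_rect X (notF lt) end); apply/eqP; rewrite -leqn0 rank_leq_row.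
 have [x hx] := IH (ltnW hn); set M := \matrix_(_, _) _ in hx.
 have : cokermx M != 0 by rewrite -mxrank_eq0 mxrank_coker hx -lt0n subn_gt0.
 case/matrix0Pn => i0 [j0 cn].
 have [y hy] : exists y, \sum_i cokermx M i j0 * f i y != 0.
  apply: contrapT => /forallNP hy; move/eqP: cn; apply.
  by apply: (ind (fun i => cokermx M i j0)) => y; apply/eqP; apply: contrapT => /negP; exact: hy.
 pose x' (k : 'I_n.+1) := if unlift ord_max k is Some k' then x k' else y.
 exists x'; set M' := \matrix_(_, _) _.
 pose v : 'rV_h := \row_i f i y.
 have sub1 : (M <= M')%MS.
  apply/row_subP => k; have -> : row k M = row (lift ord_max k) M'.
   by apply/rowP => i; rewrite !mxE /x' liftK.
  exact: row_sub.
 have sub2 : (v <= M')%MS.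
  have -> : v = row ord_max M' by apply/rowP => i; rewrite !mxE /x' unlift_none.
  exact: row_sub.
 have nv : ~~ (v <= M)%MS.
  rewrite submxE; apply/eqP => /rowP/(_ j0); rewrite !mxE => vM; move/eqP: hy; apply.
  by rewrite -[RHS]vM; apply: eq_bigr => i _; rewrite !mxE mulrC.
 apply/eqP; rewrite eqn_leq rank_leq_row /= -{1}hx.
 have : (M < M')%MS by rewrite /ltmx sub1 /=; apply: contra nv => h1; exact: submx_trans h1.
 by rewrite ltmxErank => /andP[].
have [x hx] := H h (leqnn h); exists x.
by rewrite -unitfE -unitmxE -row_free_unit /row_free hx.
Qed.

End DeterminantPoints.

(** * Numerical estimates for the choice of radii and shift *)

Section Arithmetic.
Variable R : realType.
Implicit Types (x y z : R).

Lemma slope_arith (mT mt mr l mu e X B : R) : mT <= mt + e / l * (mr - mt) -> - B <= mt -> mt <= mr ->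
 0 < mu -> mu <= l -> 0 <= e -> mr <= X -> mT - mt <= e / mu * (X + B).
Proof.
move=> h h1 h2 mu0 hmu e0 hX.
have h4 : e / l <= e / mu by rewrite ler_wpM2l // lef_pV2 // posrE; lra.
have h5 : 0 <= e / l by rewrite divr_ge0 //; lra.
have h6 : e / l * (mr - mt) <= e / mu * (X + B) by apply: ler_pM => //; lra.
lra.
Qed.

(** The radius t exp(2 b rho) is at logarithmic distance e = 2 b rho from [t]. This [rho] makes e/mu
    equal to d1/(4 (1 + Y)), small against the growth of the means, and keeps the new radius below
    [r]. *)
Lemma radius_arith (b mu d1 Y rho t r : R) : 1 <= b -> 0 <= Y -> 0 < mu -> mu <= 1 -> 0 < d1 -> d1 <= 1 / 2 ->
 rho = d1 * mu / (8 * b * (1 + Y)) -> 2 <= t -> t < r -> mu <= ln r - ln t ->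
 [/\ 0 < rho, 0 < b * rho * 2, b * rho * 2 / mu = d1 / 4 / (1 + Y),
   (t < t * expR (b * rho * 2)) && (t * expR (b * rho * 2) < r) &
   ln (t * expR (b * rho * 2)) - ln t = b * rho * 2 /\ 1 <= t * expR (- (b * rho * 2))].
Proof.
move=> b1 Y0 mu0 mu1 d10 d11 rhoE t2 tr hmu.
have b0 : 0 < b by lra.
have Y1 : 0 < 1 + Y by lra.
have rho0 : 0 < rho by rewrite rhoE divr_gt0 ?mulr_gt0.
have e0 : 0 < b * rho * 2 by rewrite !mulr_gt0.
have eE : b * rho * 2 / mu = d1 / 4 / (1 + Y).
 by rewrite rhoE; field; rewrite !gt_eqF.
have em : b * rho * 2 <= mu / 8.
 have -> : b * rho * 2 = mu * (b * rho * 2 / mu) by field; rewrite gt_eqF.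
 rewrite eE ler_wpM2l ?(ltW mu0) // ler_pdivrMr //; lra.
have t0 : 0 < t by lra.
have tT : t < t * expR (b * rho * 2) by rewrite ltr_pMr // expR_gt1.
have lT : ln (t * expR (b * rho * 2)) - ln t = b * rho * 2 by rewrite lnM ?posrE ?expR_gt0 // expRK; ring.
split => //.
 by rewrite tT /= -ltr_ln ?posrE ?mulr_gt0 ?expR_gt0 //; lra.
split => //.
have h := expR_ge1Dx (- (b * rho * 2)); have h' : 1 / 2 <= expR (- (b * rho * 2)) by lra.
have h2 : 2 * (1 / 2) <= t * expR (- (b * rho * 2)) by apply: ler_pM => //; lra.
lra.
Qed.

(** By convexity the combined growth of the means is at most 1/4, so the smoothing errors contribute
    at most [kb]; the shift 1/(1 + Y) brings the remaining term down to [kd]. The result no longer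
    involves the radii. *)
Lemma oscillation_arith (kb kd X' C1 u Fr FT Ft vT vt vT2 B d1 Y : R) : 0 <= u -> 0 <= B -> 0 <= C1 ->
 0 < kb -> 0 <= kd -> 0 < d1 -> d1 <= 1 / 2 ->
 Y = u * Fr + C1 + u * B + B -> 0 <= Y -> FT <= Fr -> - B <= vT2 ->
 FT - Ft <= d1 / 4 / (1 + Y) * (Fr + B) -> vT - vt <= d1 / 4 / (1 + Y) * (C1 + u * Fr + B) ->
 kb * X' <= 2 * kb * (u * (FT - Ft) + (vT - vt)) + (1 + Y)^-1 * (kd * (C1 + u * FT - vT2)) ->
 X' <= 1 + kd / kb.
Proof.
move=> u0 B0 C10 kb0 kd0 d10 d11 YE Y0 mT hv sF sv hX.
have Y1 : 0 < 1 + Y by lra.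
have uB : 0 <= u * B by rewrite mulr_ge0.
have k1 : u * (FT - Ft) + (vT - vt) <= 1 / 4.
 apply: (@le_trans _ _ (d1 / 4 / (1 + Y) * (u * (Fr + B) + (C1 + u * Fr + B)))).
  by rewrite [leRHS]mulrDr lerD // [leRHS]mulrCA ler_wpM2l.
 rewrite mulrAC ler_pdivrMr //.
 apply: (@le_trans _ _ (d1 / 4 * (2 * Y))).
  apply: ler_wpM2l; first by rewrite divr_ge0 // ltW.
  rewrite YE !mulrDr; lra.
 have : d1 * Y <= 1 / 2 * Y by rewrite ler_wpM2r.
 lra.
have k2 : (1 + Y)^-1 * (kd * (C1 + u * FT - vT2)) <= kd.
 rewrite mulrC ler_pdivrMr // ler_wpM2l // YE.
 have : u * FT <= u * Fr by rewrite ler_wpM2l.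
 lra.
have k3 : kb * X' <= kb + kd.
 apply: le_trans hX _; apply: lerD k2.
 have := ler_wpM2l (ltW kb0) k1; lra.
have -> : 1 + kd / kb = (kb + kd) / kb by field; rewrite gt_eqF.
by rewrite ler_pdivlMr // mulrC.
Qed.

Lemma shift_arith (b mu d1 Y d0 c : R) : 1 <= b -> 0 <= Y -> 0 < mu -> mu <= 1 -> 0 < d1 -> d1 < d0 ->
 c = d1 * mu / (8 * b * (1 + Y)) * (1 + Y)^-1 ->
 [/\ 0 < c, c < d0 & ln c = ln d1 - ln (8 * b) + ln mu - 2 * ln (1 + Y)].
Proof.
move=> b1 Y0 mu0 mu1 d10 d1d ->.
have b0 : 0 < b by lra.
have b8 : 0 < 8 * b by lra.
have Y1 : 0 < 1 + Y by lra.
have -> : d1 * mu / (8 * b * (1 + Y)) * (1 + Y)^-1 = d1 * mu / (8 * b * ((1 + Y) * (1 + Y))).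
 by field; rewrite !gt_eqF //; lra.
split; first by rewrite divr_gt0 ?mulr_gt0 ?exprn_gt0.
 apply: le_lt_trans d1d; rewrite ler_pdivrMr ?mulr_gt0 // ler_pM2l //.
 apply: le_trans mu1 _; rewrite -[leLHS]mulr1; apply: ler_pM => //; first lra.
 by rewrite -[leLHS]mulr1; apply: ler_pM => //; lra.
have Y2 : 0 < (1 + Y) * (1 + Y) by rewrite mulr_gt0.
rewrite ln_div ?posrE ?(mulr_gt0 d10 mu0) ?(mulr_gt0 b8 Y2) // (lnM d10 mu0) (lnM b8 Y2) (lnM Y1 Y1); ring.
Qed.

Lemma final_arith (kap k0 M0 le lc ld lb lm L L' mD A Q NN SC X0 : R) : 0 <= kap * k0 -> 0 <= NN -> 0 <= SC -> 0 <= X0 ->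
 M0 - kap * (M0 - (le + k0 * lc)) <= mD -> lc = ld - lb + lm - 2 * L -> 0 <= L -> lm <= 0 -> L <= L' ->
 Q = - M0 + kap * (M0 - le - k0 * (ld - lb)) ->
 - mD + (A + (NN + SC)) <= A + (`|Q| + NN + SC + 2 * (kap * k0) + X0) * (1 + L' - lm).
Proof.
move=> kk N0 S0 X00 hD lcE L0 lm0 LL QE.
have h1 : - mD <= Q + kap * k0 * (2 * L - lm).
 have -> : Q + kap * k0 * (2 * L - lm) = - (M0 - kap * (M0 - (le + k0 * lc))) by rewrite QE lcE; ring.
 by rewrite lerN2.
have h2 : kap * k0 * (2 * L - lm) <= kap * k0 * (2 * (L' - lm)) by rewrite ler_wpM2l //; lra.
have h3 : 0 <= (`|Q| + NN + SC + X0) * (L' - lm) by rewrite mulr_ge0 //; [rewrite !addr_ge0|lra].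
have h4 := ler_norm Q.
have -> : (`|Q| + NN + SC + 2 * (kap * k0) + X0) * (1 + L' - lm) =
 `|Q| + NN + SC + X0 + 2 * (kap * k0) + (`|Q| + NN + SC + X0) * (L' - lm) + kap * k0 * (2 * (L' - lm)) by ring.
lra.
Qed.

Lemma log_arith (x y : R) : 0 <= x -> x <= y -> ln (1 + x) <= ln (1 + y).
Proof. by move=> x0 xy; rewrite ler_ln ?posrE ?lerD2l // ltr_wpDr // (le_trans x0). Qed.

End Arithmetic.

(** * Determinants of torus translates and the mean inequality *)

Section AnalyticMain.
Context {R : realType} {p : nat} {dd : measure_display} {W : measurableType dd}.
Variables (P : probability W R) (Z : W -> Cn R p).
Hypothesis mod : sphere_model P Z.
Notation Ex := (Esph P Z).

Lemma cont_cabs (G : Cn R p -> R[i]) : hol G -> cont (fun z => cabs (G z)).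
Proof. by move=> [c _ _] a e /(c a)[d d0 hd]; exists d => // z /hd; apply: le_lt_trans; exact: cabs_lip. Qed.

Lemma hol_bounded (G : Cn R p -> R[i]) (r : R) : hol G -> exists M : R, forall z, cvnorm z <= r -> cabs (G z) <= M.
Proof.
move=> /cont_cabs/(cont_bounded r)[M hM]; exists M => z /hM; exact: le_trans (ler_norm _).
Qed.

Lemma lg_bounded (I : finType) (G : I -> Cn R p -> R[i]) (r : R) : (forall i, hol (G i)) ->
 exists M : R, forall d z, 0 < d -> d <= 1 -> cvnorm z <= r -> lg G d z <= M.
Proof.
move=> hG; have [M hM] := choice (fun i => hol_bounded r (hG i)).
exists (ln (\sum_i `|M i| + 1)) => d z d0 d1 zr.
have S0 : 0 <= \sum_i `|M i| by rewrite sumr_ge0.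
rewrite /lg ler_ln ?posrE ?nfd_gt0 ?ltr_wpDl // (le_trans (nfd_le_sum _ _ _)) // gtr0_norm // lerD //.
by apply: ler_sum => i _; rewrite (le_trans (hM i z zr)) // ler_norm.
Qed.

Lemma mt1 (I : finType) (G : I -> Cn R p -> R[i]) d : mt P Z G d 1 = Ex (lg G d).
Proof. by rewrite mtE; congr Esph; apply/funext => z; congr lg; apply/funext => k; rewrite /csc /rc mul1r. Qed.

Lemma mt_lmul (I : finType) (G : I -> Cn R p -> R[i]) d t l : (forall i, hol (G i)) -> 0 < d ->
 (forall k, cabs (l k) = 1) -> Ex (fun z => lg G d (lmul l (csc (rc t) z))) = mt P Z G d t.
Proof.
move=> hG d0 l1; rewrite mtE -(Ex_lmul mod (bm_lg_csc hG d0 t) l1).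
by congr Esph; apply/funext => z; congr lg; apply/funext => j; rewrite /lmul /csc mulrCA.
Qed.

Lemma Ex_combine (T : finType) (H : nat) (g f : Cn R p -> R) (w : 'I_H -> Cn R p -> R)
  (e : T -> 'I_H -> Cn R p -> R) (c S m E : R) : bm g -> bm f -> (forall k, bm (w k)) -> (forall tau i, bm (e tau i)) ->
 (forall z, g z <= - f z + (c * \sum_k w k z + (\sum_tau \sum_i e tau i z + S))) ->
 (forall k, Ex (w k) = m) -> (forall tau i, Ex (e tau i) <= E) ->
 Ex g <= - Ex f + (c * H%:R * m + (\sum_(tau : T) \sum_(i : 'I_H) E + S)).
Proof.
move=> bg bf bw be hg hw he.
have bS : bm (fun z => \sum_k w k z) by apply: bm_sum.
have bc : bm (fun z => c * \sum_k w k z) by exact: bmZ.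
have bt tau : bm (fun z => \sum_i e tau i z) by apply: bm_sum.
have bT : bm (fun z => \sum_tau \sum_i e tau i z) by apply: bm_sum.
have bTS : bm (fun z => \sum_tau \sum_i e tau i z + S) by apply: bmD => //; exact: bm_cst.
have br : bm (fun z => c * \sum_k w k z + (\sum_tau \sum_i e tau i z + S)) by exact: bmD.
have bN : bm (fun z => - f z) by exact: bmN.
have bh : bm (fun z => - f z + (c * \sum_k w k z + (\sum_tau \sum_i e tau i z + S))) by exact: bmD.
apply: le_trans (Ex_le mod bg bh (fun z _ => hg z)) _.
rewrite (ExD mod bN br) (ExN mod bf) (ExD mod bc bTS) (ExZ mod _ bS) (ExD mod bT (bm_cst _)) Ex_cst.
rewrite (Ex_sum mod _ _ bw) (Ex_sum mod _ _ bt) (eq_bigr _ (fun k _ => hw k)) sumr_const card_ord -(mulr_natl m) mulrA.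
rewrite lerD2l lerD2l lerD2r; apply: ler_sum => tau _; rewrite (Ex_sum mod _ _ (be tau)).
by apply: ler_sum => i _; exact: he.
Qed.

Lemma mean_lower_uniform (I : finType) (G : I -> Cn R p -> R[i]) i a : (forall i, hol (G i)) -> G i a != 0 ->
 exists2 B : R, 0 <= B & forall d t, 0 < d -> d <= 1 -> 1 <= t -> - B <= mt P Z G d t.
Proof.
move=> hG Ga; have [kap k0 hk] := mean_lower mod a.
have [M hM] := lg_bounded (2 * cvnorm a + 1) hG.
pose B := kap * (M - ln (cabs (G i a))) - M; exists `|B| => // d t d0 d1 t1.
apply: (@le_trans _ _ (mt P Z G d 1)); last exact: (mt_mono mod).
have e := mt1 G d.
have := hk I G d M hG d0 (fun z zr => hM d z d0 d1 zr); rewrite -e; apply: le_trans.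
have : ln (cabs (G i a)) <= lg G d a.
 by rewrite /lg ler_ln; [exact: nfd_ge_comp|rewrite posrE cabs_gt0|rewrite posrE nfd_gt0].
move=> /(ler_wpM2l (ltW k0)) h; have := ler_norm B; rewrite /B !mulrBr => hB.
rewrite lerNl opprB; apply: le_trans hB; move: h; move: (kap * M) (kap * ln _) (kap * lg _ _ _) => *; lra.
Qed.

(** Leibniz expansion, each term being replaced by that of the permutation with the largest
    product. *)
Lemma det_bound (h : nat) (N : 'M[R[i]]_h) (e : 'I_h -> 'I_h -> R) : (forall i k, cabs (N i k) <= e i k) ->
 exists s : 'S_h, cabs (\det N) <= (h`!)%:R * \prod_i e i (s i).
Proof.
move=> hN; pose f (s : 'S_h) := \prod_i e i (s i).
have e0 i k : 0 <= e i k by apply: le_trans (hN i k); exact: cabs_ge0.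
have [s _ hs] := @arg_maxP _ _ _ (1%g : 'S_h) xpredT f isT.
exists s; rewrite /determinant; apply: le_trans (cabs_sum _ _ _) _.
apply: (@le_trans _ _ (\sum_(s' : 'S_h) f s)).
 apply: ler_sum => s' _; apply: le_trans (hs s' isT); rewrite cabsM cabs_prod.
 have -> : cabs ((-1) ^+ s' : R[i]) = 1 by rewrite cabsX cabsN cabs1 expr1n.
 by rewrite mul1r; apply: ler_prod => i _; rewrite cabs_ge0 hN.
by rewrite sumr_const -cardsE cardsT card_Sn mulr_natl.
Qed.

Section MainInequality.
Variables (I : finType) (F : I -> Cn R p -> R[i]) (H u : nat) (Phi : 'I_H -> Cn R p -> R[i]).
Variables (T : finType) (A : T -> 'M[R[i]]_H) (K : R).
Hypotheses (hF : forall i, hol (F i)) (hPhi : forall i, hol (Phi i)) (uA : forall tau, A tau \in unitmx).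
Hypotheses (K0 : 0 <= K) (PhiF : forall i z, cabs (Phi i z) <= K * nfd F 0 z ^+ u).

Definition psi tau i z := \sum_j A tau i j * Phi j z.
(** [psi] has degree [u] in [F], so it is regularized by d^u: then [vlg] stays below u times the
    regularized log |F| up to a constant free of [d]. *)
Definition vlg tau i (d : R) := lg (uf (psi tau i)) (d ^+ u).

Let K1 := \sum_tau \sum_i \sum_j cabs (A tau i j) * K.
Let K10 : 0 <= K1.
Proof. by do 3!(apply: sumr_ge0 => ? _); rewrite mulr_ge0 ?cabs_ge0. Qed.

Lemma hol_psi tau i : hol (psi tau i).
Proof. by apply: hol_sum => j; apply: holM => //; exact: hol_cst. Qed.

Let C1 := ln (K1 + 1).
Let C10 : 0 <= C1. Proof. by apply: ln_ge0; rewrite lerDr. Qed.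

Let psi_bound tau i z : cabs (psi tau i z) <= K1 * nfd F 0 z ^+ u.
Proof.
have n0 : 0 <= nfd F 0 z ^+ u by rewrite exprn_ge0 // sqrtr_ge0.
apply: le_trans (cabs_sum _ _ _) _; apply: (@le_trans _ _ ((\sum_j cabs (A tau i j) * K) * nfd F 0 z ^+ u)).
 rewrite mulr_suml; apply: ler_sum => j _; rewrite cabsM -mulrA.
 by rewrite ler_wpM2l ?cabs_ge0.
apply: ler_wpM2r => //; rewrite /K1 [leRHS](bigD1 tau) //= [X in _ <= X + _](bigD1 i) //= -addrA lerDl.
by rewrite addr_ge0 //; do ?(apply: sumr_ge0 => ? _); rewrite mulr_ge0 ?cabs_ge0.
Qed.

Lemma vlg_le tau i d z : 0 < d -> vlg tau i d z <= C1 + u%:R * lg F d z.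
Proof.
move=> d0; have n0 := nfd_gt0 F z d0; have du : 0 < d ^+ u by rewrite exprn_gt0.
have K2 : 0 < K1 + 1 by rewrite ltr_wpDl.
rewrite /C1 /lg mulr_natl -lnXn // -lnM ?posrE ?exprn_gt0 // ler_ln ?posrE ?mulr_gt0 ?exprn_gt0 ?nfd_gt0 //.
apply: le_trans (nfd_le_sum _ _ _) _; rewrite gtr0_norm // mulrDl mul1r lerD //.
 rewrite (big_pred1 tt) => [|[] //]; apply: le_trans (psi_bound _ _ _) _.
 rewrite ler_wpM2l // lerXn2r ?nnegrE ?sqrtr_ge0 ?(ltW n0) //.
 by apply: nfd_le_d => //; exact: ltW.
by rewrite lerXn2r ?nnegrE ?(ltW d0) ?(ltW n0) // -{1}(gtr0_norm d0) nfd_ge.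
Qed.

(** The nonnegative difference of plurisubharmonic functions to which [modulus] will be applied. *)
Definition defect tau i d z := C1 + u%:R * lg F d z - vlg tau i d z.

Lemma defect_ge0 tau i d z : 0 < d -> 0 <= defect tau i d z.
Proof. by move=> d0; rewrite subr_ge0 vlg_le. Qed.

Section Pointwise.
Variable lam : 'I_H -> Cn R p.
Definition Dlam z := \det (\matrix_(k, i) Phi i (lmul (lam k) z)).

Lemma hol_Dlam : hol Dlam.
Proof.
apply: hol_sum => s; apply: holM; first exact: hol_cst.
apply: hol_prod => i; have := hol_lmul (lam i) (hPhi (s i)); congr hol.
by apply/funext => z; rewrite mxE.
Qed.

Definition C2 tau := ln ((cabs (\det (A tau)))^-1 * (H`!)%:R + 1) + H%:R * C1.

(** The determinant of the translates of the adapted family is det(A tau) times [Dlam], and some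
    permutation dominates its expansion. The term for [psi tau i] sits at the translate of index
    s(i); moving its defect back to [z] costs one oscillation, majorized by the sum over all
    translates so that the permutation drops out. *)
Lemma pointwise tau d z : 0 < d -> \sum_i (u%:R * lg F d z - vlg tau i d z) <=
 - lg (uf Dlam) ((d ^+ u) ^+ H) z + u%:R * \sum_k lg F d (lmul (lam k) z)
 + \sum_i \sum_k `|defect tau i d (lmul (lam k) z) - defect tau i d z| + C2 tau.
Proof.
move=> d0; have du : 0 < d ^+ u by rewrite exprn_gt0.
have duH : 0 < (d ^+ u) ^+ H by rewrite exprn_gt0.
pose e i k := expR (vlg tau i d (lmul (lam k) z)).
have eE i k : e i k = nfd (uf (psi tau i)) (d ^+ u) (lmul (lam k) z) by rewrite /e lnK // posrE nfd_gt0.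
pose N : 'M[R[i]]_H := \matrix_(i, k) psi tau i (lmul (lam k) z).
have [s hs] : exists s : 'S_H, cabs (\det N) <= (H`!)%:R * \prod_i e i (s i).
 apply: det_bound => i k; rewrite mxE eE.
 exact: (nfd_ge_comp (uf (psi tau i)) _ _ tt).
have dN : \det N = \det (A tau) * Dlam z.
 rewrite /Dlam -(det_tr (\matrix_(k, i) Phi i (lmul (lam k) z))) -det_mulmx; congr (\det _); apply/matrixP => i k; rewrite !mxE.
 by apply: eq_bigr => j _; rewrite !mxE.
have dA : 0 < cabs (\det (A tau)) by rewrite cabs_gt0 -unitfE -unitmxE.
have Pe : (d ^+ u) ^+ H <= \prod_i e i (s i).
 rewrite -[H in _ ^+ H]card_ord -prodr_const; apply: ler_prod => i _; rewrite ltW //=.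
 by rewrite eE -{1}(gtr0_norm du) nfd_ge.
have P0 : 0 < \prod_i e i (s i) by apply: lt_le_trans Pe.
have q0 : 0 <= (cabs (\det (A tau)))^-1 * (H`!)%:R by rewrite mulr_ge0 // invr_ge0 ltW.
have h1 : lg (uf Dlam) ((d ^+ u) ^+ H) z <= ln ((cabs (\det (A tau)))^-1 * (H`!)%:R + 1) + \sum_i vlg tau i d (lmul (lam (s i)) z).
 have -> : \sum_i vlg tau i d (lmul (lam (s i)) z) = ln (\prod_i e i (s i)).
  by rewrite /e -expR_sum expRK.
 rewrite -lnM ?posrE // ?ltr_wpDl // /lg ler_ln ?posrE ?nfd_gt0 ?mulr_gt0 ?ltr_wpDl //.
 apply: le_trans (nfd_le_sum _ _ _) _; rewrite gtr0_norm // mulrDl mul1r lerD //.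
 rewrite (big_pred1 tt) => [|[] //]; rewrite -mulrA ler_pdivlMl //.
 by rewrite -cabsM -dN.
have h2 i : vlg tau i d (lmul (lam (s i)) z) <= C1 + u%:R * lg F d (lmul (lam (s i)) z) - defect tau i d z
  + \sum_k `|defect tau i d (lmul (lam k) z) - defect tau i d z|.
 have h3 : `|defect tau i d (lmul (lam (s i)) z) - defect tau i d z| <=
   \sum_k `|defect tau i d (lmul (lam k) z) - defect tau i d z|.
  by rewrite (bigD1 (s i)) //= lerDl sumr_ge0.
 have h4 := le_trans (ler_norm _) h3; rewrite distrC in h3.
 have -> : vlg tau i d (lmul (lam (s i)) z) =
   C1 + u%:R * lg F d (lmul (lam (s i)) z) - defect tau i d (lmul (lam (s i)) z) by rewrite /defect; ring.
 have := le_trans (ler_norm _) h3; move: (C1 + _) (defect _ _ _ _) (defect _ _ _ _) (\sum_k _) => x y w v *; lra.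
have h5 : \sum_i vlg tau i d (lmul (lam (s i)) z) <= H%:R * C1 + u%:R * \sum_k lg F d (lmul (lam k) z)
  - \sum_i defect tau i d z + \sum_i \sum_k `|defect tau i d (lmul (lam k) z) - defect tau i d z|.
 apply: (@le_trans _ _ (\sum_i (C1 + u%:R * lg F d (lmul (lam (s i)) z) - defect tau i d z
  + \sum_k `|defect tau i d (lmul (lam k) z) - defect tau i d z|))).
  by apply: ler_sum => i _; exact: h2.
 have -> : \sum_k lg F d (lmul (lam k) z) = \sum_i lg F d (lmul (lam (s i)) z).
  exact: (reindex_inj (@perm_inj _ s)).
 by rewrite big_split lerD2r sumrB lerD2r big_split /= sumr_const card_ord (mulr_natl C1) mulr_sumr.
have h6 : \sum_i (u%:R * lg F d z - vlg tau i d z) <= \sum_i defect tau i d z.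
 by apply: ler_sum => i _; rewrite /defect -addrA lerDr.
have aux (x y w v t b c : R) : y <= c + x -> x <= t + w - v + b -> v <= - y + w + b + (c + t) by lra.
by apply: le_trans h6 _; exact: aux h1 h5.
Qed.

End Pointwise.

Lemma mt_slope (J : finType) (G : J -> Cn R p -> R[i]) (d B t r T' mu e X : R) : (forall j, hol (G j)) -> 0 < d ->
 - B <= mt P Z G d t -> 0 < t -> t < T' -> T' < r ->
 0 < mu -> mu <= ln r - ln t -> ln T' - ln t = e -> 0 <= e -> mt P Z G d r <= X ->
 mt P Z G d T' - mt P Z G d t <= e / mu * (X + B).
Proof.
move=> hG d0 hB t0 tT Tr mu0 hmu eE e0 hX.
have := mt_convex mod hG d0 t0 tT Tr; rewrite eE => h.
apply: slope_arith h hB _ mu0 hmu e0 hX.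
exact/(mt_mono mod)/(ltW (lt_trans tT Tr)).
Qed.

Hypothesis ind : forall c : 'I_H -> R[i], (forall z, \sum_i c i * Phi i z = 0) -> forall i, c i = 0.

Lemma psi_neq0 tau i : exists z, psi tau i z != 0.
Proof.
apply: contrapT => /forallNP h; have h0 : forall z, psi tau i z = 0 by move=> z; apply/eqP/negPn/negP; exact: h.
have e := congr1 (fun M : 'M[R[i]]_H => M i i) (mulmxV (uA tau)).
move: e; rewrite !mxE eqxx big1 => [/esym/eqP|j _]; first by rewrite oner_eq0.
by rewrite (ind h0) mul0r.
Qed.

Lemma exists_points : exists th : 'I_H -> 'I_p -> R, \det (\matrix_(k, i) Phi i (fun j => circ 1 (th k j))) != 0.
Proof.
apply: (det_points (f := fun i (th : 'I_p -> R) => Phi i (fun j => circ 1 (th j)))) => c hc.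
apply: ind; apply: torus_zero => //.
by apply: hol_sum => i; apply: holM => //; exact: hol_cst.
Qed.

(** With angles c theta_k the determinant at (1, ..., 1) is the value at c of an entire function of
    one variable, nonzero at 1; near 0 it is bounded below by a power of c. *)
Lemma det_lower (th : 'I_H -> 'I_p -> R) : \det (\matrix_(k, i) Phi i (fun j => circ 1 (th k j))) != 0 ->
 exists k0 (eta d : R), [/\ 0 < eta, 0 < d & forall c, 0 < c -> c < d ->
  eta * c ^+ k0 <= cabs (Dlam (fun k j => circ 1 (c * th k j)) (fun=> 1))].
Proof.
move=> D1; pose f y := \det (\matrix_(k, i) Phi i (fun j => cexp ('i%C * rc (th k j) * y))).
have ef : entire f.
 apply: entire_sum => s; apply: entireM; first exact: entire_cst.
 apply: entire_prod => k; have [_ /(_ (fun j y => cexp ('i%C * rc (th k j) * y))) + _] := hPhi (s k).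
 have e2 : forall j, entire (fun y => cexp ('i%C * rc (th k j) * y)).
  by move=> j; apply: entire_comp entire_cexp; apply: entireM; [exact: entire_cst|exact: entire_id].
 move=> /(_ e2); congr entire; apply/funext => y; by rewrite mxE.
have fE (c : R) : f c%:C = Dlam (fun k j => circ 1 (c * th k j)) (fun=> 1).
 congr (\det _); apply/matrixP => k i; rewrite !mxE; congr (Phi i _); apply/funext => j.
 rewrite /lmul mulr1 -cexp_imag /rc -mulrA; congr (cexp (_ * _)).
 by rewrite mulrC -rmorphM.
have f1 : f 1 != 0.
 rewrite -[1](rmorph1 (real_complex R)) fE; apply: contra_neq D1 => <-.
 congr (\det _); apply/matrixP => k i; rewrite !mxE; congr (Phi i _); apply/funext => j.
 by rewrite /lmul mulr1 mul1r.
have [k0 [eta [d [e0 d0 h]]]] := entire_pos_lower ef f1.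
by exists k0, eta, d; split => // c c0 cd; rewrite -fE; exact: h.
Qed.

Lemma Dlam_upper (r : R) : exists M : R, forall lam d z, (forall k j, cabs (lam k j) = 1) -> 0 < d -> d <= 1 -> cvnorm z <= r ->
 lg (uf (Dlam lam)) d z <= M.
Proof.
have [M hM] := choice (fun i => hol_bounded r (hPhi i)).
pose S := \sum_i `|M i|; have S0 : 0 <= S by rewrite sumr_ge0.
exists (ln (H`!%:R * S ^+ H + 1)) => lam d z lam1 d0 d1 zr.
rewrite /lg ler_ln ?posrE ?nfd_gt0 ?ltr_wpDl ?mulr_ge0 ?exprn_ge0 // (le_trans (nfd_le_sum _ _ _)) // gtr0_norm // lerD //.
rewrite (big_pred1 tt) => [|[] //].
have [|s hs] := @det_bound _ (\matrix_(k, i) Phi i (lmul (lam k) z)) (fun _ _ => S).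
 move=> k i; rewrite mxE /S (bigD1 i) //= -[leLHS]addr0 lerD ?sumr_ge0 //.
 apply: le_trans (ler_norm _); apply: hM; apply: le_trans (cvnorm_lmul_le _ ler01 _) _; last by rewrite mul1r.
 by move=> j; rewrite lam1.
by apply: le_trans hs _; rewrite prodr_const card_ord.
Qed.

Lemma mean_Dlam_lower (kap M0 c eta : R) k0 lam d (a : Cn R p) t : 0 <= kap -> 0 < d -> 1 <= t -> 0 < eta -> 0 < c ->
 eta * c ^+ k0 <= cabs (Dlam lam a) ->
 M0 - kap * (M0 - lg (uf (Dlam lam)) d a) <= Ex (lg (uf (Dlam lam)) d) ->
 M0 - kap * (M0 - (ln eta + k0%:R * ln c)) <= mt P Z (uf (Dlam lam)) d t.
Proof.
move=> kap0 d0 t1 eta0 c0 hc h; apply: le_trans (mt_mono mod _ d0 ltr01 t1); last by move=> _; exact: hol_Dlam.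
rewrite mt1; apply: le_trans h; rewrite lerD2l lerN2 ler_wpM2l // lerD2l lerN2 mulr_natl -lnXn // -lnM ?posrE ?exprn_gt0 //.
rewrite /lg ler_ln ?posrE ?nfd_gt0 ?mulr_gt0 ?exprn_gt0 //; apply: le_trans hc _.
exact: (nfd_ge_comp (uf (Dlam lam)) _ _ tt).
Qed.

Lemma bm_defect tau i d : 0 < d -> bm (defect tau i d).
Proof.
move=> d0; apply: bmB; last by apply: bm_lg => //; rewrite ?exprn_gt0 // => _; exact: hol_psi.
by apply: bmD; [exact: bm_cst|apply: bmZ; exact: bm_lg].
Qed.

Section Choice.
Context {d1' : measure_display} {Z1 : measurableType d1'} (mu1 : {sigma_finite_measure set Z1 -> \bar R}) (zc : Z1 -> 'I_1 -> R[i]).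
Hypothesis pl : euclid_model mu1 zc.
Local Notation kd := (pint mu1 zc disc).
Local Notation kb := (pint mu1 zc bump).
Local Opaque lg mt Esph.

(** The translation is a product of two explicit small parameters: [rho], which keeps the smoothing
    errors small, and 1/(1 + Y), which offsets the mean of the defect. They are explicit because
    their logarithm is the price in the lower bound of the determinant. *)
Lemma oscillation tau i (th : 'I_p -> R) (b B d t r mu d1 : R) : (forall k, `|th k| <= b) -> 1 <= b -> 0 <= B ->
 0 < d -> (forall s, 1 <= s -> - B <= mt P Z F d s) ->
 (forall s, 1 <= s -> - B <= mt P Z (uf (psi tau i)) (d ^+ u) s) ->
 2 <= t -> 0 < mu -> mu <= 1 -> t < r -> mu <= ln r - ln t -> 0 < d1 -> d1 <= 1 / 2 ->
 let Y := u%:R * mt P Z F d r + C1 + u%:R * B + B in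
 let rho := d1 * mu / (8 * b * (1 + Y)) in
 0 <= Y /\ Ex (fun z => `|defect tau i d (lmul (fun j => circ 1 (rho * (1 + Y)^-1 * th j)) (csc (rc t) z)) - defect tau i d (csc (rc t) z)|)
  <= 1 + kd / kb.
Proof.
move=> thb b1 B0 d0 hBF hBp t2 mu0 mu1' tr hmu d10 d11 Y rho.
have du : 0 < d ^+ u by rewrite exprn_gt0.
have u0 : 0 <= u%:R :> R by [].
have t1 : 1 <= t by apply: le_trans t2; rewrite ler1n.
have t0 : 0 < t := lt_le_trans ltr01 t1.
have r1 : 1 <= r := le_trans t1 (ltW tr).
have Y0 : 0 <= Y.
 have h : 0 <= u%:R * (mt P Z F d r + B) by rewrite mulr_ge0 // -lerBlDr sub0r hBF.
 rewrite /Y; have -> : u%:R * mt P Z F d r + C1 + u%:R * B + B = u%:R * (mt P Z F d r + B) + C1 + B by ring.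
 by rewrite !addr_ge0.
split => //.
have [rho0 e0 eE /andP[tT Tr] [lT T1]] := radius_arith b1 Y0 mu0 mu1' d10 d11 (erefl rho) t2 tr hmu.
move: tT Tr lT T1; set T' := t * expR _; set T'' := t * expR _ => tT Tr lT T1.
have hP j : hol ((uf (psi tau i)) j) by exact: hol_psi.
have bv : mt P Z (uf (psi tau i)) (d ^+ u) r <= C1 + u%:R * mt P Z F d r.
 have bF : bm (fun z => lg F d (csc (rc r) z)) by exact: bm_lg_csc.
 rewrite !mtE -(ExZ mod) // -[C1](Ex_cst P Z) -(ExD mod) //; [|exact: bm_cst|exact: bmZ].
 apply: (Ex_le mod); [exact: bm_lg_csc|apply: bmD; [exact: bm_cst|exact: bmZ]|].
 by move=> z _; exact: vlg_le.
have sF := mt_slope hF d0 (hBF t t1) t0 tT Tr mu0 hmu lT (ltW e0) (lexx _).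
have sv := mt_slope hP du (hBp t t1) t0 tT Tr mu0 hmu lT (ltW e0) bv.
have i0 : 0 <= (1 + Y)^-1 by rewrite invr_ge0 addr_ge0.
have i1 : (1 + Y)^-1 <= 1 by rewrite invf_le1 ?lerDl // ltr_wpDr.
have := @modulus _ _ _ mu1 zc pl _ _ _ P Z mod th rho b rho0 thb _ _ F (uf (psi tau i)) d (d ^+ u) C1 u%:R t (1 + Y)^-1
  hF hP d0 du u0 t0 i0 i1 (fun z => defect_ge0 tau i z d0).
rewrite -/T' -/T'' => hX.
have kd0 : 0 <= kd := pint_ge0 pl (pb_disc).
have mT : mt P Z F d T' <= mt P Z F d r by apply: (mt_mono mod) (ltW Tr) => //; exact: lt_trans t0 tT.
rewrite eE in sF sv.
exact: (oscillation_arith u0 B0 C10 (pint_bump_gt0 pl) kd0 d10 d11 (erefl Y) Y0 mT (hBp T'' T1) sF sv hX).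
Qed.

(** [C0] is chosen before [d], [t] and [r]; uniformity in [d] allows the limit d -> 0. The ordering
    may depend on the point, since the majorant of [pointwise] is made independent of it by summing
    the oscillations over all orderings. *)
Theorem main_inequality i0 a0 : F i0 a0 != 0 ->
 exists2 C0 : R, 0 <= C0 & forall (d t r : R) (g : Cn R p -> R), 0 < d -> d <= 1 -> 2 <= t -> t < r -> bm g ->
  (forall z, exists tau, g z <= \sum_i (u%:R * lg F d z - vlg tau i d z)) ->
  Ex (fun z => g (csc (rc t) z)) <= (u * H)%:R * mt P Z F d t
   + C0 * (1 + ln (1 + (u%:R * mt P Z F d r + C0)) - ln (Num.min (ln r - ln t) 1)).
Proof.
move=> Fa; have [Bw Bw0 hBw] := mean_lower_uniform hF Fa.
have exB (x : T * 'I_H) : exists B : R, 0 <= B /\ forall d s, 0 < d -> d <= 1 -> 1 <= s -> - B <= mt P Z (fun _ : unit => psi x.1 x.2) d s.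
 have [z hz] := psi_neq0 x.1 x.2.
 have [B ? ?] := @mean_lower_uniform _ (fun _ : unit => psi x.1 x.2) tt z (fun _ => hol_psi x.1 x.2) hz.
 by exists B.
have [Bv hBv] := choice exB.
pose B := Bw + \sum_x Bv x.
have sB : 0 <= \sum_x Bv x by apply: sumr_ge0 => x _; case: (hBv x).
have B0 : 0 <= B by rewrite addr_ge0.
have BwB : Bw <= B by rewrite lerDl.
have BvB x : Bv x <= B.
 by rewrite /B (bigD1 x) //= addrCA lerDl addr_ge0 // sumr_ge0 // => y _; case: (hBv y).
have [th Dth] := exists_points.
have [k0 [eta [d0' [eta0 d00 hdet]]]] := det_lower Dth.
pose b := 1 + \sum_k \sum_j `|th k j|.
have b1 : 1 <= b by rewrite lerDl; apply: sumr_ge0 => k _; apply: sumr_ge0.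
have thb k j : `|th k j| <= b.
 rewrite /b (bigD1 k) //= (bigD1 j) //= addrCA -addrA lerDl.
 by rewrite !addr_ge0 // ?sumr_ge0 // => k' _; apply: sumr_ge0.
have [kap kap0 hkap] := mean_lower mod (fun=> 1).
have [M0 hM0] := Dlam_upper (2 * cvnorm (fun _ : 'I_p => 1 : R[i]) + 1).
(* Below [d0'] for the lower bound of the determinant, and at most 1/2 for the estimates on the
   radii. *)
pose d1 := Num.min 1 d0' / 2.
have d10 : 0 < d1 by rewrite divr_gt0 // lt_min ltr01.
have d1h : d1 <= 1 / 2 by rewrite ler_pM2r ?invr_gt0 // ge_min lexx.
have d1d : d1 < d0'.
 have : Num.min 1 d0' <= d0' by rewrite ge_min lexx orbT.
 by rewrite /d1; lra.
pose kk : R := 1 + kd / kb.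
have kb0 := pint_bump_gt0 pl; have kd0 : 0 <= kd := pint_ge0 pl pb_disc.
have kk0 : 0 <= kk by rewrite /kk addr_ge0 // divr_ge0 // ltW.
have C20 tau : 0 <= C2 tau.
 by rewrite /C2 addr_ge0 ?mulr_ge0 // ln_ge0 // lerDr mulr_ge0 // invr_ge0 cabs_ge0.
pose SC := \sum_tau C2 tau; have SC0 : 0 <= SC by apply: sumr_ge0.
pose NN : R := \sum_(tau : T) \sum_(i : 'I_H) \sum_(k : 'I_H) kk.
have NN0 : 0 <= NN by rewrite /NN; do 3!apply: sumr_ge0 => ? _.
pose X0 := C1 + u%:R * B + B; have X00 : 0 <= X0 by rewrite !addr_ge0 ?mulr_ge0.
pose Q := - M0 + kap * (M0 - ln eta - k0%:R * (ln d1 - ln (8 * b))).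
exists (`|Q| + NN + SC + 2 * (kap * k0%:R) + X0); first by rewrite !addr_ge0 ?mulr_ge0 // ltW.
move=> d t r g d0 dle1 t2 tr bg hg.
have t0 : 0 < t by apply: lt_le_trans t2.
have t1 : 1 <= t by apply: le_trans t2; rewrite ler1n.
have r0 := lt_trans t0 tr.
set mu := Num.min _ _.
have mu0 : 0 < mu by rewrite /mu lt_min ltr01 subr_gt0 ltr_ln ?posrE // tr.
have mu1' : mu <= 1 by rewrite ge_min lexx orbT.
have hmu : mu <= ln r - ln t by rewrite ge_min lexx.
have bB tau i s : 1 <= s -> - B <= mt P Z (uf (psi tau i)) (d ^+ u) s.
 move=> s1; apply: (@le_trans _ _ (- Bv (tau, i))); first by rewrite lerN2.
 by have [_ h] := hBv (tau, i); apply: h => //; rewrite ?exprn_gt0 // exprn_ile1 // ltW.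
have bF s : 1 <= s -> - B <= mt P Z F d s.
 by move=> s1; apply: (@le_trans _ _ (- Bw)); [rewrite lerN2|exact: hBw].
have osc tau i k := oscillation (thb k) b1 B0 d0 bF (bB tau i) t2 mu0 mu1' tr hmu d10 d1h.
pose Y := u%:R * mt P Z F d r + C1 + u%:R * B + B.
pose rho := d1 * mu / (8 * b * (1 + Y)).
(* The shift is of order mu/(1 + Y)^2, so that - ln c is a constant plus 2 ln(1 + Y) - ln mu. *)
pose c := rho * (1 + Y)^-1.
pose lam k j := circ 1 (c * th k j).
have lam1 k j : cabs (lam k j) = 1 by rewrite cabs_circ normr1.
have Y0 : 0 <= Y.
 have h : 0 <= u%:R * (mt P Z F d r + B).
  by rewrite mulr_ge0 // -lerBlDr sub0r bF // (le_trans t1) // ltW.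
 rewrite /Y; have -> : u%:R * mt P Z F d r + C1 + u%:R * B + B = u%:R * (mt P Z F d r + B) + C1 + B by ring.
 by rewrite !addr_ge0.
have [c0 cd lnc] := shift_arith b1 Y0 mu0 mu1' d10 d1d (erefl c).
have d20 : 0 < (d ^+ u) ^+ H by rewrite !exprn_gt0.
have d21 : (d ^+ u) ^+ H <= 1 by rewrite !exprn_ile1 // ?exprn_ge0 // ltW.
have mDt := mean_Dlam_lower (ltW kap0) d20 t1 eta0 c0 (hdet c c0 cd)
 (hkap _ (uf (Dlam lam)) ((d ^+ u) ^+ H) M0 (fun _ => hol_Dlam lam) d20 (fun z zr => hM0 lam _ z lam1 d20 d21 zr)).
pose df tau i z : R := \sum_k `|defect tau i d (lmul (lam k) z) - defect tau i d z|.
have bdf1 tau i k : bm (fun z => `|defect tau i d (lmul (lam k) z) - defect tau i d z|).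
 by apply/bm_abs/bmB; [apply: bm_lmul|]; exact: bm_defect.
have bdf tau i : bm (df tau i) by apply: bm_sum.
have edf tau i : Ex (fun z => df tau i (csc (rc t) z)) <= \sum_(k : 'I_H) kk.
 rewrite (Ex_sum mod _ _ (fun k => bm_csc (rc t) (bdf1 tau i k))).
 by apply: ler_sum => k _; have [_] := osc tau i k.
have gh z : g z <= - lg (uf (Dlam lam)) ((d ^+ u) ^+ H) z + (u%:R * \sum_k lg F d (lmul (lam k) z)
  + (\sum_tau \sum_i df tau i z + SC)).
 have [tau htau] := hg z; apply: le_trans htau _; apply: le_trans (pointwise lam _ _ d0) _.
 rewrite -!addrA !lerD2l lerD // /SC.
  by rewrite [leRHS](bigD1 tau) //= lerDl; apply: sumr_ge0 => t' _; apply: sumr_ge0 => i _; apply: sumr_ge0.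
 by rewrite (bigD1 tau) //= lerDl sumr_ge0.
have Eh := Ex_combine (bm_csc (rc t) bg) (bm_lg_csc (fun _ => hol_Dlam lam) d20 t)
 (fun k => bm_csc (rc t) (bm_lmul (lam k) (bm_lg hF d0))) (fun tau i => bm_csc (rc t) (bdf tau i))
 (fun z => gh (csc (rc t) z)) (fun k => mt_lmul t hF d0 (lam1 k)) edf.
apply: le_trans Eh _; rewrite natrM.
have hL : ln (1 + Y) <= ln (1 + (u%:R * mt P Z F d r + (`|Q| + NN + SC + 2 * (kap * k0%:R) + X0))).
 have e0 : 0 <= `|Q| + NN + SC + 2 * (kap * k0%:R) by rewrite !addr_ge0 ?mulr_ge0 // ltW.
 apply: log_arith Y0 _; rewrite /Y /X0.
 by move: e0; move: (_ + 2 * (_ * _)) (u%:R * mt _ _ _ _ _) => x y x0; lra.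
have L0 : 0 <= ln (1 + Y) by rewrite ln_ge0 // lerDl.
exact: (final_arith _ (mulr_ge0 (ltW kap0) (ler0n R k0)) NN0 SC0 X00 mDt lnc L0 (ln_le0 mu1') hL (erefl Q)).
Qed.

End Choice.
End MainInequality.
End AnalyticMain.

(** * Iterated integrals of functions with infinite negative part *)

Section SignedIntegral.
Context {R : realType}.
Local Notation leb := (@lebesgue_measure R).
Local Open Scope ereal_scope.

(** If the integral of [H] is infinite, so is that of the negative part of the difference, while its
    positive part is at most [a] and integrable; both sides are then -oo. *)
Lemma integral_sub d (T : measurableType d) (mu : {measure set T -> \bar R}) (a : T -> R) (H : T -> \bar R) :
 mu.-integrable setT (EFin \o a) -> (forall x, (0 <= a x)%R) -> mfun H -> (forall x, 0 <= H x) ->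
 \int[mu]_x ((a x)%:E - H x) = \int[mu]_x (a x)%:E - \int[mu]_x H x.
Proof.
move=> ia a0 mH H0; have ma := measurable_int _ ia; have a0' x : 0 <= (a x)%:E by rewrite lee_fin.
have [Hoo|Hoo] := ltP (\int[mu]_x H x) +oo.
 rewrite -integralB //=; apply/integrableP; split => //.
 by under eq_integral do rewrite gee0_abs //.
have HE : \int[mu]_x H x = +oo by apply/eqP; rewrite eq_le leey Hoo.
have af : \int[mu]_x (a x)%:E < +oo.
 have /integrableP[_] := ia; under eq_integral do rewrite gee0_abs ?lee_fin //; exact.
rewrite HE addeC /= integralE; set f := (fun x => _ - _).
have mf : mfun f by apply: emeasurable_funB.
have fp : \int[mu]_x f^\+ x < +oo.
 apply: le_lt_trans af; apply: ge0_le_integral => //.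
 - exact: measurable_funepos.
 - move=> x _; rewrite funeposE /f ge_max lee_fin a0 andbT.
  by move: (H0 x); case: (H x) => [r|_|//]; rewrite ?leNye // lee_fin => r0; rewrite -EFinB lee_fin gerBl.
have fn : \int[mu]_x f^\- x = +oo.
 apply/eqP; rewrite eq_le leey /= leNgt; apply/negP => fn.
 have : \int[mu]_x H x <= \int[mu]_x (f^\- x + (a x)%:E).
  apply: ge0_le_integral => //.
  - by apply: emeasurable_funD => //; exact: measurable_funeneg.
  - move=> x _; rewrite funenegE /f; move: (H0 x); case: (H x) => [r|_|//].
    rewrite lee_fin => r0; rewrite -EFinB -EFinN -EFin_max -EFinD lee_fin.
    by rewrite opprB -lerBlDr le_max lexx.
   by rewrite /= maxye ?leNye.
 have -> : \int[mu]_x (f^\- x + (a x)%:E) = \int[mu]_x f^\- x + \int[mu]_x (a x)%:E.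
  by apply: ge0_integralD => //; exact: measurable_funeneg.
 rewrite HE leye_eq => /eqP h; have : \int[mu]_x f^\- x + \int[mu]_x (a x)%:E < +oo by rewrite lte_add_pinfty.
 by rewrite h ltxx.
by rewrite fn; move: fp; case: (\int[mu]_x f^\+ x) => //; move: af (integral_ge0 _ (fun x _ => a0' x)); case: (\int[mu]_x (a x)%:E).
Qed.

Lemma meas_iint k (h : (nat -> R) -> \bar R) : ebor h -> (forall x, 0 <= h x) ->
 mfun (fun x : measurableTypeR R => iint k (fun s => h (consx x (nth 0%R s)))).
Proof.
move=> bh h0; have [d [W [mu [X [mX hX _]]]]] := @lebesgue_space R k.
have -> : (fun x : measurableTypeR R => iint k (fun s => h (consx x (nth 0%R s)))) = (fun x => \int[mu]_w h (consx x (X^~ w))).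
 apply/funext => x; rewrite (hX (fun y => h (consx x y))) // => d' T Y mY.
 apply: (bh _ _ (fun i t => consx x (Y^~ t) i)) => -[|i] /=; [exact: mcst|exact: mY].
apply: (@measurable_fun_fubini_tonelli_F _ _ _ W R mu (fun w : measurableTypeR R * W => h (consx w.1 (X^~ w.2)))) => //.
apply: (bh _ _ (fun i w => consx w.1 (X^~ w.2) i)) => -[|i] /=; first exact: measurable_fst.
by apply: measurableT_comp => //; exact: measurable_snd.
Qed.

Lemma iint_ge0 k (g : seq R -> \bar R) : (forall s, 0 <= g s) -> 0 <= iint k g.
Proof. by elim: k g => //= k IH g g0; apply: integral_ge0 => x _; exact: IH. Qed.

(** Tonelli does not apply to a signed integrand, but the difference is taken out of one integral at
    a time: the subtracted function is nonnegative and the other one is constant on a cube. *)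
Lemma iint_sub k (M : R) (h : (nat -> R) -> \bar R) : (0 <= M)%R -> ebor h -> (forall x, 0 <= h x) ->
 iint k (fun s => (if all (fun x => -1 < x < 1)%R s then M else 0%R)%:E - h (nth 0%R s)) =
 (M * 2 ^+ k)%:E - iint k (fun s => h (nth 0%R s)).
Proof.
elim: k M h => [|k IH] M h M0 bh h0; first by rewrite /= expr0 mulr1.
rewrite /=; pose a (x : R) : R := if (-1 < x < 1)%R then (M * 2 ^+ k)%R else 0%R.
pose H (x : measurableTypeR R) := iint k (fun s => h (consx x (nth 0%R s))).
have HE (x : R) : iint k (fun s => h (nth 0%R (x :: s))) = H x.
 by apply: iint_ext => s _; congr h; apply/funext => -[].
have a0 x : (0 <= a x)%R by rewrite /a; case: ifP => // _; rewrite mulr_ge0 ?exprn_ge0.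
have H0 x : 0 <= H x by exact: iint_ge0.
transitivity (\int[leb]_x ((a x)%:E - H x)).
 apply: eq_integral => x _; pose Mx := (if (-1 < x < 1)%R then M else 0)%R.
 have -> : (a x)%:E = (Mx * 2 ^+ k)%:E by rewrite /a /Mx; case: ifP; rewrite ?mul0r.
 have Mx0 : (0 <= Mx)%R by rewrite /Mx; case: ifP.
 have bx : ebor (fun y => h (consx x y)).
  by move=> d' T Y mY; apply: (bh _ _ (fun i t => consx x (Y^~ t) i)) => -[|i] /=; [exact: mcst|exact: mY].
 apply: etrans (IH Mx (fun y => h (consx x y)) Mx0 bx (fun y => h0 _)).
 apply: iint_ext => s _; congr (_ - _); last by congr h; apply/funext => -[].
 by rewrite /Mx; case: (_ < _ < _)%R; rewrite //=; case: ifP.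
have aE : EFin \o a = (fun x => (M * 2 ^+ k)%:E * (\1_(`]-1, 1[%classic) x)%:E).
 apply/funext => x; rewrite /= /a indicE; case: (boolP (x \in _)); rewrite ?inE ?notin_setE /= in_itv /=.
  by move=> ->; rewrite mule1.
 by move=> /negP/negbTE ->; rewrite mule0.
have i1 : leb.-integrable setT (fun x => (\1_(`]-1, 1[%classic : set R) x)%:E).
 apply: integrable_indic_itv; exact.
have ia : leb.-integrable setT (EFin \o a) by rewrite aE; exact: integrableZl.
rewrite integral_sub //; last exact: meas_iint.
congr (_ - _); last by apply: eq_integral => x _; rewrite HE.
rewrite -[LHS]/(\int[leb]_x ((EFin \o a) x)) aE integralZl //.
have -> : \int[leb]_x (\1_(`]-1, 1[%classic : set R) x)%:E = 2%:E.
 rewrite integral_indic // setIT; have := @lebesgue_measure_itv R `](-1)%R, 1%R[; rewrite /= lte_fin => ->.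
 have -> : (-1 < 1 :> R)%R by lra.
 by rewrite -EFinB; congr EFin; ring.
by rewrite -EFinM exprS; congr EFin; ring.
Qed.

Lemma average_arith (x M k : R) (a c rh : \bar R) : (0 <= M)%R -> 0 <= rh -> 0 <= c -> 0 <= a ->
 x%:E = M%:E * a + rh -> a * k%:E = 1 -> (M%:E * a + rh - (c + rh)) * k%:E = M%:E - c * k%:E.
Proof.
move=> M0; case: rh => [rh||] //; last first.
 move=> _ _ a0; have : (0 <= M%:E * a) by rewrite mule_ge0.
 by case: (M%:E * a).
case: a => [a||] // + + + _; last first.
 move=> _ _ _; case: (ltgtP k 0%R) => k0.
 - by rewrite lt0_mulye ?lte_fin.
 - by rewrite gt0_mulye ?lte_fin.
 - by rewrite k0 mule0 => -[/eqP]; rewrite eq_sym oner_eq0.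
move=> _ + a0; rewrite -EFinM => + [ak]; have k0 : (0 < k)%R.
 rewrite ltNge; apply/negP => k0; move: a0; rewrite lee_fin => a0.
 by have := mulr_ge0_le0 a0 k0; rewrite ak ler10.
case: c => [c||] // _.
 transitivity ((M * a + rh - (c + rh)) * k)%:E; first by [].
 rewrite -EFinM -EFinB; congr EFin; rewrite -[M in RHS]mulr1 -ak; ring.
by rewrite /= -EFinD gt0_mulye // addeC gt0_mulNye.
Qed.

End SignedIntegral.

(** * The characteristic function as a limit of regularized means *)

Section Characteristic.
Context {R : realType} {p : nat} {dd : measure_display} {W : measurableType dd}.
Variables (P : probability W R) (Z : W -> Cn R p).
Hypothesis mod : sphere_model P Z.
Hypothesis p0 : (0 < p)%N.
Notation Ex := (Esph P Z).

Lemma sphere_int_ext (r : R) (f g : Cn R p -> \bar R) : 0 <= r ->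
 (forall z, cvnorm z = r -> f z = g z) -> sphere_int p r f = sphere_int p r g.
Proof.
move=> r0 h; rewrite /sphere_int; congr (_ * _)%E; apply: iint_ext => s _.
case: ifP => // /andP[_ s0]; apply: h.
have -> : (fun k => Complex (r / cvnorm (pt_of_seq p s)) 0 * pt_of_seq p s k) = csc (rc (r / cvnorm (pt_of_seq p s))) (pt_of_seq p s) by [].
by rewrite cvnormZ /rc cabs_real ger0_norm ?divr_ge0 ?cvnorm_ge0 // mulfVK // gt_eqF.
Qed.

(** The logarithm is bounded above on a sphere but may be -oo, so it is written [M] minus a
    nonnegative function. This carries the signed iterated integral over to the probability
    space. *)
Lemma sphere_int_sub (r M : R) (G : Cn R p -> \bar R) : 0 <= M -> cbor G -> (forall z, 0 <= G z)%E ->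
 (sphere_int p r (fun z => M%:E - G z) = M%:E - \int[P]_w G (csc (rc r) (Z w)))%E.
Proof.
move=> M0 bG G0; have [d [U [mu [X [mX hX _]]]]] := @lebesgue_space R (2 * p).
have [_ _ sph _ _] := mod.
pose ball (z : Cn R p) := 0 < cvnorm z < 1; pose box := @cube R p (-1) 1.
pose pr (z : Cn R p) := csc (rc (r * expR (- ln (cvnorm z)))) z.
(* Putting [h] equal to [M] on the cube outside the ball makes the constant on the cube minus [h]
   equal to M - G on the ball and 0 elsewhere. The added part is [rest], which cancels at the
   end. *)
pose h x := if ball (pt x) then G (pr (pt x)) else if box x then M%:E else 0%E.
pose g1 x := if ball (pt x) then G (pr (pt x)) else 0%E.
pose one x : \bar R := if ball (pt x) then 1%E else 0%E.
pose rest x : \bar R := if ball (pt x) then 0%E else if box x then M%:E else 0%E.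
pose I (g : (nat -> R) -> \bar R) := (\int[mu]_w g (X^~ w))%E.
have mpt d' (T : measurableType d') (Y : nat -> T -> R) : (forall i, mfun (Y i)) ->
  forall k : 'I_p, cmeas (fun t => pt (p := p) (Y^~ t) k) by move=> mY k; split; exact: mY.
have mball d' (T : measurableType d') (Y : nat -> T -> R) : (forall i, mfun (Y i)) ->
  mfun (fun t => ball (pt (Y^~ t))).
 by move=> mY; exact: meas_dot (mpt _ _ _ mY).
have mbox := @meas_cube R p (-1) 1.
have ecst c : ebor (fun _ : nat -> R => c : \bar R) by move=> d' T Y mY; exact: mcst.
have eif (b : (nat -> R) -> bool) f g : (forall d' (T : measurableType d') (Y : nat -> T -> R), (forall i, mfun (Y i)) ->
  mfun (fun t => b (Y^~ t))) -> ebor f -> ebor g -> ebor (fun x => if b x then f x else g x).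
 by move=> mb bf bg d' T Y mY; apply: measurable_fun_ifT; [exact: mb|exact: bf|exact: bg].
have ePr : ebor (fun x => G (pr (pt x))).
 move=> d' T Y mY; apply: (bG _ _ (fun k t => pr (pt (Y^~ t)) k)) => i.
 apply: cmeasM; last exact: mpt.
 split => /=; last exact: mcst.
 by apply: measurable_funM; [exact: mcst|exact: meas_cvnormV (mpt _ _ _ mY)].
have eg1 : ebor g1 by apply: eif => //; exact: ecst.
have eone : ebor one by apply: eif => //; exact: ecst.
have eMb : ebor (fun x => if box x then M%:E else 0%E) by apply: eif => //; exact: ecst.
have erest : ebor rest by apply: eif => //; exact: ecst.
have eh : ebor h by apply: eif => //; exact: ecst.
have g10 x : (0 <= g1 x)%E by rewrite /g1; case: ifP.
have one0 x : (0 <= one x)%E by rewrite /one; case: ifP.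
have rest0 x : (0 <= rest x)%E by rewrite /rest; do 2?case: ifP.
have h0 x : (0 <= h x)%E by rewrite /h; do 2?case: ifP.
have ID f g : ebor f -> ebor g -> (forall x, 0 <= f x)%E -> (forall x, 0 <= g x)%E -> I (fun x => f x + g x)%E = (I f + I g)%E.
 by move=> ef eg f0 g0; apply: ge0_integralD => //; [exact: ef|exact: eg].
have Ih : I h = (I g1 + I rest)%E.
 rewrite -ID //; congr I; apply/funext => x; rewrite /h /g1 /rest; case: ifP => _; rewrite ?adde0 ?add0e //.
have prE z : ball z -> pr z = (fun k => Complex (r / cvnorm z) 0 * z k).
 by move=> /andP[z0 _]; apply/funext => k; rewrite /pr /csc expRN lnK.
have inbox x : ball (pt x) -> box x by move=> /andP[_ zr]; exact: ball_cube.
have IM : (M * 2 ^+ (2 * p))%:E = (M%:E * I one + I rest)%E.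
 rewrite -ge0_integralZl //; last by rewrite /=; exact: eone.
 rewrite -(ID (fun x => M%:E * one x)%E) //; first last.
 - by move=> x; rewrite mule_ge0.
 - by move=> d' T Y mY; apply: measurable_funeM; exact: eone.
 transitivity (M%:E * iint (2 * p) (fun s : seq R => if all (fun x => -1 < x < 1)%R s then 1%E else 0%E))%E.
  by rewrite iint_box //; have -> : (1 - -1 = 2 :> R) by ring.
 have -> : iint (2 * p) (fun s : seq R => if all (fun x => -1 < x < 1)%R s then 1%E else 0%E) = I (fun x => if box x then 1 else 0)%E.
  rewrite /I -(hX (fun x => if box x then 1 else 0)%E) //; first last.
  - by move=> x; case: ifP.
  - by apply: eif => //; exact: ecst.
  by apply: iint_ext => s ss; rewrite /box /cube (all_nth_iota (fun x => -1 < x < 1)).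
 rewrite -ge0_integralZl //; first last.
 - by move=> x _; case: ifP.
 - by apply: (eif box (fun=> 1%E) (fun=> 0%E)) => //; exact: ecst.
 apply: eq_integral => w _; rewrite /one /rest; case: (boolP (ball _)) => [/inbox ->|_]; first by rewrite adde0.
 by rewrite mule0 add0e; case: ifP; rewrite ?mule1 ?mule0.
have avgG (G' : Cn R p -> \bar R) : iint (2 * p) (fun s : seq R => let z := @pt_of_seq R p s in
   if ((cvnorm z < 1) && (0 < cvnorm z))%R then G' (fun k => Complex (r / cvnorm z) 0 * z k) else 0%E) =
  iint (2 * p) (fun s : seq R => if ball (pt (nth 0%R s)) then G' (pr (pt (nth 0%R s))) else 0%E).
 by apply: iint_ext => s _ /=; rewrite andbC -/(ball _); case: ifP => // /prE ->.
have S1 := sph r (fun=> 1%E) (cbor_cst 1%E) (fun _ => lee01).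
have := sph r G bG G0; rewrite /rc => <-; move: S1.
rewrite /sphere_int (avgG (fun=> 1%E)) (avgG G) (avgG (fun z => M%:E - G z)%E); rewrite integral_cst //= probability_setT mule1.
rewrite (hX _ eone one0) (hX _ eg1 g10) -/(I one) -/(I g1).
have -> : iint (2 * p) (fun s : seq R => if ball (pt (nth 0%R s)) then M%:E - G (pr (pt (nth 0%R s))) else 0)%E =
  (M%:E * I one + I rest - (I g1 + I rest))%E.
 have Ihx : iint (2 * p) (fun s => h (nth 0 s)) = I h := hX h eh h0.
 rewrite -IM -Ih -Ihx -iint_sub //; apply: iint_ext => s ss.
 have -> : all (fun x => -1 < x < 1) s = box (nth 0 s) by rewrite /box /cube (all_nth_iota (fun x => -1 < x < 1)).
 rewrite /h; case: (boolP (ball _)) => [/inbox -> //|_].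
 by case: ifP => _; rewrite ?subee ?sube0.
have Ige f : (forall x, 0 <= f x)%E -> (0 <= I f)%E by move=> f0; apply: integral_ge0 => w _; exact: f0.
have := Ige _ one0; have := Ige _ g10; have := Ige _ rest0; move: IM.
move: (I one) (I g1) (I rest) => a c rh IM rh0 c0 a0 akv.
exact: average_arith IM akv.
Qed.

Lemma lee_above (x y : \bar R) : (forall c : R, (x < c%:E)%E -> (y <= c%:E)%E) -> (y <= x)%E.
Proof.
case: x => [x||] h; rewrite ?leey //.
- by apply/lee_addgt0Pr => e e0; apply: h; rewrite lte_fin ltrDl.
- case: y h => [y||] // h; last by have := h 0 (ltNyr _); rewrite leye_eq.
 by have := h (y - 1) (ltNyr _); rewrite lee_fin => hy; exfalso; lra.
Qed.

Lemma subE_lt (M c : R) (g : \bar R) : (0 <= g)%E -> (M%:E - g < c%:E)%E = ((M - c)%:E < g)%E.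
Proof. by case: g => [g||] // _; rewrite -?EFinB ?lte_fin ?ltrBlDr ?ltrBlDl ?ltrBlDr //= ?ltNyr ?ltry // addrC. Qed.

Lemma subE_le (M c : R) (g : \bar R) : (0 <= g)%E -> (M%:E - g <= c%:E)%E = ((M - c)%:E <= g)%E.
Proof. by case: g => [g||] // _; rewrite -?EFinB ?lee_fin ?lerBlDr ?lerBlDl ?lerBlDr //= ?leNye ?leey // addrC. Qed.

Section ZeroLimit.
Variables (I : finType) (F : I -> Cn R p -> R[i]).
Hypothesis hF : forall i, hol (F i).

Definition dl n : R := (n.+1%:R)^-1.
Lemma dl_gt0 n : 0 < dl n. Proof. by rewrite invr_gt0. Qed.
Lemma dl_le1 n : dl n <= 1. Proof. by rewrite invf_le1 // ler1n. Qed.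
Lemma dl_anti m n : (m <= n)%N -> dl n <= dl m.
Proof. by move=> mn; rewrite lef_pV2 ?posrE // ler_nat ltnS. Qed.
Lemma dl_small (e : R) : 0 < e -> exists n, dl n < e.
Proof.
move=> e0; exists (Num.truncn e^-1); rewrite -[ltRHS]invrK ltf_pV2 ?posrE ?invr_gt0 //.
by rewrite truncnS_gt.
Qed.

Lemma lg_mono d d' z : 0 < d -> d <= d' -> lg F d z <= lg F d' z.
Proof.
move=> d0 dd'; rewrite /lg ler_ln ?posrE ?nfd_gt0 //; last exact: lt_le_trans dd'.
exact: nfd_le_d (ltW d0) dd'.
Qed.

Lemma mt_mono_d d d' t : 0 < d -> d <= d' -> mt P Z F d t <= mt P Z F d' t.
Proof.
move=> d0 dd'; rewrite !mtE; apply: (Ex_le mod).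
- exact: bm_lg_csc.
- exact/bm_lg_csc/(lt_le_trans d0).
- by move=> z _; exact: lg_mono.
Qed.

Lemma nfd_le_add d z : 0 <= d -> nfd F d z <= nfd F 0 z + d.
Proof.
move=> d0; have n0 : 0 <= nfd F 0 z by exact: sqrtr_ge0.
rewrite -(@ler_pXn2r _ 2) ?nnegrE ?sqrtr_ge0 ?addr_ge0 //.
rewrite /nfd !sqr_sqrtr ?nfd_sqr_ge0 // sqrrD sqr_sqrtr ?nfd_sqr_ge0 // expr0n addr0 lerD2r lerDl.
by rewrite mulrn_wge0 // mulr_ge0 // sqrtr_ge0.
Qed.

Definition lg0 z := elog (nfd F 0 z).

Lemma elog_lt (x c : R) : 0 <= x -> (elog x < c%:E)%E = (x < expR c).
Proof.
move=> x0; rewrite /elog; case: eqVneq => [->|xn]; first by rewrite ltNyr expR_gt0.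
have xp : 0 < x by rewrite lt_neqAle eq_sym xn.
by rewrite lte_fin -[LHS]ltr_expR lnK ?posrE.
Qed.

Lemma lg0_le d z : 0 < d -> (lg0 z <= (lg F d z)%:E)%E.
Proof.
move=> d0; rewrite /lg0 /elog; case: eqVneq => [_|xn]; first exact: leNye.
have xp : 0 < nfd F 0 z by rewrite lt_neqAle eq_sym xn sqrtr_ge0.
have h := nfd_le_d F z (lexx 0) (ltW d0).
by rewrite lee_fin /lg ler_ln ?posrE // nfd_gt0.
Qed.

Lemma lg_lt z (c : R) : (lg0 z < c%:E)%E -> exists n, lg F (dl n) z < c.
Proof.
rewrite elog_lt ?sqrtr_ge0 // => h; have [n hn] := @dl_small (expR c - nfd F 0 z) (ltac:(by rewrite subr_gt0)).
exists n; rewrite -ltr_expR /lg lnK ?posrE ?nfd_gt0 ?dl_gt0 //.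
by apply: le_lt_trans (nfd_le_add _ (ltW (dl_gt0 n))) _; move: hn; lra.
Qed.

Lemma mean_log_limit i0 a0 : F i0 a0 != 0 -> exists m0 : R -> R, forall t, 1 <= t ->
 [/\ (forall d, 0 < d -> d <= 1 -> m0 t <= mt P Z F d t),
   (forall e, 0 < e -> exists n, forall d, 0 < d -> d <= dl n -> mt P Z F d t <= m0 t + e)
  & sphere_int p t lg0 = (m0 t)%:E].
Proof.
move=> Fa; have [B B0 hB] := mean_lower_uniform mod hF Fa.
exists (fun t => inf (range (fun n => mt P Z F (dl n) t))) => t t1.
have t0 : 0 < t by apply: lt_le_trans t1.
set m := inf _.
have hl : has_lbound (range (fun n => mt P Z F (dl n) t)).
 by exists (- B) => _ [n _ <-]; apply: hB; rewrite ?dl_gt0 ?dl_le1.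
have h1 n : m <= mt P Z F (dl n) t by apply: (ge_inf hl); exists n.
have ha d : 0 < d -> d <= 1 -> m <= mt P Z F d t.
 move=> d0 _; have [n /ltW nd] := dl_small d0; apply: le_trans (h1 n) _; exact: mt_mono_d (dl_gt0 n) nd.
have hb e : 0 < e -> exists n, forall d, 0 < d -> d <= dl n -> mt P Z F d t <= m + e.
 move=> e0; have [|_ [n _ <-] hn] := @inf_adherent _ (range (fun n => mt P Z F (dl n) t)) e e0.
  by split => //; exists (mt P Z F (dl 0) t), 0%N.
 exists n => d d0 dn; apply: le_trans (ltW hn); exact: mt_mono_d.
split => //.
have [M hM] := lg_bounded t hF.
pose M' := Num.max M 0.
have hM' d z : 0 < d -> d <= 1 -> cvnorm z <= t -> lg F d z <= M'.
 by move=> d0 d1 zt; rewrite le_max hM.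
have M'0 : 0 <= M' by rewrite le_max lexx orbT.
pose g n z : R := Num.max 0 (M' - lg F (dl n) z).
pose G z : \bar R := ereal_sup (range (fun n => (g n z)%:E)).
have bg n : bm (g n).
 apply: bm_max; first exact: bm_cst.
 by apply: bmB; [exact: bm_cst|apply: bm_lg => //; exact: dl_gt0].
have gnd z : nondecreasing_seq (fun n => (g n z)%:E).
 by move=> k n kn; rewrite lee_fin ge_max !le_max lexx /= lerD2l lerN2 lg_mono ?dl_gt0 ?dl_anti ?orbT.
have gcvg z : (fun n => (g n z)%:E) @ \oo --> G z by apply: ereal_nondecreasing_cvgn.
have bG : cbor G.
 move=> d T z mz; apply: (@emeasurable_fun_cvg _ _ _ _ (fun n t => (g n (z^~ t))%:E)) => [n|x _]; last exact: gcvg.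
 by have [bgn _] := bg n; exact: bgn.
have G0 z : (0 <= G z)%E.
 by apply: le_trans (ereal_sup_ubound _); last (by exists 0%N); rewrite lee_fin le_max lexx.
have lgG z : cvnorm z = t -> lg0 z = (M'%:E - G z)%E.
 move=> zt; have gE n : g n z = M' - lg F (dl n) z.
  by apply/max_idPr; rewrite subr_ge0 hM' ?dl_gt0 ?dl_le1 ?zt.
 apply/eqP; rewrite eq_le; apply/andP; split; apply: lee_above => c.
  rewrite subE_lt // => /ereal_sup_gt[_ [n _ <-]]; rewrite lte_fin gE => hc.
  by apply: le_trans (lg0_le _ (dl_gt0 n)) _; rewrite lee_fin; move: hc; lra.
 move=> /lg_lt[n hn]; rewrite subE_le //.
 by apply: le_trans (ereal_sup_ubound _); last (by exists n); rewrite lee_fin gE; move: hn; lra.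
rewrite (sphere_int_ext (ltW t0) lgG) (sphere_int_sub _ M'0 bG G0).
have [mZ nZ _ _ _] := mod.
have -> : (\int[P]_w G (csc (rc t) (Z w)) = (M' - m)%:E)%E.
 have -> : (fun w => G (csc (rc t) (Z w))) = (fun w => limn (fun n => (g n (csc (rc t) (Z w)))%:E)).
  by apply/funext => w; apply/esym/cvg_lim => //; exact: gcvg.
 rewrite monotone_convergence //; try by [move=> w _; exact: gnd|move=> n w _; rewrite lee_fin le_max lexx|move=> n; exact: (bm_measZ mod (bm_csc (rc t) (bg n)))].
 apply/cvg_lim => //.
 have -> : (fun n => \int[P]_w (g n (csc (rc t) (Z w)))%:E)%E = (fun n => (M' - mt P Z F (dl n) t)%:E).
  apply/funext => n; rewrite (ExE mod (bm_csc (rc t) (bg n))) mtE; congr EFin.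
  rewrite -[M' in RHS](Ex_cst P Z) -(ExB mod (bm_cst _) (bm_lg_csc hF (dl_gt0 n) t)).
  apply: (Ex_eq mod (bm_csc (rc t) (bg n)) (bmB (bm_cst _) (bm_lg_csc hF (dl_gt0 n) t))) => z z1.
  apply/max_idPr; rewrite subr_ge0; apply: hM'; rewrite ?dl_gt0 ?dl_le1 // cvnormZ z1 mulr1 cabs_real ger0_norm //.
  exact: ltW.
 apply/fine_cvgP; split; first exact: nearW.
 apply: cvgB; first exact: cvg_cst.
 apply: nonincreasing_cvgn => // k n kn; exact: mt_mono_d (dl_gt0 n) (dl_anti kn).
by rewrite -EFinB; congr EFin; ring.
Qed.
End ZeroLimit.
End Characteristic.

(** * Borel's growth lemma *)

Section Borel.
Context {R : realType}.
Implicit Types (x y z t r : R).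

Lemma ln_le_slope (e x : R) : 0 < e -> 0 <= x -> ln (1 + x) <= e * x + (e - 1 - ln e).
Proof.
move=> e0 x0; have h : 0 < 1 + x by lra.
have e1 : 0 < e * (1 + x) by rewrite mulr_gt0.
have h1 : ln (e * (1 + x)) <= e * (1 + x) - 1.
 have := expR_ge1Dx (ln (e * (1 + x))); rewrite lnK ?posrE //; lra.
by move: h1; rewrite lnM ?posrE //; lra.
Qed.

Lemma ln_ge_sub (t r : R) : 0 < t -> t < r -> (r - t) / r <= ln r - ln t.
Proof.
move=> t0 tr; have r0 := lt_trans t0 tr.
have h : ln (t / r) <= t / r - 1.
 by have := expR_ge1Dx (ln (t / r)); rewrite lnK ?posrE ?divr_gt0 //; lra.
have -> : (r - t) / r = 1 - t / r by field; rewrite gt_eqF.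
by move: h; rewrite ln_div ?posrE //; lra.
Qed.

Lemma min_ln (x y : R) : 0 < x -> 0 <= y -> - ln x <= y -> - ln (Num.min x 1) <= y.
Proof. by move=> x0 y0 h; case: (leP x 1) => [|_]; rewrite ?ln1 ?oppr0. Qed.

Variables (m : R -> R) (a C : R).
Hypotheses (m_mono : forall s t, 1 <= s -> s <= t -> m s <= m t).
Hypotheses (m_convex : forall s t, 1 < s -> s <= t -> (m s - m 1) / ln s <= (m t - m 1) / ln t).
Hypotheses (a0 : 0 < a) (m_ge : forall t, 1 <= t -> a * ln t - C <= m t).

Lemma m_unbounded (M : R) : exists t0, 1 <= t0 /\ forall t, t0 <= t -> M <= m t.
Proof.
pose x := Num.max 0 ((M + C) / a); exists (expR x); have x0 : 0 <= x by rewrite le_max lexx.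
split; first by rewrite -expR0 ler_expR.
move=> t xt; have t1 : 1 <= t by apply: le_trans xt; rewrite -expR0 ler_expR.
apply: le_trans (m_ge t1).
have h : x <= ln t by rewrite -[x]expRK ler_ln ?posrE ?expR_gt0 // (lt_le_trans ltr01).
have h2 : (M + C) / a <= ln t by apply: le_trans h; rewrite le_max lexx orbT.
by move: h2; rewrite ler_pdivrMr // mulrC; lra.
Qed.

(** Lengths of the exceptional intervals. Their sum telescopes to at most 1, and they decay only
    polynomially, so that - ln(tele n) is O(log n). *)
Definition tele n : R := (n.+1%:R * n.+2%:R)^-1.

Lemma tele_gt0 n : 0 < tele n. Proof. by rewrite invr_gt0 mulr_gt0. Qed.

Lemma teleE n : tele n = n.+1%:R^-1 - n.+2%:R^-1.
Proof. by rewrite /tele -[n.+2%:R]natr1; field; rewrite !gt_eqF // ltr_wpDl. Qed.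

Lemma tele_sum n : \sum_(0 <= k < n) tele k <= 1.
Proof.
have -> : \sum_(0 <= k < n) tele k = 1 - n.+1%:R^-1.
 elim: n => [|n IH]; first by rewrite big_geq // invr1 subrr.
 by rewrite big_nat_recr //= IH teleE; ring.
by rewrite gerBl invr_ge0.
Qed.

Lemma union_finite (s : nat -> R) (r0 : R) : exists E : set (measurableTypeR R),
 [/\ measurable E, (lebesgue_measure E < +oo)%E,
   (forall t, 0 <= t -> t <= r0 -> E t) & forall n t, s n - tele n <= t -> t <= s n -> E t].
Proof.
pose A n : set (measurableTypeR R) := `[s n - tele n, s n]%classic.
exists (`[0, r0]%classic `|` \bigcup_n A n); split.
- apply: measurableU; first exact: measurable_itv.
 by apply: bigcup_measurable => n _; exact: measurable_itv.
- have mA n : measurable (A n) by exact: measurable_itv.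
 have lA n : lebesgue_measure (A n) = (tele n)%:E.
  rewrite /A lebesgue_measure_itv /= lte_fin ltrBlDr ltrDl tele_gt0 -EFinB; congr EFin; ring.
 have h1 : (lebesgue_measure (\bigcup_n A n) <= 1)%E.
  apply: le_trans (generalized_Boole_inequality _ mA _) _; first exact: bigcup_measurable.
  apply: lime_le; first by apply: is_cvg_nneseries => n _ _.
  apply: nearW => n; rewrite (eq_bigr (fun k => (tele k)%:E)); last by move=> k _; exact: lA.
  rewrite sumEFin lee_fin; exact: tele_sum.
 have m0 : measurable (`[0, r0]%classic : set (measurableTypeR R)) by exact: measurable_itv.
 have mb : measurable (\bigcup_n A n) by exact: bigcup_measurable.
 apply: le_lt_trans (measureU2 _ m0 mb) _; rewrite [X in (X + _)%E]lebesgue_measure_itv /= lte_add_pinfty //; first by case: ifP => _; rewrite ?ltry // -EFinB ltry.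
 by apply: le_lt_trans h1 _; rewrite ltry.
- by move=> t t0 tr; left; rewrite /= in_itv /= t0.
- by move=> n t h1 h2; right; exists n => //; rewrite /A /= in_itv /= h1.
Qed.

Definition small (f : R -> R) := forall e, 0 < e -> exists t0, forall t, t0 <= t -> f t <= e * m t.

(** Since the slope of [m] in ln t is nondecreasing, exceeding a multiple of ln t once means
    exceeding it ever after. *)
Lemma superlog : (forall K, exists2 t, 1 <= t & m 1 + K * ln t < m t) -> small (@ln R).
Proof.
move=> h e e0; have [t0 t01 ht0] := h (2 / e); have [t2 [t21 ht2]] := m_unbounded `|m 1|.
have t0n : 1 < t0.
 rewrite lt_neqAle t01 andbT; apply: contraTneq ht0 => <-; by rewrite ln1 mulr0 addr0 ltxx.
exists (Num.max t0 t2) => t; rewrite ge_max => /andP[tt0 tt2].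
have l0 : 0 < ln t0 by rewrite ln_gt0.
have lt : 0 < ln t by rewrite ln_gt0 // (lt_le_trans t0n).
have := m_convex t0n tt0; rewrite ler_pdivlMr // => h1.
have h2 : 2 / e <= (m t0 - m 1) / ln t0 by rewrite ler_pdivlMr //; move: ht0; lra.
have h3 := le_trans (ler_wpM2r (ltW lt) h2) h1.
have h4 := ht2 t tt2; have h5 := ler_norm (- m 1); rewrite normrN in h5.
have h6 : 2 / e * ln t <= 2 * m t by lra.
have := ler_wpM2l (ltW e0) h6; have -> : e * (2 / e * ln t) = 2 * ln t by field; rewrite gt_eqF.
by move=> ?; lra.
Qed.

Lemma small_cst c : small (fun=> c).
Proof.
move=> e e0; have [t0 [_ h]] := m_unbounded (c / e); exists t0 => t /h.
by rewrite ler_pdivrMr // mulrC.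
Qed.

Lemma smallD f g : small f -> small g -> small (fun t => f t + g t).
Proof.
move=> hf hg e e0; have e2 : 0 < e / 2 by rewrite divr_gt0.
have [t1 h1] := hf _ e2; have [t2 h2] := hg _ e2; exists (Num.max t1 t2) => t.
by rewrite ge_max => /andP[/h1 ? /h2 ?]; lra.
Qed.

Lemma smallZ c f : 0 <= c -> small f -> small (fun t => c * f t).
Proof.
move=> c0 hf e e0; have c1 : 0 < c + 1 by rewrite ltr_wpDl.
have [t1 h1] := hf _ (divr_gt0 e0 c1); have [t2 [_ h2]] := m_unbounded 0; exists (Num.max t1 t2) => t.
rewrite ge_max => /andP[/h1 h /h2 m0]; apply: le_trans (ler_wpM2l c0 h) _.
rewrite mulrA ler_wpM2r // mulrCA ler_piMr ?(ltW e0) // ler_pdivrMr //; lra.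
Qed.

Lemma small_ln A B : 0 <= A -> 0 <= B -> small (fun t => ln (1 + (A * m t + B))).
Proof.
move=> A0 B0 e e0; have A1 : 0 < 2 * (A + 1) by rewrite mulr_gt0 // ltr_wpDl.
pose e1 := e / (2 * (A + 1)); have e10 : 0 < e1 by rewrite divr_gt0.
have e2 : 0 < e / 2 by rewrite divr_gt0.
have eA : e1 * A <= e / 2.
 have -> : e1 * A = e / 2 * (A / (A + 1)) by rewrite /e1; field; rewrite gt_eqF // ltr_wpDl.
 by rewrite ler_piMr ?(ltW e2) // ler_pdivrMr ?ltr_wpDl // mul1r lerDl.
have [t1 h1] := small_cst (e1 * B + (e1 - 1 - ln e1)) e2; have [t2 [_ h2]] := m_unbounded 0; exists (Num.max t1 t2) => t.
rewrite ge_max => /andP[/h1 h /h2 m0]; have X0 : 0 <= A * m t + B by rewrite addr_ge0 // mulr_ge0.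
apply: le_trans (ln_le_slope e10 X0) _; have := ler_wpM2r m0 eA; lra.
Qed.

Lemma small_bound (C0 C' e : R) L1 L2 : 0 <= C0 -> small L1 -> small L2 -> 0 < e ->
 exists t0, 2 <= t0 /\ forall t l1 l2, t0 <= t -> l1 <= L1 t -> l2 <= L2 t -> C0 * (1 + l1 + l2) + C' <= e * m t.
Proof.
move=> C00 h1 h2 e0; have [t0 h0] := smallD (smallZ C00 (smallD (smallD (small_cst 1) h1) h2)) (small_cst C') e0.
exists (Num.max 2 t0); rewrite le_max lexx; split => // t l1 l2; rewrite ge_max => /andP[_ /h0 h] k1 k2.
by apply: le_trans h; rewrite lerD2r ler_wpM2l //; lra.
Qed.

(** For [m] of logarithmic growth r = 2 t will do: ln r - ln t is constant, and m(2t) is at most a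
    constant multiple of m(t) plus a constant, as [m] also grows at least like a ln t. *)
Lemma slow_radius (K u C0 C' e : R) : 0 <= K -> 0 <= u -> 0 <= C0 -> 0 < e -> (forall t, 1 <= t -> m t <= m 1 + K * ln t) ->
 exists t0, 2 <= t0 /\ forall t, t0 <= t -> exists2 r, t < r &
  C0 * (1 + ln (1 + (u * (m r + 1) + C0)) - ln (Num.min (ln r - ln t) 1)) + C' <= e * m t.
Proof.
move=> K0 u0 C00 e0 hK; have l2 : 0 < ln 2 :> R by rewrite ln_gt0 // ltr1n.
have Ka : 0 <= u * (K / a) by rewrite mulr_ge0 // divr_ge0 // ltW.
pose B := u * (`|m 1| + K * ln 2 + K / a * `|C| + 1) + C0.
have B0 : 0 <= B by rewrite addr_ge0 // mulr_ge0 // !addr_ge0 // mulr_ge0 ?divr_ge0 // ltW.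
have [t0 [t02 ht0]] := small_bound C' C00 (small_ln Ka B0) (small_cst `|ln (ln 2 : R)|) e0.
have [t9 [t91 ht9]] := m_unbounded 0; exists (Num.max t0 t9); rewrite le_max t02; split => // t.
rewrite ge_max => /andP[tt0 /ht9 m0]; have t2 := le_trans t02 tt0; exists (2 * t); first lra.
have t1 : 1 <= t by apply: le_trans t2; rewrite ler1n.
have tp : 0 < t by apply: lt_le_trans t1.
have ltE : ln (2 * t) = ln 2 + ln t by rewrite lnM ?posrE.
have -> : ln (2 * t) - ln t = ln 2 by rewrite ltE; ring.
apply: ht0 => //; last by apply: min_ln; [exact: l2|exact: normr_ge0|rewrite -normrN; exact: ler_norm].
have m2 : m (2 * t) <= m 1 + K * (ln 2 + ln t) by rewrite -ltE hK // (le_trans t1) // ler_peMl ?ltW // ltr1n.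
have m20 : 0 <= m (2 * t) by apply: le_trans m0 _; apply: m_mono => //; lra.
have hl : K * ln t <= K / a * (m t + `|C|).
 rewrite -mulrA ler_wpM2l // mulrC ler_pdivlMr // mulrC; have := m_ge t1; have := ler_norm C; lra.
have X0 : 0 <= u * (m (2 * t) + 1) + C0 by rewrite addr_ge0 // mulr_ge0 // addr_ge0.
have XY : u * (m (2 * t) + 1) + C0 <= u * (K / a) * m t + B.
 have -> : u * (K / a) * m t + B = u * (`|m 1| + K * ln 2 + K / a * (m t + `|C|) + 1) + C0 by rewrite /B; ring.
 by rewrite lerD2r ler_wpM2l // lerD2r; have := ler_norm (m 1); lra.
rewrite ler_ln ?posrE ?lerD2l //; lra.
Qed.

(** [s] is where [m] reaches the next integer. Unless [t] lies within [tele n] of it, t + tele n is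
    still to its left, and [m] has grown by less than 1. *)
Lemma fast_radius (n : nat) (t s : R) : 1 <= t -> n%:R <= m t -> m t < n.+1%:R -> s = sup [set x | 1 <= x /\ m x < n.+1%:R] ->
 ~ (s - tele n <= t /\ t <= s) -> m (t + tele n) < m t + 1.
Proof.
move=> t1 nm mn sE hE; have [t0 [t01 ht0]] := m_unbounded n.+1%:R.
have hs : has_sup [set x | 1 <= x /\ m x < n.+1%:R].
 split; first by exists t.
 exists t0 => x [x1 xm]; rewrite leNgt; apply/negP => t0x; have := ht0 x (ltW t0x); by rewrite leNgt xm.
have ts : t <= s by rewrite sE; apply: sup_ubound => //; case: hs.
have h : t + tele n < s by rewrite -ltrBrDr ltNge; apply/negP => h; apply: hE.
have e0 : 0 < s - (t + tele n) by rewrite subr_gt0.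
have [x [x1 xm]] := sup_adherent e0 hs; rewrite -sE => hx.
have h2 : m (t + tele n) <= m x by apply: m_mono; have := tele_gt0 n; lra.
by apply: le_lt_trans h2 (lt_le_trans xm _); rewrite -natr1 lerD2r.
Qed.

(** Here ln r - ln t is at least tele n/(2t), so its logarithm costs ln 2 + ln t + ln((n + 1)(n +
    2)); with n at most m(t) and ln t = o(m) this is o(m). *)
Lemma fast_bound (u C0 C' e : R) : 0 <= u -> 0 <= C0 -> 0 < e -> small (@ln R) ->
 exists t0, 2 <= t0 /\ forall t n, t0 <= t -> n%:R <= m t -> m (t + tele n) < m t + 1 ->
  C0 * (1 + ln (1 + (u * (m (t + tele n) + 1) + C0)) - ln (Num.min (ln (t + tele n) - ln t) 1)) + C' <= e * m t.
Proof.
move=> u0 C00 e0 hl; have l2 : 0 < ln 2 :> R by rewrite ln_gt0 // ltr1n.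
have B0 : 0 <= 2 * u + C0 by rewrite addr_ge0 // mulr_ge0.
have h2 := smallD (smallD (small_cst (ln 2)) hl) (smallZ (ler0n R 2) (small_ln ler01 ler01)).
have [t0 [t02 ht0]] := small_bound C' C00 (small_ln u0 B0) h2 e0.
have [t9 [t91 ht9]] := m_unbounded 0; exists (Num.max t0 t9); rewrite le_max t02; split => // t n.
rewrite ge_max => /andP[tt0 /ht9 m0] nm; set r := t + tele n => hm; have t2 := le_trans t02 tt0.
have tp : 0 < t by apply: lt_le_trans t2.
have lt0 : 0 <= ln t by rewrite ln_ge0 // (le_trans _ t2) // ler1n.
have T0 := tele_gt0 n; have tr : t < r by rewrite ltrDl.
have T1 : tele n <= 1 by rewrite invf_le1 ?mulr_gt0 // -natrM ler1n.
have r2 : r <= 2 * t by rewrite /r; lra.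
have mr0 : 0 <= m r by apply: le_trans m0 _; apply: m_mono; lra.
apply: ht0 => //.
 have X0 : 0 <= u * (m r + 1) by rewrite mulr_ge0 // addr_ge0.
 have h : u * (m r + 1) <= u * (m t + 2) by rewrite ler_wpM2l //; lra.
 by rewrite ler_ln ?posrE; lra.
have q0 : 0 < tele n / (2 * t) by rewrite divr_gt0 // mulr_gt0.
have q1 : tele n / (2 * t) <= ln r - ln t.
 apply: le_trans (ln_ge_sub tp tr); have -> : r - t = tele n by rewrite /r; ring.
 by rewrite ler_wpM2l ?(ltW T0) // lef_pV2 ?posrE ?mulr_gt0 // (lt_trans tp).
have p0 : 0 < ln r - ln t by apply: lt_le_trans q0 q1.
rewrite mul1r; have h4 : 0 <= ln (1 + (m t + 1)) by rewrite ln_ge0 // lerDl addr_ge0.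
apply: min_ln => //; first lra.
apply: (@le_trans _ _ (- ln (tele n / (2 * t)))); first by rewrite lerN2 ler_ln ?posrE.
rewrite ln_div ?posrE ?mulr_gt0 // /tele lnV ?posrE ?mulr_gt0 // !lnM ?posrE //.
have h5 k : (k <= 2)%N -> ln (n + k)%:R <= ln (1 + (m t + 1)) :> R.
 move=> k2; case: (posnP (n + k)%N) => [->|nk]; first by rewrite ln0.
 rewrite ler_ln ?posrE ?ltr0n //; last lra.
 have : (n + k)%:R <= n%:R + 2 :> R by rewrite -natrD ler_nat leq_add2l.
 lra.
by have := h5 1%N isT; have := h5 2%N isT; rewrite addn1 addn2; lra.
Qed.

(** Either [m] is bounded by a multiple of ln t, and a bounded interval is the only exception, or ln
    t = o(m), and the exceptional intervals before the integer levels of [m] are removed as well. *)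
Lemma borel_growth (u C0 C' e : R) : 0 <= u -> 0 <= C0 -> 0 < e -> exists E : set (measurableTypeR R),
 [/\ measurable E, (lebesgue_measure E < +oo)%E &
  forall t, 0 <= t -> ~ E t -> [/\ 2 <= t, 0 <= m t & exists2 r, t < r &
   C0 * (1 + ln (1 + (u * (m r + 1) + C0)) - ln (Num.min (ln r - ln t) 1)) + C' <= e * m t]].
Proof.
move=> u0 C00 e0; have [t9 [t91 ht9]] := m_unbounded 0.
have [[K hK]|] := pselect (exists K, forall t, 1 <= t -> m t <= m 1 + K * ln t).
 have hK' t : 1 <= t -> m t <= m 1 + `|K| * ln t.
  move=> t1; apply: le_trans (hK t t1) _; rewrite lerD2l; apply: ler_wpM2r; [exact: ln_ge0|exact: ler_norm].
 have [t0 [t02 ht0]] := slow_radius C' (normr_ge0 K) u0 C00 e0 hK'.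
 have [E [mE lE hE _]] := union_finite (fun=> 0) (Num.max t0 t9); exists E; split => // t tp nE.
 have h : Num.max t0 t9 <= t by rewrite leNgt; apply/negP => /ltW h; apply: nE; exact: hE.
 move: h; rewrite ge_max => /andP[tt0 /ht9 m0].
 by split => //; [exact: le_trans tt0|exact: ht0].
move=> nK; have supr : forall K, exists2 t, 1 <= t & m 1 + K * ln t < m t.
 move=> K; apply: contrapT => h; apply: nK; exists K => t t1; rewrite leNgt; apply/negP => hh; apply: h; by exists t.
have [t0 [t02 ht0]] := fast_bound C' u0 C00 e0 (superlog supr).
pose s n := sup [set x | 1 <= x /\ m x < n.+1%:R].
have [E [mE lE hE hE2]] := union_finite s (Num.max t0 t9); exists E; split => // t tp nE.
have h : Num.max t0 t9 <= t by rewrite leNgt; apply/negP => /ltW h; apply: nE; exact: hE.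
move: h; rewrite ge_max => /andP[tt0 /ht9 m0].
have t2 : 2 <= t by apply: le_trans tt0.
have t1' : 1 <= t by apply: le_trans t2; rewrite ler1n.
split => //; have /andP[h1 h2] := truncn_itv m0.
exists (t + tele (Num.truncn (m t))); first by rewrite ltrDl tele_gt0.
apply: ht0 => //; apply: (fast_radius t1' h1 h2 (erefl _)) => -[h3 h4]; apply: nE; exact: hE2 h3 h4.
Qed.

End Borel.

Section Arith.
Variable R : realType.
Implicit Types x y z : R.

Lemma convex_limit_arith (th ms m1 mt Ms M1 Mt e : R) : 0 <= th -> th <= 1 -> ms <= m1 + th * (mt - m1) ->
 m1 <= M1 + e -> mt <= Mt + e -> Ms <= ms -> Ms <= th * (Mt - M1) + e + M1.
Proof.
move=> th0 th1 h h1 h2 h3; have g1 : th * mt <= th * (Mt + e) by rewrite ler_wpM2l.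
have g2 : (1 - th) * m1 <= (1 - th) * (M1 + e) by rewrite ler_wpM2l // subr_ge0.
lra.
Qed.

Lemma chain_arith (l B C X Y : R) : l - B <= X -> X <= C + Y -> l - (B + C) <= Y.
Proof. lra. Qed.

End Arith.

(** * Monotonicity and convexity of the limit mean *)

Section LimitFunction.
Context {R : realType} {p : nat} {dd : measure_display} {W : measurableType dd}.
Variables (P : probability W R) (Z : W -> Cn R p).
Hypothesis mod : sphere_model P Z.
Variables (I : finType) (F : I -> Cn R p -> R[i]) (m0 : R -> R).
Hypothesis hF : forall i, hol (F i).
Hypothesis m0P : forall t, 1 <= t -> (forall d, 0 < d -> d <= 1 -> m0 t <= mt P Z F d t) /\
 (forall e, 0 < e -> exists n, forall d, 0 < d -> d <= dl n -> mt P Z F d t <= m0 t + e).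

Lemma m0_approx (s t e : R) : 1 <= s -> 1 <= t -> 0 < e -> exists d1 : R, [/\ 0 < d1, d1 <= 1 &
 forall d, 0 < d -> d <= d1 -> mt P Z F d s <= m0 s + e /\ mt P Z F d t <= m0 t + e].
Proof.
move=> s1 t1 e0; have [_ /(_ e e0)[n hn]] := m0P s1; have [_ /(_ e e0)[k hk]] := m0P t1.
exists (Num.min (dl n) (dl k)); split; first by rewrite lt_min !dl_gt0.
 by rewrite ge_min dl_le1.
by move=> d d0; rewrite le_min => /andP[dn dk]; split; [exact: hn|exact: hk].
Qed.

Lemma m0_mono s t : 1 <= s -> s <= t -> m0 s <= m0 t.
Proof.
move=> s1 st; apply/ler_addgt0Pr => e e0; have t1 := le_trans s1 st.
have [d [d0 d1 /(_ d d0 (lexx d))[_ h]]] := m0_approx s1 t1 e0.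
apply: le_trans h; apply: le_trans ((m0P s1).1 d d0 d1) _.
by apply: (mt_mono mod) => //; apply: lt_le_trans s1.
Qed.

Lemma m0_convex s t : 1 < s -> s <= t -> (m0 s - m0 1) / ln s <= (m0 t - m0 1) / ln t.
Proof.
move=> s1; rewrite le_eqVlt => /predU1P[<- //|st]; have t1 := lt_trans s1 st.
have ls : 0 < ln s by rewrite ln_gt0.
have lt : 0 < ln t by rewrite ln_gt0.
rewrite ler_pdivrMr //; apply/ler_addgt0Pr => e e0.
have [d [d0 d1 /(_ d d0 (lexx d))[h1 ht]]] := m0_approx (lexx 1) (ltW t1) e0.
have hs := (m0P (ltW s1)).1 d d0 d1.
have := mt_convex mod hF d0 ltr01 s1 st; rewrite ln1 !subr0 => hc.
have th0 : 0 <= ln s / ln t by rewrite divr_ge0 ?ltW.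
have th1 : ln s / ln t <= 1 by rewrite ler_pdivrMr // mul1r ler_ln ?posrE ?(lt_trans ltr01) // ltW.
have -> : (m0 t - m0 1) / ln t * ln s = ln s / ln t * (m0 t - m0 1) by field; rewrite gt_eqF.
rewrite lerBlDr; exact: convex_limit_arith th0 th1 hc h1 ht hs.
Qed.

End LimitFunction.

(** * From the mean inequality to the integral bound *)

Section AnalyticBound.
Context {R : realType} {p : nat}.
Variables (I : finType) (F : I -> Cn R p -> R[i]) (H u : nat) (Phi : 'I_H -> Cn R p -> R[i]).
Variables (T : finType) (A : T -> 'M[R[i]]_H) (K : R) (tau0 : T).
Hypotheses (hF : forall i, hol (F i)) (hPhi : forall i, hol (Phi i)) (uA : forall tau, A tau \in unitmx).
Hypotheses (K0 : 0 <= K) (PhiF : forall i z, cabs (Phi i z) <= K * nfd F 0 z ^+ u).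
Hypothesis ind : forall c : 'I_H -> R[i], (forall z, \sum_i c i * Phi i z = 0) -> forall i, c i = 0.
Hypotheses (p0 : (0 < p)%N) (u0 : (0 < u)%N).
Variables (i0 : I) (a0 : Cn R p).
Hypothesis Fa : F i0 a0 != 0.

Lemma growth_arith (A' b x L l B c : R) : b <= A' + L / (l + L) * (x - A') -> 0 < L -> 0 < l -> - B <= b -> A' <= c - L ->
 2 * (B + c) <= L -> l / 2 - B <= x.
Proof.
move=> h L0 l0 hb hA hL; have lL : 0 < l + L by rewrite addr_gt0.
have h1 : (b - A') * (l + L) <= L * (x - A').
 have := ler_wpM2r (ltW lL) (ltac:(lra) : b - A' <= L / (l + L) * (x - A')).
 by have -> : L / (l + L) * (x - A') * (l + L) = L * (x - A') by field; rewrite gt_eqF.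
have h2 : L * (l / 2 - B) <= L * x.
 have e1 : 0 <= (b + B) * L by rewrite mulr_ge0 ?(ltW L0) //; lra.
 have e2 : 0 <= (b - A' - L / 2) * l by rewrite mulr_ge0 ?(ltW l0) //; lra.
 lra.
by move: h2; rewrite ler_pM2l.
Qed.

Lemma vanishing_combination (i j : 'I_H) : i != j -> exists2 c : 'I_H -> R[i], (exists k, c k != 0) & \sum_k c k * Phi k (fun=> 0) = 0.
Proof.
move=> ij; have [e|e] := eqVneq (Phi i (fun=> 0)) 0.
 exists (fun k => (k == i)%:R); first by exists i; rewrite eqxx oner_neq0.
 by rewrite (bigD1 i) //= e mulr0 add0r big1 // => k /negbTE ->; rewrite mul0r.
exists (fun k => if k == i then - Phi j (fun=> 0) else if k == j then Phi i (fun=> 0) else 0).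
 by exists j; rewrite [j == i]eq_sym (negbTE ij) eqxx.
rewrite (bigD1 i) //= (bigD1 j) 1?eq_sym //= eqxx [j == i]eq_sym (negbTE ij) eqxx big1 => [|k /andP[/negbTE -> /negbTE ->]]; last by rewrite mul0r.
by rewrite addr0 mulNr mulrC addNr.
Qed.

Section WithModel.
Context {dd : measure_display} {W : measurableType dd}.
Variables (P : probability W R) (Z : W -> Cn R p).
Hypothesis mod : sphere_model P Z.

(** Two basis elements have a nontrivial combination G that vanishes at the origin. On a sphere of
    small radius h the mean of log |G| is at most ln h plus a constant, while at radius 1 it is
    bounded below; convexity then forces growth of at least half of ln t. This gives the logarithmic
    lower bound that Borel's lemma asks for. *)
Lemma log_growth (i j : 'I_H) : i != j -> exists C d1 : R, [/\ 0 < d1, d1 <= 1 &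
 forall d t, 0 < d -> d <= d1 -> 1 < t -> ln t / 2 - C <= u%:R * mt P Z F d t].
Proof.
move=> /vanishing_combination[c [k ck] c0].
pose A1 (_ : unit) : 'M[R[i]]_H := \matrix_(i, j) c j.
pose G := psi Phi A1 tt i.
have GE z : G z = \sum_l c l * Phi l z by apply: eq_bigr => l _; rewrite mxE.
have hG : hol G by exact: hol_psi.
have G0 : G (fun=> 0) = 0 by rewrite GE.
have [z0 Gz] : exists z, G z != 0.
 apply: contrapT => /forallNP h; case/eqP: ck; apply: ind => z; rewrite -GE.
 by apply/eqP/negPn/negP; exact: h.
have hGu (_ : unit) : hol ((uf G) tt) by [].
have [B B0 hB] := mean_lower_uniform mod (G := fun _ : unit => G) (i := tt) hGu Gz.
have [_ _ [C [rho [C0 rho0 hC]]]] := hG.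
pose C1 := ln (\sum_tau \sum_i \sum_j cabs (A1 tau i j) * K + 1).
pose cc := `|ln (C + 1)|.
(* The small radius is d^u, equal to the regularization, so that the regularized norm of G there is
   at most (C + 1) d^u. The exponential makes - ln(d^u) at least 2 (B + cc), whence the slope
   1/2. *)
pose d1 := Num.min (Num.min 1 (rho / 2)) (expR (- (2 * (B + cc) + 1))).
have d10 : 0 < d1 by rewrite !lt_min ltr01 divr_gt0 ?expR_gt0.
exists (B + C1), d1; split => //; first by rewrite !ge_min lexx.
move=> d t d0; rewrite !le_min => /andP[/andP[d1' drho] dexp] t1.
have h0 : 0 < d ^+ u by rewrite exprn_gt0.
have hd : d ^+ u <= d by rewrite -[leRHS]expr1 ler_wiXn2l // ltW.
have hle : d ^+ u <= 1 by apply: le_trans d1'.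
have lh : ln (d ^+ u) <= - (2 * (B + cc) + 1).
 by rewrite -[leRHS]expRK ler_ln ?posrE ?expR_gt0 // (le_trans hd).
have cc0 : 0 <= cc by exact: normr_ge0.
have B20 : 0 <= 2 * (B + cc) by rewrite mulr_ge0 // addr_ge0.
have h1 : d ^+ u < 1.
 rewrite lt_neqAle hle andbT; apply: contra_leN (lh : is_true _) => /eqP ->; rewrite ln1; lra.
have mh : mt P Z (uf G) (d ^+ u) (d ^+ u) <= cc + ln (d ^+ u).
 rewrite mtE -[leRHS](Ex_cst P Z); apply: (Ex_le mod) => [||z z1]; [exact: bm_lg_csc|exact: bm_cst|].
 have zh : cvnorm (csc (rc (d ^+ u)) z) = d ^+ u by rewrite cvnormZ z1 mulr1 cabs_real gtr0_norm.
 have C10 : 0 < C + 1 by rewrite addr_gt0.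
 apply: (@le_trans _ _ (ln ((C + 1) * d ^+ u))); last by rewrite lnM ?posrE // lerD2r ler_norm.
 rewrite /lg ler_ln ?posrE ?nfd_gt0 ?mulr_gt0 //; apply: le_trans (nfd_le_sum _ _ _) _.
 rewrite gtr0_norm // mulrDl mul1r lerD2r (big_pred1 tt) => [|[] //].
 rewrite -[X in cabs X]subr0 -G0 -[X in _ <= C * X]zh; apply: hC; rewrite zh.
 by apply: le_lt_trans hd (le_lt_trans drho _); rewrite ltr_pdivrMr // ltr_pMr // ltr1n.
have conv := mt_convex mod hGu h0 h0 h1 t1.
have L0 : 0 < - ln (d ^+ u) by rewrite oppr_gt0; apply: le_lt_trans lh _; rewrite oppr_lt0 ltr_wpDl.
have lt : 0 < ln t by rewrite ln_gt0.
rewrite ln1 sub0r in conv.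
have gr := growth_arith conv L0 lt (hB _ _ h0 hle (lexx 1)) (c := cc) _ _.
have mG : mt P Z (uf G) (d ^+ u) t <= C1 + u%:R * mt P Z F d t.
 have bF : bm (fun z => lg F d (csc (rc t) z)) by exact: bm_lg_csc.
 rewrite !mtE -(ExZ mod) // -[C1](Ex_cst P Z) -(ExD mod) //; [|exact: bm_cst|exact: bmZ].
 apply: (Ex_le mod); [exact: bm_lg_csc|apply: bmD; [exact: bm_cst|exact: bmZ]|].
 by move=> z _; exact: (vlg_le A1 K0 PhiF tt i).
have hL : 2 * (B + cc) <= - ln (d ^+ u) by rewrite lerNr; apply: le_trans lh _; rewrite lerN2 lerDl.
by apply: chain_arith (gr _ hL) mG; rewrite opprK.
Qed.

Definition excess d tau z := \sum_i (u%:R * lg F d z - vlg u Phi A tau i d z).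
Definition max_excess d z := foldr (fun tau x => Num.max (excess d tau z) x) (excess d tau0 z) (enum T).

Lemma excess_le_max d tau z : excess d tau z <= max_excess d z.
Proof.
have : tau \in enum T by rewrite mem_enum.
rewrite /max_excess; elim: (enum T) => //= s l IH; rewrite inE => /predU1P[->|/IH h]; rewrite le_max ?lexx //.
by rewrite h orbT.
Qed.

Lemma max_excess_attained d z : exists tau, max_excess d z <= excess d tau z.
Proof.
rewrite /max_excess; elim: (enum T) => /= [|s l [tau IH]]; first by exists tau0.
case: (leP (excess d s z) (excess d tau z)) => h; first by exists tau; rewrite ge_max h.
by exists s; rewrite ge_max lexx (le_trans IH) // ltW.
Qed.

Lemma bm_max_excess d : 0 < d -> bm (max_excess d).
Proof.
move=> d0; have be tau : bm (excess d tau).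
 apply: bm_sum => i; apply: bmB; first by apply: bmZ; exact: bm_lg.
 by apply: bm_lg => [_|]; [exact: hol_psi|rewrite exprn_gt0].
by rewrite /max_excess; elim: (enum T) => /= [|s l IH]; [exact: be|apply: bm_max].
Qed.

Lemma max_excess_ge d z : 0 < d -> - (H%:R * ln (\sum_tau \sum_i \sum_j cabs (A tau i j) * K + 1)) <= max_excess d z.
Proof.
move=> d0; apply: le_trans (excess_le_max d tau0 z).
rewrite -mulrN mulr_natl; have -> (x : R) : x *+ H = \sum_(i < H) x by rewrite sumr_const card_ord.
apply: ler_sum => i _.
have := vlg_le A K0 PhiF tau0 i z d0; move: (u%:R * _) (vlg _ _ _ _ _ _ _) (ln _) => x y w; lra.
Qed.

End WithModel.

Lemma einf_le_lim (f : (\bar R)^nat) (n : nat) (x : \bar R) : (forall k, (n <= k)%N -> (x <= f k)%E) -> (x <= limn_einf f)%E.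
Proof.
move=> h; rewrite limn_einf_lim; have /cvg_lim -> // := @cvg_einfs_sup R f.
apply: le_trans (ereal_sup_ubound _); last by exists n.
by apply: le_ereal_inf_tmp => _ [k /= nk <-]; exact: h.
Qed.

Lemma lim_einf_le (f : (\bar R)^nat) (n : nat) (x : \bar R) : (forall k, (n <= k)%N -> (f k <= x)%E) -> (limn_einf f <= x)%E.
Proof.
move=> h; rewrite limn_einf_lim; have /cvg_lim -> // := @cvg_einfs_sup R f.
apply: ub_ereal_sup => _ [k _ <-]; apply: le_trans (h (maxn n k) (leq_maxl _ _)).
by apply: ereal_inf_lbound; exists (maxn n k) => //=; exact: leq_maxr.
Qed.

Lemma lee_below (x y : \bar R) : (forall c : R, (c%:E < x)%E -> (c%:E <= y)%E) -> (x <= y)%E.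
Proof.
move=> h; rewrite -leeN2; apply: lee_above => c; rewrite lteNl leeNl -EFinN; exact: h.
Qed.

Lemma bound_arith (co uH m X C1 C2 D e e' m1 : R) : 0 <= co -> 0 <= X -> 0 <= m -> co * uH <= D -> 0 < e ->
 e' = e / (co + 1) -> C2 = `|co * uH + C1 + (D + e) * m1| -> X + C2 <= e' * m ->
 co * (uH * (m + 1) + X) + C1 <= (D + e) * (m - m1).
Proof.
move=> co0 X0 m0 hD e0 -> E2 h; have c1 : 0 < co + 1 by rewrite ltr_wpDl.
have h1 : (co + 1) * (X + C2) <= e * m.
 have -> : e * m = (co + 1) * (e / (co + 1) * m) by field; rewrite gt_eqF.
 by rewrite ler_pM2l.
have C20 : 0 <= C2 by rewrite E2.
have h2 : co * uH + C1 + (D + e) * m1 <= C2 by rewrite E2 ler_norm.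
have h3 : 0 <= co * C2 by rewrite mulr_ge0.
have h4 : co * uH * m <= D * m by rewrite ler_wpM2r.
lra.
Qed.

(** [L] is pointwise at most the lower limit of the regularized majorants as d -> 0, so Fatou's
    lemma bounds its integral by means to which the main inequality applies; Borel's lemma then
    provides the second radius. *)
Theorem analytic_bound (i j : 'I_H) (L : Cn R p -> \bar R) (co C D e : R) : i != j -> 0 <= co -> co * (u * H)%:R <= D -> 0 < e ->
 cbor L -> (forall z, 0 <= L z)%E ->
 (forall z (x : R), (x%:E < L z)%E -> exists2 d0 : R, 0 < d0 & forall d, 0 < d -> d < d0 -> d <= 1 ->
   exists tau, x <= co * excess d tau z + C) ->
 exists E : set (measurableTypeR R), [/\ measurable E, (lebesgue_measure E < +oo)%E &
  forall r : R, 0 <= r -> ~ E r ->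
   (sphere_int p r L <= (D + e)%:E * (sphere_int p r (lg0 F) - sphere_int p 1 (lg0 F)))%E].
Proof.
move=> ij co0 hD e0 bL L0 hL.
have [dd [W [P [Z mod]]]] := @sphere_space R p p0.
have [d1 [Z1 [mu1 [zc pl]]]] := @euclid_space R 1.
have [C0 C00 main] := main_inequality mod hF hPhi uA K0 PhiF ind pl Fa.
have [m0 m0P] := mean_log_limit mod hF Fa.
have m0P' t : 1 <= t -> _ := fun h => let: And3 a b _ := m0P t h in conj a b.
have [C3 [dg [dg0 dg1 gr]]] := log_growth mod ij.
have uR : 0 < u%:R :> R by rewrite ltr0n.
have m_ge t : 1 <= t -> (2 * u%:R)^-1 * ln t - (`|C3| / u%:R + `|m0 1|) <= m0 t.
 rewrite le_eqVlt => /predU1P[<-|t1].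
  rewrite ln1 mulr0 sub0r opprD; have h1 := ler_norm (- m0 1); rewrite normrN in h1.
  have h2 : 0 <= `|C3| / u%:R by rewrite divr_ge0.
  by move: h1 h2; move: (`|C3| / _) `|m0 1| => *; lra.
 apply/ler_addgt0Pr => e1 e10.
 have [d [d0 d11 hd]] := m0_approx m0P' (ltW t1) (ltW t1) e10.
 have dm0 : 0 < Num.min d dg by rewrite lt_min d0.
 have [h1 _] := hd (Num.min d dg) dm0 (ltac:(by rewrite ge_min lexx)).
 have h2 := gr (Num.min d dg) t dm0 (ltac:(by rewrite ge_min lexx orbT)) t1.
 have h3 : (ln t / 2 - C3) / u%:R <= m0 t + e1.
  by rewrite ler_pdivrMr // [leRHS]mulrC; apply: le_trans h2 _; rewrite ler_pM2l.
 apply: le_trans h3; rewrite lerBlDr.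
 have -> : (2 * u%:R)^-1 * ln t = (ln t / 2 - C3) / u%:R + C3 / u%:R by field; rewrite gt_eqF.
 rewrite lerD2l; apply: (@le_trans _ _ (`|C3| / u%:R)); last by rewrite lerDl.
 by rewrite ler_pM2r ?invr_gt0 // ler_norm.
have a_gt0 : 0 < (2 * u%:R)^-1 :> R by rewrite invr_gt0 mulr_gt0.
pose c1 := H%:R * ln (\sum_tau \sum_i \sum_j cabs (A tau i j) * K + 1).
(* [C1] makes the majorants nonnegative for Fatou; [C2] absorbs the constants, the mean at radius 1
   included. *)
pose C1 := `|C| + co * `|c1|.
pose C2 := `|co * (u * H)%:R + C1 + (D + e) * m0 1|.
have e1 : 0 < e / (co + 1) by rewrite divr_gt0 // ltr_wpDl.
have [E [mE fE hE]] := borel_growth (m0_mono mod hF m0P') (m0_convex mod hF m0P') a_gt0 m_ge C2 (ler0n R u) C00 e1.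
exists E; split => // t t0 nE; have [t2 m00 [r tr hb]] := hE t t0 nE.
have t1 : 1 <= t by apply: le_trans t2; rewrite ler1n.
have r1 := le_trans t1 (ltW tr).
have [_ _ Et] := m0P t t1; have [_ _ E1] := m0P 1 (lexx 1); rewrite Et E1.
have [d [d0 d11 hd]] := m0_approx m0P' t1 r1 ltr01.
pose G n z := co * max_excess (dl n) z + C1.
have bG n : bm (fun z => G n (csc (rc t) z)).
 by apply: bm_csc; apply: bmD; [apply: bmZ; exact/bm_max_excess/dl_gt0|exact: bm_cst].
have G0 n z : 0 <= G n z.
 have h1 := ler_wpM2l co0 (max_excess_ge z (dl_gt0 n)); have h2 := ler_wpM2l co0 (ler_norm c1).
 have h3 : 0 <= `|C| by []; move: h1 h2; rewrite /G /C1 mulrN -/c1; move: (co * c1) (co * `|c1|) (co * _) => x y w; lra.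
have LG z : (L z <= limn_einf (fun n => (G n z)%:E))%E.
 apply: lee_below => x /hL[d0' d0'0 hd']; have [n hn] := dl_small d0'0.
 apply: (@einf_le_lim _ n) => k nk; rewrite lee_fin.
 have [tau htau] := hd' (dl k) (dl_gt0 k) (le_lt_trans (dl_anti nk) hn) (dl_le1 k).
 apply: le_trans htau _; apply: lerD; first exact: ler_wpM2l (excess_le_max _ _ _).
 by rewrite /C1 (le_trans (ler_norm C)) // lerDl mulr_ge0.
have [mZ _ sph _ _] := mod; rewrite (sph t L bL L0).
pose X := C0 * (1 + ln (1 + (u%:R * (m0 r + 1) + C0)) - ln (Num.min (ln r - ln t) 1)).
have m0r : 0 <= m0 r by apply: le_trans m00 _; apply: (m0_mono mod hF m0P') => //; exact: ltW.
have X0 : 0 <= X.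
 have mn : 0 < Num.min (ln r - ln t) 1.
  by rewrite lt_min ltr01 andbT subr_gt0 ltr_ln ?posrE // (lt_le_trans ltr01).
 have h1 : ln (Num.min (ln r - ln t) 1) <= 0 by apply: ln_le0; rewrite ge_min lexx orbT.
 have h2 : 0 <= ln (1 + (u%:R * (m0 r + 1) + C0)) by rewrite ln_ge0 // lerDl addr_ge0 // mulr_ge0 // addr_ge0.
 by rewrite /X mulr_ge0 // subr_ge0 (le_trans h1) // addr_ge0.
apply: (@le_trans _ _ (co * ((u * H)%:R * (m0 t + 1) + X) + C1)%:E); last first.
 have bb := bound_arith (uH := (u * H)%:R) (C1 := C1) (m1 := m0 1) co0 X0 m00 hD e0 (erefl _) (erefl C2) hb.
 by rewrite -EFinB -EFinM lee_fin.
have mG n : mfun (fun w => (G n (csc (rc t) (Z w)))%:E) := bm_measZ mod (bG n).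
apply: (@le_trans _ _ (\int[P]_w limn_einf (fun n => (G n (csc (rc t) (Z w)))%:E))%E).
 apply: ge0_le_integral => //.
 - apply: (bL _ _ (fun k w => csc (rc t) (Z w) k)) => k.
  by apply: cmeasM => //; exact: cmeas_cst.
 - apply: (@emeasurable_fun_cvg _ _ _ _ (fun n w => einfs (fun n => (G n (csc (rc t) (Z w)))%:E) n)).
   by move=> n; exact: measurable_fun_einfs.
  by move=> w _; rewrite limn_einf_lim; exact: is_cvg_einfs.
apply: le_trans (fatou _ _ _ _) _ => //; first by move=> n w _; rewrite lee_fin.
have [n hn] := dl_small d0; apply: (@lim_einf_le _ n) => k nk.
rewrite (ExE mod (bG k)) lee_fin.
have dk : dl k <= d by apply: le_trans (dl_anti nk) (ltW hn).
have [mt1' mr1] := hd (dl k) (dl_gt0 k) dk.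
have bM : bm (fun z => max_excess (dl k) (csc (rc t) z)) by apply: bm_csc; exact/bm_max_excess/dl_gt0.
rewrite (ExD mod (bmZ _ bM) (bm_cst _)) (ExZ mod _ bM) Ex_cst lerD2r ler_wpM2l //.
have hM := main (dl k) t r (max_excess (dl k)) (dl_gt0 k) (dl_le1 k) t2 tr (bm_max_excess (dl_gt0 k)) (max_excess_attained (dl k)).
apply: le_trans hM _; apply: lerD; first by rewrite ler_wpM2l.
have mrk : 0 <= mt P Z F (dl k) r by apply: le_trans m0r _; exact: (m0P' r r1).1 _ (dl_gt0 k) (dl_le1 k).
rewrite /X ler_wpM2l // lerD2r lerD2l log_arith //.
 by rewrite addr_ge0 // mulr_ge0.
by rewrite lerD2r ler_wpM2l.
Qed.

End AnalyticBound.

Import -(notations) mpoly.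
Import Algebra.

(** Truncated subtraction sends the first [l] terms to index 0 and each later one to an index of its
    own. Adding [M] makes every L j nonnegative, so each may be counted [l] times. *)
Lemma segment_sum {R : realFieldType} l n k (L : 'I_n.+1 -> R) (M : R) (x C : 'I_k -> R) : (0 < l)%N -> (k <= n + l)%N ->
 (forall j, 0 <= L j + M) -> (forall t : 'I_k, x t <= L (inord (t.+1 - l)) + C t) -> 0 <= M ->
 \sum_t x t <= l%:R * \sum_j L j + (\sum_t C t + l%:R * (n.+1%:R * M)).
Proof.
move=> l0 kl LM hx M0; pose G i := L (inord i) + M; have G0 i : 0 <= G i by exact: LM.
have h1 : \sum_t x t <= \sum_(t < k) G (t.+1 - l)%N + \sum_t C t.
 rewrite -big_split; apply: ler_sum => t _; apply: le_trans (hx t) _; by rewrite lerD2r lerDl.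
have h2 : \sum_(t < k) G (t.+1 - l)%N <= \sum_(t < l + n) G (t.+1 - l)%N.
 rewrite (addnC l) (big_ord_widen (n + l) (fun t => G (t.+1 - l)%N)) // [leRHS](bigID (fun t : 'I_(n + l) => (t < k)%N)) /=.
 by rewrite lerDl; apply: sumr_ge0.
have h3 : \sum_(t < l + n) G (t.+1 - l)%N <= l%:R * \sum_(j < n.+1) G j.
 rewrite big_split_ord /= [X in _ * X]big_ord_recl mulrDr lerD //.
  rewrite (eq_bigr (fun=> G 0%N)) => [|t _]; last by rewrite /= (eqP (ltn_ord t : (t.+1 - l == 0)%N)).
  by rewrite sumr_const card_ord mulr_natl.
 rewrite (eq_bigr (fun t : 'I_n => G t.+1)) => [|t _]; last by rewrite /= -addnS addKn.
 by rewrite ler_peMl ?ler1n //; apply: sumr_ge0.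
have h4 : \sum_(j < n.+1) G j = \sum_j L j + n.+1%:R * M.
 rewrite (eq_bigr (fun j => L j + M)) => [|j _]; last by rewrite /G inord_val.
 by rewrite big_split /= sumr_const card_ord mulr_natl.
by move: h1 h2 h3; rewrite h4 mulrDr; clear; lra.
Qed.

(** * Weil functions of hypersurfaces along the map *)

Section Estimates.
Context {R : realType} {p N : nat}.
Variable F : 'I_N.+1 -> Cn R p -> R[i].
Hypothesis hF : forall i, hol (F i).
Local Notation K := (R[i]).
Local Notation poly := (mpoly N.+1 R[i]).
Implicit Types (f g : poly) (d u : nat) (e : R) (z : Cn R p).

Definition ev f z : R[i] := peval (fval F z) f.

Lemma evM f g z : ev (f * g) z = ev f z * ev g z. Proof. exact: mevalM. Qed.
Lemma evX f k z : ev (f ^+ k) z = ev f z ^+ k. Proof. exact: pevalX. Qed.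
Lemma ev_lin c t z : ev (lin c t) z = \sum_(i < size t) c i * ev t`_i z.
Proof. by rewrite /ev /peval /lin raddf_sum /=; apply: eq_bigr => i _; rewrite mevalZ. Qed.

Lemma hol_ev f : hol (ev f).
Proof.
have -> : ev f = (fun z => \sum_(m <- msupp f) mcoeff m f * \prod_i F i z ^+ m i) by apply/funext => z.
apply: hol_sum => m; apply: holM; first exact: hol_cst.
apply: hol_prod => i; elim: (m i) => [|k IH]; first exact: hol_cst.
by under eq_fun do rewrite exprS; apply: holM.
Qed.

Lemma ev_bound u f : hg u f -> exists2 C, 0 <= C & forall e z, cabs (ev f z) <= C * nfd F e z ^+ u.
Proof.
move=> /hgP hf; exists (\sum_(m <- msupp f) cabs (mcoeff m f)); first by apply: sumr_ge0 => m _; exact: cabs_ge0.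
move=> e z; rewrite /ev /peval mevalE mulr_suml; apply: le_trans (cabs_sum _ _ _) _.
rewrite big_seq [leRHS]big_seq; apply: ler_sum => m /hf mu; rewrite cabsM ler_wpM2l ?cabs_ge0 // cabs_prod.
rewrite -mu mdegE -prodrXr; apply: ler_prod => i _; rewrite cabs_ge0 cabsX /=.
by rewrite lerXn2r ?nnegrE ?cabs_ge0 ?sqrtr_ge0 //; exact: nfd_ge_comp.
Qed.

Local Notation nq f := (nfd (uf (ev f))).
Local Notation lq f := (lg (uf (ev f))).

(** The Weil function log(|F|^d/|f(F)|), without the norm of the coefficients; the regularization
    e^d matches the degree of [f]. *)
Definition lam d f e z := d%:R * lg F e z - lq f (e ^+ d) z.

Lemma nq_le f e z : 0 <= e -> nq f e z <= cabs (ev f z) + e.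
Proof. by move=> e0; apply: le_trans (nfd_le_sum _ _ _) _; rewrite (big_pred1 tt) ?ger0_norm // => -[]. Qed.

Lemma lq_le f e z (c x : R) : 0 < e -> 0 < x -> nq f e z <= expR c * x -> lq f e z <= c + ln x.
Proof.
move=> e0 x0 h; rewrite -[c in leRHS]expRK -lnM ?posrE ?expR_gt0 // ler_ln ?posrE //; first exact: nfd_gt0.
by rewrite mulr_gt0 ?expR_gt0.
Qed.

Lemma lam_ge d f : hg d f -> exists2 C, 0 <= C & forall e z, 0 < e -> - C <= lam d f e z.
Proof.
move=> /ev_bound[C C0 hC]; have C1 : 0 < C + 1 by rewrite ltr_wpDl.
exists (ln (C + 1)); first by rewrite ln_ge0 // lerDr.
move=> e z e0; have W0 := nfd_gt0 F z e0.
rewrite /lam lerBrDr addrC lerBlDr mulr_natl -lnXn // addrC; apply: lq_le; rewrite ?exprn_gt0 // lnK ?posrE //.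
apply: le_trans (nq_le _ _ (exprn_ge0 _ (ltW e0))) _; rewrite mulrDl mul1r lerD //.
by rewrite lerXn2r ?nnegrE ?(ltW e0) ?(ltW W0) // -{1}(gtr0_norm e0) nfd_ge.
Qed.

Lemma lam_lin d c t : exists2 C, 0 <= C & forall g e z, 0 < e -> (forall i, (i < size t)%N -> cabs (ev t`_i z) <= cabs (ev g z)) ->
 lam d g e z <= lam d (lin c t) e z + C.
Proof.
pose S := \sum_(i < size t) cabs (c i); have S0 : 0 <= S by apply: sumr_ge0 => i _; exact: cabs_ge0.
have S1 : 0 < S + 1 by rewrite ltr_wpDl.
exists (ln (S + 1)); first by rewrite ln_ge0 // lerDr.
move=> g e z e0 h; have ed : 0 < e ^+ d by rewrite exprn_gt0.
have ar (a b c' b' : R) : b <= c' + b' -> a - b' <= a - b + c' by lra.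
apply: ar.
apply: lq_le => //; first exact: nfd_gt0.
rewrite lnK ?posrE //; apply: le_trans (nq_le _ _ (ltW ed)) _; rewrite mulrDl mul1r lerD //.
 rewrite ev_lin; apply: le_trans (cabs_sum _ _ _) _; rewrite mulr_suml; apply: ler_sum => i _.
 rewrite cabsM ler_wpM2l ?cabs_ge0 //; apply: le_trans (h _ (ltn_ord i)) _.
 exact: (nfd_ge_comp (uf (ev g)) _ _ tt).
by rewrite -{1}(gtr0_norm ed) nfd_ge.
Qed.

Lemma ln_prod (I : finType) (g : I -> R) (a : I -> nat) : (forall i, 0 < g i) -> ln (\prod_i g i ^+ a i) = \sum_i (a i)%:R * ln (g i).
Proof.
move=> g0; suff [] : 0 < \prod_i g i ^+ a i /\ ln (\prod_i g i ^+ a i) = \sum_i (a i)%:R * ln (g i) by [].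
apply: (big_ind2 (fun x y => 0 < x /\ ln x = y)) => [|x y x' y' [x0 <-] [x0' <-]|i _].
- by rewrite ln1.
- by rewrite mulr_gt0 // lnM.
- by rewrite exprn_gt0 // lnXn // mulr_natl.
Qed.

Section System.
Variables (n d : nat) (P : n.+1.-tuple poly).
Hypothesis hP : forall i, hg d (tnth P i).

Lemma lam_monomial v f : hg v f -> exists2 C, 0 <= C & forall (m : multinom n.+1) e z, 0 < e ->
 \sum_j (m j)%:R * lam d (tnth P j) e z - C <= lam (d * mdeg m + v) (comp_mpoly P (mpolyX K m) * f) e z.
Proof.
move=> /ev_bound[C C0 hC]; have C1 : 0 < C + 1 by rewrite ltr_wpDl.
exists (ln (C + 1)); first by rewrite ln_ge0 // lerDr.
move=> m e z e0; have W0 := nfd_gt0 F z e0; have ed : 0 < e ^+ d by rewrite exprn_gt0.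
pose g j := nq (tnth P j) (e ^+ d) z; have g0 j : 0 < g j by exact: nfd_gt0.
have G0 : 0 < \prod_j g j ^+ m j by apply: prodr_gt0 => j _; rewrite exprn_gt0.
have eW : e <= nfd F e z by rewrite -{1}(gtr0_norm e0) nfd_ge.
set h := comp_mpoly _ _ * f.
suff : lq h (e ^+ (d * mdeg m + v)) z <= ln (C + 1) + ln ((\prod_j g j ^+ m j) * nfd F e z ^+ v).
 rewrite lnM ?posrE ?exprn_gt0 // ln_prod // lnXn // -mulr_natl.
 have -> : \sum_j (m j)%:R * lam d (tnth P j) e z = (d * mdeg m)%:R * lg F e z - \sum_j (m j)%:R * ln (g j).
  rewrite mdegE natrM natr_sum mulr_sumr mulr_suml -sumrB; apply: eq_bigr => j _.
  by rewrite /lam mulrBr mulrA [_ * d%:R]mulrC.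
 have ar (a b c' v' b' : R) : b <= c' + (b' + v') -> a - b' - c' <= a + v' - b by lra.
 by rewrite /lam natrD mulrDl; exact: ar.
apply: lq_le; [by rewrite exprn_gt0|by rewrite mulr_gt0 ?exprn_gt0|rewrite lnK ?posrE //].
apply: le_trans (nq_le _ _ (exprn_ge0 _ (ltW e0))) _; rewrite mulrDl mul1r lerD //.
 rewrite /h evM cabsM mulrCA; apply: ler_pM; rewrite ?cabs_ge0 //.
 rewrite /ev /peval comp_mpolyX rmorph_prod /= cabs_prod; apply: ler_prod => j _; rewrite cabs_ge0 /=.
 rewrite -/(peval _ _) -/(ev _ z) evX cabsX lerXn2r ?nnegrE ?cabs_ge0 ?(ltW (g0 _)) //.
 exact: (nfd_ge_comp (fun _ : unit => ev (tnth P j)) _ _ tt).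
rewrite exprD exprM mdegE -prodrXr; apply: ler_pM.
- by apply: prodr_ge0 => j _; rewrite !exprn_ge0 ?(ltW e0).
- by rewrite exprn_ge0 ?(ltW e0).
- apply: ler_prod => j _; rewrite exprn_ge0 ?(ltW ed) //= lerXn2r ?nnegrE ?(ltW ed) ?(ltW (g0 j)) //.
 by rewrite -{1}(gtr0_norm ed) nfd_ge.
- by rewrite lerXn2r ?nnegrE ?(ltW e0) ?(ltW W0).
Qed.

(** By symmetry every variable has the same total exponent over the monomials of degree [b], so the
    Weil functions of all P_j receive one weight, here read off at index [ord0]. *)
Lemma lam_family b v es : inside (hg v) es -> exists2 C, 0 <= C & forall e z, 0 < e ->
 (size es * \sum_(m <- mons n b) m ord0)%:R * (\sum_j lam d (tnth P j) e z) - C <=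
 \sum_(f <- fam P (xmons n K b) es) lam (d * b + v) f e z.
Proof.
elim: es => [|f es IH] ues; first by exists 0 => // e z _; rewrite /fam /= big_nil mul0n mul0r subr0.
have [|C C0 hC] := IH; first by move=> i ie; exact: (ues i.+1).
have [C' C0' hC'] := lam_monomial (ues 0%N isT).
exists ((size (mons n b))%:R * C' + C); first by rewrite addr_ge0 // mulr_ge0.
move=> e z e0; rewrite /fam /= -/(fam P _ es) big_cat /=.
have -> : \sum_(x <- [seq comp_mpoly P x * f | x <- xmons n K b]) lam (d * b + v) x e z =
  \sum_(m <- mons n b) lam (d * b + v) (comp_mpoly P (mpolyX K m) * f) e z by rewrite big_map; exact: big_map.
have ar (x y k l c c' : R) : k - c <= x -> l - c' <= y -> (k + l) - (c + c') <= x + y by lra.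
rewrite mulSn natrD mulrDl; apply: ar; last exact: hC.
have -> : (\sum_(m <- mons n b) m ord0)%:R * (\sum_j lam d (tnth P j) e z) =
  \sum_(m <- mons n b) \sum_j (m j)%:R * lam d (tnth P j) e z.
 rewrite exchange_big /= mulr_sumr; apply: eq_bigr => j _; rewrite -mulr_suml -natr_sum; congr (_%:R * _).
 by apply/eqP; rewrite -(eqn_pmul2l (ltn0Sn n)) !sum_mons.
have -> : (size (mons n b))%:R * C' = \sum_(m <- mons n b) C' by rewrite big_const_seq count_predT iter_addr_0 mulr_natl.
rewrite -sumrB big_seq [leRHS]big_seq; apply: ler_sum => m; rewrite mem_mons => /eqP mb.
by have := hC' m e z e0; rewrite mb.
Qed.

Lemma lam_list_ge u es : inside (hg u) es -> exists2 C, 0 <= C & forall e z, 0 < e ->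
 - C <= \sum_(f <- es) lam u f e z.
Proof.
elim: es => [|f es IH] ues; first by exists 0 => // e z _; rewrite big_nil oppr0.
have [|C C0 hC] := IH; first by move=> i ie; exact: (ues i.+1).
have [C' C0' hC'] := lam_ge (ues 0%N isT).
exists (C' + C); first by rewrite addr_ge0.
by move=> e z e0; rewrite big_cons opprD lerD //; [exact: hC'|exact: hC].
Qed.

(** With [s] sorted by increasing modulus at [z], a combination of a prefix is at most a constant
    times any element from the end of that prefix on. Position t is thus served by P_i with i = t +
    1 - l, the last whose prefix ends there or before; P_0 serves the first [l] positions. *)
Lemma lam_segments l s : (0 < l)%N -> (size s <= n + l)%N ->
 (forall i : 'I_n.+1, (prefix_length l i <= size s)%N -> exists c, tnth P i = lin c (take (prefix_length l i) s)) ->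
 exists2 C, 0 <= C & forall e z, 0 < e ->
  (forall i j, (i <= j)%N -> (j < size s)%N -> cabs (ev s`_i z) <= cabs (ev s`_j z)) ->
  \sum_(f <- s) lam d f e z <= l%:R * \sum_j lam d (tnth P j) e z + C.
Proof.
move=> l0 sl cP.
have one (t : 'I_(size s)) : exists C, 0 <= C /\ forall e z, 0 < e ->
  (forall i j, (i <= j)%N -> (j < size s)%N -> cabs (ev s`_i z) <= cabs (ev s`_j z)) ->
  lam d s`_t e z <= lam d (tnth P (inord (t.+1 - l))) e z + C.
 have tn : (t.+1 - l < n.+1)%N by have := ltn_ord t; lia.
 have pt : (prefix_length l (t.+1 - l) <= t.+1)%N by case E: (t.+1 - l)%N => [|k] //; rewrite /prefix_length; lia.
 have [|c ->] := cP (inord (t.+1 - l)); first by rewrite inordK // (leq_trans pt).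
 have [C C0 hC] := lam_lin d c (take (prefix_length l (t.+1 - l)) s); rewrite inordK //.
 exists C; split => // e z e0 hs; apply: hC => // i; rewrite size_take => ilt.
 have it : (i < prefix_length l (t.+1 - l))%N by apply: leq_trans ilt _; case: ifP => // /negbT; rewrite -leqNgt.
 by rewrite nth_take //; apply: hs => //; rewrite -ltnS (leq_trans it).
have [C hC] := choice one; have [C' hC'] := choice (fun j => let: ex_intro2 c c0 h := lam_ge (hP j) in ex_intro _ c (conj c0 h)).
pose M := \sum_j C' j; have M0 : 0 <= M by apply: sumr_ge0 => j _; exact: (hC' j).1.
exists (\sum_t C t + l%:R * (n.+1%:R * M)).
 by rewrite addr_ge0 ?mulr_ge0 //; apply: sumr_ge0 => t _; exact: (hC t).1.
move=> e z e0 hs; rewrite (big_nth 0) big_mkord.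
apply: segment_sum => // [j|t]; last exact: (hC t).2.
rewrite -lerBlDr sub0r; apply: le_trans ((hC' j).2 e z e0).
rewrite lerN2 /M (bigD1 j) //= lerDl; apply: sumr_ge0 => k _; exact: (hC' k).1.
Qed.

End System.

(** Real numbers strictly below the ratio are used because it may be +oo; the regularized Weil
    function exceeds each of them once [e] is small. *)
Lemma log_ratio_limit d f z (y : R) : (0 < d)%N -> nfd F 0 z != 0 -> (y%:E < log_ratio F d f z)%E ->
 exists2 e0, 0 < e0 & forall e, 0 < e -> e < e0 -> e <= 1 -> y <= lam d f e z + ln (polynorm f).
Proof.
have cE : cvnorm (fval F z) = nfd F 0 z by rewrite cvnormE /nfd expr0n addr0.
move=> d0 W0; rewrite /log_ratio cE (negbTE W0) -/(ev f z) => hy.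
have Wp : 0 < nfd F 0 z by rewrite lt_def W0 sqrtr_ge0.
pose kap := d%:R * ln (nfd F 0 z) + ln (polynorm f) - y.
have hk : cabs (ev f z) < expR kap.
 move: hy; case: eqVneq => [->|fz]; first by rewrite cabs0 expR_gt0.
 rewrite lte_fin => h; rewrite -[ltLHS]lnK ?posrE ?cabs_gt0 // ltr_expR /kap; move: h.
 have ar (a b c x : R) : x < a + b - c -> c < a + b - x by lra.
 exact: ar.
exists (expR kap - cabs (ev f z)); first by rewrite subr_gt0.
move=> e e0 ek e1; have ed : 0 < e ^+ d by rewrite exprn_gt0.
have h1 : lg (uf (ev f)) (e ^+ d) z <= kap.
 rewrite -[kap]expRK /lg ler_ln ?posrE ?expR_gt0 ?nfd_gt0 //; apply: le_trans (nq_le _ _ (ltW ed)) _.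
 have : e ^+ d <= e by rewrite -[leRHS]expr1 ler_wiXn2l ?(ltW e0).
 have ar (a b c k : R) : b < k - a -> c <= b -> a + c <= k by lra.
 exact: ar.
have h2 : ln (nfd F 0 z) <= lg F e z by rewrite ler_ln ?posrE //; [apply: nfd_le_d => //; exact: ltW|exact: nfd_gt0].
have h3 : d%:R * ln (nfd F 0 z) <= d%:R * lg F e z by rewrite ler_wpM2l.
have ar (a b c x k : R) : k <= a + b - x -> a <= c -> x <= c - k + b by lra.
exact: ar h1 h3.
Qed.

End Estimates.

Lemma sum_limit {R : realType} (I : eqType) (r : seq I) (a : I -> \bar R) (t : I -> R -> R) :
 (forall i (y : R), i \in r -> (y%:E < a i)%E -> exists2 e0, 0 < e0 & forall e, 0 < e -> e < e0 -> e <= 1 -> y <= t i e) ->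
 (forall i, a i != -oo%E) -> forall x : R, (x%:E < \sum_(i <- r) a i)%E ->
 exists2 e0, 0 < e0 & forall e, 0 < e -> e < e0 -> e <= 1 -> x <= \sum_(i <- r) t i e.
Proof.
move=> + ai; elim: r => [|i r IH] h x.
 by rewrite big_nil lte_fin => /ltW x0; exists 1 => // e _ _ _; rewrite big_nil.
rewrite big_cons => hx.
have [y [y' [hy hy' xy]]] : exists y y' : R, [/\ (y%:E < a i)%E, (y'%:E < \sum_(i <- r) a i)%E & x <= y + y'].
 have sN : \sum_(i <- r) a i != -oo%E by apply: (big_ind (fun x : \bar R => x != -oo%E)) => // -[u| |] [v| |].
 move: hx (ai i) sN; case: (a i) => [u| |] //; case: (\sum_(i <- r) a i)%E => [v| |] // hx _ _.
 - exists (u - (u + v - x) / 2), (v - (u + v - x) / 2); move: hx; rewrite -EFinD !lte_fin => hx; split; lra.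
 - exists (u - 1), (x - u + 1); rewrite lte_fin ltry; split => //; lra.
 - exists (x - v + 1), (v - 1); rewrite lte_fin ltry; split => //; lra.
 - by exists x, 0; rewrite !ltry addr0.
have [e1 e10 h1] := h i y (mem_head _ _) hy.
have [|e2 e20 h2] := IH _ y' hy'; first by move=> j z jr; apply: h; rewrite in_cons jr orbT.
exists (Num.min e1 e2); first by rewrite lt_min e10.
by move=> e e0; rewrite lt_min => /andP[ee1 ee2] ele; rewrite big_cons; apply: le_trans xy _; rewrite lerD ?h1 ?h2.
Qed.

Section Measurability.
Context {R : realType} {p N : nat}.
Variable F : 'I_N.+1 -> Cn R p -> R[i].
Hypothesis hF : forall i, hol (F i).

Lemma bm_cabs (G : Cn R p -> R[i]) : hol G -> bm (fun z => cabs (G z)).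
Proof. by move=> h; exact/bm_cont/cont_cabs. Qed.

Lemma cbor_log_ratio d Q : cbor (log_ratio F d Q).
Proof.
move=> dd T z mz.
have mW : mfun (fun t => cvnorm (fval F (z^~ t))).
 apply: (eq_measurable_fun (fun t => Num.sqrt (\sum_i cabs (F i (z^~ t)) ^+ 2))) => [t _|]; first by rewrite cvnormE.
 have ms : mfun (@Num.sqrt R) by apply: continuous_measurable_fun; exact: sqrt_continuous.
 apply: (measurableT_comp ms).
 apply: (bm_meas (g := fun z => \sum_i cabs (F i z) ^+ 2)) => //.
 by apply: (bm_sum _ _ _).1 => i; exact: bmM (bm_cabs (hF i)) (bm_cabs (hF i)).
have mQ : mfun (fun t => cabs (ev F Q (z^~ t))) by apply: (bm_meas (bm_cabs (hol_ev hF Q)).1).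
apply: (eq_measurable_fun (fun t => if cvnorm (fval F (z^~ t)) == 0 then 0%E else if cabs (ev F Q (z^~ t)) == 0 then +oo%E
 else (d%:R * ln (cvnorm (fval F (z^~ t))) + ln (polynorm Q) - ln (cabs (ev F Q (z^~ t))))%:E)).
 by move=> t _; rewrite /log_ratio cabs_eq0.
apply: measurable_fun_ifT; [exact: measurable_fun_eqr|exact: mcst|].
apply: measurable_fun_ifT; [exact: measurable_fun_eqr|exact: mcst|].
apply/measurable_EFinP; apply: measurable_funB; last exact: measurableT_comp.
by apply: measurable_funD => //; apply: measurable_funM => //; exact: measurableT_comp.
Qed.

(** The supremum is a maximum over finitely many sets of indices. *)
Lemma cbor_max_log_prod q V d (Q : 'I_q -> _) m : cbor (max_log_prod V F d Q m).
Proof.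
move=> dd T z mz.
pose L (J : {set 'I_q}) t := (\sum_(j in J) log_ratio F d (Q j) (z^~ t))%E.
apply: (eq_measurable_fun (fun t => \big[maxe/-oo%E]_(J : {set 'I_q} | `[< admissible V Q m J >]) L J t)).
 move=> t _; apply/eqP; rewrite eq_le; apply/andP; split.
  elim/big_ind: _ => [|x y hx hy|J /asboolP aJ]; [exact: leNye|by rewrite ge_max hx|].
  by apply: ereal_sup_ubound; exists J.
 apply: ge_ereal_sup => _ [J aJ <-].
 by apply: (@le_bigmax_cond _ _ _ -oo%E J (fun J => `[< admissible V Q m J >]) (L ^~ t)); apply/asboolP.
elim: (index_enum _) => [|J s IH]; first by under eq_fun do rewrite big_nil; exact: mcst.
case E: `[< admissible V Q m J >]; last by under eq_fun do rewrite big_cons E.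
under eq_fun do rewrite big_cons E.
apply: measurable_maxe => //.
rewrite /L; under eq_fun do rewrite -big_filter.
apply: emeasurable_sum => j; exact: cbor_log_ratio.
Qed.

End Measurability.

(** * Choice of degrees and the estimate for one ordering *)

Lemma max_log_prod_ge0 {R : realType} {p N q : nat} V (F : 'I_N.+1 -> Cn R p -> R[i]) d (Q : 'I_q -> cpoly R N) m z :
 admissible V Q m finset.set0 -> (0 <= max_log_prod V F d Q m z)%E.
Proof. by move=> a0; apply: ereal_sup_ubound; exists finset.set0 => //; rewrite big_set0. Qed.

Lemma admissible0 {R : realType} {N q n m : nat} (V : set ('I_N.+1 -> R[i])) (Q : 'I_q -> cpoly R N) : (n <= m)%N ->
 dim_le V n%:Z -> admissible V Q m finset.set0.
Proof.
move=> nm [_ h]; rewrite /admissible cards0 subr0; split => // e Z [iZ cZ ZV].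
by apply: le_trans (h e Z _) _; [split => // x /ZV[]|rewrite lez_nat].
Qed.

(** Two ratios tend to 1, b/(b - b1) and that of the binomials. Each is kept below 1 + 1/(3(k + 1)),
    and two such factors multiply to at most 1 + 1/k. *)
Lemma degree_ratio n b1 c k : exists B, forall b, (B <= b)%N -> (b1 < b)%N /\
 (k * (b * 'C(b - b1 + c + n, n)) <= k.+1 * ((b - b1) * 'C(b - b1 + n, n)))%N.
Proof.
have [B hB] := bin_ratio n c (3 * k.+1); exists (B + (3 * k.+1).+2 * b1.+1)%N => b bB.
have b1b : (b1 < b)%N by nia.
split => //; have := hB (b - b1)%N; set x := 'C(_, _); set y := 'C(_, _) => h.
have {}h : (3 * k.+1 * x <= (3 * k.+1).+1 * y)%N by apply: h; nia.
have h2 : (3 * k.+1 * b <= (3 * k.+1).+1 * (b - b1))%N by nia.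
have h3 : (3 * k.+1 * (3 * k.+1) * (b * x) <= (3 * k.+1).+1 * (3 * k.+1).+1 * ((b - b1) * y))%N.
 by have := leq_mul h2 h; rewrite mulnACA [leqRHS]mulnACA.
have h4 : (k * ((3 * k.+1).+1 * (3 * k.+1).+1) <= k.+1 * (3 * k.+1 * (3 * k.+1)))%N by nia.
rewrite -(@leq_pmul2l (3 * k.+1 * (3 * k.+1))) //.
rewrite mulnCA; apply: leq_trans (leq_mul (leqnn k) h3) _; rewrite mulnA.
by apply: leq_trans (leq_mul h4 (leqnn _)) _; rewrite -mulnA mulnCA.
Qed.

Lemma tau_arith {R : realFieldType} (l co B L C1 C2 C3 M f1 f2 x : R) : 0 <= co -> l <= co * B -> B * L - C1 <= f1 -> - C2 <= f2 ->
 x <= l * L + C3 -> - M <= L -> x <= co * (f1 + f2) + ((co * B - l) * M + co * (C1 + C2) + C3).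
Proof.
move=> c0 hl h1 h2 h3 h4; apply: le_trans h3 _.
by nra.
Qed.

Section TauBound.
Context {R : realType} {p N n : nat}.
Variable F : 'I_N.+1 -> Cn R p -> R[i].
Local Notation K := (R[i]).

(** The hypersurfaces cost [l] times the sum over the P_j, while the family of monomials contains
    that sum with a weight that [co] makes at least [l]. The surplus weight and the completion [r]
    meet quantities bounded below, hence only a constant. *)
Lemma tau_bound V l d s (P : n.+1.-tuple (mpoly N.+1 K)) b1 c es b r (co : R) : (0 < l)%N -> (size s <= n + l)%N ->
 adapted V l d s P b1 c es -> inside (hg (d * (b + b1))) r -> 0 <= co ->
 l%:R <= co * (size es * \sum_(m <- mons n b) m ord0)%:R ->
 exists2 C, 0 <= C & forall e z, 0 < e ->
  (forall i j, (i <= j)%N -> (j < size s)%N -> cabs (ev F s`_i z) <= cabs (ev F s`_j z)) ->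
  \sum_(f <- s) lam F d f e z <= co * \sum_(f <- fam P (xmons n K b) es ++ r) lam F (d * (b + b1)) f e z + C.
Proof.
move=> l0 sl [hP cP [ue _] _ _] ur co0 hco.
have [C1 C10 h1] := @lam_family R p N F n d P b _ _ ue; have [C2 C20 h2] := @lam_list_ge R p N F _ _ ur.
have [C3 C30 h3] := @lam_segments R p N F n d P hP l s l0 sl cP.
have [M M0 hM] : exists2 M, 0 <= M & forall e z, 0 < e -> - M <= \sum_j lam F d (tnth P j) e z.
 have [|M M0 hM] := @lam_list_ge R p N F d (tval P); first by apply: inside_mem => f /tnthP[i ->].
 by exists M => // e z e0; have := hM e z e0; rewrite big_tuple.
set B := (size es * _)%:R in hco h1.
exists ((co * B - l%:R) * M + co * (C1 + C2) + C3).
 by apply: addr_ge0 => //; apply: addr_ge0; apply: mulr_ge0 => //; rewrite ?subr_ge0 ?addr_ge0.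
move=> e z e0 hs; have {}h1 := h1 e z e0; have {}h2 := h2 e z e0; have {}h3 := h3 e z e0 hs; have {}hM := hM e z e0.
rewrite big_cat /=; rewrite -mulnDr in h1; exact: tau_arith co0 hco h1 h2 h3 hM.
Qed.

End TauBound.

(** Along the map the elements of [L] coincide with the rows of [A tau] applied to [phi], so the
    excess is the sum of the Weil functions over the adapted basis. *)
Lemma excessE {R : realType} {p N : nat} (F : 'I_N.+1 -> Cn R p -> R[i]) u (phi L : seq (mpoly N.+1 R[i]))
 (T : finType) (A : T -> 'M[R[i]]_(size phi)) tau e z : size L = size phi ->
 (forall i : 'I_(size phi), ev F (L`_i - \sum_j A tau i j *: phi`_j) z = 0) ->
 excess F u (fun i : 'I_(size phi) => ev F phi`_i) A e tau z = \sum_(f <- L) lam F u f e z.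
Proof.
move=> sL h; rewrite (big_nth 0) big_mkord sL; apply: eq_bigr => i _; rewrite /lam; congr (_ - _).
rewrite /vlg /lg /nfd; congr (ln (Num.sqrt (_ + _))); apply: eq_bigr => _ _; congr (cabs _ ^+ 2).
have /eqP := h i; rewrite /ev /peval mevalB subr_eq0 => /eqP ->; rewrite raddf_sum /=.
by apply: eq_bigr => j _; rewrite mevalZ.
Qed.

(** Here [S] is the total exponent of one variable, [es] the rank and [H] the Hilbert function in
    degree d beta. Without the loss (k + 1)/k the factor would be exactly d l (n + 1); the loss is
    at most [e]. *)
Lemma coefficient_bound {R : realFieldType} (l d n beta b X Y es H S k : nat) (A e : R) : (0 < k)%N -> (H <= es * X)%N ->
 (k * (beta * X) <= k.+1 * (b * Y))%N -> (n.+1 * S = b * Y)%N -> A = (d * l * n.+1)%:R -> A <= e * k%:R ->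
 l%:R * (d * beta * H)%:R <= (A + e) * (es * S)%:R.
Proof.
move=> k0 hH hX hS AE Ae.
have h : (k * (l * (d * beta * H)) <= d * l * n.+1 * k.+1 * (es * S))%N.
 apply: (@leq_trans (d * l * es * (k * (beta * X)))).
  have -> : (k * (l * (d * beta * H)) = d * l * (k * beta) * H)%N by ring.
  have -> : (d * l * es * (k * (beta * X)) = d * l * (k * beta) * (es * X))%N by ring.
  by rewrite leq_mul2l hH orbT.
 have -> : (d * l * n.+1 * k.+1 * (es * S) = d * l * es * (k.+1 * (n.+1 * S)))%N by ring.
 by rewrite hS leq_mul2l hX orbT.
have k0' : 0 < k%:R :> R by rewrite ltr0n.
rewrite -(ler_pM2l k0') -natrM -natrM; move: h; rewrite -(ler_nat R) => h; apply: le_trans h _.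
rewrite natrM (natrM _ _ k.+1) -AE [leRHS]mulrA ler_wpM2r ?ler0n // -natr1 !mulrDr mulr1.
by rewrite [A * _]mulrC lerD2l mulrC.
Qed.

Theorem theorem1p12 (R : realType) (p N n q Delta m : nat)
  (V : set ('I_N.+1 -> R[i]))
  (F : 'I_N.+1 -> ('I_p -> R[i]) -> R[i])
  (Q : 'I_q -> cpoly R N) (eps : R) :
  (1 <= p)%N ->
  (1 <= n)%N ->
  smooth_proj_variety V n ->
  meromorphic_into V F ->
  alg_nondegenerate V F ->
  (1 <= Delta)%N ->
  (forall j, poly_nonzero (Q j) /\ homog Delta (Q j)) ->
  (forall j, exists z, peval (fval F z) (Q j) != 0) ->
  (n <= m)%N ->
  0 < eps ->
  exists E : set (measurableTypeR R),
    [/\ measurable E, (lebesgue_measure E < +oo)%E &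
      forall r : R, 0 <= r -> ~ E r ->
        (sphere_int p r (max_log_prod V F Delta Q m)
          <= ((Delta * (m - n).+1 * n.+1)%:R + eps)%:E * char_fun F r)%E].
Proof.
move=> p0 n0 [iV dV _] [[holF _] FV] nd D0 hQ' nQ nm eps0.
have hF i : hol (F i) by exact: holomorphic_hol.
have hQ j : hg Delta (Q j) by apply/homog_hg; exact: (hQ' j).2.
have [aV [x0 Vx0] _] := iV; have [nV _] := algebraicP aV.
have F0 u f z : (0 < u)%N -> hg u f -> common_zero F z -> ev F f z = 0.
 move=> u0 /(ev_bound F)[C _ /(_ 0 z) h] cz; apply: cabs_le0.
 apply: le_trans h _; rewrite /nfd big1 => [|i _]; last by rewrite cz cabs0 expr0n.
 by rewrite expr0n addr0 sqrtr0 expr0n gtn_eqF // mulr0.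
have vanF u f z : (0 < u)%N -> van V u f -> ev F f z = 0.
 move=> u0 [hf f0]; have [cz|ncz] := pselect (common_zero F z); first exact: F0 u0 hf cz.
 exact: f0 (FV z ncz).
have VQ j : exists2 x, V x & peval x (Q j) != 0.
 have [z hz] := nQ j; exists (fval F z) => //; apply: FV => cz.
 by move: hz; rewrite (F0 _ _ _ D0 (hQ j) cz : peval _ _ = _) eqxx.
(* Nondegeneracy applied to a coordinate that is nonzero at a point of [V]. *)
have [i0 [a0 Fa]] : exists i a, F i a != 0.
 have [i xi] := nV x0 Vx0; exists i; have [|a ha] := nd 1%N (mpolyX R[i] (mnm1 i)) ((homog_hg _ _).2 (hg_var _ i)).
  by move=> [_ /(_ x0 Vx0)/eqP]; rewrite /peval mevalXU (negbTE xi).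
 by exists a; move: ha; rewrite /peval mevalXU.
(* Orderings of index sets are sequences of length at most [q], which form a finite type; those that
   do not order an admissible set without repetition receive dummy data below. *)
pose l := (m - n).+1; pose good (tau : q.-bseq 'I_q) := uniq tau /\ admissible V Q m [set j in (tau : seq _)]%SET.
pose sys (tau : q.-bseq 'I_q) := [seq Q j | j <- tau].
have size_sys tau : good tau -> (size (sys tau) <= m.+1)%N /\ cdim (V `&` zeros (sys tau)) (m.+1 - size (sys tau)).
 by move=> [us ad]; have := admissible_cdim aV hQ us ad; rewrite size_map.
have adm0 := admissible0 Q nm dV.1; pose tau0 : q.-bseq 'I_q := [bseq].
have good0 : good tau0 by split => //; rewrite (_ : [set j in _]%SET = finset.set0) //; apply/setP => j; rewrite !inE.
have /choice[dat hdat] : forall tau, exists D : n.+1.-tuple (mpoly N.+1 R[i]) * nat * nat * seq (mpoly N.+1 R[i]),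
  good tau -> adapted V l Delta (sys tau) D.1.1.1 D.1.1.2 D.1.2 D.2.
 move=> tau; have [g|ng] := pselect (good tau); last by exists ([tuple 0 | _ < n.+1], 0%N, 0%N, [::]).
 have [st ct] := size_sys _ g.
 have [||P [b1 [c [es ad]]]] := adapted_exists iV dV n0 nm D0 st _ _ ct.
 - by move=> f /mapP[j _ ->].
 - by move=> f /mapP[j _ ->]; exact: VQ.
 by exists (P, b1, c, es).
(* Chosen so that the relative loss 1/k costs at most eps/2; the other half is left for Borel's
   lemma. *)
pose k := (Num.truncn (2 * (Delta * l * n.+1)%:R / eps)).+1.
have hk : (Delta * l * n.+1)%:R <= eps / 2 * k%:R.
 have /ltW := truncnS_gt (2 * (Delta * l * n.+1)%:R / eps); rewrite -/k ler_pdivrMr // => h.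
 by move: h; rewrite -[(Delta * l * n.+1)%:R]/((Delta * l * n.+1)%:R); lra.
have /choice[Bt hBt] := fun tau => degree_ratio n (dat tau).1.1.2 (dat tau).1.2 k.
(* One [beta] is large enough for all orderings, and the monomial degree [bt tau] absorbs the
   differing base degrees. All adapted bases then live in the same degree u = Delta beta and share
   the basis [phi]. *)
pose beta := (\sum_tau Bt tau)%N; have hbeta tau : (Bt tau <= beta)%N by rewrite /beta (bigD1 tau) //= leq_addr.
pose bt tau := (beta - (dat tau).1.1.2)%N.
have btE tau : (bt tau + (dat tau).1.1.2 = beta)%N by rewrite subnK // ltnW //; exact: (hBt _ _ (hbeta tau)).1.
have bt0 tau : (0 < bt tau)%N by rewrite subn_gt0; exact: (hBt _ _ (hbeta tau)).1.
pose u := (Delta * beta)%N; have u0 : (0 < u)%N by rewrite muln_gt0 D0 -(btE tau0) ltn_addr.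
have sJ : subsp (van V u) by case: (van_ideal V).
have [s0 [us0 _ ss0 _]] := homogeneous_basis R[i] N u.
have ss0' : spans (van V u) (hg u) s0 by apply: spans_weak ss0 => _ ->; case: sJ.
have [phi [uphi iphi sphi]] := basis_exists sJ ss0'.
pose H := size phi.
have /choice[sel hsel] : forall tau, exists Ar : 'M[R[i]]_H * seq (mpoly N.+1 R[i]), Ar.1 \in unitmx /\ (good tau ->
  let L := fam (dat tau).1.1.1 (xmons n R[i] (bt tau)) (dat tau).2 ++ Ar.2 in
  [/\ inside (hg u) Ar.2, size L = H & forall i : 'I_H, van V u (L`_i - \sum_j Ar.1 i j *: phi`_j)]).
 move=> tau; have [g|ng] := pselect (good tau); last by exists (1%:M, [::]); rewrite unitmx1.
 have := @adapted_basis R N V n l Delta _ _ _ _ _ (bt tau) phi (hdat _ g); rewrite btE => h.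
 by have [A [r [uA ur sr hA]]] := h uphi iphi sphi; exists (A, r).
pose Phi (i : 'I_H) := ev F phi`_i.
pose A tau := (sel tau).1.
pose L tau := fam (dat tau).1.1.1 (xmons n R[i] (bt tau)) (dat tau).2 ++ (sel tau).2.
have exE tau e z : good tau -> excess F u Phi A e tau z = \sum_(f <- L tau) lam F u f e z.
 by move=> g; have [_ /(_ g)[_ sL hA]] := hsel tau; apply: excessE => // i; apply: (vanF u) => //; exact: hA.
have H_le tau : good tau -> (H <= size (dat tau).2 * 'C(bt tau + (dat tau).1.2 + n, n))%N.
 by move=> g; have [_ _ _ _ h] := hdat _ g; apply: (h (bt tau) phi); rewrite btE.
(* Two basis elements are needed to form a combination vanishing at the origin. *)
have H_ge : (1 < H)%N.
 have [_ _ [_ es0] _ _] := hdat _ good0; have [_ /(_ good0)[_ sL _]] := hsel tau0.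
 apply: leq_trans (eq_leq sL); rewrite size_cat size_fam size_xmons; apply: leq_trans (leq_addr _ _); apply: leq_trans (leq_pmull _ es0).
 case: (n) n0 (bt tau0) (bt0 tau0) => // n' _ [] // b _; rewrite addSn binS.
 by rewrite -addn1 leq_add // bin_gt0 ?leq_addl // addnS -addSn leq_addl.
(* [co] is fixed by co u H = Dt, so that the mean inequality, multiplied by [co], has leading
   coefficient [Dt]. *)
pose Dt : R := (Delta * l * n.+1)%:R + eps / 2; pose co := Dt / (u * H)%:R.
have Dt0 : 0 <= Dt by rewrite addr_ge0 // divr_ge0 // ltW.
have uH0 : 0 < (u * H)%:R :> R by rewrite ltr0n muln_gt0 u0 (ltnW H_ge).
have co0 : 0 <= co by rewrite divr_ge0.
have hco tau : good tau -> l%:R <= co * (size (dat tau).2 * \sum_(a <- mons n (bt tau)) a ord0)%:R.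
 move=> g; rewrite /co mulrAC ler_pdivlMr //.
 apply: (coefficient_bound (k := k) (X := 'C(bt tau + (dat tau).1.2 + n, n)) (Y := 'C(bt tau + n, n)) (b := bt tau) (n := n)) => //.
 - exact: H_le.
 - exact: (hBt _ _ (hbeta tau)).2.
 - exact: sum_mons.
have [KP hKP] : exists KP, 0 <= KP /\ forall (i : 'I_H) z, cabs (Phi i z) <= KP * nfd F 0 z ^+ u.
 have /choice[C hC] : forall i : 'I_H, exists C, 0 <= C /\ forall z, cabs (Phi i z) <= C * nfd F 0 z ^+ u.
  by move=> i; have [C C0 hC] := ev_bound F (uphi _ (ltn_ord i)); exists C; split => // z; exact: hC.
 exists (\sum_i C i); split; first by apply: sumr_ge0 => i _; exact: (hC i).1.
 move=> i z; apply: le_trans ((hC i).2 z) _; rewrite ler_wpM2r ?exprn_ge0 ?sqrtr_ge0 // (bigD1 i) //= lerDl.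
 by apply: sumr_ge0 => j _; exact: (hC j).1.
(* Nondegeneracy: a form that vanishes along the map lies in the ideal of [V], and [phi] is
   independent modulo that ideal. *)
have ind (c : 'I_H -> R[i]) : (forall z, \sum_i c i * Phi i z = 0) -> forall i, c i = 0.
 move=> hc; pose c' i := if insub i is Some o then c o else 0.
 have cE z : ev F (lin c' phi) z = 0.
  by rewrite ev_lin -[RHS](hc z); apply: eq_bigr => i _; rewrite /c' valK.
 have hl : hg u (lin c' phi) by apply: subsp_lin => //; exact: hg_subsp.
 have /iphi h : van V u (lin c' phi).
  apply: contrapT => nv; have [|z] := nd u (lin c' phi) ((homog_hg _ _).2 hl).
   by move=> [_ hv]; apply: nv.
  by rewrite [peval _ _]cE eqxx.
 by move=> i; have := h i (ltn_ord i); rewrite /c' valK.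
have /choice[Ct hCt] : forall tau, exists C, 0 <= C /\ (good tau -> forall e z, 0 < e ->
  (forall i j, (i <= j)%N -> (j < size (sys tau))%N -> cabs (ev F (sys tau)`_i z) <= cabs (ev F (sys tau)`_j z)) ->
  \sum_(f <- sys tau) lam F Delta f e z <= co * excess F u Phi A e tau z + C).
 move=> tau; have [g|ng] := pselect (good tau); last by exists 0.
 have [_ /(_ g)[ur sL hA]] := hsel tau.
 have sl : (size (sys tau) <= n + l)%N by have [+ _] := size_sys _ g; rewrite /l addnS subnKC.
 have := @tau_bound R p N n F V l Delta (sys tau) _ _ _ _ (bt tau) (sel tau).2 co isT sl (hdat _ g).
 rewrite btE => h; have [C C0 hC] := h ur co0 (hco _ g).
 by exists C; split => // _ e z e0 hs; rewrite exE //; exact: hC.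
pose Cq := \sum_j `|ln (polynorm (Q j))|.
have := @analytic_bound R p _ F H u Phi _ A KP tau0 hF (fun i => hol_ev hF _) (fun tau => (hsel tau).1) hKP.1 hKP.2 ind p0 u0
 i0 a0 Fa (Ordinal (ltnW H_ge)) (Ordinal H_ge) (max_log_prod V F Delta Q m) co (\sum_tau Ct tau + Cq) Dt (eps / 2)
 isT co0 _ _ (cbor_max_log_prod hF _ _ _ _) (fun z => max_log_prod_ge0 _ _ _ adm0) _.
case.
- by rewrite /co divfK // gt_eqF.
- by rewrite divr_gt0.
- move=> z x /ereal_sup_gt[_ [J aJ <-]] hx.
 have Ct0 tau : Ct tau <= \sum_tau Ct tau + Cq.
  rewrite (bigD1 tau) //= -addrA lerDl addr_ge0 //; first by apply: sumr_ge0 => j _; exact: (hCt j).1.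
  by apply: sumr_ge0.
 (* At a common zero of the components all ratios are 0 by convention, and the empty ordering gives
    the bound. *)
 have [W0|W0] := eqVneq (nfd F 0 z) 0.
  exists 1 => // e e0 _ _; exists tau0.
  have := (hCt tau0).2 good0 e z e0; rewrite /sys /= big_nil => /(_ _) h.
  have x0' : x <= 0.
   apply: ltW; rewrite -lte_fin; apply: lt_le_trans hx _; rewrite big1 // => j _.
   by rewrite /log_ratio cvnormE; move: W0; rewrite /nfd expr0n addr0 => ->; rewrite eqxx.
  apply: le_trans x0' _; apply: le_trans (h _) _ => //; by rewrite lerD2l.
 pose leP f g := cabs (ev F f z) <= cabs (ev F g z).
 (* At this point [z] the set is ordered by increasing modulus of Q_j(f), so that prefixes consist
    of the smallest values. *)
 pose st := sort (relpre Q leP) (enum J).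
 have stq : (size st <= q)%N by rewrite size_sort -cardE -[leqRHS]card_ord max_card.
 pose tau : q.-bseq 'I_q := Bseq stq.
 have tauJ : [set j in (tau : seq _)]%SET = J by apply/setP => j; rewrite inE mem_sort mem_enum.
 have g : good tau by split; [rewrite /= sort_uniq enum_uniq|rewrite tauJ].
 have pJ : perm_eq (enum J) st by rewrite perm_sym; apply/permPl/perm_sort.
 have hx' : (x%:E < \sum_(j <- st) log_ratio F Delta (Q j) z)%E by rewrite -(perm_big _ pJ) big_enum.
 have [|j|e0 e00 he0] := sum_limit (t := fun j e => lam F Delta (Q j) e z + ln (polynorm (Q j))) _ _ hx'.
 - by move=> j y _; exact: log_ratio_limit.
 - by rewrite /log_ratio; case: ifP => //; case: ifP.
 exists e0 => // e ep ee e1; exists tau; apply: le_trans (he0 e ep ee e1) _.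
 rewrite big_split /=.
 have h1 : \sum_(j <- st) lam F Delta (Q j) e z <= co * excess F u Phi A e tau z + Ct tau.
  have := (hCt tau).2 g e z ep; rewrite /sys big_map; apply => i j ij js.
  have tr : transitive leP by move=> ? ? ?; exact: le_trans.
  have rf : reflexive leP by move=> ?; exact: lexx.
  have so : sorted leP [seq Q j | j <- st] by rewrite sorted_map sort_sorted // => ? ?; exact: le_total.
  by apply: (sorted_leq_nth tr rf 0 so); rewrite // inE (leq_ltn_trans ij).
 have h2 : \sum_(j <- st) ln (polynorm (Q j)) <= Cq.
  rewrite -(perm_big _ pJ) big_enum /Cq big_mkcond; apply: ler_sum => j _; case: ifP => _ //; exact: ler_norm.
 apply: le_trans (lerD h1 h2) _; rewrite -addrA lerD2l lerD2r (bigD1 tau) //= lerDl.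
 by apply: sumr_ge0 => j _; exact: (hCt j).1.
move=> E [mE fE hE]; exists E; split => // r r0 nE.
have := hE r r0 nE; rewrite /Dt -addrA -splitr.
have -> : lg0 F = log_norm_f F by apply/funext => z; rewrite /lg0 /log_norm_f cvnormE /nfd expr0n addr0.
exact.
Qed.
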